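(* Assume $\mathrm{rank}(\sigma)=n$ and let $\mathcal{U}=\ker A\cap\mathbb{S}^{n-1}$. Suppose that $B(x,x) = 0$ for every $x \in \mathcal{U}$ and that there exists a constant $C > 0$ so that $$\sup_{x \in \mathcal{U}}(\|P_x\| + \|P^{-1}_x\|) \le C,$$ where $J_x^\perp = P_x^{-1}L_x^\perp P_x$ is the Jordan canonical form of $L_x^\perp$. Then the following hold. (i) If for every $x \in \mathcal{U}$ there is an eigenvalue of $L_x^\perp$ with positive real part, then the SDE $dx_t = B(x_t,x_t)dt - Ax_t dt + \sigma dW_t$ has at least one stationary measure $\mu$, and $\langle x\rangle^p \in L^1(d\mu)$ for every $p < 2/3$. (ii) Assume that $$\Pi_{\ker A}\left(B(\Pi_{\ker A} x, \Pi_{(\ker A)^\perp} x) + B(\Pi_{(\ker A)^\perp} x, \Pi_{\ker A} x)\right) = 0$$ for every $x \in \mathbb{R}^n$. If for every $x \in \mathcal{U}$ there exist $J \in \{1,2,\ldots,n-2\}$ and constants $c_x,C_x>0$ so that $$c_x t^J \le \|e^{tL_x^\perp}\| \le C_x (1+t^J)$$ for all $t \ge 0$, then the SDE has at least one stationary measure $\mu$, and $\langle x\rangle^p \in L^1(d\mu)$ for every $p < 1/3$.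
   Context: Consider the SDE in $\mathbb{R}^n$: $dx_t = B(x_t,x_t)dt - A x_t dt + \sigma dW_t$, $x_t|_{t=0}\in\mathbb{R}^n$, where $W_t$ is an $n$-dimensional standard Brownian motion, $A \in \mathbb{R}^{n\times n}$ is positive semi-definite with nontrivial kernel, $\sigma \in \mathbb{R}^{n\times n}$, and $B:\mathbb{R}^n\times\mathbb{R}^n\to\mathbb{R}^n$ is bilinear with $x\cdot B(x,x)=0$ for all $x\in\mathbb{R}^n$. The SDE is globally well-posed. Let $\mathcal{P}_t f(x)=\mathbf{E}[f(x_t)\mid x_0=x]$ be its Markov semigroup and $\mathcal{P}_t^*$ the dual action on Borel probability measures. A stationary measure is a Borel probability measure $\mu$ with $\mathcal{P}_t^*\mu=\mu$ for all $t\ge 0$. For a subspace $S$, $\Pi_S$ is the orthogonal projection onto $S$. For $x\in\mathbb{R}^n$, $L_x v = B(x,v)+B(v,x)$ and $L_x^\perp = \Pi_{(\ker A)^\perp} L_x \Pi_{(\ker A)^\perp}$. Jordan canonical forms are taken over $\mathbb{C}$. $\langle x\rangle=(1+|x|^2)^{1/2}$. *)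

(* Defs.v *)
From HB Require Import structures.
From mathcomp Require Import all_boot all_order all_algebra.
From mathcomp Require Import complex.
From mathcomp Require Import all_classical all_reals all_analysis.

Set Implicit Arguments.
Unset Strict Implicit.
Unset Printing Implicit Defensive.

Import Order.TTheory GRing.Theory Num.Theory.
Import numFieldNormedType.Exports.

Local Open Scope classical_set_scope.
Local Open Scope ring_scope.

Section Euclidean.

(* [abs] is the modulus on the scalars, so that the same definitions serve
   real vectors (abs = Num.norm) and complex ones (abs = Normc.normc). *)
Definition l2norm (R : realType) (F : Type) (abs : F -> R) n (v : 'cV[F]_n) : R :=
  Num.sqrt (\sum_i abs (v i 0) ^+ 2).

Definition opnorm (R : realType) (F : pzRingType) (abs : F -> R) n
    (M : 'M[F]_n) : R :=
  sup [set l2norm abs (M *m v) | v in [set v : 'cV[F]_n | l2norm abs v <= 1]].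

Variables (R : realType) (n : nat).
Implicit Types (u v : 'cV[R]_n) (M : 'M[R]_n).

Definition dot u v : R := \sum_i u i 0 * v i 0.

Definition enorm v : R := l2norm Num.norm v.

Definition mxnorm M : R := opnorm Num.norm M.

Definition cmxnorm (M : 'M[R[i]]_n) : R := opnorm (@Normc.normc R) M.

Definition japanese v : R := Num.sqrt (1 + enorm v ^+ 2).

Definition psd M : Prop := M^T = M /\ forall v, 0 <= dot v (M *m v).

Definition mxexp M : 'M[R]_n :=
  limn (fun N : nat => \sum_(k < N) (k`!%:R)^-1 *: M ^+ k).

Definition complexify M : 'M[R[i]]_n := map_mx (real_complex R) M.

End Euclidean.

Section Kernels.

Variables (R : realType) (n : nat).
Implicit Types (A S : 'M[R]_n) (v w : 'cV[R]_n).

(* Subspaces of R^n are given as row spaces, as in mxalgebra, whereas the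
   vectors of the dynamics are columns: hence the transpositions. *)
Definition ker_sp A : 'M[R]_n := kermx A^T.

Definition orthocomp S : 'M[R]_n := kermx S^T.

Definition orth_proj S : 'M[R]_n := (proj_mx S (orthocomp S))^T.

Definition Pi_ker A : 'M[R]_n := orth_proj (ker_sp A).

Definition Pi_kerperp A : 'M[R]_n := orth_proj (orthocomp (ker_sp A)).

Definition ker_sphere A : set 'cV[R]_n := [set x | A *m x = 0 /\ enorm x = 1].

Lemma ker_spP A v : (v^T <= ker_sp A)%MS <-> A *m v = 0.
Proof.
rewrite /ker_sp; split=> [/sub_kermxP|Av0].
  by rewrite -trmx_mul => /(congr1 trmx); rewrite trmxK trmx0.
by apply/sub_kermxP; rewrite -trmx_mul Av0 trmx0.
Qed.

Lemma dotE v w : dot v w = (v^T *m w) 0 0.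
Proof. by rewrite mxE; apply: eq_bigr => i _; rewrite mxE. Qed.

Lemma dotC v w : dot v w = dot w v.
Proof. by apply: eq_bigr => i _; rewrite mulrC. Qed.

Lemma dot_eq0 v : dot v v = 0 -> v = 0.
Proof.
move=> /eqP; rewrite psumr_eq0 => [/allP h|i _]; last by rewrite -expr2 sqr_ge0.
apply/matrixP => i j; rewrite ord1 mxE.
by have /(_ (mem_index_enum i)) := h i; rewrite -expr2 sqrf_eq0 => /eqP.
Qed.

Lemma orthocompP S v :
  (v^T <= orthocomp S)%MS <-> forall w, (w^T <= S)%MS -> dot w v = 0.
Proof.
rewrite /orthocomp; split=> [/sub_kermxP h w /submxP[D wE]|h].
  by rewrite dotC dotE -[w]trmxK wE trmx_mul mulmxA h mul0mx mxE.
apply/sub_kermxP/matrixP => i j; rewrite !ord1 [RHS]mxE.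
have := h (row j S)^T; rewrite trmxK row_sub => /(_ isT) <-.
rewrite dotC !mxE; apply: eq_bigr => k _.
by rewrite !mxE.
Qed.

Lemma orthocomp_cap S : (S :&: orthocomp S = 0)%MS.
Proof.
apply/eqP; rewrite -submx0; apply/rV_subP => u.
rewrite sub_capmx => /andP[uS]; rewrite -(trmxK u) => /orthocompP/(_ _ _) h.
have : dot u^T u^T = 0 by apply: h; rewrite trmxK.
by move=> /dot_eq0 ->; rewrite trmx0 sub0mx.
Qed.

Lemma orthocomp_add S : (1%:M <= S + orthocomp S)%MS.
Proof.
rewrite sub1mx /row_full -(eqn_add2r (\rank (S :&: orthocomp S)%MS)).
rewrite mxrank_sum_cap orthocomp_cap mxrank0 addn0 mxrank_ker mxrank_tr.
by rewrite subnKC // rank_leq_row.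
Qed.

Lemma orth_proj_sub S v : ((orth_proj S *m v)^T <= S)%MS.
Proof. by rewrite trmx_mul trmxK proj_mx_sub. Qed.

Lemma orth_proj_orth S v w :
  (w^T <= S)%MS -> dot w (v - orth_proj S *m v) = 0.
Proof.
move: w; apply/orthocompP; rewrite linearB /= trmx_mul trmxK.
by rewrite proj_mx_compl_sub // (submx_trans (submx1 _)) // orthocomp_add.
Qed.

End Kernels.

Section Jordan.

Variable F : fieldType.

Definition jordan_block (k : nat) (a : F) : 'M[F]_k :=
  \matrix_(i < k, j < k) (a *+ (i == j) + (j == i.+1 :> nat)%:R).

Definition is_jordan n (J : 'M[F]_n) : Prop :=
  exists (m : nat) (k : 'I_m -> nat) (a : 'I_m -> F)
         (e : (\sum_i k i)%N = n),
    (forall i, (0 < k i)%N) /\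
    J = castmx (e, e) (\mxdiag_(i < m) jordan_block (k i) (a i)).

End Jordan.

Section Linearization.

Variables (R : realType) (n : nat) (B : 'cV[R]_n -> 'cV[R]_n -> 'cV[R]_n).

Definition Lmx (x : 'cV[R]_n) : 'M[R]_n :=
  \matrix_(i, j) (B x (delta_mx j 0) + B (delta_mx j 0) x) i 0.

Definition Lperp (A : 'M[R]_n) (x : 'cV[R]_n) : 'M[R]_n :=
  Pi_kerperp A *m Lmx x *m Pi_kerperp A.

End Linearization.

Lemma LmxE (R : realType) (n : nat)
    (B : {bilinear 'cV[R]_n -> 'cV[R]_n -> 'cV[R]_n}) (x v : 'cV[R]_n) :
  Lmx B x *m v = B x v + B v x.
Proof.
have vE : v = \sum_j v j 0 *: delta_mx j 0.
  by rewrite {1}(matrix_sum_delta v); apply: eq_bigr => i _; rewrite big_ord1.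
rewrite {2 3}vE linear_sumr linear_sumlz -big_split /=.
apply/matrixP => i k; rewrite ord1 summxE mxE; apply: eq_bigr => j _.
by rewrite linearZr_LR linearZl_LR -scalerDr !mxE mulrC.
Qed.

Definition borel (R : realType) (n : nat) :=
  g_sigma_algebraType (@open 'cV[R]_n).

Section SDE.

Variables (R : realType) (n : nat).
Variables (d : measure_display) (Omega : measurableType d).
Variable P : probability Omega R.

Definition nonneg_times : set R := [set t | 0 <= t].

Definition measurable_process (X : R -> Omega -> 'cV[R]_n) : Prop :=
  forall t, 0 <= t -> measurable_fun setT (X t : Omega -> borel R n).

(* For a grid t_0 < ... < t_m all the coordinates of all the increments are
   mutually independent centred Gaussian variables, of variance
   t_(j+1) - t_j; normal_prob takes the standard deviation. *)
Definition gaussian_increments (W : R -> Omega -> 'cV[R]_n) : Prop :=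
  forall (m : nat) (t : nat -> R) (E : 'I_m -> 'I_n -> set R),
    0 <= t 0%N -> (forall j, t j < t j.+1) ->
    (forall j i, measurable (E j i)) ->
    P [set w | forall j i, E j i (W (t j.+1) w i 0 - W (t j) w i 0)] =
    (\big[*%E/1%E]_(j < m) \big[*%E/1%E]_(i < n)
       normal_prob 0 (Num.sqrt (t j.+1 - t j)) (E j i))%E.

Definition brownian_motion (W : R -> Omega -> 'cV[R]_n) : Prop :=
  [/\ measurable_process W,
      {ae P, forall w, W 0 w = 0},
      {ae P, forall w, {within nonneg_times, continuous (fun t => W t w)}} &
      gaussian_increments W].

Variables (B : 'cV[R]_n -> 'cV[R]_n -> 'cV[R]_n) (A sigma : 'M[R]_n).

Definition drift (x : 'cV[R]_n) : 'cV[R]_n := B x x - A *m x.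

(* The noise being additive, the stochastic integral is sigma W_t and the
   equation in integral form makes sense path by path. *)
Definition sde_solution (W : R -> Omega -> 'cV[R]_n) (x : 'cV[R]_n)
    (X : R -> Omega -> 'cV[R]_n) : Prop :=
  measurable_process X /\
  {ae P, forall w,
    {within nonneg_times, continuous (fun t => X t w)} /\
    forall t, 0 <= t ->
      X t w = x
        + \col_i (\int[lebesgue_measure]_(s in `[0, t]) drift (X s w) i 0)%R
        + sigma *m W t w}.

(* X x is the solution started at x. *)
Variable X : 'cV[R]_n -> R -> Omega -> 'cV[R]_n.

Definition semigroup (t : R) (f : 'cV[R]_n -> R) (x : 'cV[R]_n) : \bar R :=
  (\int[P]_w (f (X x t w))%:E)%E.

Definition dual_semigroup (t : R) (mu : probability (borel R n) R)
    (E : set (borel R n)) : \bar R :=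
  (\int[mu]_x semigroup t \1_E x)%E.

Definition stationary (mu : probability (borel R n) R) : Prop :=
  forall t, 0 <= t -> forall E : set (borel R n), measurable E ->
    dual_semigroup t mu E = mu E.

Definition stationary_with_moments (p0 : R) : Prop :=
  exists mu : probability (borel R n) R,
    stationary mu /\
    forall p : R, p < p0 ->
      mu.-integrable setT (fun x : borel R n => (japanese x `^ p)%:E).

End SDE.

(* Main.v *)
(* Since x . B(x,x) = 0, the energy |X|^2 obeys E |X_1|^4 <= |x|^4 + K (|x|^2 + 1) - 4 L,
   where L is a lower bound for the mean of |X|^2 (X . A X) over the unit time interval. If L
   beats (K + 1) |x|^2 / 4 for large x, then |x|^4 is a Lyapunov function whose drift at integer
   times is at most C - |x|^2; the time averages of E |X_k|^2 stay bounded, and the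
   Krylov-Bogoliubov construction (an ultralimit of averages and the Riesz representation theorem)
   gives a stationary measure with a finite second moment, hence all the moments claimed.

   The bound on L is local in time. Write k0 for the component of the state in ker A at the start
   of a window of length tau = 1/q and y for the component orthogonal to ker A. If the dissipation
   is small on a quiet path, then y is bounded in time average, k0 moves little, and y nearly solves
   dy = L_{k0}^perp y dt + noise. Testing against covectors a_j with a_{j+1} (1 + dl L) ~ a_j and
   a_m ~ 0 shows that the Gaussian variable a_0 . y_0 + sum a_{j+1} . noise_j is much smaller than
   its standard deviation, which by the Paley-Zygmund inequality fails with probability bounded
   below. In case (i) a_j = (1 + dl mu)^(-j) l with l a left eigenvector of eigenvalue mu, Re mu > 0,
   and tau |k0| tends to infinity; the real parts are uniformly positive by compactness and
   continuity of the determinant. In case (ii) growth at x and at -x forces an imaginary spectrum and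
   a nontrivial Jordan block; a_j is a slowly decaying combination of its two last rows,
   controlled by the bound on P_x, and tau is a small constant.

   Expectations of functions of X are handled through the Euler chain, for which independence of
   the increments gives the Markov property directly. *)
Require Import Defs.
From HB Require Import structures.
From mathcomp Require Import all_boot all_order all_algebra.
From mathcomp Require Import complex.
From mathcomp Require Import all_classical all_reals all_analysis.
From mathcomp Require Import measurable_realfun ring lra.

Set Implicit Arguments.
Unset Strict Implicit.
Unset Printing Implicit Defensive.

Import Order.TTheory GRing.Theory Num.Theory.
Import numFieldNormedType.Exports.

Local Open Scope classical_set_scope.
Local Open Scope ring_scope.

(** * Ultralimits and Euclidean estimates *)

(** The fourth power is what yields moments: on the scale [|x| ~ r] the mean dissipation of [|x|^2]
    only becomes larger than any constant, but weighted by [|x|^2] it exceeds any multiple of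
    [|x|^2]. This is why [core] has an arbitrary factor [ka] and why a bound [K] on the time average
    of [|y|^2] runs through the estimates. Three scales dictate the length of a window. So [tau]
    must lie between [r^(-1)] and [r^(-3/4)], and [r^(-4/5)] is taken. In case (ii) the kernel
    component moves by an amount independent of [r], and an error of order [tau] faces a deviation
    of order [tau^(1/2)]. The drift is quadratic and would spoil the moments of a plain Euler chain,
    hence the taming. The null set off which a solution is regular depends on its initial point, so
    varying initial data are treated along sequences, or on the chain, which is continuous in its
    data. *)

Definition nultra : set_system nat := projT1 (cid (ultraFilterLemma eventually_filter)).

Lemma nultra_ultra : UltraFilter nultra.
Proof. by rewrite /nultra; case: cid => ? []. Qed.

#[global] Instance nultra_proper : ProperFilter nultra.
Proof. exact: (@ultra_proper _ _ nultra_ultra). Qed.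

Lemma nultra_oo (A : set nat) : (\forall k \near \oo, A k) -> nultra A.
Proof. by rewrite /nultra; case: cid => ? [? /= H]; exact: H. Qed.

Lemma nultra_large (A : set nat) (n0 : nat) : nultra A -> exists2 k, (n0 <= k)%N & A k.
Proof.
move=> UA; have Un0 : nultra [set k | (n0 <= k)%N].
  by apply: nultra_oo; exists n0.
have /filter_ex[k [Ak n0k]] : nultra (A `&` [set k | (n0 <= k)%N]) by exact: filterI.
by exists k.
Qed.

Section UltraLimit.
Context {R : realType}.

Definition ulim (u : nat -> R) : R := lim (u @ nultra).

(** The image of an ultrafilter under any map is an ultrafilter, and on the compact segment
    [[- M, M]] it converges. This replaces the extraction of subsequences, and since one filter
    serves all bounded sequences at once, [ulim] is linear. *)
Lemma ulim_cvg (u : nat -> R) M : (forall k, `|u k| <= M) -> u @ nultra --> ulim u.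
Proof.
move=> uM.
have Uu : UltraFilter (u @ nultra).
  split; first exact: fmap_proper_filter.
  move=> G GF sub; apply/funext => A; apply/propext; split; last exact: sub.
  move=> GA; have [//|UC] := in_ultra_setVsetC (u @^-1` A) nultra_ultra.
  have GC : G (~` A) by apply: sub.
  by have /filter_ex[x []] : G (A `&` ~` A) by exact: filterI.
have := @segment_compact R (- M) M; rewrite compact_ultra => /(_ _ Uu).
case.
  by apply: (@filterE _ nultra) => k; rewrite /= in_itv /= -ler_norml.
by move=> p [_ up]; rewrite /ulim; apply: cvgP up.
Qed.

Lemma ulimP (u : nat -> R) l : u @ nultra --> l -> ulim u = l.
Proof. by move=> ul; apply: cvg_lim. Qed.

Lemma cvg_nultra (T : topologicalType) (u : nat -> T) (l : T) : u @ \oo --> l -> u @ nultra --> l.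
Proof. by move=> ul A Al; apply: nultra_oo; exact: (ul _ Al). Qed.

End UltraLimit.

Section VectorNorm.
Context {R : realType}.

Lemma le_coord_norm m n (M : 'M[R]_(m, n)) i j : `|M i j| <= `|M|.
Proof.
rewrite [leRHS]/Num.norm/= mx_normrE.
exact: (le_bigmax _ (fun ij : 'I_m * 'I_n => `|M ij.1 ij.2|) (i, j)).
Qed.

Lemma mx_norm_le m n (M : 'M[R]_(m, n)) C :
  0 <= C -> (forall i j, `|M i j| <= C) -> `|M| <= C.
Proof.
move=> C0 MC; rewrite [leLHS]/Num.norm/= mx_normrE.
by apply/bigmax_leP; split=> // -[i j] _; exact: MC.
Qed.

Lemma norm_mulmx m n p (M : 'M[R]_(m, n)) (N : 'M[R]_(n, p)) :
  `|M *m N| <= n%:R * `|M| * `|N|.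
Proof.
apply: mx_norm_le => [|i j]; first by rewrite !mulr_ge0.
rewrite mxE (le_trans (ler_norm_sum _ _ _))//.
apply: (@le_trans _ _ (\sum_(k < n) `|M| * `|N|)).
  by apply: ler_sum => k _; rewrite normrM ler_pM// le_coord_norm.
by rewrite sumr_const card_ord -mulrA mulr_natl.
Qed.

Lemma norm_delta m n i j : `|delta_mx i j : 'M[R]_(m, n)| <= 1.
Proof. by apply: mx_norm_le => // k l; rewrite mxE; case: (_ && _); rewrite /= ?normr1 ?normr0. Qed.

Lemma bilinear_bounded n (B : {bilinear 'cV[R]_n -> 'cV[R]_n -> 'cV[R]_n}) :
  exists2 C, 0 <= C & forall u v, `|B u v| <= C * `|u| * `|v|.
Proof.
pose C := \sum_i \sum_j `|B (delta_mx i 0) (delta_mx j 0)|.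
have C0 : 0 <= C by apply: sumr_ge0 => i _; apply: sumr_ge0.
exists C => // u v.
have E (w : 'cV[R]_n) : w = \sum_j w j 0 *: delta_mx j 0.
  by rewrite {1}(matrix_sum_delta w); apply: eq_bigr => i _; rewrite big_ord1.
rewrite {1}(E u) {1}(E v) linear_sumlz /= mulr_suml mulr_suml.
rewrite (le_trans (ler_norm_sum _ _ _))//; apply: ler_sum => i _.
rewrite linearZl_LR linear_sumr /= normrZ !mulr_suml.
rewrite (le_trans (ler_wpM2l _ (ler_norm_sum _ _ _)))// mulr_sumr.
apply: ler_sum => j _; rewrite linearZr_LR normrZ /= mulrA mulrC -mulrA.
by rewrite ler_wpM2l// ler_pM// le_coord_norm.
Qed.

End VectorNorm.

Lemma cvg_sumr {R : realType} (T I : Type) (F : set_system T) {FF : Filter F}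
    (r : seq I) (f : I -> T -> R) (a : I -> R) :
  (forall i, f i @ F --> a i) ->
  (fun k => \sum_(i <- r) f i k) @ F --> \sum_(i <- r) a i.
Proof.
move=> fa; elim: r => [|i r IH].
  under eq_fun do rewrite big_nil.
  by rewrite big_nil; exact: cvg_cst.
under eq_fun do rewrite big_cons.
by rewrite big_cons; apply: cvgD.
Qed.

Section Dot.
Context {R : realType} {n : nat}.
Implicit Types u v w : 'cV[R]_n.

Lemma dotDl u v w : dot (u + v) w = dot u w + dot v w.
Proof. by rewrite /dot -big_split; apply: eq_bigr => i _; rewrite mxE mulrDl. Qed.

Lemma dotZl a u v : dot (a *: u) v = a * dot u v.
Proof. by rewrite /dot mulr_sumr; apply: eq_bigr => i _; rewrite mxE mulrA. Qed.

Lemma dotDr u v w : dot w (u + v) = dot w u + dot w v.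
Proof. by rewrite ![dot w _]dotC dotDl. Qed.

Lemma dotZr a u v : dot u (a *: v) = a * dot u v.
Proof. by rewrite ![dot u _]dotC dotZl. Qed.

Lemma dotNl u v : dot (- u) v = - dot u v.
Proof. by rewrite -scaleN1r dotZl mulN1r. Qed.

Lemma dotNr u v : dot u (- v) = - dot u v.
Proof. by rewrite dotC dotNl dotC. Qed.

Lemma dotBl u v w : dot (u - v) w = dot u w - dot v w.
Proof. by rewrite dotDl dotNl. Qed.

Lemma dotBr u v w : dot w (u - v) = dot w u - dot w v.
Proof. by rewrite dotDr dotNr. Qed.

Lemma dot0l u : dot 0 u = 0.
Proof. by rewrite -(scale0r u) dotZl mul0r. Qed.

Lemma dot_sqrD u v : dot (u + v) (u + v) = dot u u + 2 * dot u v + dot v v.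
Proof. by rewrite !dotDl !dotDr [dot v u]dotC; ring. Qed.

Lemma dot_mulmx (M : 'M[R]_n) u v : dot (M *m u) v = dot u (M^T *m v).
Proof. by rewrite !dotE trmx_mul mulmxA. Qed.

Lemma dot_ge0 u : 0 <= dot u u.
Proof. by apply: sumr_ge0 => i _; rewrite -expr2 sqr_ge0. Qed.

Lemma le_norm_dot u : `|u| ^+ 2 <= dot u u.
Proof.
rewrite -[leRHS]sqr_sqrtr ?dot_ge0// lerXn2r ?nnegrE ?sqrtr_ge0//.
apply: mx_norm_le => [|i j]; rewrite ?sqrtr_ge0// (ord1 j).
rewrite -sqrtr_sqr ler_sqrt ?dot_ge0// /dot (bigD1 i)//= -expr2.
by rewrite lerDl; apply: sumr_ge0 => k _; rewrite -expr2 sqr_ge0.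
Qed.

Lemma norm_dot_le u v : `|dot u v| <= n%:R * `|u| * `|v|.
Proof.
rewrite (le_trans (ler_norm_sum _ _ _))//.
apply: (@le_trans _ _ (\sum_(k < n) `|u| * `|v|)).
  by apply: ler_sum => k _; rewrite normrM ler_pM// le_coord_norm.
by rewrite sumr_const card_ord -mulrA mulr_natl.
Qed.

Lemma dot_norm_le u : dot u u <= n%:R * `|u| ^+ 2.
Proof. by rewrite expr2 mulrA (le_trans (ler_norm _))// norm_dot_le. Qed.

Lemma enorm_dot u : enorm u ^+ 2 = dot u u.
Proof.
rewrite /enorm /l2norm sqr_sqrtr; last by apply: sumr_ge0 => i _; rewrite sqr_ge0.
by apply: eq_bigr => i _; rewrite real_normK ?num_real// expr2.
Qed.

Lemma japaneseE u : japanese u = Num.sqrt (1 + dot u u).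
Proof. by rewrite /japanese enorm_dot. Qed.

Lemma enorm_ge0 u : 0 <= enorm u. Proof. exact: sqrtr_ge0. Qed.

Lemma dot1_enorm u : dot u u = 1 -> enorm u = 1.
Proof.
by move=> u1; apply/eqP; rewrite -(@eqrXn2 _ 2)// ?enorm_ge0// enorm_dot u1 expr1n.
Qed.

Lemma ulim_cV (x : nat -> 'cV[R]_n) C : (forall k, `|x k| <= C) ->
  exists y : 'cV[R]_n, forall i, (fun k => x k i 0) @ nultra --> y i 0.
Proof.
move=> xC; exists (\col_i ulim (fun k => x k i 0)) => i; rewrite mxE.
by apply: (@ulim_cvg _ _ C) => k; exact: le_trans (le_coord_norm _ _ _) (xC k).
Qed.

Lemma cvg_dot (T : Type) (F : set_system T) {FF : Filter F} (x y : T -> 'cV[R]_n) (a b : 'cV[R]_n) :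
  (forall i, (fun k => x k i 0) @ F --> a i 0) ->
  (forall i, (fun k => y k i 0) @ F --> b i 0) ->
  (fun k => dot (x k) (y k)) @ F --> dot a b.
Proof.
by move=> xa yb; apply: cvg_sumr => i; apply: cvgM.
Qed.

Lemma cvg_mulmx (T : Type) (F : set_system T) {FF : Filter F} (M : 'M[R]_n)
  (x : T -> 'cV[R]_n) (a : 'cV[R]_n) :
  (forall i, (fun k => x k i 0) @ F --> a i 0) ->
  (forall i, (fun k => (M *m x k) i 0) @ F --> (M *m a) i 0).
Proof.
move=> xa i; rewrite mxE; under eq_fun do rewrite mxE.
by apply: cvg_sumr => j; apply: cvgM; [exact: cvg_cst|exact: xa].
Qed.

End Dot.

(** * The projections onto ker A and its complement *)

Section Projections.
Context {R : realType} {n : nat}.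
Variable A : 'M[R]_n.
Implicit Types v w : 'cV[R]_n.

Lemma Pi_ker_in v : A *m (Pi_ker A *m v) = 0.
Proof. by apply/ker_spP; exact: orth_proj_sub. Qed.

Lemma Pi_kerperp_orth w v : A *m w = 0 -> dot w (Pi_kerperp A *m v) = 0.
Proof. by move=> /ker_spP; move: w; apply/orthocompP; exact: orth_proj_sub. Qed.

Lemma orth_ker_perp w : (forall v, A *m v = 0 -> dot v w = 0) -> forall v,
  dot w (v - Pi_kerperp A *m v) = 0.
Proof.
move=> wk v; apply: orth_proj_orth; apply/orthocompP => u /ker_spP; exact: wk.
Qed.

(** [Pi_kerperp] projects onto the complement along the complement of the complement, so the two
    projections do not add up by definition. The defect [p + q - v] is orthogonal to ker A, in
    particular to [p], and then also to [v - q]; being [p - (v - q)], it is orthogonal to itself. *)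
Lemma Pi_kerD v : Pi_ker A *m v + Pi_kerperp A *m v = v.
Proof.
apply/eqP; rewrite -subr_eq0; apply/eqP/dot_eq0.
set p := Pi_ker A *m v; set q := Pi_kerperp A *m v.
have H1 u : A *m u = 0 -> dot u (v - p) = 0 by move=> /ker_spP; exact: orth_proj_orth.
have H2 u : A *m u = 0 -> dot u q = 0 by exact: Pi_kerperp_orth.
have E u : A *m u = 0 -> dot u (p + q - v) = 0.
  by move=> u0; rewrite addrAC -opprB dotDr dotNr H1// H2// oppr0 addr0.
have F : dot (p + q - v) (v - q) = 0.
  by apply: orth_ker_perp => u; exact: E.
have dE : p - (v - q) = p + q - v by rewrite opprB addrA.
by rewrite -{2}dE dotBr F subr0 dotC E// Pi_ker_in.
Qed.

Lemma Pi_ker_id w : A *m w = 0 -> Pi_ker A *m w = w.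
Proof.
move=> Aw; apply/eqP; rewrite -subr_eq0; apply/eqP/dot_eq0.
have E : Pi_ker A *m w - w = - (Pi_kerperp A *m w) by rewrite -{2}(Pi_kerD w) opprD addNKr.
rewrite {2}E dotNr Pi_kerperp_orth ?oppr0// mulmxBr Aw Pi_ker_in subrr//.
Qed.

Lemma Pi_kerperp0 w : A *m w = 0 -> Pi_kerperp A *m w = 0.
Proof. by move=> Aw; have := Pi_kerD w; rewrite Pi_ker_id// -[RHS]addr0 => /addrI. Qed.

Lemma Pi_kerperpE v : Pi_kerperp A *m v = v - Pi_ker A *m v.
Proof. by rewrite -{2}(Pi_kerD v) addrC addrA addNr add0r. Qed.

Lemma Pi_kerperp_ker v : Pi_kerperp A *m (Pi_ker A *m v) = 0.
Proof. by rewrite Pi_kerperp0// Pi_ker_in. Qed.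

Lemma Pi_kerperp_idem v : Pi_kerperp A *m (Pi_kerperp A *m v) = Pi_kerperp A *m v.
Proof. by rewrite {1}[Pi_kerperp A *m v]Pi_kerperpE mulmxBr Pi_kerperp_ker subr0. Qed.

Lemma mulmx_Pi_kerperp v : A *m (Pi_kerperp A *m v) = A *m v.
Proof. by rewrite Pi_kerperpE mulmxBr Pi_ker_in subr0. Qed.

Lemma Pi_kerperp_idem_mx : Pi_kerperp A *m Pi_kerperp A = Pi_kerperp A.
Proof.
apply/matrixP => i j; have := Pi_kerperp_idem (delta_mx j 0).
by rewrite !mulmxA -!colE => /matrixP/(_ i 0); rewrite !mxE.
Qed.

Hypothesis Apsd : psd A.

Lemma Pi_ker_mulmx v : Pi_ker A *m (A *m v) = 0.
Proof.
apply: dot_eq0; set p := Pi_ker A *m _.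
have -> : dot p p = dot p (A *m v).
  by rewrite -[A *m v in RHS]Pi_kerD dotDr Pi_kerperp_orth ?addr0// Pi_ker_in.
by rewrite dotC dot_mulmx Apsd.1 Pi_ker_in dotC dot0l.
Qed.

Lemma Pi_kerperp_mulmx v : Pi_kerperp A *m (A *m v) = A *m v.
Proof. by rewrite Pi_kerperpE Pi_ker_mulmx subr0. Qed.

Lemma dot_mulmx_Pi_kerperp v :
  dot v (A *m v) = dot (Pi_kerperp A *m v) (A *m (Pi_kerperp A *m v)).
Proof.
rewrite mulmx_Pi_kerperp -{1}(Pi_kerD v) dotDl.
by rewrite [X in X + _](_ : _ = 0) ?add0r// dotC dot_mulmx Apsd.1 Pi_ker_in dotC dot0l.
Qed.

(** First-order condition at a minimum: along [v + t *: w] with [w = A v] the nonnegative form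
    equals [2 t |w|^2 + t^2 (w . A w)], which is negative for small negative [t] unless [w = 0]. *)
Lemma psd_dot0 v : dot v (A *m v) = 0 -> A *m v = 0.
Proof.
move=> v0; apply: dot_eq0; set w := A *m v.
have H t : 0 <= 2 * t * dot w w + t ^+ 2 * dot w (A *m w).
  have := Apsd.2 (v + t *: w).
  rewrite mulmxDr -scalemxAr !(dotDl, dotDr, dotZl, dotZr) v0 -/w.
  have -> : dot v (A *m w) = dot w w by rewrite dotC dot_mulmx Apsd.1.
  by move=> /le_trans; apply; rewrite le_eqVlt; apply/orP; left; apply/eqP; ring.
have w0 := dot_ge0 w; have q0 := Apsd.2 w.
apply/eqP; rewrite eq_le w0 andbT leNgt; apply/negP => wp.
(* Close to the minimizer [t = - |w|^2 / (w . A w)]; the added 1 covers the case of a zero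
   denominator. *)
have := H (- (dot w w / (1 + dot w (A *m w)))).
set a := dot w w in wp *; set q := dot w (A *m w) in q0 *.
have q1 : 0 < 1 + q by lra.
have -> : 2 * - (a / (1 + q)) * a + (- (a / (1 + q))) ^+ 2 * q =
  - (a ^+ 2 / (1 + q) ^+ 2 * (2 + q)) by field; rewrite gt_eqF.
rewrite oppr_ge0 leNgt mulr_gt0// ?divr_gt0 ?exprn_gt0//; lra.
Qed.

(** Compactness in place of diagonalization: unit vectors of the complement on which the form tends
    to 0 have as ultralimit a unit vector of the complement that [A] annihilates, hence one
    orthogonal to itself. *)
Lemma psd_gap : exists2 a, 0 < a &
  forall v, a * dot (Pi_kerperp A *m v) (Pi_kerperp A *m v) <= dot v (A *m v).
Proof.
apply: contrapT => H.
have {}H (k : nat) : exists v, [/\ dot v v = 1, Pi_kerperp A *m v = v &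
    dot v (A *m v) <= k.+1%:R^-1].
  apply: contrapT => Hk; apply: H; exists k.+1%:R^-1; first by rewrite invr_gt0.
  move=> v; rewrite dot_mulmx_Pi_kerperp; set y := Pi_kerperp A *m v.
  have [y0|yN] := eqVneq (dot y y) 0.
    by rewrite y0 mulr0; exact: Apsd.2.
  have yp : 0 < dot y y by rewrite lt_def yN dot_ge0.
  rewrite leNgt; apply/negP => Hy; apply: Hk.
  exists ((Num.sqrt (dot y y))^-1 *: y).
  have sq : (Num.sqrt (dot y y))^-1 * (Num.sqrt (dot y y))^-1 = (dot y y)^-1.
    by rewrite -invfM -expr2 sqr_sqrtr ?dot_ge0.
  split.
  - by rewrite dotZl dotZr mulrA sq mulVf.
  - by rewrite -scalemxAr Pi_kerperp_idem.
  - by rewrite -scalemxAr dotZl dotZr mulrA sq mulrC ler_pdivrMr// ltW.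
have [x xP] := choice H.
have x1 k : `|x k| <= 1.
  have [xx _ _] := xP k.
  by rewrite -(@ler_pXn2r _ 2)// ?nnegrE// expr1n -xx le_norm_dot.
have [y xy] := ulim_cV x1.
have yy : dot y y = 1.
  have H1 : (fun k => dot (x k) (x k)) @ nultra --> dot y y by exact: cvg_dot.
  rewrite -(cvg_unique _ H1 (_ : _ --> (1 : R)))//.
  by under eq_fun => k do (have [-> _ _] := xP k); exact: cvg_cst.
have Ay : dot y (A *m y) = 0.
  have H1 : (fun k => dot (x k) (A *m x k)) @ nultra --> dot y (A *m y).
    by apply: cvg_dot => //; exact: cvg_mulmx.
  rewrite -(cvg_unique _ H1 (_ : _ --> (0 : R)))//.
  apply: cvg_nultra; apply: (@squeeze_cvgr _ _ _ _ (fun=> 0) (fun k : nat => k.+1%:R^-1)).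
  - by apply: nearW => k; have [_ _ ->] := xP k; rewrite andbT; exact: Apsd.2.
  - exact: cvg_cst.
  - exact: cvg_harmonic.
have : dot y y = 0.
  have Py : Pi_kerperp A *m y = y.
    apply/matrixP => i j; rewrite (ord1 j).
    have H1 : (fun k => (Pi_kerperp A *m x k) i 0) @ nultra --> (Pi_kerperp A *m y) i 0.
      exact: cvg_mulmx.
    rewrite -(cvg_unique _ H1 (_ : _ --> y i 0))//.
    by under eq_fun => k do (have [_ -> _] := xP k); exact: xy.
  by rewrite -{1}Py dotC Pi_kerperp_orth// psd_dot0.
by rewrite yy => /eqP; rewrite oner_eq0.
Qed.

End Projections.

(** * Paths driven by additive noise *)

Section Paths.
Context {R : realType} {V : normedModType R}.

Definition path_cont (x : R -> V) := forall s e : R, 0 <= s -> 0 < e ->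
  exists2 h : R, 0 < h & forall t : R, 0 <= t -> `|t - s| < h -> `|x t - x s| <= e.

Lemma within_path_cont (x : R -> V) :
  {within @nonneg_times R, continuous x} -> path_cont x.
Proof.
move=> /subspace_continuousP xc s e s0 e0.
have /cvgrPdist_le/(_ _ e0) := xc s s0.
rewrite near_withinE => /nbhs_ballP[h /= h0 H]; exists h => // t t0 ts.
by rewrite distrC; apply: H => //; rewrite /ball/= distrC.
Qed.

Lemma path_cont_cvg (x : R -> V) (t : nat -> R) (s : R) (F : set_system nat) :
  Filter F -> path_cont x -> 0 <= s -> (forall k, 0 <= t k) -> t @ F --> s ->
  (fun k => x (t k)) @ F --> x s.
Proof.
move=> FF xc s0 t0 ts; apply/cvgrPdist_le => e e0.
have [h h0 H] := xc s e s0 e0.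
have /cvgrPdist_lt/(_ h h0) := ts; apply: filterS => k; rewrite distrC => /H.
by rewrite distrC; apply.
Qed.

Lemma ulim_itv (T : R) (t : nat -> R) : (forall k, 0 <= t k <= T) ->
  exists2 s : R, 0 <= s <= T & t @ nultra --> s.
Proof.
move=> tT; have tc : t @ nultra --> ulim t.
  by apply: (@ulim_cvg _ _ T) => k; have /andP[t0 tk] := tT k; rewrite ger0_norm.
exists (ulim t) => //; apply/andP; split.
- apply: limr_ge; first exact: cvgP tc.
  by apply: filterE => k; case/andP: (tT k).
- apply: limr_le; first exact: cvgP tc.
  by apply: filterE => k; case/andP: (tT k).
Qed.

Lemma path_bounded (x : R -> V) (T : R) : path_cont x ->
  exists2 M : R, 0 <= M & forall t : R, 0 <= t <= T -> `|x t| <= M.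
Proof.
move=> xc; apply: contrapT => H.
have {}H (k : nat) : exists t, 0 <= t <= T /\ k%:R < `|x t|.
  apply: contrapT => Hk; apply: H; exists k%:R => // t tT.
  by rewrite leNgt; apply/negP => kt; apply: Hk; exists t.
have [t tP] := choice H.
have [s /andP[s0 sT] ts] := @ulim_itv T t (fun k => (tP k).1).
have xs : (fun k => x (t k)) @ nultra --> x s.
  by apply: path_cont_cvg => // k; have [/andP[]] := tP k.
have /cvgrPdist_le/(_ 1 ltr01) xs1 := xs.
have [k kN xk] := @nultra_large _ (Num.truncn (`|x s| + 1)).+1 xs1.
have [_] := tP k; apply/negP; rewrite -leNgt.
apply: (@le_trans _ _ (`|x s| + 1)).
  by rewrite -lerBlDl (le_trans (lerB_dist _ _))// distrC.
apply: ltW; rewrite (lt_le_trans (truncnS_gt _))// ler_nat//.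
Qed.

Lemma path_unif_cont (x : R -> V) (T e : R) : path_cont x -> 0 < e ->
  exists2 h : R, 0 < h & forall s t : R, 0 <= s <= T -> 0 <= t <= T ->
    `|t - s| <= h -> `|x t - x s| <= e.
Proof.
move=> xc e0; apply: contrapT => H.
have {}H (k : nat) : exists st : R * R, [/\ 0 <= st.1 <= T, 0 <= st.2 <= T,
   `|st.2 - st.1| <= k.+1%:R^-1 & e < `|x st.2 - x st.1|].
  apply: contrapT => Hk; apply: H; exists k.+1%:R^-1; first by rewrite invr_gt0.
  move=> s t sT tT ts.
  by rewrite leNgt; apply/negP => kt; apply: Hk; exists (s, t).
have [st stP] := choice H.
pose s k := (st k).1; pose t k := (st k).2.
have sT k : 0 <= s k <= T by have [] := stP k.
have tT k : 0 <= t k <= T by have [] := stP k.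
have [l /andP[l0 lT] sl] := @ulim_itv T s sT.
have tl : t @ nultra --> l.
  have -> : t = s \+ (t \- s) by apply/funext => k /=; rewrite addrC subrK.
  rewrite -[l]addr0; apply: cvgD => //.
  apply: cvg_nultra; apply/cvgrPdist_le => d d0.
  have /cvgrPdist_le/(_ d d0) := @cvg_harmonic R.
  apply: filterS => k; rewrite !sub0r !normrN => kd.
  have [_ _ stk _] := stP k; rewrite (le_trans stk)//.
  by rewrite (le_trans _ kd)// ler_norm.
have e2 : 0 < e / 2 by rewrite divr_gt0.
have sc : (fun k => x (s k)) @ nultra --> x l.
  by apply: path_cont_cvg => // k; case/andP: (sT k).
have tc : (fun k => x (t k)) @ nultra --> x l.
  by apply: path_cont_cvg => // k; case/andP: (tT k).
have /cvgrPdist_le/(_ _ e2) s2 := sc; have /cvgrPdist_le/(_ _ e2) t2 := tc.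
have /filter_ex[k [/= sk tk]] : nultra ([set k | `|x l - x (s k)| <= e / 2] `&`
    [set k | `|x l - x (t k)| <= e / 2]) by exact: filterI.
have [_ _ _] := stP k; apply/negP; rewrite -leNgt.
rewrite -[x (st k).2](subrK (x l)) -addrA (le_trans (ler_normD _ _))//.
by rewrite [leRHS]splitr lerD// distrC.
Qed.

End Paths.

Section Drift.
Context {R : realType} {n : nat}.
Implicit Types (x y : 'cV[R]_n).

Definition quad_lip (b : 'cV[R]_n -> 'cV[R]_n) (C : R) :=
  b 0 = 0 /\ forall x y, `|b x - b y| <= C * (1 + `|x| + `|y|) * `|x - y|.

Lemma quad_lip_le b C x : quad_lip b C -> `|b x| <= C * (1 + `|x|) * `|x|.
Proof. by move=> [b0 /(_ x 0)]; rewrite b0 !subr0 normr0 addr0. Qed.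

Lemma drift_quad_lip (B : {bilinear 'cV[R]_n -> 'cV[R]_n -> 'cV[R]_n}) (A : 'M[R]_n) :
  exists2 C, 0 <= C & quad_lip (drift B A) C.
Proof.
have [C C0 BC] := bilinear_bounded B.
exists (C + n%:R * `|A|); first by rewrite addr_ge0// mulr_ge0.
split=> [|x y]; first by rewrite /drift linear0r mulmx0 subr0.
have -> : drift B A x - drift B A y = B x (x - y) + B (x - y) y - A *m (x - y).
  rewrite /drift linearBr linearBl mulmxBr /=.
  apply/matrixP => i j; rewrite !mxE; ring.
rewrite (le_trans (ler_normB _ _))//.
rewrite (le_trans (lerD (ler_normD _ _) (lexx _)))//.
have h1 := BC x (x - y); have h2 := BC (x - y) y; have h3 := norm_mulmx A (x - y).
have xy0 := normr_ge0 (x - y); have x0 := normr_ge0 x; have y0 := normr_ge0 y.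
have A0 : 0 <= n%:R * `|A| by rewrite mulr_ge0.
move: h1 h2 h3; set p := `|x - y| in xy0 *; set a := n%:R * `|A| in A0 *.
move=> h1 h2 h3; apply: le_trans (lerD (lerD h1 h2) h3) _.
rewrite -subr_ge0; have -> : (C + a) * (1 + `|x| + `|y|) * p - (C * `|x| * p + C * p * `|y| + a * p) = C * p + a * `|x| * p + a * `|y| * p by ring.
by rewrite !addr_ge0// !mulr_ge0.
Qed.

(** The integral equation read as consistency of the Euler step, uniformly on [[0, T]]. In this form
    it contains no integral and passes directly to time shifts and to grids. *)
Definition path_ode (b : 'cV[R]_n -> 'cV[R]_n) (S : 'M[R]_n) (x w : R -> 'cV[R]_n) :=
  forall T e : R, 0 < e -> exists2 h : R, 0 < h & forall s t : R, 0 <= s -> s <= t -> t <= T ->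
    t - s <= h ->
    `|x t - x s - (t - s) *: b (x s) - S *m (w t - w s)| <= e * (t - s).

Lemma path_cont_comp (f : 'cV[R]_n -> 'cV[R]_n) C (x : R -> 'cV[R]_n) : quad_lip f C -> 0 <= C ->
  path_cont x -> path_cont (fun t : R => f (x t)).
Proof.
move=> [_ fC] C0 xc s e s0 e0.
pose K := C * (2 + 2 * `|x s|) + 1.
have xs0 := normr_ge0 (x s).
have K1 : 1 <= K by rewrite /K lerDr mulr_ge0//; lra.
have K0 : 0 < K by lra.
have m0 : 0 < Num.min 1 (e / K) by rewrite lt_min ltr01 divr_gt0.
have [h h0 H] := xc s _ s0 m0; exists h => // t t0 ts.
have := H t t0 ts; rewrite le_min => /andP[x1 xe].
apply: le_trans (fC _ _) _.
have xt : `|x t| <= 1 + `|x s|.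
  by rewrite -[x t](subrK (x s)) (le_trans (ler_normD _ _))// lerD2r.
apply: (@le_trans _ _ (K * `|x t - x s|)); last by rewrite mulrC -ler_pdivlMr.
by apply: ler_wpM2r => //; rewrite /K ler_wpDr// ler_wpM2l//; lra.
Qed.

Lemma path_cont_coord (f : R -> 'cV[R]_n) i : path_cont f ->
  path_cont (fun t : R => (f t i 0 : R)).
Proof.
move=> fc s e s0 e0; have [h h0 H] := fc s e s0 e0; exists h => // t t0 ts.
apply: le_trans (H t t0 ts).
by have := le_coord_norm (f t - f s) i 0; rewrite !mxE.
Qed.

Lemma path_cont_integrable (f : R -> R) (t : R) : path_cont f ->
  (@lebesgue_measure R).-integrable `[0, t] (EFin \o f).
Proof.
move=> fc; apply: continuous_compact_integrable; first exact: segment_compact.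
apply/subspace_continuousP => s; rewrite /= in_itv /= => /andP[s0 st].
apply/cvgrPdist_le => e e0; have [h h0 H] := fc s e s0 e0.
rewrite near_withinE; apply/nbhs_ballP; exists h => //= u.
rewrite /ball/= => su; rewrite in_itv/= => /andP[u0 _].
by rewrite distrC; apply: H => //; rewrite distrC.
Qed.

Lemma Rintegral_increment (f : R -> R) (s t e : R) : path_cont f -> 0 <= s -> s <= t ->
  (forall u, s <= u <= t -> `|f u - f s| <= e) ->
  `|\int[lebesgue_measure]_(u in `[0, t]) f u -
    \int[lebesgue_measure]_(u in `[0, s]) f u - (t - s) * f s| <= e * (t - s).
Proof.
move=> fc s0 st fe.
have i0t := path_cont_integrable t fc.
have sub : `]s, t]%classic `<=` (`[0, t]%classic : set R).
  move=> u /=; rewrite !in_itv/= => /andP[su ->]; rewrite andbT.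
  exact: le_trans s0 (ltW su).
have ist : (@lebesgue_measure R).-integrable `]s, t] (EFin \o f).
  by apply: integrableS i0t.
have mst : measurable (`]s, t]%classic : set R) by [].
have icst k : (@lebesgue_measure R).-integrable `]s, t] (EFin \o (fun=> k)).
  have i1 : (@lebesgue_measure R).-integrable `[0, t] (EFin \o (fun=> k)).
    by apply: path_cont_integrable => u d u0 d0; exists 1 => // *; rewrite subrr normr0 ltW.
  by apply: integrableS i1.
have len : fine (@lebesgue_measure R `]s, t]%classic) = t - s.
  rewrite lebesgue_measure_itv /= lte_fin.
  have [//|ts] := ltP s t; have -> : t = s by apply/eqP; rewrite eq_le ts.
  by rewrite subrr.
rewrite Rintegral_itvB ?bnd_simp// -[(t - s) * f s](_ : \int[lebesgue_measure]_(x in `]s, t]) f s = _);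
  last by rewrite Rintegral_cst// len mulrC.
rewrite (_ : _ - _ = \int[lebesgue_measure]_(u in `]s, t]) (f u - f s)); last first.
  by rewrite RintegralB//; exact: icst.
have iB : (@lebesgue_measure R).-integrable `]s, t] (EFin \o (fun u => f u - f s)).
  by rewrite (_ : _ \o _ = ((EFin \o f) \- (EFin \o (fun=> f s)))%E)//; exact: integrableB.
rewrite (le_trans (le_normr_Rintegral _ _))//.
rewrite -len -Rintegral_cst//; apply: le_Rintegral => //.
  exact: (integrable_norm iB).
by move=> u; rewrite /= in_itv/= => /andP[su ut]; rewrite fe// ut (ltW su).
Qed.

Lemma sol_path_ode (B : 'cV[R]_n -> 'cV[R]_n -> 'cV[R]_n) (A S : 'M[R]_n) C x0
    (x w : R -> 'cV[R]_n) :
  0 <= C -> quad_lip (drift B A) C -> path_cont x ->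
  (forall t, 0 <= t -> x t = x0
     + \col_i (\int[lebesgue_measure]_(s in `[0, t]) drift B A (x s) i 0)%R
     + S *m w t) ->
  path_ode (drift B A) S x w.
Proof.
move=> C0 bC xc xE T e e0.
have bc : path_cont (fun t => drift B A (x t)) by exact: path_cont_comp bC C0 xc.
have [h h0 H] := @path_unif_cont _ _ _ T _ bc e0.
exists h => // s t s0 st tT ts.
apply: mx_norm_le => [|i j]; first by rewrite mulr_ge0 ?(ltW e0)// subr_ge0.
rewrite (ord1 j); pose f (u : R) : R := drift B A (x u) i 0.
have -> : (x t - x s - (t - s) *: drift B A (x s) - S *m (w t - w s)) i 0 =
    \int[lebesgue_measure]_(u in `[0, t]) f u -
    \int[lebesgue_measure]_(u in `[0, s]) f u - (t - s) * f s.
  have -> : (x t - x s - (t - s) *: drift B A (x s) - S *m (w t - w s)) i 0 =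
      x t i 0 - x s i 0 - (t - s) * f s - ((S *m w t) i 0 - (S *m w s) i 0).
    by rewrite mulmxBr /f; move: (S *m w t) (S *m w s) (drift B A (x s)) => p q r; rewrite !mxE.
  have /matrixP/(_ i 0) -> := xE t (le_trans s0 st).
  have /matrixP/(_ i 0) -> := xE s s0.
  by move: (S *m w t) (S *m w s) => p q; rewrite !mxE -/(f _); ring.
apply: Rintegral_increment => //; first exact: path_cont_coord bc.
move=> u /andP[su ut].
have := H s u; rewrite s0 (le_trans st tT) (le_trans s0 su) (le_trans ut tT).
move=> /(_ isT isT) Hu.
have -> : f u - f s = (drift B A (x u) - drift B A (x s)) i 0.
  by rewrite /f; move: (drift B A (x u)) (drift B A (x s)) => p q; rewrite !mxE.
apply: le_trans (le_coord_norm _ _ _) _; apply: Hu.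
rewrite ger0_norm ?subr_ge0//; lra.
Qed.

End Drift.

Section Gronwall.
Context {R : realType}.

Lemma discrete_gronwall (u : nat -> R) (a c : R) N : 0 <= a -> 0 <= c -> 0 <= u 0%N ->
  (forall k, (k < N)%N -> u k.+1 <= (1 + a) * u k + c) ->
  forall k, (k <= N)%N -> u k <= (u 0%N + k%:R * c) * expR (k%:R * a).
Proof.
move=> a0 c0 u0 H; elim=> [|k IH] kN; first by rewrite !mul0r addr0 expR0 mulr1.
apply: le_trans (H _ kN) _.
have {}IH := IH (ltnW kN).
have ea : 1 + a <= expR a by exact: expR_ge1Dx.
have e1 : 1 <= expR (k.+1%:R * a) by rewrite -expR0 ler_expR mulr_ge0.
have a1 : 0 <= 1 + a by lra.
apply: (@le_trans _ _ ((u 0%N + k%:R * c) * expR (k.+1%:R * a) + c * expR (k.+1%:R * a))).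
  apply: lerD; last by rewrite ler_peMr.
  apply: le_trans (ler_wpM2l a1 IH) _.
  have -> : k.+1%:R * a = k%:R * a + a by rewrite -natr1 mulrDl mul1r.
  rewrite expRD mulrCA ler_wpM2l//; first by rewrite addr_ge0// mulr_ge0.
  by rewrite mulrC ler_wpM2l// expR_ge0.
have -> : k.+1%:R * c = k%:R * c + c by rewrite -natr1 mulrDl mul1r.
by rewrite -mulrDl -addrA.
Qed.

Lemma growth_upper (u : R -> R) (T L : R) : 0 <= L -> 0 <= T -> (forall t, 0 <= u t) ->
  (forall e : R, 0 < e -> exists2 h : R, 0 < h & forall s t : R, 0 <= s -> s <= t -> t <= T ->
    t - s <= h -> `|u t - u s| <= (t - s) * (L * u s + e)) ->
  u T <= u 0 * expR (T * L) /\ u 0 <= u T * expR (T * (2 * L)).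
Proof.
move=> L0 T0 u0 H.
have [->|TN0] := eqVneq T 0; first by rewrite !mul0r expR0 mulr1.
have Tp : 0 < T by rewrite lt_neqAle eq_sym TN0.
have key (e : R) : 0 < e -> u T <= (u 0 + T * e) * expR (T * L) /\
    u 0 <= (u T + 2 * T * e) * expR (T * (2 * L)).
  move=> e0; have [h h0 Hh] := H e e0.
  (* The second bound on the mesh gives [d * L <= 1 / 2], used for the backward recursion. *)
  have m0 : 0 < Num.min h (1 / (2 * (L + 1))).
    by rewrite lt_min h0 divr_gt0// mulr_gt0//; lra.
  pose N := (Num.truncn (T / Num.min h (1 / (2 * (L + 1))))).+1.
  have N0 : 0 < N%:R :> R by rewrite ltr0n.
  pose d : R := T / N%:R.
  have d0 : 0 < d by rewrite divr_gt0.
  have Nd : N%:R * d = T by rewrite mulrC divfK// gt_eqF.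
  have dm : d <= Num.min h (1 / (2 * (L + 1))).
    rewrite /d ler_pdivrMr// mulrC -ler_pdivrMr//.
    by apply: ltW; exact: truncnS_gt.
  clearbody d; move: dm; rewrite le_min => /andP[dh dL].
  have dL2 : d * (2 * (L + 1)) <= 1 by rewrite -ler_pdivlMr// mulr_gt0//; lra.
  have step k : (k < N)%N -> `|u (k.+1%:R * d) - u (k%:R * d)| <= d * (L * u (k%:R * d) + e).
    move=> kN.
    have E : k.+1%:R * d - k%:R * d = d by rewrite -mulrBl -natr1 addrAC subrr add0r mul1r.
    have := Hh (k%:R * d) (k.+1%:R * d); rewrite E; apply => //.
    - by rewrite mulr_ge0// ltW.
    - by rewrite ler_wpM2r ?(ltW d0)// ler_nat.
    - by rewrite -Nd ler_wpM2r ?(ltW d0)// ler_nat.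
  have L20 : 0 <= d * L by rewrite mulr_ge0// ltW.
  have de0 : 0 <= d * e by rewrite mulr_ge0// ltW.
  split.
    have := @discrete_gronwall (fun k => u (k%:R * d)) (d * L) (d * e) N L20 de0.
    rewrite /= mul0r => /(_ (u0 _)) G; have := G _ N (leqnn _).
    rewrite !mulrA Nd; apply.
    move=> k kN; have := step k kN; rewrite ler_distl => /andP[_ +].
    by move=> /le_trans; apply; rewrite le_eqVlt; apply/orP; left; apply/eqP; ring.
  (* Time reversal: the sequence starts from the value at [T] and ends at the value at 0. *)
  have := @discrete_gronwall (fun k => u ((N - k)%:R * d)) (d * (2 * L)) (2 * (d * e)) N.
  rewrite /= subn0 Nd => /(_ _ _ (u0 _)) G; have := G _ _ _ N (leqnn _).
  have -> : N%:R * (2 * (d * e)) = 2 * T * e by rewrite -Nd; ring.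
  have -> : N%:R * (d * (2 * L)) = T * (2 * L) by rewrite mulrA Nd.
  rewrite subnn mul0r; apply; rewrite ?mulr_ge0// ?(ltW d0)// ?(ltW e0)//.
  move=> k kN.
  have kN' : (N - k.+1 < N)%N by rewrite ltn_subrL /= (leq_ltn_trans (leq0n k) kN).
  have := step _ kN'; rewrite (subnSK kN) ler_distl => /andP[+ _].
  set a := u _; set b := u _ => ab.
  have a0 : 0 <= a by exact: u0.
  have b0 : 0 <= b by exact: u0.
  have t0 : 0 <= d * L by [].
  have E : a * (1 - d * L) <= b + d * e by lra.
  have F : 1 <= (1 - d * L) * (1 + d * (2 * L)).
    rewrite -subr_ge0; have -> : (1 - d * L) * (1 + d * (2 * L)) - 1 = d * L * (1 - 2 * (d * L)) by ring.
    rewrite mulr_ge0// subr_ge0; apply: le_trans dL2.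
    by have := d0; lra.
  have G1 : 0 <= 1 + d * (2 * L) by rewrite addr_ge0// mulr_ge0// ?(ltW d0)// mulr_ge0.
  have h1 : a <= a * (1 - d * L) * (1 + d * (2 * L)).
    by rewrite -mulrA -[leLHS]mulr1 ler_wpM2l.
  apply: le_trans h1 (le_trans (ler_wpM2r G1 E) _); rewrite mulrDl mulrC lerD2l mulrC.
  apply: ler_wpM2r => //.
  by have := d0; lra.
split; apply/ler_addgt0Pr => e e0.
- have E0 := expR_gt0 (T * L).
  have p0 : 0 < e / (T * expR (T * L)) by rewrite divr_gt0// mulr_gt0.
  have [h _] := key _ p0; apply: le_trans h _.
  rewrite mulrDl lerD2l le_eqVlt; apply/orP; left; apply/eqP.
  by field; rewrite TN0 gt_eqF.
- have E0 := expR_gt0 (T * (2 * L)).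
  have p0 : 0 < e / (2 * T * expR (T * (2 * L))) by rewrite divr_gt0// !mulr_gt0.
  have [_ h] := key _ p0; apply: le_trans h _.
  rewrite mulrDl lerD2l le_eqVlt; apply/orP; left; apply/eqP.
  by field; rewrite TN0 gt_eqF.
Qed.

End Gronwall.

(** * Stability of Euler schemes with a locally Lipschitz drift, and the tamed chain *)

Section Stability.
Context {R : realType} {n : nat}.
Variables (b : 'cV[R]_n -> 'cV[R]_n) (C : R).
Hypothesis C0 : 0 <= C.
Hypothesis bC : quad_lip b C.
Implicit Types (x y v : nat -> 'cV[R]_n).

(** A bootstrap. The scheme [y] is only assumed consistent while [|y| <= M + 1], and the Lipschitz
    constant is the one of that ball. As long as the distance is at most 1 the discrete Gronwall
    inequality applies one step further, and its bound is again at most 1 by hypothesis. *)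
Lemma scheme_stability x y v (M e d : R) N : 0 <= M -> 0 <= e -> 0 <= d ->
  (forall k, (k <= N)%N -> `|x k| <= M) ->
  (forall k, (k < N)%N -> `|x k.+1 - x k - d *: b (x k) - v k| <= e * d) ->
  (forall k, (k < N)%N -> `|y k| <= M + 1 -> `|y k.+1 - y k - d *: b (y k) - v k| <= e * d) ->
  (`|x 0%N - y 0%N| + N%:R * (2 * e * d)) * expR (N%:R * (d * (C * (2 + 2 * M)))) <= 1 ->
  forall k, (k <= N)%N -> `|x k - y k| <=
    (`|x 0%N - y 0%N| + N%:R * (2 * e * d)) * expR (N%:R * (d * (C * (2 + 2 * M)))).
Proof.
move=> M0 e0 d0 xM xs ys; set L := C * (2 + 2 * M).
have L0 : 0 <= L by rewrite mulr_ge0//; lra.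
set G := (_ * _) => G1.
have gr K : (K <= N)%N -> (forall k, (k < K)%N -> `|x k - y k| <= 1) ->
    forall k, (k <= K)%N -> `|x k - y k| <= G.
  move=> KN H k kK.
  have st j : (j < K)%N -> `|x j.+1 - y j.+1| <= (1 + d * L) * `|x j - y j| + 2 * e * d.
    move=> jK; have jN := leq_trans jK KN.
    have yM : `|y j| <= M + 1.
      rewrite -[y j](subrK (x j)) (le_trans (ler_normD _ _))// addrC lerD ?xM// ?(ltnW jN)//.
      by rewrite distrC H.
    have h1 := xs j jN; have h2 := ys j jN yM.
    have -> : x j.+1 - y j.+1 = (x j - y j) + d *: (b (x j) - b (y j)) +
      ((x j.+1 - x j - d *: b (x j) - v j) - (y j.+1 - y j - d *: b (y j) - v j)).
      by apply/matrixP => p q; rewrite scalerBr;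
         move: (b (x j)) (b (y j)) => bx bby; rewrite !mxE; ring.
    apply: le_trans (ler_normD _ _) _; apply: lerD; last first.
      apply: le_trans (ler_normB _ _) _; rewrite (le_trans (lerD h1 h2))//.
      by rewrite le_eqVlt; apply/orP; left; apply/eqP; ring.
    apply: le_trans (ler_normD _ _) _; rewrite mulrDl mul1r lerD2l.
    rewrite normrZ ger0_norm// -mulrA ler_wpM2l//.
    apply: le_trans (bC.2 _ _) _; rewrite ler_wpM2r// ler_wpM2l//.
    by have := xM j (ltnW jN); lra.
  have := @discrete_gronwall _ (fun j => `|x j - y j|) (d * L) (2 * e * d) K _ _ (normr_ge0 _) st k kK.
  move=> H1; have dL0 : 0 <= d * L by exact: mulr_ge0.
  have ed0 : 0 <= 2 * e * d by rewrite !mulr_ge0.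
  apply: le_trans (H1 dL0 ed0) _.
  have kN : k%:R <= N%:R :> R by rewrite ler_nat (leq_trans kK).
  apply: ler_pM; rewrite ?addr_ge0 ?mulr_ge0 ?expR_ge0//.
    by rewrite lerD2l ler_wpM2r// !mulr_ge0.
  by rewrite ler_expR ler_wpM2r// mulr_ge0.
have all1 K : (K <= N)%N -> forall k, (k <= K)%N -> `|x k - y k| <= 1.
  elim: K => [|K IH] KN k kK.
    by apply: le_trans G1; apply: (gr 0%N) => // -[].
  apply: le_trans G1; apply: (gr K.+1) => // j jK.
  by apply: IH => //; exact: ltnW.
by move=> k kN; apply: (gr N) => // j jN; apply: (all1 N) => //; exact: ltnW.
Qed.

Implicit Types (z : 'cV[R]_n).

(** The factor that tames the quadratic drift: [tame d z * Num.sqrt d * |z|^2 <= 1], so the square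
    of the drift increment [d *: tamed d z] is of order [d] uniformly in [z], while on bounded sets
    the factor differs from 1 by at most a multiple of [Num.sqrt d]. *)
Definition tame (d : R) (z : 'cV[R]_n) : R := (1 + Num.sqrt d * dot z z)^-1.

Lemma tame_den_ge1 d z : 1 <= 1 + Num.sqrt d * dot z z.
Proof. by rewrite lerDl mulr_ge0 ?sqrtr_ge0 ?dot_ge0. Qed.

Lemma tame_gt0 d z : 0 < tame d z.
Proof. by rewrite invr_gt0 (lt_le_trans ltr01)// tame_den_ge1. Qed.

Lemma tame_le1 d z : tame d z <= 1.
Proof. by rewrite invf_le1 ?tame_den_ge1// (lt_le_trans ltr01)// tame_den_ge1. Qed.

Lemma tame_ge d z : 1 - tame d z <= Num.sqrt d * dot z z.
Proof.
have h := tame_den_ge1 d z; have t1 := tame_le1 d z; have t0 := tame_gt0 d z.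
have E : tame d z * (1 + Num.sqrt d * dot z z) = 1.
  by rewrite /tame mulVf// gt_eqF// (lt_le_trans ltr01).
have s0 : 0 <= Num.sqrt d * dot z z by rewrite mulr_ge0 ?sqrtr_ge0 ?dot_ge0.
have : tame d z * (Num.sqrt d * dot z z) <= Num.sqrt d * dot z z by rewrite ler_piMl.
by lra.
Qed.

Definition tamed d z := tame d z *: b z.

Lemma tamed_close d z M : 0 <= M -> `|z| <= M ->
  `|tamed d z - b z| <= Num.sqrt d * (n%:R * M ^+ 2 * (C * (1 + M) * M)).
Proof.
move=> M0 zM.
have -> : tamed d z - b z = - ((1 - tame d z) *: b z).
  by rewrite scalerBl scale1r opprB.
rewrite normrN normrZ ger0_norm ?subr_ge0 ?tame_le1// mulrA.
have d1 : dot z z <= n%:R * M ^+ 2.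
  apply: le_trans (dot_norm_le _) _.
  by rewrite ler_wpM2l// lerXn2r// nnegrE.
apply: ler_pM => //; first by rewrite subr_ge0 tame_le1.
  apply: le_trans (tame_ge _ _) _.
  by rewrite ler_wpM2l// sqrtr_ge0.
apply: le_trans (quad_lip_le _ bC) _; apply: ler_pM => //.
  by rewrite mulr_ge0// addr_ge0.
by rewrite ler_wpM2l// lerD2l.
Qed.

(** The step may vary with the index, so that two stretches of time with different meshes can be
    concatenated; the Markov property for arbitrary times [s] and [t] relies on this. *)
Fixpoint chain (d : nat -> R) (v : nat -> 'cV[R]_n) (z : 'cV[R]_n) (k : nat) : 'cV[R]_n :=
  if k is j.+1 then let y := chain d v z j in y + d j *: tamed (d j) y + v j else z.

Lemma chainD (d : nat -> R) v z M k :
  chain d v z (M + k) = chain (fun j => d (M + j)%N) (fun j => v (M + j)%N) (chain d v z M) k.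
Proof. by elim: k => [|k IH]; rewrite ?addn0// addnS /= IH. Qed.

Lemma eq_chain (d d' : nat -> R) v v' z K : (forall k, (k < K)%N -> d k = d' k) ->
  (forall k, (k < K)%N -> v k = v' k) ->
  forall k, (k <= K)%N -> chain d v z k = chain d' v' z k.
Proof.
by move=> dd vv; elim=> // k IH kK; rewrite /= IH ?(ltnW kK)// dd// vv.
Qed.

End Stability.

(** * Pathwise convergence of the chain and continuity in the initial point *)

Section Convergence.
Context {R : realType} {n : nat}.
Variables (b : 'cV[R]_n -> 'cV[R]_n) (C : R).
Hypothesis C0 : 0 <= C.
Hypothesis bC : quad_lip b C.
Variable S : 'M[R]_n.
Implicit Types (x w : R -> 'cV[R]_n) (T M e s t : R).

Lemma exists_mesh (T h : R) : 0 <= T -> 0 < h ->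
  exists N0, forall N, (N0 < N)%N -> T / N%:R <= h.
Proof.
move=> T0 h0; exists (Num.truncn (T / h)) => N NN.
have N0 : 0 < N%:R :> R by rewrite ltr0n (leq_ltn_trans (leq0n _) NN).
rewrite ler_pdivrMr// mulrC -ler_pdivrMr//; apply: ltW.
by rewrite (lt_le_trans (truncnS_gt _))// ler_nat.
Qed.

Lemma mesh_mul T (d : R) N k : N%:R * d = T -> 0 <= d -> (k <= N)%N ->
  0 <= k%:R * d <= T.
Proof. by move=> <- d0 kN; rewrite mulr_ge0//= ler_wpM2r// ler_nat. Qed.

Lemma mesh_step (d : R) k : k.+1%:R * d - k%:R * d = d.
Proof. by rewrite -mulrBl -natr1 addrAC subrr add0r mul1r. Qed.

Definition grid_noise (w : R -> 'cV[R]_n) (d : R) (k : nat) : 'cV[R]_n :=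
  S *m (w (k.+1%:R * d) - w (k%:R * d)).

Lemma path_ode_grid x w T e : 0 <= T -> 0 < e -> path_ode b S x w ->
  exists N0, forall N, (N0 < N)%N -> forall k, (k < N)%N ->
  `|x (k.+1%:R * (T / N%:R)) - x (k%:R * (T / N%:R)) - (T / N%:R) *: b (x (k%:R * (T / N%:R)))
    - grid_noise w (T / N%:R) k| <= e * (T / N%:R).
Proof.
move=> T0 e0 /(_ T e e0)[h h0 H]; have [N0 HN] := exists_mesh T0 h0.
exists N0 => N NN k kN; have Np : (0 < N)%N by exact: leq_ltn_trans NN.
have := H (k%:R * (T / N%:R)) (k.+1%:R * (T / N%:R)).
have Nd : N%:R * (T / N%:R) = T by rewrite mulrC divfK// pnatr_eq0 -lt0n.
have d0 : 0 <= T / N%:R by rewrite divr_ge0.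
rewrite mesh_step; apply.
- by case/andP: (mesh_mul Nd d0 (ltnW kN)).
- by rewrite ler_wpM2r// ler_nat.
- by case/andP: (mesh_mul Nd d0 kN).
- exact: HN.
Qed.

(** [scheme_stability] compares the sampled path with the chain; the taming error is one more
    consistency error. The starting point [z N] may vary with the mesh, because in the Markov
    property the second half of the chain starts from an approximation of the solution. *)
Lemma chain_cvg x w (z : nat -> 'cV[R]_n) T M e : 0 < T -> 0 <= M -> 0 < e ->
  path_ode b S x w -> (forall t, 0 <= t <= T -> `|x t| <= M) ->
  z @ \oo --> x 0 ->
  exists N0, forall N, (N0 < N)%N -> forall k, (k <= N)%N ->
  `|chain b (fun=> T / N%:R) (grid_noise w (T / N%:R)) (z N) k - x (k%:R * (T / N%:R))| <= e.
Proof.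
move=> T0 M0 e0 xode xM zx.
pose L := C * (2 + 2 * M); pose E := expR (T * L).
have E0 : 0 < E := expR_gt0 _.
pose m := Num.min e 1; have m0 : 0 < m by rewrite lt_min e0 ltr01.
(* With this value the accumulated consistency error [N * (2 * ep * d)] is [m / (2 * E)], half of
   the budget; the other half goes to the initial distance. *)
pose ep := m / (4 * T * E); have ep0 : 0 < ep by rewrite divr_gt0// !mulr_gt0.
pose K := n%:R * (M + 1) ^+ 2 * (C * (1 + (M + 1)) * (M + 1)).
have K0 : 0 <= K by rewrite !mulr_ge0//; lra.
have [N1 H1] := path_ode_grid (ltW T0) ep0 xode.
have q0 : 0 < (ep / (K + 1)) ^+ 2 by rewrite exprn_gt0// divr_gt0//; lra.
have [N2 H2] := exists_mesh (ltW T0) q0.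
have eta0 : 0 < m / (2 * E) by rewrite divr_gt0// mulr_gt0.
have /cvgrPdist_le/(_ _ eta0)[N3 _ H3] := zx.
exists (maxn N1 (maxn N2 N3)) => N; rewrite !gtn_max => /andP[NN1 /andP[NN2 NN3]] k kN.
have Np : (0 < N)%N by exact: leq_ltn_trans NN1.
have NR : 0 < N%:R :> R by rewrite ltr0n.
have {}H1 := H1 N NN1; have {}H2 := H2 N NN2.
set d := T / N%:R in H1 H2 *; have d0 : 0 < d by rewrite divr_gt0.
have Nd : N%:R * d = T by rewrite /d mulrC divfK// gt_eqF.
clearbody d.
have sq : Num.sqrt d * K <= ep.
  have : Num.sqrt d <= ep / (K + 1).
    have epK0 : 0 <= ep / (K + 1) by apply: divr_ge0; [exact: ltW|exact: addr_ge0].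
    rewrite -(@ler_pXn2r _ 2)// ?nnegrE ?sqrtr_ge0//.
    by rewrite sqr_sqrtr ?(ltW d0)//; exact: H2.
  have K1 : 0 < K + 1 by lra.
  by rewrite ler_pdivlMr// => h; have := sqrtr_ge0 d; lra.
pose xs k := x (k%:R * d).
pose ys := chain b (fun=> d) (grid_noise w d) (z N).
have G1 : (`|xs 0%N - ys 0%N| + N%:R * (2 * ep * d)) * expR (N%:R * (d * L)) <= m.
  have -> : N%:R * (d * L) = T * L by rewrite mulrA Nd.
  rewrite -/E /xs /ys /= mul0r -ler_pdivlMr//.
  have -> : N%:R * (2 * ep * d) = m / (2 * E).
    rewrite (_ : _ * _ = 2 * ep * (N%:R * d)); last by ring.
    by rewrite Nd /ep; field; rewrite !gt_eqF.
  apply: (@le_trans _ _ (m / (2 * E) + m / (2 * E))).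
    by rewrite lerD2r; apply: H3; exact: ltnW.
  by rewrite le_eqVlt; apply/orP; left; apply/eqP; field; rewrite gt_eqF.
have H := @scheme_stability _ _ b C C0 bC xs ys (grid_noise w d) M ep d N M0 (ltW ep0) (ltW d0) _ _ _ _ k kN.
rewrite distrC; apply: (le_trans (H _ _ _ _)).
- by move=> j jN; apply: xM; exact: mesh_mul Nd (ltW d0) jN.
- by move=> j jN; exact: H1.
- move=> j jN yM; rewrite /ys /= -/ys.
  have -> : ys j + d *: tamed b d (ys j) + grid_noise w d j - ys j - d *: b (ys j) - grid_noise w d j
     = d *: (tamed b d (ys j) - b (ys j)).
    rewrite scalerBr; move: (grid_noise w d j) (tamed b d (ys j)) (b (ys j)) (ys j) => p q r s.
    by apply/matrixP => i l; rewrite !mxE; ring.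
  rewrite normrZ ger0_norm ?(ltW d0)// mulrC ler_wpM2r ?(ltW d0)//.
  apply: le_trans sq; apply: (@tamed_close _ _ b C) => //; lra.
- by apply: le_trans G1 _; rewrite ge_min lexx orbT.
- by apply: le_trans G1 _; rewrite ge_min lexx.
Qed.

(** Both paths, sampled on one fine grid, are consistent schemes with the same noise, which cancels
    in the difference. The threshold depends on the bound [M] of the first path only; boundedness of
    the second comes out of the bootstrap. *)
Lemma paths_close T M e : 0 < T -> 0 <= M -> 0 < e -> exists2 h : R, 0 < h &
  forall x x' w, path_ode b S x w -> path_ode b S x' w ->
   (forall t, 0 <= t <= T -> `|x t| <= M) -> `|x 0 - x' 0| <= h -> `|x T - x' T| <= e.
Proof.
move=> T0 M0 e0; pose L := C * (2 + 2 * M); pose E := expR (T * L).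
have E0 : 0 < E := expR_gt0 _.
pose m := Num.min e 1; have m0 : 0 < m by rewrite lt_min e0 ltr01.
pose ep := m / (4 * T * E); have ep0 : 0 < ep by rewrite divr_gt0// !mulr_gt0.
have eta0 : 0 < m / (2 * E) by rewrite divr_gt0// mulr_gt0.
exists (m / (2 * E)) => // x x' w xode xode' xM xx.
have [N1 H1] := path_ode_grid (ltW T0) ep0 xode.
have [N2 H2] := path_ode_grid (ltW T0) ep0 xode'.
pose N := (maxn N1 N2).+1; have Np : (0 < N)%N by [].
have NN1 : (N1 < N)%N by rewrite ltnS leq_maxl.
have NN2 : (N2 < N)%N by rewrite ltnS leq_maxr.
have NR : 0 < N%:R :> R by rewrite ltr0n.
clearbody N.
have {}H1 := H1 N NN1; have {}H2 := H2 N NN2.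
set d := T / N%:R in H1 H2 *; have d0 : 0 < d by rewrite divr_gt0.
have Nd : N%:R * d = T by rewrite /d mulrC divfK// gt_eqF.
clearbody d.
pose xs k := x (k%:R * d); pose ys k := x' (k%:R * d).
have G1 : (`|xs 0%N - ys 0%N| + N%:R * (2 * ep * d)) * expR (N%:R * (d * L)) <= m.
  have -> : N%:R * (d * L) = T * L by rewrite mulrA Nd.
  rewrite -/E /xs /ys /= mul0r -ler_pdivlMr//.
  have -> : N%:R * (2 * ep * d) = m / (2 * E).
    rewrite (_ : _ * _ = 2 * ep * (N%:R * d)); last by ring.
    by rewrite Nd /ep; field; rewrite !gt_eqF.
  apply: (@le_trans _ _ (m / (2 * E) + m / (2 * E))).
    by rewrite lerD2r.
  by rewrite le_eqVlt; apply/orP; left; apply/eqP; field; rewrite gt_eqF.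
have H := @scheme_stability _ _ b C C0 bC xs ys (grid_noise w d) M ep d N M0 (ltW ep0) (ltW d0) _ _ _ _ N (leqnn N).
rewrite (_ : x T - x' T = xs N - ys N); last by rewrite /xs /ys Nd.
apply: (le_trans (H _ _ _ _)).
- by move=> j jN; apply: xM; exact: mesh_mul Nd (ltW d0) jN.
- by move=> j jN; exact: H1.
- by move=> j jN _; exact: H2.
- by apply: le_trans G1 _; rewrite ge_min lexx orbT.
- by apply: le_trans G1 _; rewrite ge_min lexx.
Qed.

Lemma path_ode_shift x w s : 0 <= s -> path_ode b S x w ->
  path_ode b S (fun t : R => x (s + t)) (fun t : R => w (s + t)).
Proof.
move=> s0 H T e e0; have [h h0 Hh] := H (s + T) e e0; exists h => // u v u0 uv vT uvh.
have E : (s + v) - (s + u) = v - u by rewrite opprD addrACA subrr add0r.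
have := Hh (s + u) (s + v); rewrite E; apply => //.
- exact: addr_ge0.
- by rewrite lerD2l.
- by rewrite lerD2l.
Qed.

End Convergence.

Section SupBound.
Context {R : realType} {n : nat}.
Variables (B : {bilinear 'cV[R]_n -> 'cV[R]_n -> 'cV[R]_n}) (A S : 'M[R]_n).
Hypothesis B_cons : forall x : 'cV[R]_n, dot x (B x x) = 0.
Implicit Types (x w : R -> 'cV[R]_n) (T M e s t : R).

(* Removing the noise from the state costs only a term linear in |y|^2, because
   [dot y (B y y) = 0]. *)
Lemma dot_drift_shift M : 0 <= M -> exists2 L : R, 0 <= L &
  forall y z : 'cV[R]_n, `|z| <= M -> `|dot y (drift B A (y + z))| <= L * (1 + dot y y).
Proof.
move=> M0; have [C C0 BC] := bilinear_bounded B.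
pose a := n%:R * `|A|; have a0 : 0 <= a by rewrite mulr_ge0.
exists (n%:R * (2 * C * M + C * M ^+ 2 + a + a * M)).
  by rewrite !(mulr_ge0, addr_ge0)// exprn_ge0.
move=> y z zM.
have -> : dot y (drift B A (y + z)) =
  dot y (B y z) + dot y (B z y) + dot y (B z z) - dot y (A *m (y + z)).
  by rewrite /drift linearDl !linearDr /= dotBr !dotDr B_cons add0r !addrA.
have y0 := normr_ge0 y; have z0 := normr_ge0 z.
have y2 := le_norm_dot y.
have p1 : `|dot y (B y z)| <= n%:R * (C * M * `|y| ^+ 2).
  apply: le_trans (norm_dot_le _ _) _; rewrite -mulrA ler_wpM2l//.
  apply: le_trans (ler_wpM2l y0 (BC _ _)) _.
  have -> : C * M * `|y| ^+ 2 = `|y| * (C * `|y| * M) by ring.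
  by rewrite ler_wpM2l// ler_wpM2l// mulr_ge0.
have p2 : `|dot y (B z y)| <= n%:R * (C * M * `|y| ^+ 2).
  apply: le_trans (norm_dot_le _ _) _; rewrite -mulrA ler_wpM2l//.
  apply: le_trans (ler_wpM2l y0 (BC _ _)) _.
  have -> : C * M * `|y| ^+ 2 = `|y| * (C * M * `|y|) by ring.
  by rewrite ler_wpM2l// ler_wpM2r// ler_wpM2l.
have p3 : `|dot y (B z z)| <= n%:R * (C * M ^+ 2 * `|y|).
  apply: le_trans (norm_dot_le _ _) _; rewrite -mulrA ler_wpM2l//.
  apply: le_trans (ler_wpM2l y0 (BC _ _)) _.
  have -> : C * M ^+ 2 * `|y| = `|y| * (C * M * M) by ring.
  by rewrite ler_wpM2l// ler_pM// ?mulr_ge0// ler_wpM2l.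
have p4 : `|dot y (A *m (y + z))| <= n%:R * (a * `|y| ^+ 2 + a * M * `|y|).
  apply: le_trans (norm_dot_le _ _) _; rewrite -mulrA ler_wpM2l//.
  apply: le_trans (ler_wpM2l y0 (norm_mulmx _ _)) _.
  have -> : a * `|y| ^+ 2 + a * M * `|y| = `|y| * (a * (`|y| + M)) by ring.
  rewrite ler_wpM2l// ler_wpM2l// (le_trans (ler_normD _ _))// lerD2l//.
have q : `|y| <= 1 + dot y y.
  apply: (@le_trans _ _ (1 + `|y| ^+ 2)); last by rewrite lerD2l.
  by have := sqr_ge0 (`|y| - 1); lra.
have q2 : `|y| ^+ 2 <= 1 + dot y y by rewrite ler_wpDl.
apply: le_trans (ler_normB _ _) _.
apply: le_trans (lerD (ler_normD _ _) (lexx _)) _.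
apply: le_trans (lerD (lerD (ler_normD _ _) (lexx _)) (lexx _)) _.
apply: le_trans (lerD (lerD (lerD p1 p2) p3) p4) _.
have -> : n%:R * (C * M * `|y| ^+ 2) + n%:R * (C * M * `|y| ^+ 2) +
  n%:R * (C * M ^+ 2 * `|y|) + n%:R * (a * `|y| ^+ 2 + a * M * `|y|) =
  n%:R * (2 * C * M * `|y| ^+ 2 + C * M ^+ 2 * `|y| + a * `|y| ^+ 2 + a * M * `|y|) by ring.
rewrite -[leRHS]mulrA ler_wpM2l// !mulrDl.
by repeat apply: lerD; apply: ler_wpM2l => //; rewrite ?mulr_ge0// ?exprn_ge0.
Qed.

(** For [y = x - S w] the quantity [1 + |y|^2] has relative growth rate at most [2 * L] in absolute
    value, with [L] depending only on the bound of the noise, so it can neither explode nor collapse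
    within a unit of time. The collapse estimate is as important as the other: it keeps a solution
    that starts far away far away. *)
Lemma sup_bound M : 0 <= M -> exists L : R, 0 <= L /\
  forall x w T, 0 <= T <= 1 -> path_cont x -> path_cont w ->
   path_ode (drift B A) S x w -> w 0 = 0 -> (forall t, 0 <= t <= 1 -> `|S *m w t| <= M) ->
   1 + dot (x T - S *m w T) (x T - S *m w T) <= (1 + dot (x 0) (x 0)) * expR L /\
   1 + dot (x 0) (x 0) <= (1 + dot (x T - S *m w T) (x T - S *m w T)) * expR L.
Proof.
move=> M0; have [L L0 LP] := dot_drift_shift M0.
exists (2 * (2 * L)); split; first by rewrite !mulr_ge0.
move=> x w T /andP[T0 T1] xc wc xode w0 wM.
pose y t := x t - S *m w t.
have y00 : y 0 = x 0 by rewrite /y w0 mulmx0 subr0.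
have [Cb Cb0 bC] := drift_quad_lip B A.
have [K K0 xK] := path_bounded 1 xc.
pose D := Cb * (1 + K) * K.
have D0 : 0 <= D by rewrite !mulr_ge0// addr_ge0.
have yK t : 0 <= t <= 1 -> `|y t| <= K + M.
  by move=> tT; rewrite (le_trans (ler_normB _ _))// lerD ?xK// wM.
have H : forall e : R, 0 < e -> exists2 h : R, 0 < h & forall s t : R, 0 <= s -> s <= t -> t <= T ->
    t - s <= h -> `|(1 + dot (y t) (y t)) - (1 + dot (y s) (y s))| <= (t - s) * (2 * L * (1 + dot (y s) (y s)) + e).
  (* [Z] and [Q] below limit the two errors of a step, [2 y . g] from the defect [g] and [|u|^2]
     from second order, to [(t - s) * (e / 2)] each. *)
  move=> e e0; pose Z := 2 * n%:R * (K + M) + 1.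
  have nKM : 0 <= 2 * n%:R * (K + M) by rewrite !mulr_ge0// addr_ge0.
  have Z1 : 1 <= Z by rewrite /Z lerDr.
  have Z0 : 0 < Z by lra.
  have ZE : n%:R * (K + M) = (Z - 1) / 2 by rewrite /Z; field.
  clearbody Z.
  pose ep := Num.min 1 (e / 2 / Z).
  have ep0 : 0 < ep by rewrite lt_min ltr01 !divr_gt0.
  have [h h0 Hh] := xode T ep ep0.
  pose Q := n%:R * (D + 1) ^+ 2 + 1.
  have Q1 : 1 <= Q by rewrite /Q lerDr mulr_ge0// exprn_ge0// addr_ge0.
  have Q0 : 0 < Q by lra.
  exists (Num.min h (e / 2 / Q)); first by rewrite lt_min h0 !divr_gt0.
  move=> s t s0 st tT; rewrite le_min => /andP[tsh tsQ].
  have ts0 : 0 <= t - s by rewrite subr_ge0.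
  have s1 : 0 <= s <= 1 by rewrite s0 (le_trans st)// (le_trans tT).
  have Hst := Hh s t s0 st tT tsh.
  set g := x t - x s - (t - s) *: drift B A (x s) - S *m (w t - w s) in Hst.
  pose u := (t - s) *: drift B A (x s) + g.
  have yt : y t = y s + u.
    rewrite /u /g /y mulmxBr; move: (drift B A (x s)) (S *m w t) (S *m w s) => p q r.
    by apply/matrixP => i j; rewrite !mxE; ring.
  have bs : `|drift B A (x s)| <= D.
    apply: le_trans (quad_lip_le _ bC) _; have xs := xK s s1.
    by rewrite ler_pM ?mulr_ge0 ?addr_ge0// ler_wpM2l// lerD2l.
  have gn : `|g| <= 1 * (t - s).
    by apply: le_trans Hst _; rewrite ler_wpM2r// /ep ge_min lexx.
  have un : `|u| <= (D + 1) * (t - s).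
    rewrite (le_trans (ler_normD _ _))// mulrDl lerD//.
    by rewrite normrZ ger0_norm// mulrC ler_wpM2r.
  have ysu : dot (y s) u = (t - s) * dot (y s) (drift B A (x s)) + dot (y s) g.
    by rewrite /u dotDr dotZr.
  clearbody u.
  have uu : dot u u <= (t - s) * (e / 2).
    apply: le_trans (dot_norm_le _) _.
    apply: (@le_trans _ _ (n%:R * ((D + 1) * (t - s)) ^+ 2)).
      by rewrite ler_wpM2l// lerXn2r// nnegrE// mulr_ge0// addr_ge0.
    have -> : n%:R * ((D + 1) * (t - s)) ^+ 2 = (t - s) * ((t - s) * (n%:R * (D + 1) ^+ 2)) by ring.
    rewrite ler_wpM2l//; rewrite ler_pdivlMr// in tsQ; apply: le_trans tsQ.
    by rewrite ler_wpM2l// /Q lerDl.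
  have ug : `|dot (y s) g| * 2 <= (t - s) * (e / 2).
    have h1 : `|dot (y s) g| <= n%:R * (K + M) * (e / 2 / Z * (t - s)).
      apply: le_trans (norm_dot_le _ _) _; apply: ler_pM; rewrite ?mulr_ge0//.
        by rewrite ler_wpM2l// yK.
      by apply: le_trans Hst _; rewrite ler_wpM2r// /ep ge_min lexx orbT.
    apply: (@le_trans _ _ (n%:R * (K + M) * (e / 2 / Z * (t - s)) * 2)); first by rewrite ler_wpM2r.
    have -> : n%:R * (K + M) * (e / 2 / Z * (t - s)) * 2 = ((t - s) * (e / 2)) * ((Z - 1) / Z).
      by rewrite ZE; field; rewrite gt_eqF.
    apply: ler_piMr; first by rewrite mulr_ge0// divr_ge0// ltW.
    by rewrite ler_pdivrMr// mul1r; lra.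
  have ub : `|dot (y s) (drift B A (x s))| <= L * (1 + dot (y s) (y s)).
    have -> : x s = y s + S *m w s by rewrite /y subrK.
    by apply: LP; exact: wM.
  have -> : (1 + dot (y t) (y t)) - (1 + dot (y s) (y s)) =
     2 * (t - s) * dot (y s) (drift B A (x s)) + (dot (y s) g * 2 + dot u u).
    by rewrite yt dot_sqrD ysu; ring.
  rewrite (le_trans (ler_normD _ _))// [leRHS]mulrDr lerD//.
    rewrite normrM normrM ger0_norm// ger0_norm//.
    have -> : (t - s) * (2 * L * (1 + dot (y s) (y s))) = 2 * (t - s) * (L * (1 + dot (y s) (y s))) by ring.
    by rewrite ler_wpM2l// mulr_ge0.
  rewrite (le_trans (ler_normD _ _))//.
  rewrite normrM (@ger0_norm _ 2)// (@ger0_norm _ (dot u u)) ?dot_ge0//.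
  by rewrite (le_trans (lerD ug uu))// -mulrDr -splitr.
have L20 : 0 <= 2 * L by rewrite mulr_ge0.
have [h1 h2] := @growth_upper _ (fun t : R => 1 + dot (y t) (y t)) T (2 * L) L20 T0
  (fun t => addr_ge0 ler01 (dot_ge0 _)) H.
rewrite y00 in h1 h2; split.
  apply: le_trans h1 _; rewrite ler_wpM2l ?addr_ge0 ?dot_ge0// ler_expR.
  by rewrite (@le_trans _ _ (1 * (2 * L)))// ?ler_wpM2r// ?mul1r ?ler_peMl// ?ler1n.
apply: le_trans h2 _; rewrite ler_wpM2l ?addr_ge0 ?dot_ge0// ler_expR.
by rewrite ler_piMl// mulr_ge0.
Qed.

End SupBound.

(** * Independence *)

Section BorelVectors.
Context {R : realType} {n : nat}.

Lemma measurable_forall d (T : measurableType d) (I : finType) (E : I -> set T) :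
  (forall i, measurable (E i)) -> measurable [set w | forall i, E i w].
Proof.
move=> mE; rewrite (_ : [set w | _] = \bigcap_(i in [set: I]) E i).
  by apply: fin_bigcap_measurable => //; exact: finite_finset.
by apply/seteqP; split => [w Ew i _|w Ew i]; exact: Ew.
Qed.

(** Cubes with rational centre form a countable family in which every open set is a union. With it,
    measurability into [borel] can be tested on the coordinates. *)
Definition qbox (q : 'cV[rat]_n) (k : nat) : set 'cV[R]_n :=
  [set v | forall i, `|v i 0 - ratr (q i 0)| < k.+1%:R^-1].

Lemma open_qbox (U : set 'cV[R]_n) : open U ->
  U = \bigcup_(qk in [set qk | qbox qk.1 qk.2 `<=` U]) qbox qk.1 qk.2.
Proof.
move=> oU; apply/seteqP; split => [v Uv|v [qk /= sub]]; last exact: sub.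
have /nbhs_ballP[e e0 be] := open_nbhs_nbhs (conj oU Uv).
have [k ke] : exists k : nat, k.+1%:R^-1 <= e / 2.
  have e2 : 0 < 2 / e by rewrite divr_gt0.
  exists (Num.truncn (2 / e)); rewrite -[leRHS]invrK lef_pV2 ?posrE ?invr_gt0 ?divr_gt0//.
  by rewrite invf_div ltW// truncnS_gt.
have k0 : 0 < k.+1%:R^-1 :> R by rewrite invr_gt0.
have [q qP] : exists q : 'cV[rat]_n, forall i, `|v i 0 - ratr (q i 0)| < k.+1%:R^-1.
  have H (i : 'I_n) : exists p : rat, `|v i 0 - ratr p| < k.+1%:R^-1.
    have [|p] := @rat_in_itvoo R (v i 0 - k.+1%:R^-1) (v i 0 + k.+1%:R^-1).
      by rewrite ltrBlDr -addrA ltrDl addr_gt0.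
    rewrite in_itv /= => /andP[p1 p2]; exists p.
    by rewrite ltr_distlC p1.
  have [q qP] := choice H; exists (\col_i q i) => i; by rewrite mxE.
exists (q, k) => //= u uq; apply: be; split => // i j; rewrite (ord1 j) /ball /=.
rewrite -[v i 0](subrK (ratr (q i 0))) -addrA (le_lt_trans (ler_normD _ _))//.
rewrite [ltRHS]splitr ltr_leD//; first exact: lt_le_trans (qP i) ke.
by rewrite distrC ltW// (lt_le_trans (uq i)).
Qed.

Lemma measurable_cV d (T : measurableType d) (f : T -> 'cV[R]_n) :
  (forall i, measurable_fun setT (fun w => f w i 0 : R)) ->
  measurable_fun setT (f : T -> borel R n).
Proof.
move=> mf; apply: (@measurability _ _ T (borel R n) setT f (@open 'cV[R]_n)) => //.
move=> _ [U oU <-]; rewrite setTI [U]open_qbox// preimage_bigcup.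
rewrite bigcup_mkcond; apply: countable_bigcupT_measurable => [|qk].
  exact: countableP.
case: ifP => _; last exact: measurable0.
rewrite (_ : f @^-1` _ = [set w | forall i, (fun v : R => `|v - ratr (qk.1 i 0)| < qk.2.+1%:R^-1) (f w i 0)])//.
apply: (@measurable_forall _ _ _ (fun i w => `|f w i 0 - ratr (qk.1 i 0)| < qk.2.+1%:R^-1)) => i.
have mg : measurable_fun setT (fun w => `|f w i 0 - ratr (qk.1 i 0)|).
  by apply: measurableT_comp => //; apply: measurable_funB.
have := mg measurableT _ (open_measurable (@open_lt R (qk.2.+1%:R^-1))).
by rewrite setTI.
Qed.

Lemma continuous_borel (f : 'cV[R]_n -> R) : continuous f ->
  measurable_fun setT (f : borel R n -> R).
Proof.
move=> /continuousP cf; apply: (measurability _ (RGenOpens.measurableE R)).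
move=> _ [_ [a [b ->] <-]]; rewrite setTI.
by apply: sub_sigma_algebra; exact/cf/interval_open.
Qed.

Lemma measurable_coord i : measurable_fun setT (fun v : borel R n => (v : 'cV[R]_n) i 0 : R).
Proof. by apply: (@continuous_borel (fun v => v i 0)); exact: coord_continuous. Qed.

Lemma measurable_cV_coord d (T : measurableType d) (f : T -> 'cV[R]_n) i :
  measurable_fun setT (f : T -> borel R n) -> measurable_fun setT (fun w => f w i 0 : R).
Proof. by move=> mf; apply: (measurableT_comp (measurable_coord i)). Qed.

End BorelVectors.

Section PiSystems.
Context {R : realType} {T : pointedType} {I : finType}.

Definition cylinders (Z : I -> T -> R) : set (set T) :=
  [set A | exists E : I -> set R, (forall i, measurable (E i)) /\
     A = [set w | forall i, E i (Z i w)]].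

Lemma cylinders_setI (Z : I -> T -> R) : setI_closed (cylinders Z).
Proof.
move=> _ _ [E [mE ->]] [F [mF ->]]; exists (fun i => E i `&` F i); split.
  by move=> i; exact: measurableI.
apply/seteqP; split=> [w [Ew Fw] i|w EF]; first by split.
by split=> i; have [] := EF i.
Qed.

Lemma cylinders_setT (Z : I -> T -> R) : cylinders Z setT.
Proof. by exists (fun=> setT); split => //; apply/seteqP; split. Qed.

Lemma cylinders_coord (Z : I -> T -> R) i :
  measurable_fun setT (Z i : g_sigma_algebraType (cylinders Z) -> R).
Proof.
move=> _ E mE; rewrite setTI; apply: sub_sigma_algebra.
exists (fun j => if j == i then E else setT); split => [j|]; first by case: ifP.
apply/seteqP; split=> [w /= Ew j|w /= /(_ i)]; last by rewrite eqxx.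
by case: eqP => [->|].
Qed.

End PiSystems.

Section Independence.
Context {R : realType} {d : measure_display} {Omega : measurableType d}.
Variable P : probability Omega R.
Local Open Scope ereal_scope.

Definition indep_systems (C D : set (set Omega)) :=
  forall A B, C A -> D B -> P (A `&` B) = P A * P B.

Lemma indep_systems_sym C D : indep_systems C D -> indep_systems D C.
Proof. by move=> CD A B DA CB; rewrite setIC CD// muleC. Qed.

(** For fixed [B] the finite measures [A -> P (A & B)] and [A -> P A * P B] agree on a system closed
    under intersection, hence on the sigma-algebra that it generates. *)
Lemma indep_systems_gen1 (C D : set (set Omega)) :
  C `<=` measurable -> D `<=` measurable -> setI_closed C -> C setT ->
  indep_systems C D -> indep_systems <<s C >> D.
Proof.
move=> Cm Dm CI CT CD A B sA DB.
have mB := Dm _ DB.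
have PB0 : (0 <= fine (P B))%R by exact: fine_ge0.
have PBE : P B = (NngNum PB0)%:num%:E by rewrite /= fineK// fin_num_measure.
have H := @g_sigma_algebra_measure_unique _ R Omega C Cm (fun=> setT) (fun=> CT)
  _ (mrestr P mB) (mscale (NngNum PB0) P) CI.
rewrite muleC PBE; apply: H => //.
- by apply/seteqP; split => // x _; exists 0%N.
- by move=> E CE; transitivity (P (E `&` B)) => //; rewrite CD// muleC {1}PBE.
- by move=> _; rewrite /mrestr (le_lt_trans (probability_le1 P _)) ?ltry//; exact: measurableI.
Qed.

Lemma indep_systems_gen (C D : set (set Omega)) :
  C `<=` measurable -> D `<=` measurable -> setI_closed C -> C setT ->
  setI_closed D -> D setT ->
  indep_systems C D -> indep_systems <<s C >> <<s D >>.
Proof.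
move=> Cm Dm CI CT DI DT CD.
have sCm : <<s C >> `<=` measurable by apply: smallest_sub => //; exact: sigma_algebra_measurable.
apply: indep_systems_sym; apply: indep_systems_gen1 => //.
by apply: indep_systems_sym; apply: indep_systems_gen1.
Qed.

Definition mfun_of d1 d2 (T1 : measurableType d1) (T2 : measurableType d2)
  (f : T1 -> T2) (mf : measurable_fun setT f) : {mfun T1 >-> T2} :=
  HB.pack f (isMeasurableFun.Build _ _ _ _ f mf).

(** Independence says that the joint law of [(U, V)] is the product of the laws; the iterated
    integral is then Tonelli's theorem. *)
Lemma indep_integral d1 d2 (T1 : measurableType d1) (T2 : measurableType d2)
    (U : Omega -> T1) (V : Omega -> T2) (G : T1 * T2 -> \bar R) :
  measurable_fun setT U -> measurable_fun setT V ->
  (forall A B, measurable A -> measurable B ->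
     P (U @^-1` A `&` V @^-1` B) = P (U @^-1` A) * P (V @^-1` B)) ->
  measurable_fun setT G -> (forall z, 0 <= G z) ->
  \int[P]_w G (U w, V w) = \int[P]_w \int[P]_w' G (U w, V w').
Proof.
move=> mU mV ind mG G0.
have mUV : measurable_fun setT (fun w => (U w, V w)) by exact: measurable_fun_pair.
pose DU := distribution P (mfun_of mU); pose DV := distribution P (mfun_of mV).
pose DUV := distribution P (mfun_of mUV).
rewrite -(ge0_integral_distribution (mfun_of mUV) mG G0).
have -> : \int[DUV]_z G z = \int[DU \x DV]_z G z.
  apply: eq_measure_integral => A mA _; apply/esym.
  apply: product_measure_unique; last exact: mA.
  move=> A1 A2 mA1 mA2.
  by transitivity (P (U @^-1` A1 `&` V @^-1` A2)) => //; exact: ind.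
rewrite fubini_tonelli1//.
rewrite (ge0_integral_distribution (mfun_of mU)); last 2 first.
- exact: measurable_fun_fubini_tonelli_F.
- by move=> y; apply: integral_ge0.
apply: eq_integral => w _ /=; rewrite /fubini_F.
rewrite (ge0_integral_distribution (mfun_of mV))// => y.
exact: measurableT_comp.
Qed.

Lemma same_law_integral d1 (T1 : measurableType d1) (C : set (set T1))
    (U V : Omega -> T1) (G : T1 -> \bar R) :
  @measurable _ T1 = <<s C >> -> setI_closed C -> C setT ->
  measurable_fun setT U -> measurable_fun setT V ->
  (forall A, C A -> P (U @^-1` A) = P (V @^-1` A)) ->
  measurable_fun setT G -> (forall z, 0 <= G z) ->
  \int[P]_w G (U w) = \int[P]_w G (V w).
Proof.
move=> CE CI CT mU mV UV mG G0.
rewrite -(ge0_integral_distribution (mfun_of mU) mG G0).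
rewrite -(ge0_integral_distribution (mfun_of mV) mG G0).
apply: eq_measure_integral => A mA _.
apply: (measure_unique C (fun=> setT)) => //.
- by apply/seteqP; split => // x _; exists 0%N.
- by move=> _; rewrite (le_lt_trans (probability_le1 _ _)) ?ltry.
Qed.

End Independence.

(** * Gaussian moments and the spread of Gaussian sums *)

Section Density.
Context {R : realType} d (T : measurableType d).
Variables (mu nu : {measure set T -> \bar R}) (g : T -> R).
Hypothesis mg : measurable_fun setT g.
Hypothesis g0 : forall x, 0 <= g x.
Hypothesis nuE : forall A, measurable A -> nu A = (\int[mu]_(x in A) (g x)%:E)%E.
Local Open Scope ereal_scope.
Import HBNNSimple.

Lemma ge0_integral_density (f : T -> \bar R) :
  measurable_fun setT f -> (forall x, 0 <= f x) ->
  \int[nu]_x f x = \int[mu]_x (f x * (g x)%:E).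
Proof.
move=> mf f0; pose f_ := nnsfun_approx measurableT mf.
have fE x : f x = limn (fun n => (f_ n x)%:E).
  by apply/esym/cvg_lim => //; apply: cvg_nnsfun_approx.
have S (h : {nnsfun T >-> R}) : \int[nu]_x (h x)%:E = \int[mu]_x ((h x)%:E * (g x)%:E).
  rewrite integralT_nnsfun sintegralE.
  have E x : (h x)%:E * (g x)%:E = \sum_(k \in range h)
      ((k%:E * (\1_(h @^-1` [set k]) x)%:E) * (g x)%:E).
    rewrite {1}fimfunE -fsumEFin// ge0_mule_fsuml// => r.
    exact: nnfun_muleindic_ge0.
  under [RHS]eq_integral do rewrite E.
  rewrite ge0_integral_fsum//=; last 2 first.
  - move=> r; apply: emeasurable_funM; exact/measurable_EFinP/measurableT_comp.
  - by move=> r x _; rewrite mule_ge0 ?lee_fin//; exact: nnfun_muleindic_ge0.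
  apply: eq_fsbigr => r _.
  under [RHS]eq_integral do rewrite -muleA.
  have [r0|r0] := leP 0%R r; last first.
    rewrite preimage_nnfun0// measure0 mule0; apply/esym.
    by rewrite integral0_eq// => x _; rewrite indic0 mul0e mule0.
  rewrite ge0_integralZl//=; last 2 first.
  - by apply: emeasurable_funM; exact/measurable_EFinP.
  - by move=> x _; rewrite mule_ge0// lee_fin.
  congr (_ * _); rewrite nuE// integral_mkcond; apply: eq_integral => x _.
  by rewrite patchE /= indicE; case: ifP => _; rewrite ?mul1e ?mul0e.
rewrite (eq_integral (fun x => limn (fun n => (f_ n x)%:E))); last by move=> x _; exact: fE.
rewrite monotone_convergence//; last 3 first.
- by move=> n; exact/measurable_EFinP.
- by move=> n x _; rewrite lee_fin.
- by move=> x _ m n mn; rewrite lee_fin; exact/lefP/nd_nnsfun_approx.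
rewrite [RHS](eq_integral (fun x => limn (fun n => (f_ n x)%:E * (g x)%:E))); last first.
  move=> x _; apply/esym/cvg_lim => //; apply: cvgeZr => //.
  exact: cvg_nnsfun_approx.
rewrite monotone_convergence//; last 3 first.
- by move=> n; apply: emeasurable_funM; exact/measurable_EFinP.
- by move=> n x _; rewrite mule_ge0 ?lee_fin.
- move=> x _ m n mn; rewrite lee_wpmul2r ?lee_fin//; exact/lefP/nd_nnsfun_approx.
by congr (limn _); apply/funext => n; exact: S.
Qed.

End Density.

(** * Crude moment bounds for the normal law *)

Section NormalMoments.
Context {R : realType}.
Variable s : R.
Hypothesis s0 : 0 < s.
Let sN0 : s != 0. Proof. by rewrite gt_eqF. Qed.
Local Notation nu := (normal_prob 0 s).

Lemma normal_integral (f : R -> \bar R) :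
  measurable_fun setT f -> (forall x, (0 <= f x)%E) ->
  (\int[nu]_x f x = \int[lebesgue_measure]_x (f x * (normal_pdf 0 s x)%:E))%E.
Proof.
move=> mf f0.
apply: (@ge0_integral_density _ _ _ lebesgue_measure nu (normal_pdf 0 s)) => //.
- exact: measurable_normal_pdf.
- exact: normal_pdf_ge0.
Qed.

Lemma normal_prob_opp (A : set R) : measurable A -> nu (-%R @^-1` A) = nu A.
Proof.
move=> mA; have mN : measurable_fun [set: R] (-%R : R -> R) by exact: oppr_measurable.
have mNA : measurable (-%R @^-1` A) by rewrite -[X in measurable X]setTI; exact: mN.
have mp : measurable_fun [set: R] (fun x => (normal_pdf 0 s x)%:E).
  by apply/measurable_EFinP; exact: measurable_normal_pdf.
rewrite /normal_prob /=.
transitivity (\int[lebesgue_measure]_(x in (-%R : R -> measurableTypeR R) @^-1` A)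
    ((fun x => (normal_pdf 0 s x)%:E) \o (-%R : R -> measurableTypeR R)) x)%E.
  by apply: eq_integral => x _; rewrite /= !normal_pdfE// /normal_fun !subr0 sqrrN.
rewrite -ge0_integral_pushforward//=; last 2 first.
- exact: measurable_funTS.
- by move=> x _; rewrite lee_fin normal_pdf_ge0.
by apply: eq_measure_integral => //= B mB _; exact: lebesgue_measureN.
Qed.

(** Comparison with a wider normal density: with [u = x^2 / (4 s^2)] the integrand is [16 s^4 u^2]
    times the peak times [exp (- 2 u)]. One factor [exp (- u)] absorbs [u^2] at the cost of 4, and
    the other is the shape of the density of standard deviation [Num.sqrt 2 * s]. The ratio of the
    peaks, at most 2, gives 128. *)
Lemma normal_moment4 : (\int[nu]_x (x ^+ 4)%:E <= (128 * s ^+ 4)%:E)%E.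
Proof.
rewrite normal_integral//; last 2 first.
- by apply/measurable_EFinP; exact: measurable_funX.
- by move=> x; rewrite lee_fin exprn_even_ge0.
pose s' := Num.sqrt 2 * s.
have s'0 : 0 < s' by rewrite mulr_gt0// sqrtr_gt0.
have s'N : s' != 0 by rewrite gt_eqF.
have ss : s' ^+ 2 = 2 * s ^+ 2 by rewrite exprMn sqr_sqrtr.
have peakE : normal_peak s = Num.sqrt 2 * normal_peak s'.
  rewrite /normal_peak ss.
  have -> : 2 * s ^+ 2 * pi *+ 2 = 2 * (s ^+ 2 * pi *+ 2) :> R by rewrite mulrnAr mulrA.
  by rewrite sqrtrM// invfM mulrA divff ?mul1r// gt_eqF// sqrtr_gt0.
have H x : ((x ^+ 4)%:E * (normal_pdf 0 s x)%:E <= (128 * s ^+ 4)%:E * (normal_pdf 0 s' x)%:E)%E.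
  rewrite -!EFinM lee_fin !normal_pdfE// /normal_fun peakE !subr0 ss.
  set u := x ^+ 2 / (2 * s ^+ 2 *+ 2).
  have u0 : 0 <= u by rewrite divr_ge0 ?sqr_ge0// mulrn_wge0// mulr_ge0// sqr_ge0.
  have E1 : - x ^+ 2 / (s ^+ 2 *+ 2) = - u + - u.
    by rewrite /u; field.
  have E2 : - x ^+ 2 / (2 * s ^+ 2 *+ 2) = - u by rewrite /u mulNr.
  rewrite E1 E2 expRD.
  have x4 : x ^+ 4 = 16 * s ^+ 4 * u ^+ 2 by rewrite /u; field.
  have eu : u ^+ 2 * expR (- u) <= 4.
    have eu := @expR_ge1Dx R (u / 2); have e0 := expR_gt0 (u / 2).
    have -> : expR (- u) = (expR (u / 2) ^+ 2)^-1.
      by rewrite expRN expr2 -expRD -splitr.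
    rewrite ler_pdivrMr ?exprn_gt0//.
    have -> : 4 * expR (u / 2) ^+ 2 = (2 * expR (u / 2)) ^+ 2 by ring.
    by apply: lerXn2r; rewrite ?nnegrE//; lra.
  have p0 : 0 <= normal_peak s' by exact: normal_peak_ge0.
  have e0 : 0 <= expR (- u) by exact: expR_ge0.
  have s2 : Num.sqrt 2 <= 2 :> R.
    rewrite -[leRHS]ger0_norm// -sqrtr_sqr ler_sqrt// expr2; lra.
  have s40 : 0 <= s ^+ 4 by rewrite exprn_ge0// ltW.
  rewrite x4.
  have -> : 16 * s ^+ 4 * u ^+ 2 * (Num.sqrt 2 * normal_peak s' * (expR (- u) * expR (- u)))
    = (16 * s ^+ 4 * (normal_peak s' * expR (- u))) * (Num.sqrt 2 * (u ^+ 2 * expR (- u))) by ring.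
  have -> : 128 * s ^+ 4 * (normal_peak s' * expR (- u)) = (16 * s ^+ 4 * (normal_peak s' * expR (- u))) * (2 * 4) by ring.
  apply: ler_wpM2l; first by apply: mulr_ge0; apply: mulr_ge0.
  by apply: ler_pM; rewrite ?sqrtr_ge0// mulr_ge0// sqr_ge0.
apply: (@le_trans _ _ (\int[lebesgue_measure]_x ((128 * s ^+ 4)%:E * (normal_pdf 0 s' x)%:E))%E).
  apply: ge0_le_integral => //.
  - by move=> x _; rewrite mule_ge0// ?lee_fin ?normal_pdf_ge0// exprn_even_ge0.
  - by apply: emeasurable_funM; apply/measurable_EFinP; [exact: measurable_funX|exact: measurable_normal_pdf].
  - by apply: emeasurable_funM; apply/measurable_EFinP; [exact: measurable_cst|exact: measurable_normal_pdf].
rewrite ge0_integralZl//=; last 3 first.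
- by apply/measurable_EFinP; exact: measurable_normal_pdf.
- by move=> x _; rewrite lee_fin normal_pdf_ge0.
- by rewrite lee_fin mulr_ge0// exprn_even_ge0.
by rewrite integral_normal_pdf mule1.
Qed.

End NormalMoments.


Section GaussianVariable.
Context {R : realType} {d : measure_display} {Omega : measurableType d}.
Variable P : probability Omega R.
Variables (xi : Omega -> R) (t : R).
Hypothesis t0 : 0 < t.
Hypothesis mxi : measurable_fun setT xi.
Hypothesis xiE : forall E, measurable E -> P (xi @^-1` E) = normal_prob 0 (Num.sqrt t) E.
Let s0 : 0 < Num.sqrt t. Proof. by rewrite sqrtr_gt0. Qed.

Lemma gaussian_integral (f : R -> \bar R) :
  measurable_fun setT f -> (forall x, (0 <= f x)%E) ->
  (\int[P]_w f (xi w) = \int[normal_prob 0 (Num.sqrt t)]_x f x)%E.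
Proof.
move=> mf f0.
have mX : measurable_fun setT (xi : Omega -> measurableTypeR R) by exact: mxi.
have mf' : measurable_fun setT (f : measurableTypeR R -> \bar R) by exact: mf.
transitivity (\int[distribution P (mfun_of mX)]_x f x)%E.
  by rewrite (ge0_integral_distribution (mfun_of mX) mf' f0).
by apply: eq_measure_integral => A mA _; exact: xiE.
Qed.

Lemma gaussian_moment4 : (\int[P]_w (xi w ^+ 4)%:E <= (128 * t ^+ 2)%:E)%E.
Proof.
rewrite (@gaussian_integral (fun x => (x ^+ 4)%:E)); last 2 first.
- by apply/measurable_EFinP; exact: measurable_funX.
- by move=> x; rewrite lee_fin exprn_even_ge0.
rewrite (le_trans (normal_moment4 s0))//.
by rewrite -[4%N]/(2 * 2)%N exprM sqr_sqrtr// ltW.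
Qed.

Lemma le_pow4 (k : nat) (x : R) : (k <= 4)%N -> `|x| ^+ k <= 1 + x ^+ 4.
Proof.
move=> k4; have -> : x ^+ 4 = `|x| ^+ 4 by rewrite -normrX ger0_norm// exprn_even_ge0.
have [x1|x1] := leP `|x| 1.
  by rewrite (le_trans (exprn_ile1 _ (normr_ge0 x) x1))// lerDl exprn_ge0.
by rewrite (@le_trans _ _ (`|x| ^+ 4))// ?lerDr// ler_eXn2l// ltW.
Qed.

Lemma gaussian_integrable_pow4 : P.-integrable setT (fun w => (xi w ^+ 4)%:E).
Proof.
apply/integrableP; split; first by apply/measurable_EFinP; exact: measurable_funX.
under eq_integral do rewrite gee0_abs ?lee_fin ?exprn_even_ge0//.
by rewrite (le_lt_trans gaussian_moment4)// ltry.
Qed.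

Lemma gaussian_integrable k : (k <= 4)%N -> P.-integrable setT (fun w => (xi w ^+ k)%:E).
Proof.
move=> k4.
apply: (@le_integrable _ _ _ _ _ measurableT _ (fun w => (1 + xi w ^+ 4)%:E)).
- by apply/measurable_EFinP; exact: measurable_funX.
- move=> w _; rewrite /= lee_fin normrX (le_trans (le_pow4 _ k4))// ler_norm//.
- rewrite (_ : (fun w => _) = (fun=> 1%:E) \+ (fun w => (xi w ^+ 4)%:E))%E//.
  apply: integrableD => //; last exact: gaussian_integrable_pow4.
  exact: finite_measure_integrable_cst.
Qed.

(** By symmetry of the law the positive and the negative part of [xi] have the same integral, which
    is finite. *)
Lemma gaussian_mean : (\int[P]_w (xi w)%:E = 0)%E.
Proof.
have mN : measurable_fun setT (fun w => - xi w) by exact: measurableT_comp.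
have H (f : R -> \bar R) : measurable_fun setT f -> (forall x, (0 <= f x)%E) ->
    (\int[P]_w f (xi w) = \int[P]_w f (- xi w)%R)%E.
  move=> mf f0; rewrite gaussian_integral//.
  have mX : measurable_fun setT ((fun w => - xi w) : Omega -> measurableTypeR R) by exact: mN.
  have mf' : measurable_fun setT (f : measurableTypeR R -> \bar R) by exact: mf.
  transitivity (\int[distribution P (mfun_of mX)]_x f x)%E; last first.
    by rewrite (ge0_integral_distribution (mfun_of mX) mf' f0).
  apply/esym/eq_measure_integral => A mA _ /=.
  transitivity (P (xi @^-1` (-%R @^-1` A))) => //.
  have mNA : measurable (-%R @^-1` A).
    by rewrite -[X in measurable X]setTI; exact: (oppr_measurable measurableT).
  by rewrite xiE// normal_prob_opp.
pose f w := (xi w)%:E.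
have pE : (f^\+)%E = (fun w => (Num.max (xi w) 0)%:E).
  by apply/funext => w; rewrite funeposE EFin_max.
have nE : (f^\-)%E = (fun w => (Num.max (- xi w) 0)%:E).
  by apply/funext => w; rewrite funenegE EFin_max.
have PN : (\int[P]_w (f^\+)%E w = \int[P]_w (f^\-)%E w)%E.
  rewrite pE nE; apply: (H (fun x => (Num.max x 0)%:E)).
    by apply/measurable_EFinP; apply: measurable_maxr.
  by move=> x; rewrite lee_fin le_max lexx orbT.
rewrite -/f integralE PN.
rewrite subee//.
have i1 : P.-integrable setT (fun w => (xi w)%:E).
  have := @gaussian_integrable 1 isT; rewrite (_ : (fun w => _) = (fun w => (xi w)%:E))//.
exact: (integrable_neg_fin_num measurableT i1).
Qed.

(** The density is at most [1 / s], so [|xi| <= s / 4] has probability at most 1/2; on the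
    complement [xi^2 >= s^2 / 16]. *)
Lemma gaussian_moment2_ge : ((t / 64)%:E <= \int[P]_w (xi w ^+ 2)%:E)%E.
Proof.
pose s := Num.sqrt t; have sN : s != 0 by rewrite gt_eqF.
pose a := s / 4; have a0 : 0 < a by rewrite divr_gt0.
pose E := `[- a, a]%classic : set R.
have mE0 : measurable E by exact: measurable_itv.
have PE : (P (xi @^-1` E) <= (2^-1)%:E)%E.
  rewrite xiE// /normal_prob -/s.
  apply: (@le_trans _ _ (\int[lebesgue_measure]_(x in E) (normal_peak s)%:E)%E).
    apply: ge0_le_integral => //=.
    - by move=> x _; rewrite lee_fin normal_pdf_ge0.
    - by apply/measurable_funTS/measurable_EFinP; exact: measurable_normal_pdf.
    - by move=> x _; rewrite ?lee_fin; exact: normal_pdf_ub.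
  rewrite integral_cst; last exact: measurable_itv.
  have LE : lebesgue_measure E = (a + a)%:E.
    by rewrite /E lebesgue_measure_itv /= lte_fin ifT ?gtrN// -EFinD opprK.
  rewrite [X in (_ * X)%E](_ : _ = (a + a)%:E)// -EFinM lee_fin.
  have sp : 0 < s by exact: s0.
  have q0 : 0 < s ^+ 2 * pi *+ 2 by rewrite pmulrn_lgt0// mulr_gt0 ?pi_gt0// exprn_gt0.
  have ps : normal_peak s <= s^-1.
    rewrite /normal_peak lef_pV2 ?posrE ?sqrtr_gt0//.
    rewrite -[leLHS]gtr0_norm// -sqrtr_sqr ler_sqrt ?(ltW q0)//.
    rewrite -mulrnAr ler_peMr ?sqr_ge0// -mulr_natr.
    by have := @pi_ge2 R; lra.
  apply: (@le_trans _ _ (s^-1 * (a + a))).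
    by rewrite ler_wpM2r// addr_ge0// ltW.
  rewrite le_eqVlt; apply/orP; left; apply/eqP; rewrite /a.
  by move: (s) sN => r rN; field.
have mE : measurable (xi @^-1` E) by rewrite -[X in measurable X]setTI; apply: mxi => //; exact: measurable_itv.
have mC : measurable (~` (xi @^-1` E)) by exact: measurableC.
have PC : ((2^-1)%:E <= P (~` (xi @^-1` E)))%E.
  rewrite probability_setC//; have := PE.
  have fin : P (xi @^-1` E) \is a fin_num by exact: fin_num_measure.
  by rewrite -(fineK fin) -EFinB !lee_fin; lra.
have mx2 : measurable_fun setT (fun w => (xi w ^+ 2)%:E).
  by apply/measurable_EFinP; exact: measurable_funX.
apply: (@le_trans _ _ (\int[P]_(w in ~` (xi @^-1` E)) (xi w ^+ 2)%:E)%E); last first.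
  by apply: ge0_subset_integral => // w _; rewrite lee_fin sqr_ge0.
apply: (@le_trans _ _ (\int[P]_(w in ~` (xi @^-1` E)) (a ^+ 2)%:E)%E); last first.
  apply: ge0_le_integral => //.
  - by move=> w _; rewrite lee_fin sqr_ge0.
  - exact: measurable_funTS.
  - move=> w /= wE; rewrite lee_fin -[leRHS]real_normK ?num_real// lerXn2r ?nnegrE ?(ltW a0)//.
    rewrite leNgt; apply/negP => xa; apply: wE.
    by rewrite /E /= in_itv /= -ler_norml ltW.
rewrite integral_cst//; apply: (@le_trans _ _ ((a ^+ 2)%:E * (2^-1)%:E)%E).
  rewrite -EFinM lee_fin /a /s expr_div_n sqr_sqrtr ?(ltW t0)//.
  have -> : (4 : R) ^+ 2 = 16 by ring.
  by have := t0; lra.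
by apply: lee_wpmul2l => //; rewrite lee_fin sqr_ge0.
Qed.

End GaussianVariable.

Lemma prob_integral_cst {R : realType} {d : measure_display} {Omega : measurableType d}
  (P : probability Omega R) (c : \bar R) : (\int[P]_w c = c)%E.
Proof.
by rewrite integral_cst// -[RHS]mule1; congr (_ * _)%E; exact: probability_setT.
Qed.

Section IndependentFamily.
Context {R : realType} {d : measure_display} {Omega : measurableType d}.
Variable P : probability Omega R.
Variables (I : finType) (Z : I -> Omega -> R) (nu : I -> set R -> \bar R).
Hypothesis mZ : forall i, measurable_fun setT (Z i).
Hypothesis nuT : forall i, nu i setT = 1%E.
Hypothesis ZE : forall E : I -> set R, (forall i, measurable (E i)) ->
  P [set w | forall i, E i (Z i w)] = (\big[*%E/1%E]_i nu i (E i))%E.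
Implicit Types J : pred I.

Definition subcylinders J : set (set Omega) :=
  [set A | exists E : I -> set R, [/\ forall i, measurable (E i),
     forall i, ~~ J i -> E i = setT & A = [set w | forall i, E i (Z i w)]]].

Lemma subcylinders_setI J : setI_closed (subcylinders J).
Proof.
move=> _ _ [E [mE ET ->]] [F [mF FT ->]]; exists (fun i => E i `&` F i); split.
- by move=> i; exact: measurableI.
- by move=> i iJ; rewrite ET// FT// setIT.
apply/seteqP; split=> [w [Ew Fw] i|w EF]; first by split.
by split=> i; have [] := EF i.
Qed.

Lemma subcylinders_setT J : subcylinders J setT.
Proof. by exists (fun=> setT); split => //; apply/seteqP; split. Qed.

Lemma subcylinders_measurable J : subcylinders J `<=` measurable.
Proof.
move=> _ [E [mE _ ->]]; apply: (@measurable_forall _ _ _ (fun i w => E i (Z i w))) => i.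
by have := mZ i measurableT (mE i); rewrite setTI.
Qed.

Lemma subcylinders_coord J i : J i ->
  measurable_fun setT (Z i : g_sigma_algebraType (subcylinders J) -> R).
Proof.
move=> iJ _ E mE; rewrite setTI; apply: sub_sigma_algebra.
exists (fun j => if j == i then E else setT); split => [j|j jJ|]; first by case: ifP.
  by case: eqP jJ => // ->; rewrite iJ.
apply/seteqP; split=> [w /= Ew j|w /= /(_ i)]; last by rewrite eqxx.
by case: eqP => [->|].
Qed.

Lemma sigma_subcylinders_measurable J : <<s subcylinders J >> `<=` measurable.
Proof. by apply: smallest_sub; [exact: sigma_algebra_measurable|exact: subcylinders_measurable]. Qed.

Lemma measurable_fun_subcylinders J d1 (T1 : measurableType d1) (f : Omega -> T1) :
  measurable_fun setT (f : g_sigma_algebraType (subcylinders J) -> T1) ->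
  measurable_fun setT f.
Proof.
move=> mf _ A mA; apply: (@sigma_subcylinders_measurable J).
exact: (mf measurableT A mA).
Qed.

Lemma subcylinders_indep J J' : (forall i, J i -> ~~ J' i) ->
  indep_systems P <<s subcylinders J >> <<s subcylinders J' >>.
Proof.
move=> JJ'; apply: indep_systems_gen.
1, 2: exact: subcylinders_measurable.
1, 3: exact: subcylinders_setI.
1, 2: exact: subcylinders_setT.
move=> _ _ [E [mE ET ->]] [F [mF FT ->]].
rewrite (_ : _ `&` _ = [set w | forall i, (E i `&` F i) (Z i w)]); last first.
  apply/seteqP; split=> [w [Ew Fw] i|w EF]; first by split.
  by split=> i; have [] := EF i.
rewrite (ZE mE) (ZE mF) (@ZE (fun i => E i `&` F i)); last by move=> i; exact: measurableI.
rewrite -big_split; apply: eq_bigr => i _ /=.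
have [Ji|Ji] := boolP (J i).
  by rewrite (FT i (JJ' i Ji)) setIT nuT mule1.
by rewrite (ET i Ji) setTI nuT mul1e.
Qed.

Lemma subcylinders_indep_fun J J' d1 d2 (T1 : measurableType d1) (T2 : measurableType d2)
    (U : Omega -> T1) (V : Omega -> T2) (G : T1 * T2 -> \bar R) :
  (forall i, J i -> ~~ J' i) ->
  measurable_fun setT (U : g_sigma_algebraType (subcylinders J) -> T1) ->
  measurable_fun setT (V : g_sigma_algebraType (subcylinders J') -> T2) ->
  measurable_fun setT G -> (forall z, (0 <= G z)%E) ->
  (\int[P]_w G (U w, V w) = \int[P]_w \int[P]_w' G (U w, V w'))%E.
Proof.
move=> JJ' mU mV mG G0; apply: indep_integral => //.
- exact: measurable_fun_subcylinders mU.
- exact: measurable_fun_subcylinders mV.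
move=> A B mA mB; apply: (subcylinders_indep JJ').
- by have := mU measurableT A mA; rewrite setTI.
- by have := mV measurableT B mB; rewrite setTI.
Qed.

End IndependentFamily.

(** * Sums of independent Gaussian variables: moments and spread *)

Section GaussianSum.
Context {R : realType} {d : measure_display} {Omega : measurableType d}.
Variable P : probability Omega R.
Variables (I : finType) (Z : I -> Omega -> R) (t : R).
Hypothesis t0 : 0 < t.
Hypothesis mZ : forall i, measurable_fun setT (Z i).
Hypothesis ZE : forall E : I -> set R, (forall i, measurable (E i)) ->
  P [set w | forall i, E i (Z i w)] =
  (\big[*%E/1%E]_i normal_prob 0 (Num.sqrt t) (E i))%E.

Let nuT (i : I) : normal_prob 0 (Num.sqrt t) setT = 1%E :> \bar R.
Proof. exact: probability_setT. Qed.

Lemma gaussian_family_coord i E : measurable E ->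
  P (Z i @^-1` E) = normal_prob 0 (Num.sqrt t) E.
Proof.
move=> mE; have := @ZE (fun j => if j == i then E else setT).
rewrite (bigD1 i)//= eqxx big1 ?mule1; last first.
  by move=> j /negPf ->; exact: nuT.
move=> <-; last by move=> j; case: ifP.
congr (P _); apply/seteqP; split=> [w /= Ew j|w /= /(_ i)]; last by rewrite eqxx.
by case: eqP => [->|].
Qed.

Variable c : I -> R.
Definition gsum (s : seq I) (w : Omega) : R := \sum_(i <- s) c i * Z i w.

Lemma measurable_gsum s : measurable_fun setT (gsum s).
Proof.
by apply: measurable_sum => i; exact: measurable_funM.
Qed.

Lemma measurable_gsum_sub s : measurable_fun setT
  (gsum s : g_sigma_algebraType (subcylinders Z (mem s)) -> R).
Proof.
rewrite (_ : gsum s = (fun w => \sum_(i <- s | i \in s) c i * Z i w)); last first.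
  by apply/funext => w; rewrite /gsum big_seq.
under eq_fun do rewrite big_mkcond.
apply: measurable_sum => i; have [si|//] := boolP (i \in s).
by apply: measurable_funM => //; exact: (@subcylinders_coord _ _ _ I Z (mem s) i si).
Qed.

Let step (G : R -> \bar R) i s : i \notin s -> measurable_fun setT G -> (forall x, (0 <= G x)%E) ->
  (\int[P]_w G (gsum (i :: s) w) = \int[P]_w \int[P]_w' G (gsum s w + c i * Z i w')%R)%E.
Proof.
move=> si mG G0.
have := @subcylinders_indep_fun _ _ _ P I Z (fun=> normal_prob 0 (Num.sqrt t)) mZ nuT ZE
  (mem s) (pred1 i) _ _ R R (gsum s) (Z i) (fun p => G (p.1 + c i * p.2)%R).
move=> <-//.
- by apply: eq_integral => w _; rewrite /gsum big_cons addrC.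
- by move=> j /= sj; apply: contraNN si => /eqP <-.
- exact: measurable_gsum_sub.
- by apply: subcylinders_coord => /=.
- apply: measurableT_comp => //; apply: measurable_funD => //.
  by apply: measurable_funM.
Qed.

Definition ss (s : seq I) : R := \sum_(i <- s) c i ^+ 2.

Lemma ss_ge0 s : 0 <= ss s. Proof. by apply: sumr_ge0 => i _; rewrite sqr_ge0. Qed.

Lemma inner2 i (a : R) : (\int[P]_w ((a + c i * Z i w) ^+ 2)%:E =
  (a ^+ 2)%:E + (c i ^+ 2)%:E * \int[P]_w (Z i w ^+ 2)%:E)%E.
Proof.
have iZ k : (k <= 4)%N -> P.-integrable setT (fun w => (Z i w ^+ k)%:E).
  by apply: (gaussian_integrable t0) => // E; exact: gaussian_family_coord.
have iZ1 : P.-integrable setT (fun w => (Z i w)%:E) by exact: (iZ 1%N).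
rewrite (eq_integral (fun w => (a ^+ 2)%:E + ((2 * a * c i)%:E * (Z i w)%:E
   + (c i ^+ 2)%:E * (Z i w ^+ 2)%:E))%E); last first.
  by move=> w _; rewrite -!EFinM -!EFinD; congr EFin; ring.
rewrite integralD//; last 2 first.
- exact: finite_measure_integrable_cst.
- by apply: integrableD => //; apply: integrableZl => //; exact: iZ.
rewrite integralD//; last 2 first.
- exact: integrableZl.
- by apply: integrableZl => //; exact: iZ.
rewrite !integralZl//; last exact: iZ.
rewrite prob_integral_cst.
by rewrite (gaussian_mean t0 (mZ i)) ?mule0 ?add0e// => E; exact: gaussian_family_coord.
Qed.

(** Adding [2 x^2 (a - x)^2], with [x = c i * Z i], to [(a + x)^4] removes the cubic term, so that
    only the mean, which is 0, and even moments appear. *)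
Lemma inner4 i (a : R) : (\int[P]_w ((a + c i * Z i w) ^+ 4)%:E <=
  (a ^+ 4)%:E + ((8 * c i ^+ 2)%:E * \int[P]_w (Z i w ^+ 2)%:E * (a ^+ 2)%:E
   + (3 * c i ^+ 4)%:E * \int[P]_w (Z i w ^+ 4)%:E))%E.
Proof.
have iZ k : (k <= 4)%N -> P.-integrable setT (fun w => (Z i w ^+ k)%:E).
  by apply: (gaussian_integrable t0) => // E; exact: gaussian_family_coord.
have iZ1 : P.-integrable setT (fun w => (Z i w)%:E) by exact: (iZ 1%N).
pose g w := ((a ^+ 4)%:E + ((4 * a ^+ 3 * c i)%:E * (Z i w)%:E
   + ((8 * c i ^+ 2 * a ^+ 2)%:E * (Z i w ^+ 2)%:E + (3 * c i ^+ 4)%:E * (Z i w ^+ 4)%:E)))%E.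
have i3 : P.-integrable setT (fun w => ((8 * c i ^+ 2 * a ^+ 2)%:E * (Z i w ^+ 2)%:E +
    (3 * c i ^+ 4)%:E * (Z i w ^+ 4)%:E)%E).
  by apply: integrableD => //; apply: integrableZl => //; exact: iZ.
have i2 : P.-integrable setT (fun w => ((4 * a ^+ 3 * c i)%:E * (Z i w)%:E
   + ((8 * c i ^+ 2 * a ^+ 2)%:E * (Z i w ^+ 2)%:E + (3 * c i ^+ 4)%:E * (Z i w ^+ 4)%:E))%E).
  by apply: integrableD => //; apply: integrableZl.
have ig : P.-integrable setT g.
  by apply: integrableD => //; exact: finite_measure_integrable_cst.
apply: (@le_trans _ _ (\int[P]_w g w)%E).
  apply: ge0_le_integral => //.
  - by move=> w _; rewrite lee_fin exprn_even_ge0.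
  - apply/measurable_EFinP/measurable_funX; apply: measurable_funD => //.
    by apply: measurable_funM.
  - exact: measurable_int ig.
  - move=> w _; rewrite /g -!EFinM -!EFinD lee_fin.
    set x := c i * Z i w.
    have -> : a ^+ 4 + (4 * a ^+ 3 * c i * Z i w + (8 * c i ^+ 2 * a ^+ 2 * Z i w ^+ 2 + 3 * c i ^+ 4 * Z i w ^+ 4))
      = (a + x) ^+ 4 + 2 * (x ^+ 2 * (a - x) ^+ 2) by rewrite /x; ring.
    by rewrite lerDl mulr_ge0// mulr_ge0// sqr_ge0.
rewrite /g integralD//; last exact: finite_measure_integrable_cst.
rewrite integralD//; last exact: integrableZl.
rewrite integralD//; last 2 first.
- by apply: integrableZl => //; exact: iZ.
- by apply: integrableZl => //; exact: iZ.
rewrite !integralZl//; last 2 first.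
- exact: iZ.
- exact: iZ.
rewrite prob_integral_cst.
rewrite (gaussian_mean t0 (mZ i)); last by move=> E; exact: gaussian_family_coord.
by rewrite mule0 add0e (EFinM (8 * c i ^+ 2)) muleAC.
Qed.

(** The fourth moment is bounded by a multiple of the square of the second with a constant
    independent of the number of variables, which is what the spread estimate needs. The variables
    are added one at a time, each being independent of the partial sum before it. *)
Lemma gsum_moments (a : R) s : uniq s ->
  [/\ ((a ^+ 2 + t / 64 * ss s)%:E <= \int[P]_w ((a + gsum s w) ^+ 2)%:E)%E,
      (\int[P]_w ((a + gsum s w) ^+ 2)%:E <= (a ^+ 2 + 129 * t * ss s)%:E)%E &
      (\int[P]_w ((a + gsum s w) ^+ 4)%:E <= (32 * 64 * 64 * (a ^+ 2 + t * ss s) ^+ 2)%:E)%E].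
Proof.
have mgX k s' : measurable_fun setT (fun w => ((a + gsum s' w) ^+ k)%:E).
  apply/measurable_EFinP/measurable_funX; apply: measurable_funD => //.
  exact: measurable_gsum.
have ex4 (x : R) : 0 <= x ^+ 4 by rewrite exprn_even_ge0.
elim: s => [_|i s ih].
  have e0 k : (\int[P]_w ((a + gsum [::] w) ^+ k)%:E = (a ^+ k)%:E)%E.
    under eq_integral do rewrite /gsum big_nil addr0.
    by rewrite prob_integral_cst.
  rewrite !e0 /ss big_nil !mulr0 !addr0; split; rewrite ?lee_fin//.
  by rewrite -exprM ler_peMl//; lra.
move=> /= /andP[si us].
have [l2 u2 u4] := ih us.
have mG k : measurable_fun setT (fun x : R => ((a + x) ^+ k)%:E).
  by apply/measurable_EFinP/measurable_funX; apply: measurable_funD.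
(* [Z^2 <= t + Z^4 / t] reduces this to the fourth moment, whence [129 = 1 + 128]. *)
have m2le : (\int[P]_w (Z i w ^+ 2)%:E <= (129 * t)%:E)%E.
  apply: (@le_trans _ _ (\int[P]_w (t%:E + (t^-1)%:E * (Z i w ^+ 4)%:E))%E).
    apply: ge0_le_integral => //.
    - by move=> w _; rewrite lee_fin sqr_ge0.
    - by apply/measurable_EFinP/measurable_funX.
    - apply/measurable_EFinP; apply: measurable_funD => //; apply: measurable_funM => //.
      exact: measurable_funX.
    - move=> w _; rewrite -EFinM -EFinD lee_fin.
      have -> : t + t^-1 * Z i w ^+ 4 = Z i w ^+ 2 + (t * (1 - t^-1 * Z i w ^+ 2) ^+ 2 + Z i w ^+ 2).
        by field; rewrite gt_eqF.
      by rewrite lerDl addr_ge0 ?sqr_ge0// mulr_ge0 ?sqr_ge0// ltW.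
  rewrite ge0_integralD//; last 3 first.
  - by move=> w _; rewrite lee_fin ltW.
  - by move=> w _; rewrite -EFinM lee_fin mulr_ge0// invr_ge0 ltW.
  - apply/measurable_EFinP; apply: measurable_funM => //; exact: measurable_funX.
  rewrite prob_integral_cst.
  rewrite ge0_integralZl//; last 3 first.
  - by apply/measurable_EFinP/measurable_funX.
  - by move=> w _; rewrite lee_fin.
  - by rewrite lee_fin invr_ge0 ltW.
  apply: (@le_trans _ _ (t%:E + (t^-1)%:E * (128 * t ^+ 2)%:E)%E).
    rewrite leeD2l// lee_pmul2l ?lte_fin ?invr_gt0//.
    by apply: (gaussian_moment4 t0 (mZ i)) => E; exact: gaussian_family_coord.
  rewrite -EFinM -EFinD lee_fin.
  have -> : t + t^-1 * (128 * t ^+ 2) = 129 * t by field; rewrite gt_eqF.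
  by [].
have m2ge : ((t / 64)%:E <= \int[P]_w (Z i w ^+ 2)%:E)%E.
  by apply: (gaussian_moment2_ge t0 (mZ i)) => E; exact: gaussian_family_coord.
have m4le : (\int[P]_w (Z i w ^+ 4)%:E <= (128 * t ^+ 2)%:E)%E.
  by apply: (gaussian_moment4 t0 (mZ i)) => E; exact: gaussian_family_coord.
have stepk k : ~~ odd k -> (\int[P]_w ((a + gsum (i :: s) w) ^+ k)%:E =
    \int[P]_w \int[P]_w' ((a + gsum s w + c i * Z i w') ^+ k)%:E)%E.
  move=> ok; rewrite (@step (fun x => ((a + x) ^+ k)%:E) i s si (mG k)); last first.
    by move=> x; rewrite lee_fin exprn_even_ge0.
  by under eq_integral => w _ do under eq_integral => w' _ do rewrite addrA.
have ssE : ss (i :: s) = c i ^+ 2 + ss s by rewrite /ss big_cons.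
have ss0 : 0 <= ss s by exact: ss_ge0.
have two_step : (\int[P]_w ((a + gsum (i :: s) w) ^+ 2)%:E =
    \int[P]_w ((a + gsum s w) ^+ 2)%:E + (c i ^+ 2)%:E * \int[P]_w (Z i w ^+ 2)%:E)%E.
  rewrite stepk//; under eq_integral do rewrite inner2.
  rewrite ge0_integralD//; last 2 first.
  - by move=> w _; rewrite lee_fin sqr_ge0.
  - by move=> w _; rewrite mule_ge0// ?lee_fin ?sqr_ge0// integral_ge0// => w' _; rewrite lee_fin sqr_ge0.
    by rewrite prob_integral_cst.
split.
- rewrite two_step ssE.
  apply: (@le_trans _ _ ((a ^+ 2 + t / 64 * ss s)%:E + (c i ^+ 2)%:E * (t / 64)%:E)%E).
    by rewrite -EFinM -EFinD lee_fin le_eqVlt; apply/orP; left; apply/eqP; ring.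
  by rewrite leeD// lee_wpmul2l// lee_fin sqr_ge0.
- rewrite two_step ssE.
  apply: (@le_trans _ _ ((a ^+ 2 + 129 * t * ss s)%:E + (c i ^+ 2)%:E * (129 * t)%:E)%E).
    by rewrite leeD// lee_wpmul2l// lee_fin sqr_ge0.
  by rewrite -EFinM -EFinD lee_fin le_eqVlt; apply/orP; left; apply/eqP; ring.
- rewrite stepk// ssE.
  have [k1 k1E] : exists k : R, k = 8 * 129 * t * c i ^+ 2 by eexists.
  have [k2 k2E] : exists k : R, k = 3 * 128 * c i ^+ 4 * t ^+ 2 by eexists.
  have k10 : 0 <= k1 by rewrite k1E mulr_ge0 ?sqr_ge0// mulr_ge0// ltW.
  have k20 : 0 <= k2 by rewrite k2E mulr_ge0 ?sqr_ge0// mulr_ge0.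
  have n1 w : (0 <= k1%:E * ((a + gsum s w) ^+ 2)%:E)%E.
    by rewrite mule_ge0 ?lee_fin ?sqr_ge0.
  have m1 : measurable_fun setT (fun w => k1%:E * ((a + gsum s w) ^+ 2)%:E)%E.
    exact: emeasurable_funM.
  have n2 w : (0 <= k1%:E * ((a + gsum s w) ^+ 2)%:E + k2%:E)%E by rewrite adde_ge0.
  have m2 : measurable_fun setT (fun w => k1%:E * ((a + gsum s w) ^+ 2)%:E + k2%:E)%E.
    exact: emeasurable_funD.
  have n4 w : (0 <= ((a + gsum s w) ^+ 4)%:E)%E by rewrite lee_fin.
  pose H (z : Omega * Omega) := ((a + gsum s z.1 + c i * Z i z.2) ^+ 4)%:E.
  have mH : measurable_fun setT H.
    apply/measurable_EFinP/measurable_funX; apply: measurable_funD.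
      apply: measurable_funD; first exact: measurable_cst.
      by apply: measurableT_comp; [exact: measurable_gsum|exact: measurable_fst].
    apply: measurable_funM; first exact: measurable_cst.
    by apply: measurableT_comp; [exact: mZ|exact: measurable_snd].
  have H0 z : (0 <= H z)%E by rewrite lee_fin.
  have mFH := @measurable_fun_fubini_tonelli_F _ _ _ _ _ P H mH H0.
  apply: (@le_trans _ _ (\int[P]_w (((a + gsum s w) ^+ 4)%:E +
      (k1%:E * ((a + gsum s w) ^+ 2)%:E + k2%:E)))%E).
    apply: ge0_le_integral.
    - exact: measurableT.
    - by move=> w _; apply: integral_ge0 => w' _; rewrite lee_fin.
    - exact: mFH.
    - exact: (emeasurable_funD (mgX 4%N s) m2).
    - move=> w _; apply: le_trans (inner4 _ _) _.
      rewrite leeD2l// leeD//.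
        apply: (@le_trans _ _ ((8 * c i ^+ 2)%:E * (129 * t)%:E * ((a + gsum s w) ^+ 2)%:E)%E).
          rewrite lee_wpmul2r ?lee_fin ?sqr_ge0// lee_wpmul2l// lee_fin.
          by rewrite mulr_ge0// sqr_ge0.
        by rewrite -!EFinM lee_fin le_eqVlt k1E; apply/orP; left; apply/eqP; ring.
      apply: (@le_trans _ _ ((3 * c i ^+ 4)%:E * (128 * t ^+ 2)%:E)%E).
        by rewrite lee_wpmul2l// lee_fin mulr_ge0.
      by rewrite -!EFinM lee_fin le_eqVlt k2E; apply/orP; left; apply/eqP; ring.
  rewrite (@ge0_integralD _ _ _ P _ measurableT _ _ (fun w _ => n4 w) (mgX 4%N s) (fun w _ => n2 w) m2).
  rewrite (@ge0_integralD _ _ _ P _ measurableT _ (cst k2%:E) (fun w _ => n1 w) m1); last 2 first.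
  - by move=> w _; rewrite lee_fin.
  - exact: measurable_cst.
  rewrite ge0_integralZl//; last by move=> w _; rewrite lee_fin sqr_ge0.
  rewrite prob_integral_cst.
  apply: (@le_trans _ _ ((32 * 64 * 64 * (a ^+ 2 + t * ss s) ^+ 2)%:E +
    (k1%:E * (a ^+ 2 + 129 * t * ss s)%:E + k2%:E))%E).
    by rewrite leeD// leeD2r// lee_wpmul2l// lee_fin.
  rewrite -EFinM -!EFinD lee_fin k1E k2E.
  have ct : 0 <= t * c i ^+ 2 by rewrite mulr_ge0 ?sqr_ge0// ltW.
  have ts : 0 <= t * ss s by rewrite mulr_ge0// ltW.
  have a2 : 0 <= a ^+ 2 by rewrite sqr_ge0.
  (* These three inequalities are what the constant [32 * 64 * 64] has to satisfy for the induction
     to close; the tightest is that its double dominates [8 * 129 * 129]. *)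
  have [K0 K1 K2] : [/\ 0 <= 2 * (32 * 64 * 64) - 8 * 129 :> R,
    0 <= 2 * (32 * 64 * 64) - 8 * 129 * 129 :> R & 0 <= 32 * 64 * 64 - 3 * 128 :> R] by rewrite !subr_ge0 -!natrM !ler_nat.
  move: K0 K1 K2; move: (32 * 64 * 64 : R) => K K0 K1 K2.
  rewrite -subr_ge0 (_ : _ - _ = (2 * K - 8 * 129) * ((t * c i ^+ 2) * a ^+ 2)
    + (2 * K - 8 * 129 * 129) * ((t * c i ^+ 2) * (t * ss s))
    + (K - 3 * 128) * (t * c i ^+ 2) ^+ 2); last by ring.
  apply: addr_ge0; last exact: mulr_ge0 K2 (sqr_ge0 _).
  exact: addr_ge0 (mulr_ge0 K0 (mulr_ge0 ct a2)) (mulr_ge0 K1 (mulr_ge0 ct ts)).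
Qed.

(* Paley-Zygmund: Y <= m/2 + Y 1_A and Y 1_A <= Y^2/(2 lam) + lam 1_A/2. *)
Lemma gsum_spread (a : R) s : uniq s ->
  (((4 * (32 * 64 * 64) * (64 * 64))^-1)%:E <= P [set w | (t / 128 * ss s <= (a + gsum s w) ^+ 2)%R])%E.
Proof.
move=> us; have [l2 _ u4] := gsum_moments a us.
have ss0 : 0 <= ss s by exact: ss_ge0.
pose Y w := (a + gsum s w) ^+ 2.
have mY : measurable_fun setT Y.
  by apply: measurable_funX; apply: measurable_funD => //; exact: measurable_gsum.
pose m : R := a ^+ 2 + t / 64 * ss s.
(* If [m = 0] then the threshold is 0 and the event is the whole space. *)
have [m0|m0] := eqVneq m 0.
  have h : t / 64 * ss s = 0.
    by apply/eqP; move/eqP: m0; rewrite paddr_eq0 ?sqr_ge0 ?mulr_ge0 ?divr_ge0// ?ltW// => /andP[].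
  rewrite (_ : [set w | _] = setT); last first.
    apply/seteqP; split=> // w _ /=.
    have -> : t / 128 * ss s = (t / 64 * ss s) / 2 by field.
    by rewrite h mul0r sqr_ge0.
  rewrite probability_setT lee_fin.
  by rewrite -[leLHS]mul1r ler_pdivrMr ?mulr_gt0//; lra.
have mp : 0 < m by rewrite lt_def m0 addr_ge0 ?sqr_ge0 ?mulr_ge0 ?divr_ge0// ltW.
set D := [set w | _].
have mD : measurable D.
  rewrite (_ : D = Y @^-1` [set x | t / 128 * ss s <= x])//.
  rewrite -[X in measurable X]setTI; apply: mY => //.
  by rewrite -set_itvcy; exact: measurable_itv.
(* Chosen so that the term with the fourth moment is at most [m / 4]. There remains
   [m / 4 <= la / 2 * P D], and [m / (2 * la)] is the announced probability. *)
pose la : R := 2 * (32 * 64 * 64) * (64 * 64) * m.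
have lap : 0 < la by rewrite /la !mulr_gt0.
have key : (m%:E <= (m / 2)%:E + ((2 * la)^-1)%:E * (32 * 64 * 64 * (a ^+ 2 + t * ss s) ^+ 2)%:E + (la / 2)%:E * P D)%E.
  apply: le_trans l2 _.
  apply: (@le_trans _ _ (\int[P]_w ((m / 2)%:E + ((2 * la)^-1)%:E * ((a + gsum s w) ^+ 4)%:E + (la / 2)%:E * (\1_D w)%:E))%E).
    apply: ge0_le_integral => //.
    - by move=> w _; rewrite lee_fin sqr_ge0.
    - exact/measurable_EFinP.
    - apply: emeasurable_funD; last first.
        by apply: emeasurable_funM => //; apply/measurable_EFinP; exact: measurable_indic.
      apply: emeasurable_funD => //; apply: emeasurable_funM => //.
      apply/measurable_EFinP/measurable_funX; apply: measurable_funD => //.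
      exact: measurable_gsum.
    - move=> w _; rewrite -!EFinM -!EFinD lee_fin.
      have -> : (a + gsum s w) ^+ 4 = Y w ^+ 2 by rewrite /Y; ring.
      rewrite -/(Y w) indicE.
      have Y0 : 0 <= (2 * la)^-1 * Y w ^+ 2.
        by rewrite mulr_ge0 ?sqr_ge0// invr_ge0 mulr_ge0// ltW.
      have [wD|wD] := boolP (w \in D).
        rewrite mulr1.
        have h : Y w <= (2 * la)^-1 * Y w ^+ 2 + la / 2.
          rewrite -subr_ge0 (_ : _ - _ = (2 * la)^-1 * (Y w - la) ^+ 2).
            by rewrite mulr_ge0 ?sqr_ge0// invr_ge0 mulr_ge0// ltW.
          by field; rewrite gt_eqF.
        by rewrite (le_trans h)// -addrA lerDr divr_ge0// ltW.
      rewrite mulr0 addr0.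
      have h : Y w <= t / 128 * ss s.
        by rewrite leNgt; apply: contra wD => /ltW yw; rewrite inE.
      rewrite (le_trans h)// (@le_trans _ _ (m / 2)) ?lerDl//.
      rewrite /m -subr_ge0 (_ : _ - _ = a ^+ 2 / 2) ?divr_ge0 ?sqr_ge0//.
      by field.
  rewrite ge0_integralD//; last 4 first.
  - move=> w _; rewrite -EFinM -EFinD lee_fin addr_ge0 ?divr_ge0//; first by rewrite ltW.
    by rewrite mulr_ge0 ?exprn_even_ge0// invr_ge0 mulr_ge0// ltW.
  - apply: emeasurable_funD => //; apply: emeasurable_funM => //.
    apply/measurable_EFinP/measurable_funX; apply: measurable_funD => //.
    exact: measurable_gsum.
  - by move=> w _; rewrite -EFinM lee_fin mulr_ge0 ?divr_ge0// ltW.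
  - by apply: emeasurable_funM => //; apply/measurable_EFinP; exact: measurable_indic.
  have mg4 : measurable_fun setT (fun w => ((a + gsum s w) ^+ 4)%:E).
    apply/measurable_EFinP/measurable_funX; apply: measurable_funD => //.
    exact: measurable_gsum.
  have li : (0 <= ((2 * la)^-1)%:E)%E by rewrite lee_fin invr_ge0 mulr_ge0// ltW.
  rewrite ge0_integralD//; last 3 first.
  - by move=> w _; rewrite lee_fin divr_ge0// ltW.
  - by move=> w _; rewrite mule_ge0// lee_fin exprn_even_ge0.
  - by apply: emeasurable_funM.
  rewrite prob_integral_cst.
  rewrite ge0_integralZl//; last by move=> w _; rewrite lee_fin exprn_even_ge0.
  have mI : measurable_fun setT (fun w => (\1_D w)%:E : \bar R).
    by apply/measurable_EFinP; exact: measurable_indic.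
  rewrite (ge0_integralZl P measurableT mI)//; last first.
    by rewrite lee_fin divr_ge0// ltW.
  rewrite integral_indic// setIT leeD2r// leeD2l//.
  by rewrite lee_wpmul2l.
have PD : (P D < +oo)%E by rewrite (le_lt_trans (probability_le1 P mD))// ltry.
have PD0 : P D \is a fin_num by rewrite ge0_fin_numE.
move: key; rewrite -(fineK PD0) -!EFinM -!EFinD !lee_fin.
set p := fine _ => key.
have bd : (2 * la)^-1 * (32 * 64 * 64 * (a ^+ 2 + t * ss s) ^+ 2) <= m / 4.
  have h1 : (a ^+ 2 + t * ss s) ^+ 2 <= (64 * m) ^+ 2.
    have ts : 0 <= t * ss s by rewrite mulr_ge0// ltW.
    have h00 : 0 <= a ^+ 2 + t * ss s by rewrite addr_ge0// sqr_ge0.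
    have h0 : a ^+ 2 + t * ss s <= 64 * m.
      rewrite -subr_ge0 (_ : _ - _ = 63 * a ^+ 2); first by rewrite mulr_ge0// sqr_ge0.
      by rewrite /m; field.
    by rewrite lerXn2r// nnegrE (le_trans h00 h0).
  apply: (@le_trans _ _ ((2 * la)^-1 * (32 * 64 * 64 * (64 * m) ^+ 2))).
    have la0 : 0 <= (2 * la)^-1 by rewrite invr_ge0 mulr_ge0 ?(ltW lap).
    by apply: ler_wpM2l => //; apply: ler_wpM2l => //; rewrite !mulr_ge0.
  rewrite /la le_eqVlt; apply/orP; left; apply/eqP; field.
  by rewrite gt_eqF.
have : m / 4 <= la / 2 * p by lra.
rewrite /la (_ : 2 * (32 * 64 * 64) * (64 * 64) * m / 2 * p = m * (32 * 64 * 64 * (64 * 64) * p)); last by field.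
rewrite ler_pM2l// => h; rewrite -[leLHS]mul1r ler_pdivrMr ?mulr_gt0//; lra.
Qed.

End GaussianSum.

(** * The Euler chain *)

Section LocallyLipschitz.
Context {R : realType} {n : nat}.

Definition loc_lip (f : 'cV[R]_n -> R) := forall M : R, exists2 L : R, 0 <= L &
  forall x y : 'cV[R]_n, `|x| <= M -> `|y| <= M -> `|f x - f y| <= L * `|x - y|.

Lemma loc_lip_continuous f : loc_lip f -> continuous f.
Proof.
move=> lf x; have [L L0 fL] := lf (`|x| + 1).
have fx : Filter (nbhs x) by exact: nbhs_filter.
apply: (proj2 (@cvgrPdist_le _ _ _ _ fx f (f x))) => e e0.
have h0 : 0 < Num.min 1 (e / (L + 1)) by rewrite lt_min ltr01 divr_gt0// ltr_wpDl.
have H : nbhs x [set y | `|x - y| < Num.min 1 (e / (L + 1))] by apply/nbhs_ballP; exists (Num.min 1 (e / (L + 1))) => //= y; rewrite -ball_normE.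
apply: filterS H => y /=.
rewrite lt_min => /andP[xy1 xye].
apply: le_trans (fL _ _ _ _) _; first by rewrite lerDl.
  rewrite -lerBlDl (le_trans (lerB_dist _ _))// distrC ltW//.
apply: (@le_trans _ _ ((L + 1) * `|x - y|)); first by rewrite ler_wpM2r// lerDl.
by rewrite mulrC -ler_pdivlMr ?ltW// ltr_wpDl.
Qed.

Lemma loc_lip_dot : loc_lip (fun x => dot x x).
Proof.
move=> M; exists (n%:R * (2 * `|M|)); first by rewrite !mulr_ge0.
move=> x y xM yM.
have -> : dot x x - dot y y = dot (x - y) (x + y).
  by rewrite dotBl !dotDr [dot y x]dotC; ring.
apply: le_trans (norm_dot_le _ _) _.
rewrite -!mulrA ler_wpM2l// mulrC [leRHS]mulrA ler_wpM2r//.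
by rewrite (le_trans (ler_normD _ _))// mulr2n mulrDl !mul1r lerD// (le_trans _ (ler_norm _)).
Qed.

Lemma quad_lip_loc_lip (b : 'cV[R]_n -> 'cV[R]_n) (C : R) i : 0 <= C -> quad_lip b C ->
  loc_lip (fun x => b x i 0).
Proof.
move=> C0 [_ bC] M; exists (C * (1 + `|M| + `|M|)); first by rewrite mulr_ge0// !addr_ge0.
move=> x y xM yM.
have -> : b x i 0 - b y i 0 = (b x - b y) i 0 by rewrite !mxE.
apply: le_trans (le_coord_norm _ _ _) _; apply: le_trans (bC _ _) _.
by rewrite ler_wpM2r// ler_wpM2l// !lerD// (le_trans _ (ler_norm _)).
Qed.

Lemma continuous_tamed (b : 'cV[R]_n -> 'cV[R]_n) (C : R) (d : R) i : 0 <= C -> quad_lip b C ->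
  continuous (fun x => tamed b d x i 0).
Proof.
move=> C0 bC x.
have Fx : Filter (nbhs x) by exact: nbhs_filter.
have cb : (fun z : 'cV[R]_n => b z i 0) @ nbhs x --> (b x i 0 : R).
  exact: (loc_lip_continuous (quad_lip_loc_lip i C0 bC)).
have cd : (fun z : 'cV[R]_n => dot z z) @ nbhs x --> dot x x.
  exact: (loc_lip_continuous loc_lip_dot).
have cden : (fun z : 'cV[R]_n => 1 + Num.sqrt d * dot z z) @ nbhs x --> 1 + Num.sqrt d * dot x x.
  exact: (@cvgD _ _ _ _ Fx _ _ _ _ (cvg_cst _) (@cvgM _ _ _ Fx _ _ _ _ (cvg_cst _) cd)).
have ct : (fun z : 'cV[R]_n => tame d z) @ nbhs x --> tame d x.
  apply: (@cvgV _ _ _ Fx _ _ _ cden).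
  by rewrite gt_eqF// (lt_le_trans ltr01)// tame_den_ge1.
have H := @cvgM _ _ _ Fx _ _ _ _ ct cb.
rewrite /continuous_at [tamed b d x i 0](_ : _ = tame d x * b x i 0); last by rewrite /tamed mxE.
apply: cvg_trans H; apply: near_eq_cvg; apply: (@filterE _ _ Fx) => z.
by rewrite /tamed mxE.
Qed.

End LocallyLipschitz.

Section ChainMeasurable.
Context {R : realType} {n : nat}.
Variables (b : 'cV[R]_n -> 'cV[R]_n) (C : R).
Hypothesis C0 : 0 <= C.
Hypothesis bC : quad_lip b C.

Lemma measurable_comp_continuous d (T : measurableType d) (f : 'cV[R]_n -> R) (u : T -> 'cV[R]_n) :
  continuous f -> (forall i, measurable_fun setT (fun w => u w i 0 : R)) ->
  measurable_fun setT (fun w => f (u w)).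
Proof.
move=> cf mu; apply: (@measurableT_comp _ _ _ T (borel R n) R f) => //.
  exact: continuous_borel.
exact: measurable_cV.
Qed.

Lemma measurable_chain d (T : measurableType d) (dt : nat -> R) (v : nat -> T -> 'cV[R]_n)
    (u : T -> 'cV[R]_n) K :
  (forall i, measurable_fun setT (fun w => u w i 0 : R)) ->
  (forall j i, (j < K)%N -> measurable_fun setT (fun w => v j w i 0 : R)) ->
  forall k, (k <= K)%N ->
  forall i, measurable_fun setT (fun w => chain b dt (v^~ w) (u w) k i 0 : R).
Proof.
move=> mu mv; elim=> [//|k ih kK] i /=.
have {}ih := ih (ltnW kK).
rewrite (_ : (fun w => _) = (fun w => chain b dt (v^~ w) (u w) k i 0 +
  dt k * tamed b (dt k) (chain b dt (v^~ w) (u w) k) i 0 + v k w i 0)); last first.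
  by apply/funext => w; rewrite !mxE.
apply: measurable_funD; last exact: mv.
apply: measurable_funD; first exact: ih.
apply: measurable_funM; first exact: measurable_cst.
exact: (@measurable_comp_continuous _ _ (fun x => tamed b (dt k) x i 0 : R)
  (fun w => chain b dt (v^~ w) (u w) k) (continuous_tamed C0 bC) ih).
Qed.

Lemma measurable_mulmx d (T : measurableType d) (S : 'M[R]_n) (u : T -> 'cV[R]_n) :
  (forall i, measurable_fun setT (fun w => u w i 0 : R)) ->
  forall i, measurable_fun setT (fun w => (S *m u w) i 0 : R).
Proof.
move=> mu i; rewrite (_ : (fun w => _) = (fun w => \sum_j S i j * u w j 0)); last first.
  by apply/funext => w; rewrite mxE.
apply: measurable_sum => j.
by apply: measurable_funM; [exact: measurable_cst|exact: mu].
Qed.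

End ChainMeasurable.

Section ChainLaw.
Context {R : realType} {n : nat}.
Variables (d : measure_display) (Omega : measurableType d).
Variable P : probability Omega R.
Variables (b : 'cV[R]_n -> 'cV[R]_n) (C : R) (S : 'M[R]_n).
Hypothesis C0 : 0 <= C.
Hypothesis bC : quad_lip b C.
Variable W : R -> Omega -> 'cV[R]_n.
Hypothesis mW : measurable_process W.
Hypothesis gW : gaussian_increments P W.

Definition partial (dt : nat -> R) (k : nat) : R := \sum_(j < k) dt j.

Lemma partialS dt k : partial dt k.+1 = partial dt k + dt k.
Proof. by rewrite /partial big_ord_recr. Qed.

Lemma partial_ge0 dt k : (forall j, 0 < dt j) -> 0 <= partial dt k.
Proof. by move=> dt0; apply: sumr_ge0 => j _; rewrite ltW. Qed.

Lemma partial_cst (h : R) k : partial (fun=> h) k = k%:R * h.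
Proof. by rewrite /partial sumr_const card_ord mulr_natl. Qed.

Lemma partialD dt M k : partial dt (M + k) = partial dt M + partial (fun j => dt (M + j)%N) k.
Proof.
elim: k => [|k ih]; first by rewrite addn0 {3}/partial big_ord0 addr0.
by rewrite addnS !partialS ih addrA.
Qed.

Definition noise (s : R) (dt : nat -> R) (j : nat) (w : Omega) : 'cV[R]_n :=
  S *m (W (s + partial dt j.+1) w - W (s + partial dt j) w).

Lemma measurable_increment s t i : 0 <= s -> 0 <= t ->
  measurable_fun setT (fun w => (W t w - W s w) i 0 : R).
Proof.
move=> s0 t0; rewrite (_ : (fun w => _) = (fun w => W t w i 0 - W s w i 0)); last first.
  by apply/funext => w; rewrite !mxE.
by apply: measurable_funB; apply: measurable_cV_coord; exact: mW.
Qed.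

Lemma gaussian_family m (dt : nat -> R) (s : R) (E : 'I_m * 'I_n -> set R) :
  0 <= s -> (forall j, 0 < dt j) -> (forall p, measurable (E p)) ->
  P [set w | forall p : 'I_m * 'I_n, E p ((W (s + partial dt p.1.+1) w - W (s + partial dt p.1) w) p.2 0)] =
  (\big[*%E/1%E]_(p : 'I_m * 'I_n) normal_prob 0 (Num.sqrt (dt p.1)) (E p))%E.
Proof.
move=> s0 dt0 mE.
have := @gW m (fun j => s + partial dt j) (fun j i => E (j, i)).
rewrite pair_bigA/= => H.
rewrite (_ : [set w | _] = [set w | forall j i, E (j, i)
   (W (s + partial dt j.+1) w i 0 - W (s + partial dt j) w i 0)]); last first.
  apply/seteqP; split=> [w h j i|w h [j i]]; first by have := h (j, i); rewrite /= !mxE.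
  by have := h j i; rewrite /= !mxE.
have h1 : 0 <= s + partial dt 0 by rewrite addr_ge0// partial_ge0.
have h2 j : s + partial dt j < s + partial dt j.+1 by rewrite partialS ltrD2l ltrDl.
etransitivity; first exact: (H h1 h2 (fun j i => mE (j, i))).
apply: eq_bigr => -[j i] _ /=.
have -> : s + partial dt j.+1 - (s + partial dt j) = dt j by rewrite partialS; ring.
by [].
Qed.

(** The noise of the second stretch of a chain is packed into a single random element. With the
    sigma-algebra generated by the coordinates, its measurability and its law are both decided on
    cylinders. *)
Definition noise_space m : pointedType := ('I_m * 'I_n)%type -> R.
Definition noise_eval m (p : 'I_m * 'I_n) (v : noise_space m) : R := v p.
Definition noise_meas m := g_sigma_algebraType (cylinders (@noise_eval m)).
(** The value 0 for [j >= m] is a default; a chain of [m] steps does not read it. *)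
Definition noise_col m (v : noise_space m) (j : nat) : 'cV[R]_n :=
  if insub j is Some j' then S *m \col_i v (j', i) else 0.

Lemma measurable_noise_map m d1 (T : measurableType d1) (V : T -> noise_space m) :
  (forall p, measurable_fun setT (fun w => V w p)) ->
  measurable_fun setT (V : T -> noise_meas m).
Proof.
move=> mV; apply: (@measurability _ _ T (noise_meas m) setT V (cylinders (@noise_eval m))) => //.
move=> _ [_ [E [mE ->]] <-]; rewrite setTI.
apply: (@measurable_forall _ T _ (fun (p : 'I_m * 'I_n) w => E p (V w p))) => p.
by have := mV p measurableT (E p) (mE p); rewrite setTI.
Qed.

(** The Markov property of the chain. The state after [M] steps is a function of the increments with
    index below [M], the remaining noise [V] of the others, and the two groups are independent; as
    increments are stationary, [V] can then be exchanged for the noise [V0] that restarts at time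
    0. *)
Lemma chain_split (dt : nat -> R) M N z (h : 'cV[R]_n -> \bar R) :
  (forall j, 0 < dt j) -> measurable_fun setT (h : borel R n -> \bar R) ->
  (forall x, (0 <= h x)%E) ->
  (\int[P]_w h (chain b dt (fun j => noise 0 dt j w) z (M + N)) =
   \int[P]_w \int[P]_w' h (chain b (fun j => dt (M + j)%N)
     (fun j => noise 0 (fun j => dt (M + j)%N) j w')
     (chain b dt (fun j => noise 0 dt j w) z M) N))%E.
Proof.
move=> dt0 mh h0.
pose dt' j := dt (M + j)%N.
have dt'0 j : 0 < dt' j by exact: dt0.
pose inc (s : R) (dt : nat -> R) m (p : 'I_m * 'I_n) w : R :=
  (W (s + partial dt p.1.+1) w - W (s + partial dt p.1) w) p.2 0.
have minc (s : R) (dd : nat -> R) m (p : 'I_m * 'I_n) : 0 <= s -> (forall j, 0 < dd j) ->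
    measurable_fun setT (inc s dd m p).
  by move=> s0 dd0; apply: measurable_increment; rewrite addr_ge0// partial_ge0.
pose Z := inc 0 dt (M + N)%N.
pose nu (p : 'I_(M + N) * 'I_n) := normal_prob (0 : R) (Num.sqrt (dt p.1)).
have mZ p : measurable_fun setT (Z p) by exact: minc.
have nuT p : nu p setT = 1%E by exact: probability_setT.
have ZE (E : 'I_(M + N) * 'I_n -> set R) : (forall p, measurable (E p)) ->
    P [set w | forall p, E p (Z p w)] = (\big[*%E/1%E]_p nu p (E p))%E.
  by move=> mE; exact: gaussian_family.
pose J : pred ('I_(M + N) * 'I_n) := fun p => (p.1 < M)%N.
pose J' : pred ('I_(M + N) * 'I_n) := fun p => (M <= p.1)%N.
pose U w := chain b dt (fun j => noise 0 dt j w) z M.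
pose V w : noise_space N := fun p => Z (rshift M p.1, p.2) w.
pose V0 w : noise_space N := inc 0 dt' N ^~ w.
pose G (q : borel R n * noise_meas N) : \bar R := h (chain b dt' (noise_col q.2) q.1 N).
have noiseE w j : (j < N)%N -> noise_col (V w) j = noise 0 dt (M + j) w.
  move=> jN; rewrite /noise_col insubT/= /noise; congr (_ *m _).
  by apply/matrixP => i k; rewrite ord1 mxE /V /Z /inc.
have noise0E w j : (j < N)%N -> noise_col (V0 w) j = noise 0 dt' j w.
  move=> jN; rewrite /noise_col insubT/= /noise; congr (_ *m _).
  by apply/matrixP => i k; rewrite ord1 mxE /V0 /inc.
have mU : measurable_fun setT (U : g_sigma_algebraType (subcylinders Z J) -> borel R n).
  apply: measurable_cV => i0.
  apply: (@measurable_chain _ _ b C C0 bC _ (g_sigma_algebraType (subcylinders Z J))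
    dt (noise 0 dt) (cst z) M) => // j i jM.
  apply: measurable_mulmx => k.
  have jMN : (j < M + N)%N by rewrite (leq_trans jM)// leq_addr.
  exact: (@subcylinders_coord _ _ _ _ Z J (Ordinal jMN, k)).
have mV : measurable_fun setT (V : g_sigma_algebraType (subcylinders Z J') -> noise_meas N).
  apply: measurable_noise_map => p.
  by apply: (@subcylinders_coord _ _ _ _ Z J' (rshift M p.1, p.2)); rewrite /J'/= leq_addr.
have mV1 : measurable_fun setT (V : Omega -> noise_meas N).
  by apply: measurable_noise_map => p; exact: mZ.
have mV0 : measurable_fun setT (V0 : Omega -> noise_meas N).
  by apply: measurable_noise_map => p; exact: minc.
have mcol d1 (T : measurableType d1) (f : T -> noise_meas N) j i :
    measurable_fun setT f -> measurable_fun setT (fun w => noise_col (f w) j i 0 : R).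
  move=> mf; rewrite /noise_col; case: insubP => [j' _ _|_]; last first.
    by under eq_fun do rewrite mxE; exact: measurable_cst.
  apply: measurable_mulmx => k.
  rewrite [X in measurable_fun _ X](_ : _ = @noise_eval N (j', k) \o f); last first.
    by apply/funext => w; rewrite mxE.
  have h1 := @cylinders_coord R (noise_space N) _ (@noise_eval N) (j', k).
  exact: (measurableT_comp h1 mf).
have mG : measurable_fun setT G.
  apply: (measurableT_comp mh); apply: measurable_cV => i0.
  apply: (@measurable_chain _ _ b C C0 bC _ (borel R n * noise_meas N)%type dt' (fun j (q : borel R n * noise_meas N) => noise_col q.2 j) (fun q => q.1) N) => //.
    by move=> i; apply: (measurableT_comp (measurable_coord i)); exact: measurable_fst.
  by move=> j i _; apply: mcol; exact: measurable_snd.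
have G0 q : (0 <= G q)%E by exact: h0.
have JJ' p : J p -> ~~ J' p by rewrite /J /J'/= -ltnNge.
transitivity (\int[P]_w G (U w, V w))%E.
  apply: eq_integral => w _; rewrite /G/= chainD /U; congr (h _).
  by apply: (@eq_chain _ _ b _ _ _ _ _ N) => // k kN; rewrite noiseE.
rewrite (subcylinders_indep_fun mZ nuT ZE JJ' mU mV mG G0).
apply: eq_integral => w _.
(* With the first stretch frozen only the law of the second matters, and [V] and [V0] agree on
   cylinders by [gaussian_family] applied at the two starting times. *)
transitivity (\int[P]_w' G (U w, V0 w'))%E.
  apply: (@same_law_integral _ _ _ P _ (noise_meas N) (cylinders (@noise_eval N)) V V0
    (fun v => G (U w, v))) => //.
  - exact: cylinders_setI.
  - exact: cylinders_setT.
  - move=> _ [E [mE ->]].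
    have e1 : P (V @^-1` [set v | forall p, E p (noise_eval p v)]) =
        (\big[*%E/1%E]_(p : 'I_N * 'I_n) normal_prob 0 (Num.sqrt (dt' p.1)) (E p))%E.
      rewrite -(@gaussian_family N dt' (partial dt M) E)// ?partial_ge0//.
      congr (P _); apply/seteqP; split => w' /= H p; have := H p;
        by rewrite /noise_eval /V /Z /inc/= !add0r -addnS !partialD.
    by rewrite e1 -(@gaussian_family N dt' 0 E).
  - by apply: (measurableT_comp mG); exact: pair1_measurable.
by apply: eq_integral => w' _; rewrite /G/=; congr (h _);
  apply: (@eq_chain _ _ b _ _ _ _ _ N) => // k kN; rewrite noise0E.
Qed.

End ChainLaw.

(** * The transition semigroup and the Markov property *)

Section Expectation.
Context {R : realType} {d : measure_display} {T : measurableType d}.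
Variable P : probability T R.
Implicit Types (f g : T -> R).

Definition bdd f := measurable_fun setT f /\ exists M : R, forall w, `|f w| <= M.

Definition Ex f : R := fine (\int[P]_w (f w)%:E)%E.

Lemma bdd_integrable f : bdd f -> P.-integrable setT (EFin \o f).
Proof.
move=> [mf [M fM]]; apply: (@le_integrable _ _ _ P _ measurableT _ (cst M%:E)) => //.
- exact/measurable_EFinP.
- by move=> w _ /=; rewrite lee_fin (le_trans (fM w))// ler_norm.
- exact: finite_measure_integrable_cst.
Qed.

Lemma EFin_Ex f : bdd f -> ((Ex f)%:E = \int[P]_w (f w)%:E)%E.
Proof. by move=> bf; rewrite fineK//; apply: integrable_fin_num => //; exact: bdd_integrable. Qed.

Lemma bdd_cst c : bdd (fun=> c).
Proof. by split=> //; exists `|c|. Qed.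

Lemma bddD f g : bdd f -> bdd g -> bdd (fun w => f w + g w).
Proof.
move=> [mf [M fM]] [mg [N gN]]; split; first exact: measurable_funD.
by exists (M + N) => w; rewrite (le_trans (ler_normD _ _))// lerD.
Qed.

Lemma bddZ c f : bdd f -> bdd (fun w => c * f w).
Proof.
move=> [mf [M fM]]; split; first exact: measurable_funM.
by exists (`|c| * M) => w; rewrite normrM ler_wpM2l.
Qed.

Lemma bdd_sum (I : Type) (s : seq I) (F : I -> T -> R) :
  (forall i, bdd (F i)) -> bdd (fun w => \sum_(i <- s) F i w).
Proof.
move=> bF; elim: s => [|i s ih].
  by under eq_fun do rewrite big_nil; exact: bdd_cst.
by under eq_fun do rewrite big_cons; exact: bddD.
Qed.

Lemma Ex_cst c : Ex (fun=> c) = c.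
Proof. by rewrite /Ex prob_integral_cst. Qed.

Lemma ExD f g : bdd f -> bdd g -> Ex (fun w => f w + g w) = Ex f + Ex g.
Proof.
move=> bf bg; apply: EFin_inj; rewrite EFinD !EFin_Ex//; last exact: bddD.
by rewrite -integralD//; exact: bdd_integrable.
Qed.

Lemma ExZ c f : bdd f -> Ex (fun w => c * f w) = c * Ex f.
Proof.
move=> bf; apply: EFin_inj; rewrite EFinM !EFin_Ex//; last exact: bddZ.
by rewrite -integralZl//; exact: bdd_integrable.
Qed.

Lemma Ex_sum (I : Type) (s : seq I) (F : I -> T -> R) : (forall i, bdd (F i)) ->
  Ex (fun w => \sum_(i <- s) F i w) = \sum_(i <- s) Ex (F i).
Proof.
move=> bF; elim: s => [|i s ih].
  by rewrite big_nil; under [X in Ex X]eq_fun do rewrite big_nil; exact: Ex_cst.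
rewrite big_cons -ih -ExD//; last exact: bdd_sum.
by congr Ex; apply/funext => w; rewrite big_cons.
Qed.

Lemma Ex_ge0 f : (forall w, 0 <= f w) -> 0 <= Ex f.
Proof. by move=> f0; rewrite fine_ge0//; apply: integral_ge0 => w _; rewrite lee_fin. Qed.

Lemma Ex_ext_ae f g : bdd f -> bdd g -> {ae P, forall w, f w = g w} -> Ex f = Ex g.
Proof.
move=> [mf _] [mg _] fg; congr fine; apply: ae_eq_integral => //.
- exact/measurable_EFinP.
- exact/measurable_EFinP.
- by apply: filterS fg => w -> _.
Qed.

Lemma Ex_le_ae f g : bdd f -> bdd g -> {ae P, forall w, f w <= g w} -> Ex f <= Ex g.
Proof.
move=> bf bg fg.
have bm : bdd (fun w => Num.max (f w) (g w)).
  have [[mf [M fM]] [mg [N gN]]] := (bf, bg); split; first exact: measurable_maxr.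
  exists (M + N) => w; have M0 := le_trans (normr_ge0 _) (fM w).
  have N0 := le_trans (normr_ge0 _) (gN w).
  rewrite maxEle; case: ifP => _.
    by apply: le_trans (gN w) _; rewrite lerDr.
  by apply: le_trans (fM w) _; rewrite lerDl.
rewrite (@Ex_ext_ae g (fun w => Num.max (f w) (g w)))//; last first.
  by apply: filterS fg => w h; rewrite max_r.
have bn : bdd (fun w => Num.max (f w) (g w) + -1 * f w) by apply: bddD => //; exact: bddZ.
have : 0 <= Ex (fun w => Num.max (f w) (g w) + -1 * f w).
  by apply: Ex_ge0 => w; rewrite mulN1r subr_ge0 le_max lexx.
by rewrite ExD ?ExZ// ?mulN1r ?subr_ge0//; exact: bddZ.
Qed.

Lemma Ex_le f g : bdd f -> bdd g -> (forall w, f w <= g w) -> Ex f <= Ex g.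
Proof. by move=> bf bg fg; apply: Ex_le_ae => //; exact: aeW. Qed.

Lemma Ex_norm_le f M : bdd f -> (forall w, `|f w| <= M) -> `|Ex f| <= M.
Proof.
move=> bf fM; rewrite ler_norml; apply/andP; split.
  by rewrite -[leLHS]Ex_cst; apply: Ex_le => //; [exact: bdd_cst|move=> w; have := fM w; rewrite ler_norml => /andP[]].
by rewrite -[leRHS]Ex_cst; apply: Ex_le => //; [exact: bdd_cst|move=> w; have := fM w; rewrite ler_norml => /andP[]].
Qed.

Lemma Ex_cvg (F : nat -> T -> R) f (M : R) :
  (forall k, measurable_fun setT (F k)) -> (forall k w, `|F k w| <= M) -> bdd f ->
  {ae P, forall w, (fun k => F k w) @ \oo --> f w} -> (fun k => Ex (F k)) @ \oo --> Ex f.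
Proof.
move=> mF FM bf cF; have [mf [N fN]] := bf.
apply: fine_cvg; rewrite EFin_Ex//.
have h1 k : measurable_fun setT (fun w => (F k w)%:E) by exact/measurable_EFinP.
have h2 : measurable_fun setT (fun w => (f w)%:E) by exact/measurable_EFinP.
have h3 : {ae P, forall w, setT w -> (fun k => (F k w)%:E) @ \oo --> (f w)%:E}.
  by apply: filterS cF => w h _; apply: cvg_EFin => //; exact: nearW.
have h4 : P.-integrable setT (fun=> M%:E) by exact: finite_measure_integrable_cst.
have h5 : {ae P, forall w (k : nat), setT w -> (`|(F k w)%:E| <= M%:E)%E}.
  by apply: aeW => w k _; rewrite lee_fin.
by have [_ _] := dominated_convergence measurableT h1 h2 h3 h4 h5.
Qed.

End Expectation.

Lemma seq_continuous {R : realType} {n : nat} (f : 'cV[R]_n -> R) :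
  (forall x (u : nat -> 'cV[R]_n), (fun k => `|u k - x|) @ \oo --> (0 : R) ->
     (fun k => f (u k)) @ \oo --> f x) -> continuous f.
Proof.
move=> H x; have Fx : Filter (nbhs x) by exact: nbhs_filter.
apply: (proj2 (@cvgrPdist_le _ _ _ _ Fx f (f x))) => e e0; apply: contrapT => Hn.
have {}Hn (k : nat) : exists y, `|x - y| < k.+1%:R^-1 /\ ~ `|f x - f y| <= e.
  apply: contrapT => Hk; apply: Hn; apply/nbhs_ballP; exists k.+1%:R^-1.
    by rewrite /= invr_gt0.
  move=> y; rewrite -ball_normE/= => xy.
  by apply: contrapT => fe; apply: Hk; exists y.
have [u uP] := choice Hn.
have := H x u; have u0 : (fun k => `|u k - x|) @ \oo --> (0 : R).
  apply: (@squeeze_cvgr _ _ _ _ (cst 0) (fun k => k.+1%:R^-1)).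
  - by apply: nearW => k; rewrite normr_ge0 distrC ltW// (uP k).1.
  - exact: cvg_cst.
  - exact: cvg_harmonic.
move=> /(_ u0) /cvgrPdist_le/(_ _ e0)[k _ /(_ k (leqnn k))].
exact: (uP k).2.
Qed.

Lemma continuous_vseq {R : realType} {n : nat} (f : 'cV[R]_n -> R) (u : nat -> 'cV[R]_n) x :
  continuous f -> (forall e : R, 0 < e -> \forall k \near \oo, `|u k - x| <= e) ->
  (fun k => f (u k)) @ \oo --> f x.
Proof.
move=> cf ux; apply: (@cvg_comp _ _ _ u f _ (nbhs x)); last exact: cf.
move=> A /nbhs_ballP[e /= e0 eA].
have e2 : 0 < e / 2 by rewrite divr_gt0.
apply: filterS (ux _ e2) => k h; apply: eA; rewrite -ball_normE/= distrC.
by rewrite (le_lt_trans h)// ltr_pdivrMr// ltr_pMr// ltr1n.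
Qed.

Section SolutionProcess.
Context {R : realType} {n : nat}.
Variables (B : {bilinear 'cV[R]_n -> 'cV[R]_n -> 'cV[R]_n}) (A S : 'M[R]_n).
Variables (d : measure_display) (Omega : measurableType d) (P : probability Omega R).
Variables (W : R -> Omega -> 'cV[R]_n) (X : 'cV[R]_n -> R -> Omega -> 'cV[R]_n).
Hypothesis W_bm : brownian_motion P W.
Hypothesis X_sol : forall x : 'cV[R]_n, sde_solution P B A S W x (X x).
Let b := drift B A.

Definition good z w := [/\ path_cont (fun t => X z t w), path_cont (fun t => W t w),
  path_ode b S (fun t => X z t w) (fun t => W t w), W 0 w = 0 & X z 0 w = z].

Lemma ae_good z : {ae P, forall w, good z w}.
Proof.
have [_ w0 cw _] := W_bm; have [_ xs] := X_sol z.
have [C C0 bC] := drift_quad_lip B A.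
near=> w; split.
- by apply: within_path_cont; near: w; apply: filterS xs => w [].
- by apply: within_path_cont; near: w.
- apply: (@sol_path_ode _ _ _ _ _ C z) => //.
    by apply: within_path_cont; near: w; apply: filterS xs => w [].
  by near: w; apply: filterS xs => w [].
- by near: w.
- have W0 : W 0 w = 0 by near: w.
  have -> : X z 0 w = z + \col_i (\int[lebesgue_measure]_(s in `[0, 0]) drift B A (X z s w) i 0)%R
        + S *m W 0 w by near: w; apply: filterS xs => w [_]; apply.
  rewrite W0 mulmx0 addr0; apply/matrixP => i j; rewrite ord1 mxE [in X in _ + X]mxE.
  by rewrite set_itv1 Rintegral_set1 addr0.
Unshelve. all: by end_near.
Qed.

Lemma mX z t : 0 <= t -> measurable_fun setT (X z t : Omega -> borel R n).
Proof. by move=> t0; have [mx _] := X_sol z; exact: mx. Qed.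

Lemma mX_comp z t (f : 'cV[R]_n -> R) : 0 <= t -> continuous f ->
  measurable_fun setT (fun w => f (X z t w)).
Proof.
by move=> t0 cf; apply: (measurableT_comp (continuous_borel cf)); exact: mX.
Qed.

Definition bc (f : 'cV[R]_n -> R) := continuous f /\ exists M : R, forall x, `|f x| <= M.

Lemma bdd_X z t f : 0 <= t -> bc f -> bdd (fun w => f (X z t w)).
Proof. by move=> t0 [cf [M fM]]; split; [exact: mX_comp|exists M]. Qed.

Definition Tr t f z : R := Ex P (fun w => f (X z t w)).

Lemma Tr0 f z : bc f -> Tr 0 f z = f z.
Proof.
move=> bf; rewrite -[RHS](Ex_cst P); apply: Ex_ext_ae.
- exact: bdd_X.
- exact: bdd_cst.
- by apply: filterS (ae_good z) => w [_ _ _ _ ->].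
Qed.

(** The Feller property: pathwise continuity in the initial point and dominated convergence.
    Continuity is tested along sequences, because the exceptional null set depends on the initial
    point and only countably many of them can be discarded together. *)
Lemma Tr_bc t f : 0 <= t -> bc f -> bc (Tr t f).
Proof.
move=> t0 bf; have [cf [M fM]] := bf; split; last first.
  exists M => x; apply: Ex_norm_le => //; exact: bdd_X.
have [tp|t00] := ltP 0 t; last first.
  have -> : t = 0 by apply/eqP; rewrite eq_le t0 t00.
  by rewrite (_ : Tr 0 f = f)//; apply/funext => z; exact: Tr0.
apply: seq_continuous => z u uz.
apply: (@Ex_cvg _ _ _ P (fun k w => f (X (u k) t w)) _ M).
- by move=> k; exact: mX_comp.
- by move=> k w.
- exact: bdd_X.
have gk : {ae P, forall w, forall k, good (u k) w} by apply: ae_foralln => k; exact: ae_good.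
apply: filterS2 (ae_good z) gk => w [xc wc xo w0 x0] gu.
have [C C0 bC] := drift_quad_lip B A.
have [M1 M10 xM] := path_bounded t xc.
apply: continuous_vseq => // e e0.
have [h h0 H] := @paths_close _ _ b C C0 bC S t M1 e tp M10 e0.
move/cvgrPdist_le/(_ _ h0) : uz; apply: filterS => k.
rewrite sub0r normrN normr_id => uh.
have [_ _ xuo _ xu0] := gu k.
by rewrite distrC; apply: (H _ _ _ xo xuo xM); rewrite x0 xu0 distrC.
Qed.

Lemma Tr_time f z (t : nat -> R) (s : R) : bc f -> (forall k, 0 <= t k) -> 0 <= s -> t @ \oo --> s ->
  (fun k => Tr (t k) f z) @ \oo --> Tr s f z.
Proof.
move=> bf t0 s0 ts; have [cf [M fM]] := bf.
apply: (@Ex_cvg _ _ _ P (fun k w => f (X z (t k) w)) _ M).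
- by move=> k; exact: mX_comp.
- by move=> k w.
- exact: bdd_X.
apply: filterS (ae_good z) => w [xc _ _ _ _].
have H : (fun k => X z (t k) w) @ \oo --> X z s w.
  exact: (@path_cont_cvg _ _ (fun r => X z r w) t s \oo _ xc s0 t0 ts).
by apply: continuous_vseq => // e e0; move/cvgrPdist_le/(_ _ e0) : H; apply: filterS => k; rewrite distrC.
Qed.

Lemma mesh_full (t : R) N : N.+1%:R * (t / N.+1%:R) = t.
Proof. by rewrite mulrCA divff ?mulr1// pnatr_eq0. Qed.

Definition euler (h : R) (z : 'cV[R]_n) (N : nat) (w : Omega) :=
  chain b (fun=> h) (grid_noise S (fun t => W t w) h) z N.

Lemma euler_cvg z (u : nat -> 'cV[R]_n) t w : 0 < t -> good z w ->
  u @ \oo --> z -> (fun N => euler (t / N.+1%:R) (u N.+1) N.+1 w) @ \oo --> X z t w.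
Proof.
move=> t0 [xc wc xo w0 x0] uz.
have [C C0 bC] := drift_quad_lip B A.
have [M M0 xM] := path_bounded t xc.
apply/cvgrPdist_le => e e0.
have uz' : u @ \oo --> X z 0 w by rewrite x0.
have [N0 HN] := @chain_cvg _ _ b C C0 bC S _ _ u t M e t0 M0 e0 xo xM uz'.
exists N0 => // N /= N0N; rewrite distrC.
have := HN N.+1 N0N N.+1 (leqnn _).
by rewrite mesh_full.
Qed.

Lemma cvg_vseq (u : nat -> 'cV[R]_n) (z : 'cV[R]_n) (e : R) : u @ \oo --> z -> 0 < e ->
  \forall k \near \oo, `|u k - z| <= e.
Proof. by move=> /cvgrPdist_le H e0; apply: filterS (H e e0) => k; rewrite distrC. Qed.

Section Markov.
Variables (s t : R).
Hypothesis s0 : 0 < s.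
Hypothesis t0 : 0 < t.
Let dt N j : R := if (j < N.+1)%N then s / N.+1%:R else t / N.+1%:R.

Let dt_gt0 N j : 0 < dt N j.
Proof. by rewrite /dt; case: ifP => _; rewrite divr_gt0. Qed.

Let dtD N : (fun j => dt N (N.+1 + j)%N) = (fun=> t / N.+1%:R).
Proof. by apply/funext => j; rewrite /dt ltnNge leq_addr. Qed.

Let partial_lo N j : (j <= N.+1)%N -> partial (dt N) j = j%:R * (s / N.+1%:R).
Proof.
elim: j => [|j ih] jN; first by rewrite /partial big_ord0 mul0r.
by rewrite partialS ih ?(ltnW jN)// /dt jN -(natr1 j) mulrDl mul1r.
Qed.

Let partial_mid N : partial (dt N) N.+1 = s.
Proof. by rewrite partial_lo// mesh_full. Qed.

Let partial_hi N j : partial (dt N) (N.+1 + j) = s + j%:R * (t / N.+1%:R).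
Proof. by rewrite partialD partial_mid dtD partial_cst. Qed.

Let lo N w z : chain b (dt N) (fun j => noise S W 0 (dt N) j w) z N.+1 = euler (s / N.+1%:R) z N.+1 w.
Proof.
apply: (@eq_chain _ _ b _ _ _ _ _ N.+1) => // k kN; first by rewrite /dt kN.
by rewrite /noise /grid_noise !add0r !partial_lo// ltnW.
Qed.

Let cst_noise h w : (fun j => noise S W 0 (fun=> h) j w) = grid_noise S (fun u => W u w) h.
Proof. by apply/funext => j; rewrite /noise /grid_noise !add0r !partial_cst. Qed.

Let hi N w z : chain b (dt N) (fun j => noise S W 0 (dt N) j w) z (N.+1 + N.+1) =
  chain b (fun=> t / N.+1%:R) (grid_noise S (fun u => W (s + u) w) (t / N.+1%:R))
    (euler (s / N.+1%:R) z N.+1 w) N.+1.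
Proof.
rewrite chainD lo dtD; congr (chain _ _ _ _ _); apply/funext => j.
by rewrite /noise /grid_noise !add0r -addnS !partial_hi.
Qed.

Lemma measurable_euler (h : R) N d1 (T : measurableType d1) (u : T -> 'cV[R]_n) (g : T -> Omega) :
  0 <= h -> (forall i, measurable_fun setT (fun q => u q i 0 : R)) -> measurable_fun setT g ->
  forall i, measurable_fun setT (fun q => euler h (u q) N (g q) i 0 : R).
Proof.
move=> h0 mu mg i; have [C C0 bC] := drift_quad_lip B A; have [mW _ _ _] := W_bm.
apply: (@measurable_chain _ _ b C C0 bC _ T (fun=> h)
  (fun j q => grid_noise S (fun u => W u (g q)) h j) u N) => // j k _.
apply: measurable_mulmx => l.
have := @measurable_increment _ _ _ _ _ mW (j%:R * h) (j.+1%:R * h) l.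
by move=> /(_ (mulr_ge0 (ler0n _ _) h0) (mulr_ge0 (ler0n _ _) h0)) m1; exact: (measurableT_comp m1 mg).
Qed.

(** The identity of [chain_split] is passed to the limit on both sides. In the inner integral [w] is
    fixed, so the null set attached to the starting point [X z s w] is harmless; joint measurability
    in [(w, w')] is that of the chain. Nonnegativity of [f] is what Tonelli's theorem asks for. *)
Lemma markov f z : bc f -> (forall x, 0 <= f x) -> Tr (s + t) f z = Tr s (Tr t f) z.
Proof.
move=> bf f0; have [cf [M fM]] := bf; have [mW _ _ gW] := W_bm.
have [C C0 bC] := drift_quad_lip B A.
have st0 : 0 <= s + t by rewrite addr_ge0// ltW.
pose Y N w := euler (s / N.+1%:R) z N.+1 w.
pose F N w := f (chain b (dt N) (fun j => noise S W 0 (dt N) j w) z (N.+1 + N.+1)).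
pose G N w := Ex P (fun w' => f (euler (t / N.+1%:R) (Y N w) N.+1 w')).
have sN N : 0 <= s / N.+1%:R by rewrite divr_ge0// ltW.
have tN N : 0 <= t / N.+1%:R by rewrite divr_ge0// ltW.
have mF N : measurable_fun setT (F N).
  apply: measurable_comp_continuous => // i.
  apply: (@measurable_chain _ _ b C C0 bC _ Omega (dt N) (noise S W 0 (dt N)) (cst z) (N.+1 + N.+1)) => // j k _.
  apply: measurable_mulmx => l; apply: measurable_increment => //; rewrite add0r partial_ge0//.
have mf2 N : measurable_fun setT (fun q : Omega * Omega => f (euler (t / N.+1%:R) (Y N q.1) N.+1 q.2)).
  apply: measurable_comp_continuous => // i; apply: measurable_euler => // j.
  by apply: (@measurable_euler _ _ _ _ (cst z) fst).
have bG1 N w : bdd (fun w' => f (euler (t / N.+1%:R) (Y N w) N.+1 w')).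
  split; last by exists M.
  by apply: measurable_comp_continuous => // i; exact: (@measurable_euler _ _ _ _ (cst (Y N w)) id).
have mG N : measurable_fun setT (G N).
  apply: (@measurableT_comp _ _ _ _ _ _ (@fine R)); first exact: fine_measurable.
  have mf2' := proj2 (measurable_EFinP _ _) (mf2 N).
  exact: (@measurable_fun_fubini_tonelli_F _ _ _ _ _ P _ mf2' (fun q => f0 _)).
have FG N : Ex P (F N) = Ex P (G N).
  rewrite /Ex; congr fine.
  have mh : measurable_fun setT ((fun x => (f x)%:E) : borel R n -> \bar R).
    by apply/measurable_EFinP; exact: continuous_borel.
  have h0 (x : 'cV[R]_n) : (0 <= (f x)%:E)%E by rewrite lee_fin.
  have := @chain_split _ _ _ _ P b C S C0 bC W mW gW (dt N) N.+1 N.+1 z _ (dt_gt0 N) mh h0.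
  rewrite /F => ->; apply: eq_integral => w _.
  rewrite /G (EFin_Ex P (bG1 N w)); apply: eq_integral => w' _.
  by rewrite lo dtD cst_noise.
have cF : (fun N => Ex P (F N)) @ \oo --> Tr (s + t) f z.
  apply: (@Ex_cvg _ _ _ P F _ M) => //.
  - by move=> k w; exact: fM.
  - exact: bdd_X.
  apply: filterS (ae_good z) => w gw; have [xc wc xo w0 x0] := gw.
  apply: continuous_vseq => // e e0.
  have Ycv : (fun N => Y N w) @ \oo --> X z (s + 0) w.
    rewrite addr0; apply: (@euler_cvg z (fun=> z) s w s0 gw); exact: cvg_cst.
  pose u N := if N is N'.+1 then Y N' w else z.
  have uc : u @ \oo --> X z (s + 0) w.
    by rewrite -(cvg_shiftS u).
  (* After the first [N.+1] steps the chain follows the path shifted by [s], from starting points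
     that converge to the value of the path at time [s]. *)
  have xo' := path_ode_shift (ltW s0) xo.
  have [M1 M10 xM] := path_bounded (s + t) xc.
  have xM' (r : R) : 0 <= r <= t -> `|X z (s + r) w| <= M1.
    by move=> /andP[r0 rt]; apply: xM; rewrite addr_ge0 ?(ltW s0)//= lerD2l.
  have [N0 HN] := @chain_cvg _ _ b C C0 bC S _ _ u t M1 e t0 M10 e0 xo' xM' uc.
  exists N0 => // N N0N'; have N0N : (N0 <= N)%N := N0N'.
  rewrite (hi N w z); have := HN N.+1 N0N N.+1 (leqnn _).
  by rewrite mesh_full.
have cG : (fun N => Ex P (G N)) @ \oo --> Tr s (Tr t f) z.
  apply: (@Ex_cvg _ _ _ P G _ M) => //.
  - by move=> k w; exact: Ex_norm_le.
  - by apply: bdd_X; [exact: ltW|apply: Tr_bc => //; exact: ltW].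
  apply: filterS (ae_good z) => w gw.
  apply: (@Ex_cvg _ _ _ P (fun N w' => f (euler (t / N.+1%:R) (Y N w) N.+1 w')) _ M) => //.
  - by move=> k; have [] := bG1 k w.
  - by apply: bdd_X => //; exact: ltW.
  apply: filterS (ae_good (X z s w)) => w' gw'.
  have Ycv : (fun N => Y N w) @ \oo --> X z s w.
    by apply: (@euler_cvg z (fun=> z) s w s0 gw); exact: cvg_cst.
  pose u N := if N is N'.+1 then Y N' w else z.
  have uc : u @ \oo --> X z s w by rewrite -(cvg_shiftS u).
  have H := euler_cvg t0 gw' uc.
  by apply: continuous_vseq => // e e0; exact: cvg_vseq.
have FG' : (fun N => Ex P (F N)) = (fun N => Ex P (G N)) by apply/funext.
rewrite FG' in cF.
by rewrite -(cvg_lim _ cF)// -(cvg_lim _ cG).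
Qed.

End Markov.

End SolutionProcess.

(** * Energy estimates *)

Section IncrementMoments.
Context {R : realType} {n : nat}.
Variables (d : measure_display) (Omega : measurableType d) (P : probability Omega R).
Variable W : R -> Omega -> 'cV[R]_n.
Hypothesis mW : measurable_process W.
Hypothesis gW : gaussian_increments P W.
Variable h : R.
Hypothesis h0 : 0 < h.

Definition incr (i : 'I_n) (w : Omega) : R := (W h w - W 0 w) i 0.

Lemma measurable_incr i : measurable_fun setT (incr i).
Proof. by apply: measurable_increment => //; exact: ltW. Qed.

Lemma incr_law i E : measurable E -> P (incr i @^-1` E) = normal_prob 0 (Num.sqrt h) E.
Proof.
move=> mE.
pose Z (p : 'I_1 * 'I_n) w : R :=
  (W (0 + partial (fun=> h) p.1.+1) w - W (0 + partial (fun=> h) p.1) w) p.2 0.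
have ZE (F : 'I_1 * 'I_n -> set R) : (forall p, measurable (F p)) ->
    P [set w | forall p, F p (Z p w)] = (\big[*%E/1%E]_p normal_prob 0 (Num.sqrt h) (F p))%E.
  by move=> mF; exact: (@gaussian_family _ _ _ _ P W gW 1 (fun=> h) 0 F (lexx 0) (fun=> h0) mF).
rewrite -(@gaussian_family_coord _ _ _ P _ Z h ZE (ord0, i) E mE).
have -> : incr i = Z (ord0, i); last by [].
by apply/funext => w; rewrite /Z /incr !add0r !partial_cst/= mul0r mul1r.
Qed.

Lemma incr_integrable i k : (k <= 4)%N -> P.-integrable setT (fun w => (incr i w ^+ k)%:E).
Proof.
by apply: (gaussian_integrable h0) => [|E]; [exact: measurable_incr|exact: incr_law].
Qed.

Let F (a g c : R) i w := a * incr i w + (g * incr i w ^+ 4 + c).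

Let FE a g c i w : ((F a g c i w)%:E = a%:E * (incr i w)%:E + (g%:E * (incr i w ^+ 4)%:E + c%:E))%E.
Proof. by rewrite /F -!EFinM -!EFinD. Qed.

Let F_integrable a g c i : P.-integrable setT (fun w => (F a g c i w)%:E).
Proof.
under eq_fun do rewrite FE.
apply: integrableD => //; first by apply: integrableZl => //; exact: (@incr_integrable i 1%N).
apply: integrableD => //; first by apply: integrableZl => //; exact: incr_integrable.
exact: finite_measure_integrable_cst.
Qed.

Let F_integral a g c i : 0 <= g ->
  (\int[P]_w (F a g c i w)%:E <= (g * (128 * h ^+ 2) + c)%:E)%E.
Proof.
move=> g0; under eq_integral do rewrite FE.
have i1 : P.-integrable setT (fun w => (incr i w)%:E) by exact: (@incr_integrable i 1%N).
have i4 : P.-integrable setT (fun w => (incr i w ^+ 4)%:E) by exact: incr_integrable.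
have ic : P.-integrable setT (fun=> c%:E) by exact: finite_measure_integrable_cst.
rewrite integralD//; last 2 first.
- exact: integrableZl.
- by apply: integrableD => //; exact: integrableZl.
rewrite integralD//; last exact: integrableZl.
rewrite !integralZl// prob_integral_cst.
rewrite (gaussian_mean h0 (measurable_incr i)); last by move=> E; exact: incr_law.
rewrite mule0 add0e EFinD EFinM leeD2r// lee_wpmul2l ?lee_fin//.
by apply: (gaussian_moment4 h0 (measurable_incr i)) => E; exact: incr_law.
Qed.

Lemma incr_bound (f : Omega -> R) (c0 : R) (a : 'I_n -> R) (be g : R) :
  measurable_fun setT f -> (forall w, 0 <= f w) -> 0 <= be -> 0 <= g ->
  (forall w, f w <= c0 + \sum_i (a i * incr i w + be * incr i w ^+ 2 + g * incr i w ^+ 4)) ->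
  (\int[P]_w (f w)%:E <= (c0 + n%:R * (129 * be * h + 128 * g * h ^+ 2))%:E)%E.
Proof.
move=> mf f0 be0 g0 fle.
(* [be x^2 <= (be / h) x^4 + be h] trades the second moment for the fourth one, so that only the
   mean and the fourth moment of an increment enter. *)
pose G i := F (a i) (be / h + g) (be * h) i.
have sumG (s : seq 'I_n) : P.-integrable setT (fun w => (c0 + \sum_(i <- s) G i w)%:E) /\
    (\int[P]_w (c0 + \sum_(i <- s) G i w)%:E <=
     (c0 + (size s)%:R * (129 * be * h + 128 * g * h ^+ 2))%:E)%E.
  elim: s => [|i s [ih1 ih2]].
    have -> : (fun w => (c0 + \sum_(j <- [::]) G j w)%:E) = (fun=> c0%:E).
      by apply/funext => w; rewrite big_nil addr0.
    rewrite prob_integral_cst mul0r addr0; split => //; exact: finite_measure_integrable_cst.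
  have -> : (fun w => (c0 + \sum_(j <- i :: s) G j w)%:E) = (fun w => (G i w)%:E + (c0 + \sum_(j <- s) G j w)%:E)%E.
    by apply/funext => w; rewrite big_cons -EFinD; congr EFin; ring.
  split; first by apply: integrableD => //; exact: F_integrable.
  rewrite integralD//; last exact: F_integrable.
  apply: le_trans (leeD (F_integral _ _ _ _) ih2) _.
    by rewrite addr_ge0// divr_ge0// ltW.
  rewrite -EFinD lee_fin le_eqVlt; apply/orP; left; apply/eqP => /=.
  by rewrite -(natr1 (size s)); field; rewrite gt_eqF.
have [iG leG] := sumG (index_enum 'I_n).
rewrite -[X in (c0 + X%:R * _)%:E]card_ord cardE enumT.
apply: le_trans leG; apply: ge0_le_integral => //.
- by move=> w _; rewrite lee_fin.
- exact/measurable_EFinP.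
- exact: measurable_int iG.
- move=> w _; rewrite lee_fin (le_trans (fle w))// lerD2l; apply: ler_sum => i _.
  rewrite /G /F -subr_ge0.
  rewrite (_ : _ - _ = be / h * (incr i w ^+ 4 - h * incr i w ^+ 2 + h ^+ 2)); last first.
    by field; rewrite gt_eqF.
  rewrite mulr_ge0 ?divr_ge0 ?(ltW h0)//.
  rewrite (_ : _ + _ = (incr i w ^+ 2 - h / 2) ^+ 2 + 3 / 4 * h ^+ 2); last by field.
  by rewrite addr_ge0 ?sqr_ge0// mulr_ge0 ?sqr_ge0//; lra.
Qed.

End IncrementMoments.

Section Truncation.
Context {R : realType} {d : measure_display} {T : measurableType d}.
Variable P : probability T R.

Lemma bdd_min (f : T -> R) (K : R) : measurable_fun setT f -> (forall w, 0 <= f w) -> 0 <= K ->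
  bdd (fun w => Num.min (f w) K).
Proof.
move=> mf f0 K0; split; first exact: measurable_minr.
by exists K => w; rewrite ger0_norm ?ge_min ?lexx ?orbT// le_min f0.
Qed.

Lemma trunc_le (f : T -> R) (l : R) : measurable_fun setT f -> (forall w, 0 <= f w) ->
  (forall K : nat, Ex P (fun w => Num.min (f w) K%:R) <= l) -> (\int[P]_w (f w)%:E <= l%:E)%E.
Proof.
move=> mf f0 H.
pose g (K : nat) w := (Num.min (f w) K%:R)%:E.
have bg (K : nat) : bdd (fun w => Num.min (f w) K%:R) by exact: bdd_min.
have mg K : measurable_fun setT (g K).
  by have [h _] := bg K; exact/measurable_EFinP.
have g0 K w : setT w -> (0 <= g K w)%E by move=> _; rewrite lee_fin le_min f0 ler0n.
have ndg w : setT w -> {homo g ^~ w : m k / (m <= k)%N >-> (m <= k)%E}.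
  by move=> _ m k mk; rewrite lee_fin le_min ge_min lexx/= ge_min ler_nat mk orbT.
have cv := cvg_monotone_convergence measurableT mg g0 ndg.
have limg w : limn (g ^~ w) = (f w)%:E.
  apply: cvg_lim => //; apply: cvg_near_cst.
  exists (Num.truncn (f w)).+1 => // k /= fk; congr EFin; apply/min_idPl.
  by rewrite (le_trans (ltW (truncnS_gt _)))// ler_nat.
rewrite (eq_integral (fun w => limn (g ^~ w))); last by move=> w _; rewrite limg.
rewrite -(cvg_lim _ (cv P))//; apply: lime_le; first exact: cvgP (cv P).
by apply: nearW => K; rewrite -(EFin_Ex P (bg K)) lee_fin.
Qed.

Lemma fatou_le (F : nat -> T -> R) (f : T -> R) (c : nat -> R) (l : R) :
  (forall k, measurable_fun setT (F k)) -> (forall k w, 0 <= F k w) ->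
  measurable_fun setT f -> (forall w, 0 <= f w) ->
  {ae P, forall w, (fun k => F k w) @ \oo --> f w} ->
  (forall k, (\int[P]_w (F k w)%:E <= (c k)%:E)%E) -> c @ \oo --> l ->
  (\int[P]_w (f w)%:E <= l%:E)%E.
Proof.
move=> mF F0 mf f0 cF Fc cl; apply: trunc_le => // K.
have H : (fun k => Ex P (fun w => Num.min (F k w) K%:R)) @ \oo --> Ex P (fun w => Num.min (f w) K%:R).
  apply: (@Ex_cvg _ _ _ P (fun k w => Num.min (F k w) K%:R) _ K%:R).
  - by move=> k; exact: measurable_minr.
  - by move=> k w; rewrite ger0_norm ?ge_min ?lexx ?orbT// le_min F0/=.
  - exact: bdd_min.
  - apply: filterS cF => w cw.
    under eq_fun do rewrite minr_absE; rewrite minr_absE.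
    apply: cvgMl; apply: cvgB; first by apply: cvgD => //; exact: cvg_cst.
    by apply: cvg_norm; apply: cvgB => //; exact: cvg_cst.
rewrite -(cvg_lim _ H)// -(cvg_lim _ cl)//; apply: ler_lim.
- exact: cvgP H.
- exact: cvgP cl.
apply: nearW => k; rewrite -lee_fin EFin_Ex//; last exact: bdd_min.
apply: le_trans (Fc k); apply: ge0_le_integral => //.
- by move=> w _; rewrite lee_fin le_min F0/=.
- by apply/measurable_EFinP; exact: measurable_minr.
- exact/measurable_EFinP.
- by move=> w _; rewrite lee_fin ge_min lexx.
Qed.

Lemma EFin_integralD (f g : T -> R) : measurable_fun setT f -> (forall w, 0 <= f w) ->
  measurable_fun setT g -> (forall w, 0 <= g w) ->
  (\int[P]_w ((f w)%:E + (g w)%:E) = \int[P]_w (f w)%:E + \int[P]_w (g w)%:E)%E.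
Proof.
move=> mf f0 mg g0; rewrite ge0_integralD//.
- by move=> w _; rewrite lee_fin.
- exact/measurable_EFinP.
- by move=> w _; rewrite lee_fin.
- exact/measurable_EFinP.
Qed.

Lemma EFin_integralZ (c : R) (f : T -> R) : measurable_fun setT f -> (forall w, 0 <= f w) ->
  0 <= c -> (\int[P]_w (c * f w)%:E = c%:E * \int[P]_w (f w)%:E)%E.
Proof.
move=> mf f0 c0; under eq_integral do rewrite EFinM; rewrite ge0_integralZl//.
- exact/measurable_EFinP.
- by move=> w _; rewrite lee_fin.
Qed.

End Truncation.

Section Energy.
Context {R : realType} {n : nat}.
Variables (B : {bilinear 'cV[R]_n -> 'cV[R]_n -> 'cV[R]_n}) (A S : 'M[R]_n).
Variables (d : measure_display) (Omega : measurableType d) (P : probability Omega R).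
Variables (W : R -> Omega -> 'cV[R]_n) (X : 'cV[R]_n -> R -> Omega -> 'cV[R]_n).
Hypothesis W_bm : brownian_motion P W.
Hypothesis X_sol : forall x : 'cV[R]_n, sde_solution P B A S W x (X x).
Hypothesis B_cons : forall x : 'cV[R]_n, dot x (B x x) = 0.
Hypothesis A_ge0 : forall x : 'cV[R]_n, 0 <= dot x (A *m x).
Let b := drift B A.

(** Conservation cancels the first-order contribution of [B], and taming bounds the second-order one
    by a multiple of [h] uniformly in [z]. What remains at first order is twice the dissipation, the
    quantity [e], whose square is also of order [h] thanks to taming. *)
Lemma drift_step : exists2 K : R, 0 <= K & forall (h : R) (z : 'cV[R]_n), 0 < h <= 1 ->
  let u := z + h *: tamed b h z in
  dot u u <= dot z z + K * h /\
  dot u u ^+ 2 + 4 * h * (tame h z * (dot z z * dot z (A *m z))) <=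
    dot z z ^+ 2 + K * h * (dot z z + 1).
Proof.
have [C C0 bC] := drift_quad_lip B A.
pose a : R := n%:R * (n%:R * `|A|).
have a0 : 0 <= a by rewrite !mulr_ge0.
pose K : R := 4 * (n%:R * C ^+ 2).
have K0 : 0 <= K by rewrite !mulr_ge0 ?sqr_ge0.
have ex (h : R) (z : 'cV[R]_n) : 0 < h <= 1 -> let u := z + h *: tamed b h z in
    exists e : R, [/\ e = 2 * h * (tame h z * dot z (A *m z)), 0 <= e, e ^+ 2 <= 4 * a ^+ 2 * h,
       dot u u <= dot z z - e + K * h & 0 <= dot u u].
  move=> /andP[hp h1] u.
  exists (2 * h * (tame h z * dot z (A *m z))).
  have tp := tame_gt0 h z; have t1 := tame_le1 h z.
  have p0 := dot_ge0 z; have e0 := A_ge0 z.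
  (* With [q] the square root of [h], taming reads [tame * (1 + q |z|^2) = 1]; every factor [|z|^2]
     is paid by one [q]. *)
  have [q [q0 q1 qh]] : exists q : R, [/\ 0 <= q, q <= 1 & h = q ^+ 2].
    exists (Num.sqrt h); rewrite sqrtr_ge0 sqr_sqrtr ?(ltW hp)//; split => //.
    by rewrite -sqrtr1 ler_wsqrtr.
  have tq : tame h z * (1 + q * dot z z) = 1.
    rewrite /tame qh sqrtr_sqr ger0_norm// mulVf// gt_eqF//.
    by rewrite ltr_pwDl// mulr_ge0.
  have dA : dot z (A *m z) <= a * dot z z.
    apply: le_trans (ler_norm _) _; apply: le_trans (norm_dot_le _ _) _.
    apply: (@le_trans _ _ (n%:R * `|z| * (n%:R * `|A| * `|z|))).
      by rewrite ler_wpM2l ?mulr_ge0// norm_mulmx.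
    have -> : n%:R * `|z| * (n%:R * `|A| * `|z|) = a * `|z| ^+ 2 by rewrite /a; ring.
    by rewrite ler_wpM2l// le_norm_dot.
  have db : dot (b z) (b z) <= n%:R * C ^+ 2 * (2 * (1 + dot z z) * dot z z).
    apply: le_trans (dot_norm_le _) _.
    have z0 := normr_ge0 z; have zp := le_norm_dot z.
    have bz : `|b z| ^+ 2 <= (C * (1 + `|z|) * `|z|) ^+ 2.
      rewrite lerXn2r ?nnegrE// ?mulr_ge0// ?addr_ge0//; exact: (quad_lip_le _ bC).
    have c2 : 0 <= C ^+ 2 by rewrite sqr_ge0.
    have zz : ((1 + `|z|) * `|z|) ^+ 2 <= 2 * (1 + dot z z) * dot z z.
      rewrite exprMn; apply: ler_pM; rewrite ?sqr_ge0//.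
      have := sqr_ge0 (1 - `|z|); move: zp; rewrite expr2; nra.
    rewrite -[leRHS]mulrA ler_wpM2l// (le_trans bz)// -mulrA exprMn.
    by rewrite ler_wpM2l.
  have tqp : tame h z * q * dot z z <= 1 by nra.
  have tqp0 : 0 <= tame h z * q * dot z z by rewrite !mulr_ge0// ltW.
  split=> //.
  - by rewrite !mulr_ge0// ltW.
  - apply: (@le_trans _ _ ((2 * h * (tame h z * (a * dot z z))) ^+ 2)).
      rewrite ler_pXn2r ?nnegrE ?mulr_ge0 ?(ltW hp) ?(ltW tp)//.
      by rewrite ler_wpM2l ?mulr_ge0 ?(ltW hp)// ler_wpM2l ?(ltW tp).
    rewrite (_ : _ ^+ 2 = 4 * a ^+ 2 * h * (tame h z * q * dot z z) ^+ 2); last by rewrite qh; ring.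
    rewrite -[leRHS]mulr1 ler_wpM2l ?mulr_ge0 ?sqr_ge0 ?(ltW hp)//.
    by rewrite expr_le1.
  - rewrite /u dot_sqrD dotZr dotZl dotZr /tamed dotZr dotZl dotZr.
    rewrite [dot z (b z)]dotBr B_cons sub0r.
    have : h * (h * (tame h z * (tame h z * dot (b z) (b z)))) <= K * h.
      apply: (@le_trans _ _ (h * (h * (tame h z * (tame h z * (n%:R * C ^+ 2 * (2 * (1 + dot z z) * dot z z))))))).
        by rewrite ler_wpM2l ?(ltW hp)// ler_wpM2l ?(ltW hp)// ler_wpM2l ?(ltW tp)// ler_wpM2l ?(ltW tp).
      have -> : h * (h * (tame h z * (tame h z * (n%:R * C ^+ 2 * (2 * (1 + dot z z) * dot z z))))) =
         h * (n%:R * C ^+ 2) * (2 * (tame h z * q * (tame h z * q * dot z z)) +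
         2 * (tame h z * q * dot z z) ^+ 2) by rewrite {2}qh; ring.
      have -> : K * h = h * (n%:R * C ^+ 2) * 4 by rewrite /K; ring.
      have c2 : 0 <= C ^+ 2 by rewrite sqr_ge0.
      rewrite ler_wpM2l ?mulr_ge0 ?(ltW hp)//.
      have tq1 : tame h z * q <= 1 by nra.
      have tq0 : 0 <= tame h z * q by rewrite mulr_ge0// ltW.
      by nra.
    move: (dot z (A *m z)) (tame h z) (dot (b z) (b z)) (dot z z) => x1 x2 x3 x4; lra.
  - exact: dot_ge0.
exists (K + 4 * a ^+ 2 + 2 * K + K ^+ 2); first by rewrite !addr_ge0 ?mulr_ge0 ?sqr_ge0.
move=> h z h01 u; have [e [eE e0 e2 ue u0]] := ex h z h01; have /andP[hp h1] := h01.
have p0 := dot_ge0 z.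
have a2 : 0 <= a ^+ 2 by rewrite sqr_ge0.
have K2 : 0 <= K ^+ 2 by rewrite sqr_ge0.
split.
  have : K * h <= (K + 4 * a ^+ 2 + 2 * K + K ^+ 2) * h by rewrite ler_wpM2r ?(ltW hp)//; lra.
  by lra.
have -> : 4 * h * (tame h z * (dot z z * dot z (A *m z))) = 2 * dot z z * e by rewrite eE; ring.
apply: (@le_trans _ _ ((dot z z - e + K * h) ^+ 2 + 2 * dot z z * e)).
  by rewrite lerD2r ler_pXn2r// nnegrE// (le_trans u0).
move: e2 e0 p0 hp h1 a2 K2 K0; clearbody K.
move: (dot z z) (a ^+ 2) => p a2 e2 e0 p0 hp h1 a20 K2 K0.
have h2 : h ^+ 2 <= h by rewrite expr2 -[leRHS]mulr1 ler_wpM2l// ltW.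
have m1 : K ^+ 2 * h ^+ 2 <= K ^+ 2 * h by rewrite ler_wpM2l.
have m2 : 0 <= K * h * e by rewrite !mulr_ge0// ltW.
have m3 : 0 <= K * h * p by rewrite !mulr_ge0// ltW.
have m4 : 0 <= a2 * h * p by rewrite !mulr_ge0// ltW.
have m5 : 0 <= K ^+ 2 * h * p by rewrite !mulr_ge0// ltW.
have m6 : 0 <= K * h by rewrite !mulr_ge0// ltW.
rewrite -subr_ge0 (_ : _ - _ = (4 * a2 * h - e ^+ 2) + (K ^+ 2 * h - K ^+ 2 * h ^+ 2) +
  2 * (K * h * e) + K * h * p + 4 * (a2 * h * p) + K ^+ 2 * h * p + 3 * (K * h)); last by ring.
by lra.
Qed.

Lemma noise_step : exists2 K : R, 0 <= K & forall (h : R) (u : 'cV[R]_n), 0 < h <= 1 ->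
  let Y w := u + S *m (W h w - W 0 w) in
  (\int[P]_w (dot (Y w) (Y w))%:E <= (dot u u + K * h)%:E)%E /\
  (\int[P]_w (dot (Y w) (Y w) ^+ 2)%:E <= (dot u u ^+ 2 + K * h * (dot u u + 1))%:E)%E.
Proof.
have [mW _ _ gW] := W_bm.
pose k1 : R := n%:R * (n%:R * `|S|) ^+ 2.
have k10 : 0 <= k1 by rewrite mulr_ge0// sqr_ge0.
(* In the square of [p + 2 b + c], with [p = |u|^2], [b = u . xi] and [c = |xi|^2], the mixed term
   [4 b c] is split into [2 b^2 + 2 c^2]. This makes [6 b^2], at most [6 n^2 p c], next to the term
   [2 p c]. *)
pose be : R := (6 * n%:R ^+ 2 + 2) * k1.
pose g : R := (3 + 2) * k1 ^+ 2 * n%:R.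
have be0 : 0 <= be by rewrite mulr_ge0// addr_ge0// mulr_ge0// sqr_ge0.
have g0 : 0 <= g by rewrite !mulr_ge0// sqr_ge0.
exists (n%:R * (129 * k1) + n%:R * (129 * be + 128 * g)).
  by rewrite addr_ge0 ?mulr_ge0 ?addr_ge0 ?mulr_ge0.
move=> h u /andP[hp h1] Y.
have mY : measurable_fun setT (fun w => dot (Y w) (Y w)).
  apply: (@measurable_comp_continuous _ _ _ _ (fun x => dot x x)).
    exact: loc_lip_continuous loc_lip_dot.
  move=> i; rewrite (_ : (fun w => _) = (fun w => u i 0 + (S *m (W h w - W 0 w)) i 0)); last first.
    by apply/funext => w; rewrite mxE.
  apply: measurable_funD; first exact: measurable_cst.
  by apply: measurable_mulmx => j; exact: measurable_incr.
pose xi w := S *m (W h w - W 0 w).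
pose q w := \sum_i incr W h i w ^+ 2.
have q0 w : 0 <= q w by apply: sumr_ge0 => i _; rewrite sqr_ge0.
have xq w : dot (xi w) (xi w) <= k1 * q w.
  apply: le_trans (dot_norm_le _) _; rewrite /k1 -mulrA ler_wpM2l//.
  apply: (@le_trans _ _ ((n%:R * `|S| * `|W h w - W 0 w|) ^+ 2)).
    by rewrite ler_pXn2r ?nnegrE ?mulr_ge0// norm_mulmx.
  have -> : q w = dot (W h w - W 0 w) (W h w - W 0 w) by apply: eq_bigr => i _; rewrite /incr expr2.
  rewrite exprMn; apply: ler_wpM2l; [exact: sqr_ge0|exact: le_norm_dot].
have qq w : q w ^+ 2 <= n%:R * \sum_i incr W h i w ^+ 4.
  rewrite expr2 {1}/q mulr_suml.
  have -> : n%:R * \sum_i incr W h i w ^+ 4 = \sum_i \sum_j (incr W h i w ^+ 4 + incr W h j w ^+ 4) / 2.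
    under [RHS]eq_bigr do (rewrite -mulr_suml big_split/= sumr_const card_ord).
    rewrite -mulr_suml big_split/= sumr_const card_ord sumrMnl -mulr_natl.
    by field.
  apply: ler_sum => i _; rewrite /q mulr_sumr; apply: ler_sum => j _.
  by have := sqr_ge0 (incr W h i w ^+ 2 - incr W h j w ^+ 2); nra.
pose a (i : 'I_n) : R := (S^T *m u) i 0.
have ua w : dot u (xi w) = \sum_i a i * incr W h i w.
  by rewrite dotC dot_mulmx dotC.
have YE w : dot (Y w) (Y w) = dot u u + 2 * dot u (xi w) + dot (xi w) (xi w) by rewrite dot_sqrD.
split.
  apply: le_trans (@incr_bound _ _ _ _ P W mW gW h hp _ (dot u u) (fun i => 2 * a i) k1 0 mY _ k10 _ _) _.
  - by move=> w; exact: dot_ge0.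
  - by [].
  - move=> w; rewrite YE -addrA lerD2l ua mulr_sumr.
    under [leRHS]eq_bigr do rewrite mul0r addr0 -mulrA.
    rewrite big_split/= lerD2l (le_trans (xq w))// /q mulr_sumr.
    by apply: ler_sum.
  rewrite lee_fin lerD2l -subr_ge0 (_ : _ - _ = n%:R * (129 * be + 128 * g) * h); last by ring.
  by rewrite !mulr_ge0 ?addr_ge0 ?mulr_ge0 ?(ltW hp).
apply: le_trans (@incr_bound _ _ _ _ P W mW gW h hp _ (dot u u ^+ 2) (fun i => 4 * dot u u * a i)
    (be * dot u u) g _ _ _ _ _) _.
- exact: measurable_funX.
- by move=> w; rewrite sqr_ge0.
- by rewrite mulr_ge0// dot_ge0.
- by [].
- move=> w; rewrite YE.
  have -> : \sum_i (4 * dot u u * a i * incr W h i w + be * dot u u * incr W h i w ^+ 2 +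
      g * incr W h i w ^+ 4) =
      4 * dot u u * dot u (xi w) + be * dot u u * q w + g * \sum_i incr W h i w ^+ 4.
    rewrite !big_split/= ua !mulr_sumr; congr (_ + _ + _).
    by apply: eq_bigr => i _; rewrite !mulrA.
  have D0 := dot_ge0 u; have c0 := dot_ge0 (xi w).
  have b2 : dot u (xi w) ^+ 2 <= n%:R ^+ 2 * (dot u u * dot (xi w) (xi w)).
    apply: (@le_trans _ _ ((n%:R * `|u| * `|xi w|) ^+ 2)).
      by rewrite -[leLHS]real_normK ?num_real// ler_pXn2r ?nnegrE ?mulr_ge0// norm_dot_le.
    rewrite !exprMn -mulrA ler_wpM2l ?sqr_ge0//.
    by apply: ler_pM; rewrite ?sqr_ge0// le_norm_dot.
  have aq : dot u u * dot (xi w) (xi w) <= dot u u * (k1 * q w) by rewrite ler_wpM2l.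
  have c2 : dot (xi w) (xi w) ^+ 2 <= k1 ^+ 2 * (n%:R * \sum_i incr W h i w ^+ 4).
    apply: (@le_trans _ _ ((k1 * q w) ^+ 2)).
      by rewrite ler_pXn2r ?nnegrE// mulr_ge0.
    by rewrite exprMn ler_wpM2l ?sqr_ge0.
  have n2 : 0 <= n%:R ^+ 2 :> R by rewrite sqr_ge0.
  have aq' : (6 * n%:R ^+ 2 + 2) * (dot u u * dot (xi w) (xi w)) <= (6 * n%:R ^+ 2 + 2) * (dot u u * (k1 * q w)).
    by rewrite ler_wpM2l//; lra.
  rewrite /be /g.
  move: b2 aq' c2 D0 c0; move: (dot u u) (dot u (xi w)) (dot (xi w) (xi w)) (q w) (\sum_i _) (n%:R ^+ 2 : R)
    => p b1 c Q S4 N2 b2 aq' c2 D0 c0.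
  rewrite (_ : (6 * N2 + 2) * k1 * p * Q = (6 * N2 + 2) * (p * (k1 * Q))); last by ring.
  rewrite (_ : (3 + 2) * k1 ^+ 2 * n%:R * S4 = 5 * (k1 ^+ 2 * (n%:R * S4))); last by ring.
  rewrite (_ : (p + 2 * b1 + c) ^+ 2 = p ^+ 2 + 4 * p * b1 + 4 * b1 ^+ 2 + 2 * (p * c) + (4 * b1 * c + c ^+ 2)); last by ring.
  have := sqr_ge0 (b1 - c); rewrite sqrrB => sq.
  have s2 : 4 * b1 * c + c ^+ 2 <= 2 * b1 ^+ 2 + 3 * c ^+ 2 by lra.
  have s3 : 0 <= c ^+ 2 by rewrite sqr_ge0.
  by lra.
rewrite lee_fin lerD2l.
have hh : h ^+ 2 <= h by rewrite expr2 -[leRHS]mulr1 ler_wpM2l// ltW.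
have D0 := dot_ge0 u.
have n0 : 0 <= n%:R :> R by [].
apply: (@le_trans _ _ (n%:R * (129 * (be * dot u u) * h + 128 * g * h))).
  by rewrite ler_wpM2l// lerD2l ler_wpM2l// mulr_ge0.
move: (dot u u) D0 => p p0.
have [m1 m2 m3] : [/\ 0 <= n%:R * (k1 * h * p) , 0 <= n%:R * (k1 * h) & 0 <= n%:R * (be * h)].
  by rewrite !mulr_ge0 ?(ltW hp).
have m4 : 0 <= n%:R * (g * h * p) by rewrite !mulr_ge0 ?(ltW hp).
rewrite -subr_ge0 (_ : _ - _ = 129 * (n%:R * (k1 * h * p)) + 129 * (n%:R * (k1 * h)) + 129 * (n%:R * (be * h)) +
  128 * (n%:R * (g * h * p))); last by ring.
by lra.
Qed.

Lemma noise_grid h w : (fun j => noise S W 0 (fun=> h) j w) = grid_noise S (fun u => W u w) h.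
Proof. by apply/funext => j; rewrite /noise /grid_noise !add0r !partial_cst. Qed.

Let Y h z k w := euler B A S W h z k w.
Let drifted h x : 'cV[R]_n := x + h *: tamed b h x.

Lemma measurable_Y h z k i : 0 <= h -> measurable_fun setT (fun w => Y h z k w i 0 : R).
Proof. by move=> h0; exact: (@measurable_euler _ _ B A S _ _ P W W_bm h k _ _ (cst z) id h0). Qed.

Lemma measurable_step h z k (g : 'cV[R]_n -> R) : 0 <= h -> continuous g ->
  measurable_fun setT (fun q : Omega * Omega =>
    (g (drifted h (Y h z k q.1) + S *m (W h q.2 - W 0 q.2)) : R)).
Proof.
have [mW _ _ _] := W_bm; have [C C0 bC] := drift_quad_lip B A.
move=> h0 cg; apply: measurable_comp_continuous => // i.
have mYk j : measurable_fun setT (fun q : Omega * Omega => Y h z k q.1 j 0 : R).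
  exact: (@measurable_euler _ _ B A S _ _ P W W_bm h k _ _ (cst z) fst h0).
rewrite (_ : (fun q => _) = (fun q : Omega * Omega => Y h z k q.1 i 0 +
    h * tamed b h (Y h z k q.1) i 0 + (S *m (W h q.2 - W 0 q.2)) i 0)); last first.
  by apply/funext => q; rewrite !mxE.
apply: measurable_funD; first apply: measurable_funD => //.
  apply: measurable_funM; first exact: measurable_cst.
  exact: (@measurable_comp_continuous _ _ _ _ (fun x => tamed b h x i 0 : R)
    (fun q : Omega * Omega => Y h z k q.1) (continuous_tamed C0 bC) mYk).
apply: (@measurable_mulmx _ _ _ (Omega * Omega)%type S (fun q => W h q.2 - W 0 q.2)) => j.
by apply: (measurableT_comp (measurable_increment mW j (lexx 0) h0)); exact: measurable_snd.
Qed.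

Lemma euler_step h z k (g : 'cV[R]_n -> R) : 0 < h -> continuous g -> (forall x, 0 <= g x) ->
  (\int[P]_w (g (Y h z k.+1 w))%:E =
   \int[P]_w \int[P]_w' (g (drifted h (Y h z k w) + S *m (W h w' - W 0 w')))%:E)%E.
Proof.
move=> h0 cg g0; have [mW _ _ gW] := W_bm; have [C C0 bC] := drift_quad_lip B A.
have mg : measurable_fun setT ((fun x => (g x)%:E) : borel R n -> \bar R).
  by apply/measurable_EFinP; exact: continuous_borel.
have g0' (x : 'cV[R]_n) : (0 <= (g x)%:E)%E by rewrite lee_fin.
have := @chain_split _ _ _ _ P b C S C0 bC W mW gW (fun=> h) k 1%N z _ (fun=> h0) mg g0'.
rewrite addn1 => H; transitivity (\int[P]_w
    (g (chain b (fun=> h) (fun j => noise S W 0 (fun=> h) j w) z k.+1))%:E)%E.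
  by apply: eq_integral => w _; rewrite noise_grid.
rewrite H; apply: eq_integral => w _; apply: eq_integral => w' _.
rewrite !noise_grid; congr (g _)%:E.
by rewrite [LHS]/= /grid_noise mul0r mul1r.
Qed.

(** [phi] is a bounded continuous minorant of the dissipation: its expectations are finite and will
    pass to the limit of small steps. [N] fixes the time horizon, so that the bound on the second
    moment used at each step is uniform in [k]. *)
Lemma euler_energy : exists2 K : R, 0 <= K & forall (h : R) z, 0 < h <= 1 ->
  (forall k, (\int[P]_w (dot (Y h z k w) (Y h z k w))%:E <= (dot z z + k%:R * (K * h))%:E)%E) /\
  forall phi N, bc phi -> (forall x, 0 <= phi x <= dot x x * dot x (A *m x)) ->
   forall k, (k <= N)%N -> (\int[P]_w (dot (Y h z k w) (Y h z k w) ^+ 2)%:E <=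
   (dot z z ^+ 2 + k%:R * (K * h * (dot z z + N%:R * (K * h) + 1))
     - 4 * h * \sum_(j < k) Ex P (fun w => tame h (Y h z j w) * phi (Y h z j w)))%:E)%E.
Proof.
have [K1 K10 D] := drift_step; have [K2 K20 Nz] := noise_step.
pose K := K1 + K2 + K2 * K1.
have K12 : 0 <= K2 * K1 by rewrite mulr_ge0.
have K0 : 0 <= K by rewrite !addr_ge0.
exists K => // h z h01; have /andP[hp h1] := h01.
have cdot : continuous (fun x : 'cV[R]_n => dot x x) by exact: loc_lip_continuous loc_lip_dot.
have cdot2 : continuous (fun x : 'cV[R]_n => dot x x ^+ 2).
  by move=> x; apply: (@continuous_comp _ _ _ (fun x : 'cV[R]_n => dot x x) (fun y : R => y ^+ 2));
    [exact: cdot|exact: exprn_continuous].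
pose p k w := dot (Y h z k w) (Y h z k w).
have p0 k w : 0 <= p k w by exact: dot_ge0.
have mp k : measurable_fun setT (p k).
  exact: (@measurable_comp_continuous _ _ _ _ (fun x => dot x x) (fun w => Y h z k w) cdot
    (fun i => measurable_Y z k i (ltW hp))).
have Kh0 : 0 <= K * h by rewrite mulr_ge0// ltW.
have e2 k : (\int[P]_w (p k w)%:E <= (dot z z + k%:R * (K * h))%:E)%E.
  elim: k => [|k ih].
    by rewrite /p /Y /euler/= prob_integral_cst mul0r addr0.
  rewrite /p (@euler_step h z k (fun x => dot x x))//; last by move=> x; exact: dot_ge0.
  apply: (@le_trans _ _ (\int[P]_w ((p k w)%:E + (K * h)%:E))%E).
    apply: ge0_le_integral => //.
    - by move=> w _; apply: integral_ge0 => w' _; rewrite lee_fin dot_ge0.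
    - have m2 := proj2 (measurable_EFinP _ _) (@measurable_step h z k _ (ltW hp) cdot).
      exact: (@measurable_fun_fubini_tonelli_F _ _ _ _ _ P _ m2 (fun q => dot_ge0 _)).
    - by apply: emeasurable_funD => //; exact/measurable_EFinP.
    - move=> w _; have [h1' _] := Nz h (drifted h (Y h z k w)) h01.
      apply: le_trans h1' _; rewrite -EFinD lee_fin.
      have [d1 _] := D h (Y h z k w) h01.
      have : (K1 + K2) * h <= K * h by rewrite ler_wpM2r ?(ltW hp)// /K; lra.
      rewrite /drifted /p; lra.
  rewrite (@EFin_integralD _ _ _ P (p k) (fun=> K * h))//.
  rewrite prob_integral_cst; apply: le_trans (leeD ih (lexx _)) _.
  by rewrite -EFinD lee_fin (_ : k.+1%:R = k%:R + 1 :> R) ?natr1//; lra.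
split=> // phi N [cphi [Mp bphi]] phiP.
pose q k w := tame h (Y h z k w) * phi (Y h z k w).
have q0 k w : 0 <= q k w.
  by have /andP[f0 _] := phiP (Y h z k w); rewrite mulr_ge0// ltW// tame_gt0.
have bq k : bdd (q k).
  split.
    apply: measurable_funM; last first.
      by apply: measurable_comp_continuous => // i; apply: measurable_Y; exact: ltW.
    have ct : continuous (fun x : 'cV[R]_n => tame h x).
      move=> x; have Fx : Filter (nbhs x) by exact: nbhs_filter.
      apply: (@cvgV _ _ _ Fx); first by rewrite gt_eqF// (lt_le_trans ltr01)// tame_den_ge1.
      exact: (@cvgD _ _ _ _ Fx _ _ _ _ (cvg_cst _) (@cvgM _ _ _ Fx _ _ _ _ (cvg_cst _) (cdot x))).
    by apply: measurable_comp_continuous => // i; apply: measurable_Y; exact: ltW.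
  exists Mp => w; rewrite ger0_norm// (le_trans _ (bphi (Y h z k w)))//.
  rewrite -[leRHS]mul1r ger0_norm; last by have /andP[] := phiP (Y h z k w).
  by apply: ler_pM; rewrite ?tame_le1 ?(ltW (tame_gt0 _ _))//; have /andP[] := phiP (Y h z k w).
elim=> [_|k ih kN].
  by rewrite /Y /euler/= prob_integral_cst mul0r addr0 big_ord0 mulr0 subr0.
have {}ih := ih (ltnW kN).
rewrite (@euler_step h z k (fun x => dot x x ^+ 2))//; last by move=> x; rewrite sqr_ge0.
pose F w := (\int[P]_w' (dot (drifted h (Y h z k w) + S *m (W h w' - W 0 w'))
   (drifted h (Y h z k w) + S *m (W h w' - W 0 w')) ^+ 2)%:E)%E.
have F0 w : (0 <= F w)%E by apply: integral_ge0 => w' _; rewrite lee_fin sqr_ge0.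
have mF : measurable_fun setT F.
  have m2 := proj2 (measurable_EFinP _ _) (@measurable_step h z k _ (ltW hp) cdot2).
  exact: (@measurable_fun_fubini_tonelli_F _ _ _ _ _ P _ m2 (fun q => sqr_ge0 _)).
have [mq _] := bq k.
have mqE : measurable_fun setT (fun w => (4 * h * q k w)%:E).
  by apply/measurable_EFinP; apply: measurable_funM.
have q40 w : (0 <= (4 * h * q k w)%:E)%E by rewrite lee_fin mulr_ge0// mulr_ge0// ltW.
have key : (\int[P]_w F w + (4 * h * Ex P (q k))%:E <=
    (dot z z ^+ 2 + k%:R * (K * h * (dot z z + N%:R * (K * h) + 1))
     - 4 * h * \sum_(j < k) Ex P (q j))%:E + (K * h * (dot z z + N%:R * (K * h) + 1))%:E)%E.
  rewrite -ExZ// EFin_Ex; last exact: bddZ.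
  rewrite -ge0_integralD//.
  apply: (@le_trans _ _ (\int[P]_w ((p k w ^+ 2)%:E + ((K * h)%:E * (p k w)%:E + (K * h)%:E)))%E).
    have mp2 : measurable_fun setT (fun w => (p k w ^+ 2)%:E).
      by apply/measurable_EFinP; exact: measurable_funX.
    have mpK : measurable_fun setT (fun w => (K * h)%:E * (p k w)%:E + (K * h)%:E)%E.
      apply: emeasurable_funD => //; apply/measurable_EFinP; exact: measurable_funM.
    apply: ge0_le_integral => //.
    - by move=> w _; rewrite adde_ge0.
    - exact: emeasurable_funD.
    - exact: emeasurable_funD.
    - move=> w _; have [_ h1'] := Nz h (drifted h (Y h z k w)) h01.
      have [d1 d2] := D h (Y h z k w) h01.
      apply: le_trans (leeD h1' (lexx _)) _; rewrite -EFinM -!EFinD lee_fin.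
      move: d1 d2; rewrite -/(drifted h (Y h z k w)) -/(p k w).
      have /andP[f0 f1] := phiP (Y h z k w).
      have q1 : 4 * h * q k w <= 4 * h * (tame h (Y h z k w) * (p k w * dot (Y h z k w) (A *m Y h z k w))).
        by rewrite ler_wpM2l ?mulr_ge0 ?(ltW hp)// ler_wpM2l// ltW// tame_gt0.
      move: q1; move: (dot (drifted _ _) _) (tame _ _ * _) (4 * h * q k w) => uu tt qq q1 d1 d2.
      have hh : h * h <= h by rewrite -[leRHS]mulr1 ler_wpM2l// ltW.
      have m1 : K2 * h * uu <= K2 * h * (p k w + K1 * h) by rewrite ler_wpM2l// mulr_ge0// ltW.
      have m2 : K2 * K1 * (h * h) <= K2 * K1 * h by rewrite ler_wpM2l.
      have m3 : 0 <= K2 * K1 * h * p k w by rewrite !mulr_ge0// ltW.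
      rewrite /K; move: (p k w) (p0 k w) m1 m2 m3 d2 => pp pp0 m1 m2 m3 d2.
      lra.
  rewrite (@EFin_integralD _ _ _ P (fun w => p k w ^+ 2) (fun w => K * h * p k w + K * h)); last 4 first.
  - exact: measurable_funX.
  - by move=> w; rewrite sqr_ge0.
  - by apply: measurable_funD => //; exact: measurable_funM.
  - by move=> w; rewrite addr_ge0// mulr_ge0.
  apply: leeD => //.
  rewrite (@EFin_integralD _ _ _ P (fun w => K * h * p k w) (fun=> K * h))//; last 2 first.
  - exact: measurable_funM.
  - by move=> w; rewrite mulr_ge0.
  rewrite EFin_integralZ// prob_integral_cst.
  apply: (@le_trans _ _ ((K * h)%:E * (dot z z + k%:R * (K * h))%:E + (K * h)%:E)%E).
    by rewrite leeD2r// lee_wpmul2l// lee_fin.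
  rewrite -EFinM -EFinD lee_fin -[X in _ + X <= _]mulr1 -mulrDr ler_wpM2l// lerD2r lerD2l ler_wpM2r//.
  by rewrite ler_nat ltnW.
rewrite -leeBrDr// in key; apply: le_trans key _.
rewrite -!EFinD lee_fin big_ord_recr/= (_ : k.+1%:R = k%:R + 1 :> R) ?natr1//.
by rewrite le_eqVlt; apply/orP; left; apply/eqP; rewrite /q; ring.
Qed.

Lemma euler_path_cvg z t w : 0 < t -> good B A S W X z w -> forall e : R, 0 < e ->
  exists2 M : R, 0 <= M & exists N0, forall N, (N0 <= N)%N -> forall k, (k <= N.+1)%N ->
    [/\ `|Y (t / N.+1%:R) z k w - X z (k%:R * (t / N.+1%:R)) w| <= e,
       `|X z (k%:R * (t / N.+1%:R)) w| <= M & `|Y (t / N.+1%:R) z k w| <= M].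
Proof.
move=> t0 [xc wc xo w0 x0] e e0; have [C C0 bC] := drift_quad_lip B A.
have [M M0 xM] := path_bounded t xc.
have zc : (fun _ : nat => z) @ \oo --> X z 0 w by rewrite x0; exact: cvg_cst.
have [N0 HN] := @chain_cvg _ _ b C C0 bC S _ _ _ t M e t0 M0 e0 xo xM zc.
exists (M + e); first by rewrite addr_ge0// ltW.
exists N0 => N N0N k kN.
have h1 := HN N.+1 N0N k kN.
have h2 : `|X z (k%:R * (t / N.+1%:R)) w| <= M.
  by apply: xM; apply: (@mesh_mul _ _ _ N.+1) => //; [exact: mesh_full|rewrite divr_ge0// ltW].
split=> //; first by rewrite (le_trans h2)// lerDl ltW.
by rewrite -[Y _ _ _ _](subrK (X z (k%:R * (t / N.+1%:R)) w)) (le_trans (ler_normD _ _))// addrC lerD.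
Qed.

Let path2 : exists2 K : R, 0 <= K & forall z (t : R), 0 < t ->
  (\int[P]_w (dot (X z t w) (X z t w))%:E <= (dot z z + K * t)%:E)%E.
Proof.
have [K K0 H] := euler_energy; exists K => // z t t0.
have cdot : continuous (fun x : 'cV[R]_n => dot x x) by exact: loc_lip_continuous loc_lip_dot.
pose N0 := Num.truncn t.
have tN k : 0 < t / (k + N0).+1%:R <= 1.
  rewrite divr_gt0//= ler_pdivrMr// mul1r ltW// (lt_le_trans (truncnS_gt _))//.
  by rewrite ler_nat ltnS leq_addl.
apply: (@fatou_le _ _ _ P (fun k w => dot (Y (t / (k + N0).+1%:R) z (k + N0).+1 w) (Y (t / (k + N0).+1%:R) z (k + N0).+1 w))
   _ (fun=> dot z z + K * t)).
- move=> k; have /andP[hp _] := tN k.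
  exact: (@measurable_comp_continuous _ _ _ _ (fun x => dot x x) (fun w => Y _ z _ w) cdot
    (fun i => measurable_Y z _ i (ltW hp))).
- by move=> k w; exact: dot_ge0.
- exact: (mX_comp X_sol z (ltW t0) cdot).
- by move=> w; exact: dot_ge0.
- apply: filterS (ae_good W_bm X_sol z) => w gw.
  apply: (continuous_vseq cdot) => e e0.
  have [M M0 [N1 HN]] := euler_path_cvg t0 gw e0.
  exists N1 => // k /= N1k.
  have [h _ _] := HN (k + N0)%N (leq_trans N1k (leq_addr _ _)) _ (leqnn _).
  by rewrite mesh_full in h.
- move=> k; have [h _] := H _ z (tN k); apply: le_trans (h _) _.
  rewrite lee_fin lerD2l (_ : _ * _ = K * ((k + N0).+1%:R * (t / (k + N0).+1%:R))).
    by rewrite mesh_full.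
  by rewrite mulrCA.
- exact: cvg_cst.
Qed.

Lemma energy2 : exists2 K : R, 0 <= K & forall z (t : R), 0 <= t ->
  (\int[P]_w (dot (X z t w) (X z t w))%:E <= (dot z z + K * t)%:E)%E.
Proof.
have [K K0 H] := path2; exists K => // z t; rewrite le_eqVlt => /predU1P[<-|]; last exact: H.
have cdot : continuous (fun x : 'cV[R]_n => dot x x) by exact: loc_lip_continuous loc_lip_dot.
rewrite mulr0 addr0 (ae_eq_integral (cst (dot z z)%:E))//.
- by rewrite prob_integral_cst.
- by apply/measurable_EFinP; exact: (mX_comp X_sol z (lexx 0) cdot).
- by apply: filterS (ae_good W_bm X_sol z) => w [_ _ _ _ ->].
Qed.

(** The limit of [euler_energy] along the meshes [g] on which the Riemann sum is at least [L]:
    Fatou's lemma on the left, dominated convergence for the difference of the Riemann sums on the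
    right. It suffices that such meshes are arbitrarily fine. *)
Lemma energy4 : exists2 K : R, 0 <= K & forall (phi : 'cV[R]_n -> R) z (L : R),
  bc phi -> loc_lip phi -> (forall x, 0 <= phi x <= dot x x * dot x (A *m x)) ->
  (forall N0 : nat, exists2 N, (N0 <= N)%N &
     L <= N.+1%:R^-1 * \sum_(k < N.+1) Tr P X (k%:R * N.+1%:R^-1) phi z) ->
  (\int[P]_w (dot (X z 1 w) (X z 1 w) ^+ 2)%:E <=
    (dot z z ^+ 2 + K * (dot z z + 1) - 4 * L)%:E)%E.
Proof.
have [K K0 H] := euler_energy; exists (K * (1 + K) + K); first by rewrite !addr_ge0 ?mulr_ge0 ?addr_ge0.
move=> phi z L bphi lphi phiP HL; have [cphi [Mp phiM]] := bphi.
have [g gP] : exists g : nat -> nat, forall i, (i <= g i)%N /\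
     L <= (g i).+1%:R^-1 * \sum_(k < (g i).+1) Tr P X (k%:R * (g i).+1%:R^-1) phi z.
  have HL' i : exists N, (i <= N)%N /\
     L <= N.+1%:R^-1 * \sum_(k < N.+1) Tr P X (k%:R * N.+1%:R^-1) phi z.
    by have [N h1 h2] := HL i; exists N.
  by have [g gP] := choice HL'; exists g.
have cdot : continuous (fun x : 'cV[R]_n => dot x x) by exact: loc_lip_continuous loc_lip_dot.
have cdot2 : continuous (fun x : 'cV[R]_n => dot x x ^+ 2).
  by move=> x; apply: (@continuous_comp _ _ _ (fun x : 'cV[R]_n => dot x x) (fun y : R => y ^+ 2));
    [exact: cdot|exact: exprn_continuous].
pose h i : R := 1 / (g i).+1%:R.
have h01 i : 0 < h i <= 1.
  by rewrite /h divr_gt0//= ler_pdivrMr// mul1r ler1n.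
have hN i : (g i).+1%:R * h i = 1 by exact: mesh_full.
pose q i k w := tame (h i) (Y (h i) z k w) * phi (Y (h i) z k w).
have mY i k : forall j, measurable_fun setT (fun w => Y (h i) z k w j 0 : R).
  by move=> j; apply: measurable_Y; have /andP[/ltW] := h01 i.
have phi0 x : 0 <= phi x by have /andP[] := phiP x.
have q0 i k w : 0 <= q i k w by rewrite mulr_ge0// ltW// tame_gt0.
have qM i k w : q i k w <= Mp.
  rewrite (le_trans _ (phiM (Y (h i) z k w)))// -[leRHS]mul1r ger0_norm//.
  by rewrite ler_wpM2r// tame_le1.
have mq i k : measurable_fun setT (q i k).
  apply: measurable_funM; last exact: (@measurable_comp_continuous _ _ _ _ phi (fun w => Y (h i) z k w) cphi (mY i k)).
  have ct : continuous (fun x : 'cV[R]_n => tame (h i) x).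
    move=> x; have Fx : Filter (nbhs x) by exact: nbhs_filter.
    apply: (@cvgV _ _ _ Fx); first by rewrite gt_eqF// (lt_le_trans ltr01)// tame_den_ge1.
    exact: (@cvgD _ _ _ _ Fx _ _ _ _ (cvg_cst _) (@cvgM _ _ _ Fx _ _ _ _ (cvg_cst _) (cdot x))).
  exact: (@measurable_comp_continuous _ _ _ _ _ (fun w => Y (h i) z k w) ct (mY i k)).
have bq i k : bdd (q i k).
  by split => //; exists Mp => w; rewrite ger0_norm.
have bX i k : bdd (fun w => phi (X z (k%:R * h i) w)).
  by apply: (bdd_X X_sol) => //; rewrite mulr_ge0//; have /andP[/ltW] := h01 i.
(* The Riemann sum of [phi] along the solution minus that of the tamed [phi] along the chain. It is
   bounded by [2 * Mp] and tends to 0 on good paths. *)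
pose e i w := h i * \sum_(k < (g i).+1) (phi (X z (k%:R * h i) w) + -1 * q i k w).
have be i : bdd (e i) by apply: bddZ; apply: bdd_sum => k; apply: bddD => //; exact: bddZ.
have Mp0 : 0 <= Mp by exact: le_trans (normr_ge0 _) (phiM z).
have eM i w : `|e i w| <= 2 * Mp.
  rewrite normrM ger0_norm; last by have /andP[/ltW] := h01 i.
  apply: (@le_trans _ _ (h i * ((g i).+1%:R * (2 * Mp)))); last by rewrite mulrCA mulrA hN mul1r.
  apply: ler_wpM2l; first by have /andP[/ltW] := h01 i.
  apply: (le_trans (ler_norm_sum _ _ _)).
  rewrite -[X in X%:R * _]card_ord mulr_natl -sumr_const; apply: ler_sum => k _.
  rewrite (le_trans (ler_normD _ _))// (_ : 2 * Mp = Mp + Mp); last by ring.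
  rewrite lerD//.
  by rewrite mulN1r normrN ger0_norm.
have e_cvg : (fun i => Ex P (e i)) @ \oo --> (0 : R).
  rewrite -[X in _ --> X](Ex_cst P); apply: (@Ex_cvg _ _ _ P e (fun=> 0) (2 * Mp)) => //.
  - by move=> i; have [] := be i.
  - exact: bdd_cst.
  apply: filterS (ae_good W_bm X_sol z) => w gw; apply/cvgrPdist_le => ep ep0.
  have [M0 M00 [N00 HM]] := euler_path_cvg ltr01 gw ltr01.
  have [L0 L00 HL0] := lphi M0.
  have ep1 : 0 < ep / 2 / (L0 + 1) by rewrite !divr_gt0// ltr_wpDl.
  have [Mx Mx0 [N1 HN1]] := euler_path_cvg ltr01 gw ep1.
  pose G : R := n%:R * M0 ^+ 2 * Mp.
  have G0 : 0 <= G by rewrite !mulr_ge0 ?sqr_ge0.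
  pose dl : R := (ep / 2 / (G + 1)) ^+ 2.
  have dl0 : 0 < dl by rewrite exprn_gt0// !divr_gt0// ltr_wpDl.
  pose N2 := Num.truncn (dl^-1).
  exists (maxn (maxn N00 N1) N2) => // i /=; rewrite !geq_max => /andP[/andP[iN0 iN1] iN2].
  have [gi _] := gP i.
  have hd : Num.sqrt (h i) <= ep / 2 / (G + 1).
    rewrite -[leRHS]ger0_norm ?divr_ge0 ?(ltW ep0) ?addr_ge0// -sqrtr_sqr ler_wsqrtr//.
    rewrite -/dl /h mul1r -[leRHS]invrK lef_pV2 ?posrE ?invr_gt0//.
    by rewrite ltW// (lt_le_trans (truncnS_gt _))// ler_nat ltnS (leq_trans iN2).
  rewrite sub0r normrN /e normrM ger0_norm; last by have /andP[/ltW] := h01 i.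
  apply: (@le_trans _ _ (h i * ((g i).+1%:R * ep))); last by rewrite mulrCA mulrA hN mul1r.
  apply: ler_wpM2l; first by have /andP[/ltW] := h01 i.
  apply: (le_trans (ler_norm_sum _ _ _)).
  rewrite -[X in X%:R * _]card_ord mulr_natl -sumr_const; apply: ler_sum => k _.
  have kN : (k <= (g i).+1)%N by exact: ltnW.
  have [_ XM YM] := HM (g i) (leq_trans iN0 gi) k kN.
  have [XY _ _] := HN1 (g i) (leq_trans iN1 gi) k kN.
  rewrite -/(h i) in XM YM XY.
  have -> : phi (X z (k%:R * h i) w) + -1 * q i k w =
     (phi (X z (k%:R * h i) w) - phi (Y (h i) z k w)) +
     (1 - tame (h i) (Y (h i) z k w)) * phi (Y (h i) z k w) by rewrite /q; ring.
  rewrite (le_trans (ler_normD _ _))// [ep]splitr lerD//.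
    apply: le_trans (HL0 _ _ XM YM) _; rewrite distrC.
    apply: (@le_trans _ _ ((L0 + 1) * (ep / 2 / (L0 + 1)))); last by rewrite mulrC divfK// gt_eqF// ltr_wpDl.
    by apply: ler_pM => //; rewrite lerDl.
  have t1 : 0 <= 1 - tame (h i) (Y (h i) z k w) by rewrite subr_ge0 tame_le1.
  rewrite ger0_norm ?mulr_ge0//.
  apply: (@le_trans _ _ (Num.sqrt (h i) * dot (Y (h i) z k w) (Y (h i) z k w) * Mp)).
    apply: ler_pM => //; first exact: tame_ge.
    by rewrite (le_trans (ler_norm _)).
  apply: (@le_trans _ _ (Num.sqrt (h i) * (n%:R * M0 ^+ 2) * Mp)).
    rewrite ler_wpM2r// ler_wpM2l ?sqrtr_ge0// (le_trans (dot_norm_le _))// ler_wpM2l//.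
    by rewrite lerXn2r ?nnegrE.
  apply: (@le_trans _ _ (ep / 2 / (G + 1) * (G + 1))); last by rewrite divfK// gt_eqF// ltr_wpDl.
  rewrite -mulrA -/G; apply: ler_pM; rewrite ?sqrtr_ge0//.
  by rewrite lerDl.
apply: (@le_trans _ _ (dot z z ^+ 2 + K * (dot z z + K + 1) - 4 * L)%:E); last first.
  have : 0 <= K ^+ 2 * dot z z by rewrite mulr_ge0 ?sqr_ge0 ?dot_ge0.
  have : 0 <= K * dot z z by rewrite mulr_ge0 ?dot_ge0.
  by rewrite lee_fin; lra.
apply: (@fatou_le _ _ _ P (fun i w => dot (Y (h i) z (g i).+1 w) (Y (h i) z (g i).+1 w) ^+ 2) _
   (fun i => dot z z ^+ 2 + K * (dot z z + K + 1) - 4 * L + 4 * Ex P (e i))).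
- move=> i; exact: (@measurable_comp_continuous _ _ _ _ _ (fun w => Y (h i) z (g i).+1 w) cdot2 (mY i _)).
- by move=> i w; rewrite sqr_ge0.
- exact: (mX_comp X_sol z ler01 cdot2).
- by move=> w; rewrite sqr_ge0.
- apply: filterS (ae_good W_bm X_sol z) => w gw.
  apply: (continuous_vseq cdot2) => ep ep0.
  have [Mx Mx0 [N1 HN1]] := euler_path_cvg ltr01 gw ep0.
  exists N1 => // i /= N1i; have [gi Lg] := gP i.
  have [h1 _ _] := HN1 (g i) (leq_trans N1i gi) _ (leqnn _).
  by rewrite mesh_full in h1.
- move=> i; have [_ h4] := H _ z (h01 i); have [gi Lg] := gP i.
  apply: le_trans (h4 phi (g i).+1 bphi phiP _ (leqnn _)) _.
  rewrite lee_fin (_ : (g i).+1%:R * (K * h i * _) = K * ((g i).+1%:R * h i) * (dot z z + K * ((g i).+1%:R * h i) + 1)); last by ring.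
  rewrite hN !mulr1.
  have -> : Ex P (e i) = h i * \sum_(k < (g i).+1) Tr P X (k%:R * h i) phi z -
      h i * \sum_(k < (g i).+1) Ex P (q i k).
    rewrite /e ExZ; last by apply: bdd_sum => k; apply: bddD => //; exact: bddZ.
    rewrite Ex_sum; last by move=> k; apply: bddD => //; exact: bddZ.
    rewrite -mulrBr -sumrB; congr (_ * _); apply: eq_bigr => k _.
    by rewrite ExD ?ExZ// ?mulN1r//; exact: bddZ.
  have : L <= h i * \sum_(k < (g i).+1) Tr P X (k%:R * h i) phi z by rewrite /h mul1r.
  rewrite /q; lra.
- have H0 : (fun i => dot z z ^+ 2 + K * (dot z z + K + 1) - 4 * L + 4 * Ex P (e i)) @ \oo -->
      (dot z z ^+ 2 + K * (dot z z + K + 1) - 4 * L) + 4 * 0.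
    by apply: cvgD; [exact: cvg_cst|apply: cvgM => //; exact: cvg_cst].
  by rewrite mulr0 addr0 in H0.
Qed.

End Energy.

(** * Krylov-Bogoliubov *)

Section BoundedContinuous.
Context {R : realType} {n : nat}.
Implicit Types (f g : 'cV[R]_n -> R) (G : set 'cV[R]_n).

Lemma bc_cst (c : R) : bc (fun _ : 'cV[R]_n => c).
Proof. split; last by exists `|c|.
exact: cst_continuous. Qed.

Lemma bcD f g : bc f -> bc g -> bc (fun x => f x + g x).
Proof.
move=> [cf [M fM]] [cg [N gN]]; split.
  move=> x; have Fx : Filter (nbhs x) by exact: nbhs_filter.
  exact: (@cvgD _ _ _ _ Fx _ _ _ _ (cf x) (cg x)).
by exists (M + N) => x; rewrite (le_trans (ler_normD _ _))// lerD.
Qed.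

Lemma bcZ (c : R) f : bc f -> bc (fun x => c * f x).
Proof.
move=> [cf [M fM]]; split.
  move=> x; have Fx : Filter (nbhs x) by exact: nbhs_filter.
  exact: (@cvgM _ _ _ Fx _ _ _ _ (cvg_cst _) (cf x)).
by exists (`|c| * M) => x; rewrite normrM ler_wpM2l.
Qed.

Lemma continuous_min f g : continuous f -> continuous g -> continuous (fun x => Num.min (f x) (g x)).
Proof.
move=> cf cg x; have Fx : Filter (nbhs x) by exact: nbhs_filter.
rewrite /continuous_at minr_absE.
have H : (fun y => (f y + g y - `|f y - g y|) / 2) @ nbhs x --> (f x + g x - `|f x - g x|) / 2.
  apply: (@cvgMl _ _ _ Fx); apply: (@cvgB _ _ _ _ Fx).
    exact: (@cvgD _ _ _ _ Fx _ _ _ _ (cf x) (cg x)).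
  apply: (@cvg_norm _ _ _ _ Fx).
  exact: (@cvgB _ _ _ _ Fx _ _ _ _ (cf x) (cg x)).
apply: cvg_trans H; apply: near_eq_cvg; apply: (@filterE _ _ Fx) => z.
by rewrite minr_absE.
Qed.

Lemma bc_min f g : bc f -> bc g -> bc (fun x => Num.min (f x) (g x)).
Proof.
move=> [cf [M fM]] [cg [N gN]]; split; first exact: continuous_min.
exists (M + N) => w; have M0 := le_trans (normr_ge0 _) (fM w).
have N0 := le_trans (normr_ge0 _) (gN w).
rewrite minEle; case: ifP => _.
  by apply: le_trans (fM w) _; rewrite lerDl.
by apply: le_trans (gN w) _; rewrite lerDr.
Qed.

Lemma bc_continuous_min f (c : R) : continuous f -> (forall x, 0 <= f x) -> 0 <= c ->
  bc (fun x => Num.min (f x) c).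
Proof.
move=> cf f0 c0; split; first by apply: continuous_min => //; exact: (bc_cst c).1.
by exists c => x; rewrite ger0_norm ?ge_min ?lexx ?orbT// le_min f0.
Qed.

Lemma bc_sum (I : Type) (s : seq I) (F : I -> 'cV[R]_n -> R) : (forall i, bc (F i)) ->
  bc (fun x => \sum_(i <- s) F i x).
Proof.
move=> bF; elim: s => [|i s ih].
  by under eq_fun do rewrite big_nil; exact: bc_cst.
by under eq_fun do rewrite big_cons; exact: bcD.
Qed.

Lemma open_gt_cont f (a : R) : continuous f -> open [set x | a < f x].
Proof. by move=> /continuousP cf; exact: (cf _ (@open_gt R a)). Qed.

Lemma open_lt_cont f (a : R) : continuous f -> open [set x | f x < a].
Proof. by move=> /continuousP cf; exact: (cf _ (@open_lt R a)). Qed.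

(** The supremum of these radii is the distance to the complement of [G], capped at 1 so that it is
    finite also for the whole space. It is 1-Lipschitz, and positive exactly on [G] when [G] is
    open, hence a source of continuous bumps. *)
Let gaps G x := [set r : R | 0 <= r <= 1 /\ forall y, `|x - y| < r -> G y].
Definition gap G x : R := sup (gaps G x).

Let gaps_sup G x : has_sup (gaps G x).
Proof.
split; last by exists 1 => r [/andP[]].
by exists 0; split; [rewrite lexx ler01|move=> y; rewrite ltNge normr_ge0].
Qed.

Lemma gap_ge0 G x : 0 <= gap G x.
Proof.
apply: (sup_upper_bound (gaps_sup G x)).
by split; [rewrite lexx ler01|move=> y; rewrite ltNge normr_ge0].
Qed.

Lemma gap_lip G x y : gap G x <= gap G y + `|x - y|.
Proof.
apply: sup_le_ub; first exact: (gaps_sup G x).1.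
move=> r [/andP[r0 r1] rG]; have [rxy|rxy] := leP r `|x - y|.
  by rewrite (le_trans rxy)// lerDr gap_ge0.
rewrite -lerBlDr; apply: (sup_upper_bound (gaps_sup G y)); split.
  by rewrite subr_ge0 ltW//= lerBlDr (le_trans r1)// lerDl.
move=> z yz; apply: rG; rewrite -[x](subrK y) -addrA.
by rewrite (le_lt_trans (ler_normD _ _))// -ltrBrDl.
Qed.

Lemma gap_continuous G : continuous (gap G).
Proof.
apply: loc_lip_continuous => M; exists 1 => // x y _ _; rewrite mul1r.
have := gap_lip G x y; have := gap_lip G y x; rewrite [`|y - x|]distrC => h1 h2.
by rewrite ler_norml; lra.
Qed.

Lemma gap_gt0 G x : open G -> G x -> 0 < gap G x.
Proof.
move=> oG Gx; have /nbhs_ballP[e /= e0 eG] := open_nbhs_nbhs (conj oG Gx).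
rewrite (@lt_le_trans _ _ (Num.min e 1))//; first by rewrite lt_min e0 ltr01.
apply: (sup_upper_bound (gaps_sup G x)); split.
  by rewrite le_min (ltW e0) ler01 ge_min lexx orbT.
by move=> y; rewrite lt_min => /andP[h _]; apply: eG; rewrite -ball_normE.
Qed.

Lemma gap_out G x : ~ G x -> gap G x = 0.
Proof.
move=> nG; apply/eqP; rewrite eq_le gap_ge0 andbT; apply: sup_le_ub.
  exact: (gaps_sup G x).1.
move=> r [_ rG]; rewrite leNgt; apply/negP => r0; apply: nG.
by apply: rG; rewrite subrr normr0.
Qed.

End BoundedContinuous.

Section Staircase.
Context {R : realType}.

(** Layers of height 1. Together with [count_sum] it compares a function with the indicators of its
    superlevel sets at a cost of one layer, which replaces the layer-cake integral in the
    representation theorem. *)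
Lemma clip_sum (m : nat) (y : R) : 0 <= y -> y <= m%:R ->
  y = \sum_(j < m) Num.min (Num.max (y - j%:R) 0) 1.
Proof.
elim: m => [|k ih] y0 yk; first by rewrite big_ord0; apply/eqP; rewrite eq_le y0 yk.
rewrite big_ord_recr/=; have [yk'|yk'] := leP y k%:R.
  rewrite -ih// (_ : Num.max _ 0 = 0); last by apply/max_idPr; rewrite subr_le0.
  by rewrite (_ : Num.min 0 1 = 0) ?addr0//; apply/min_idPl.
have -> : \sum_(i < k) Num.min (Num.max (y - i%:R) 0) 1 = k%:R.
  rewrite -[RHS]mulr1 mulr_natl -[X in _ *+ X]card_ord -sumr_const.
  apply: eq_bigr => i _; apply/min_idPr; rewrite le_max lerBrDr.
  by rewrite addrC natr1 (le_trans _ (ltW yk'))// ler_nat.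
rewrite (_ : Num.max _ 0 = y - k%:R); last by apply/max_idPl; rewrite subr_ge0 ltW.
rewrite (_ : Num.min _ 1 = y - k%:R); first by rewrite addrC subrK.
by apply/min_idPl; rewrite lerBlDr addrC natr1.
Qed.

Lemma count_sum (m : nat) (y : R) : y <= m%:R ->
  y <= 1 + \sum_(j < m) (if j.+1%:R < y then 1 else 0).
Proof.
elim: m => [|k ih] yk; first by rewrite big_ord0 addr0 (le_trans yk).
rewrite big_ord_recr/=; have [yk'|yk'] := leP y k%:R.
  rewrite (le_trans (ih yk'))// lerD2l lerDl; by case: ifP.
have -> : \sum_(j < k) (if j.+1%:R < y then 1 else 0) = k%:R :> R.
  rewrite -[RHS]mulr1 mulr_natl -[X in _ *+ X]card_ord -sumr_const.
  by apply: eq_bigr => i _; rewrite (le_lt_trans _ yk')// ler_nat.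
have e : k.+1%:R = k%:R + 1 :> R by rewrite natr1.
by case: ifP => _; lra.
Qed.

End Staircase.

(** * Representation of a tight positive functional on bounded continuous functions *)

Section Riesz.
Context {R : realType} {n : nat}.
Variable Lam : ('cV[R]_n -> R) -> R.
Hypothesis LD : forall f g, bc f -> bc g -> Lam (fun x => f x + g x) = Lam f + Lam g.
Hypothesis LZ : forall c f, bc f -> Lam (fun x => c * f x) = c * Lam f.
Hypothesis Lle : forall f g, bc f -> bc g -> (forall x, f x <= g x) -> Lam f <= Lam g.
Hypothesis L1 : Lam (fun=> 1) = 1.
Variable K : R.
Hypothesis Ltight : forall M : R, 0 < M -> Lam (fun x => Num.min (dot x x / M) 1) <= K / M.
Implicit Types (f g : 'cV[R]_n -> R) (G : set 'cV[R]_n).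

Let Lcst c : Lam (fun=> c) = c.
Proof.
rewrite -[RHS]mulr1 -L1 -LZ; last exact: bc_cst.
by congr Lam; apply/funext => x; rewrite mulr1.
Qed.

Lemma Lam_sum (I : Type) (s : seq I) F : (forall i, bc (F i)) ->
  Lam (fun x => \sum_(i <- s) F i x) = \sum_(i <- s) Lam (F i).
Proof.
move=> bF; elim: s => [|i s ih].
  by rewrite big_nil; under [X in Lam X]eq_fun do rewrite big_nil; exact: Lcst.
rewrite big_cons -ih -LD//; last exact: bc_sum.
by congr Lam; apply/funext => w; rewrite big_cons.
Qed.

Let bc_cut (M : R) : 0 < M -> bc (fun x : 'cV[R]_n => Num.min (dot x x / M) 1).
Proof.
move=> M0; apply: bc_continuous_min => //; last by move=> x; rewrite divr_ge0 ?dot_ge0 ?ltW.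
move=> x; have Fx : Filter (nbhs x) by exact: nbhs_filter.
apply: (@cvgMl _ _ _ Fx); exact: (loc_lip_continuous loc_lip_dot).
Qed.

(* Dini on a large ball, tightness outside. *)
Lemma Lam_dini (f : nat -> 'cV[R]_n -> R) (e : R) : (forall k, bc (f k)) ->
  (forall k x, 0 <= f k x <= 1) -> (forall j k x, (j <= k)%N -> f k x <= f j x) ->
  (forall x (d : R), 0 < d -> exists k, f k x <= d) -> 0 < e ->
  exists k, Lam (f k) <= e.
Proof.
move=> bf f01 fd f0 e0.
have e2 : 0 < e / 2 by rewrite divr_gt0.
(* Tightness then leaves at most [e / 2] for the part outside the ball [|x|^2 <= M]. *)
pose M : R := 1 + 2 * `|K| / e.
have M0 : 0 < M by rewrite ltr_pwDl// divr_ge0 ?mulr_ge0// ltW.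
have KM : K / M <= e / 2.
  rewrite ler_pdivrMr// /M mulrDr mulr1 (_ : e / 2 * (2 * `|K| / e) = `|K|); last by field; rewrite gt_eqF.
  by rewrite (le_trans (ler_norm K))// lerDr ltW.
have [k Hk] : exists k, forall x, dot x x <= M -> f k x <= e / 2.
  apply: contrapT => Hn.
  have {}Hn k : exists x, dot x x <= M /\ e / 2 < f k x.
    apply: contrapT => Hk; apply: Hn; exists k => x xM.
    by rewrite leNgt; apply/negP => h; apply: Hk; exists x.
  have [x xP] := choice Hn.
  have xb k : `|x k| <= M + 1.
    have [xM _] := xP k; have := le_norm_dot (x k); have := normr_ge0 (x k).
    have := sqr_ge0 (`|x k| - 1); nra.
  have [y xy] := ulim_cV xb.
  (* By monotonicity all later functions lie below [f j], and continuity of [f j] at the limit point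
     [y] contradicts the values above [e / 2] along the sequence. *)
  have [j fj] := f0 y (e / 4) ltac:(by rewrite divr_gt0).
  have cfj : (fun k => f j (x k)) @ nultra --> f j y.
    have [cf _] := bf j.
    apply: (@cvg_comp _ _ _ x (f j) _ (nbhs y)); last exact: cf.
    move=> A /nbhs_ballP[r /= r0 rA].
    have Hc (i : 'I_n) : nultra [set k | `|y i 0 - x k i 0| <= r / 2].
      have r2 : 0 < r / 2 by rewrite divr_gt0.
      exact: (proj1 (@cvgrPdist_le _ _ _ _ _ _ _) (xy i) _ r2).
    have : nultra [set k | forall i, `|y i 0 - x k i 0| <= r / 2].
      exact: filter_forall.
    apply: filterS => k Hk; apply: rA; rewrite -ball_normE/=.
    apply: (@le_lt_trans _ _ (r / 2)); last by rewrite ltr_pdivrMr// ltr_pMr// ltr1n.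
    apply: mx_norm_le => [|i i0]; first by rewrite divr_ge0// ltW.
    by rewrite ord1 !mxE; exact: Hk.
  have : e / 2 <= f j y.
    rewrite -(cvg_lim _ cfj)//; apply: limr_ge; first exact: cvgP cfj.
    apply: nultra_oo; exists j => // k /= jk; have [_ h] := xP k.
    by rewrite (le_trans (ltW h))// fd.
  by apply/negP; rewrite -ltNge; lra.
exists k.
apply: (@le_trans _ _ (Lam (fun x => e / 2 + Num.min (dot x x / M) 1))).
  apply: Lle => //; first by apply: bcD; [exact: bc_cst|exact: bc_cut].
  move=> x; have [xM|xM] := leP (dot x x) M.
    by rewrite (le_trans (Hk x xM))// lerDl le_min ler01 divr_ge0 ?dot_ge0// ltW.
  have -> : Num.min (dot x x / M) 1 = 1.
    by apply/min_idPr; rewrite ler_pdivlMr// mul1r ltW.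
  by have /andP[_ h] := f01 k x; rewrite (le_trans h)// lerDr ltW.
rewrite LD//; [|exact: bc_cst|exact: bc_cut].
by rewrite Lcst; have := Ltight M0; lra.
Qed.

(** No compact support is imposed: the test functions are global, and control at infinity comes from
    tightness through [Lam_dini]. *)
Definition test G f := [/\ bc f, forall x, 0 <= f x <= 1 & forall x, ~ G x -> f x = 0].
Definition lam G : R := sup [set Lam f | f in test G].

Let test0 G : test G (fun=> 0).
Proof. by split => //; [exact: bc_cst|move=> x; rewrite lexx ler01]. Qed.

Let Lam01 G f : test G f -> 0 <= Lam f <= 1.
Proof.
move=> [bf f01 _]; apply/andP; split; [rewrite -(Lcst 0)|rewrite -L1]; apply: Lle => //.
- exact: bc_cst.
- by move=> x; have /andP[] := f01 x.
- exact: bc_cst.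
- by move=> x; have /andP[] := f01 x.
Qed.

Let lam_sup G : has_sup [set Lam f | f in test G].
Proof.
split; first by exists (Lam (fun=> 0)); exists (fun=> 0).
by exists 1 => _ [f tf <-]; have /andP[] := Lam01 tf.
Qed.

Let le_lam G f : test G f -> Lam f <= lam G.
Proof. by move=> tf; apply: (sup_upper_bound (lam_sup G)); exists f. Qed.

Let lam_le G c : (forall f, test G f -> Lam f <= c) -> lam G <= c.
Proof. by move=> H; apply: sup_le_ub => [|_ [f tf <-]]; [exact: (lam_sup G).1|exact: H]. Qed.

Let lam_ge0 G : 0 <= lam G.
Proof. by rewrite -(Lcst 0); exact: le_lam (test0 G). Qed.

Let lam_approx G (e : R) : 0 < e -> exists2 f, test G f & lam G - e <= Lam f.
Proof.
move=> e0; have [_ [f tf <-] h] := sup_adherent e0 (lam_sup G).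
by exists f => //; rewrite ltW.
Qed.

Let bump G k x : R := Num.min (k%:R * gap G x) 1.

Let bump_test G k : test G (bump G k).
Proof.
split.
- apply: bc_continuous_min => //; last by move=> x; rewrite mulr_ge0// gap_ge0.
  move=> x; have Fx : Filter (nbhs x) by exact: nbhs_filter.
  exact: (@cvgM _ _ _ Fx _ _ _ _ (cvg_cst _) (@gap_continuous _ _ G x)).
- by move=> x; rewrite le_min mulr_ge0 ?gap_ge0//= ler01/= ge_min lexx orbT.
- by move=> x nG; rewrite /bump gap_out// mulr0; apply/min_idPl.
Qed.

(** Countable subadditivity with a finite sum and an error. A nearly optimal [f] for the union
    exceeds the sum of the first bumps by a sequence decreasing to 0, to which [Lam_dini]
    applies. *)
Let lam_bigcup (G : nat -> set 'cV[R]_n) : (forall i, open (G i)) ->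
  forall (e : R), 0 < e -> exists m, lam (\bigcup_i G i) <= \sum_(i < m) lam (G i) + e.
Proof.
move=> oG e e0; have e2 : 0 < e / 2 by rewrite divr_gt0.
have [f tf fl] := lam_approx (\bigcup_i G i) e2; have [bf f01 fout] := tf.
pose s m x := \sum_(i < m) bump (G i) m x.
have bb i m : bc (bump (G i) m) by have [] := bump_test (G i) m.
have bs m : bc (s m) by apply: bc_sum.
pose h m x := f x + -1 * Num.min (f x) (s m x).
have bh m : bc (h m) by apply: bcD => //; apply: bcZ; exact: bc_min.
have s0 m x : 0 <= s m x.
  by apply: sumr_ge0 => i _; have [_ /(_ x)/andP[]] := bump_test (G i) m.
have sm j k x : (j <= k)%N -> s j x <= s k x.
  move=> jk; rewrite /s -(big_mkord xpredT (fun i => bump (G i) j x)) -(big_mkord xpredT (fun i => bump (G i) k x)).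
  rewrite (big_cat_nat _ jk)//= -[leLHS]addr0; apply: lerD.
    by apply: ler_sum => i _; rewrite /bump le_min !ge_min lexx orbT andbT ler_wpM2r ?gap_ge0// ler_nat.
  by apply: sumr_ge0 => i _; have [_ /(_ x)/andP[]] := bump_test (G i) k.
have hE m x : h m x = f x - Num.min (f x) (s m x) by rewrite /h mulN1r.
have [k hk] : exists k, Lam (h k) <= e / 2.
  apply: Lam_dini => //.
  - move=> k x; rewrite hE subr_ge0 ge_min lexx/= lerBlDr.
    have /andP[f0 f1] := f01 x; rewrite (le_trans f1)// lerDl le_min f0//=.
  - move=> j k x jk; rewrite !hE lerD2l lerN2 le_min ge_min lexx/= ge_min sm//= orbT//.
  - move=> x d d0; have [[i _ Gi]|nG] := pselect ((\bigcup_i G i) x); last first.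
      exists 0%N; rewrite hE fout//; rewrite (_ : Num.min 0 _ = 0) ?subrr ?ltW//.
      by apply/min_idPl.
    have gp := gap_gt0 (oG i) Gi.
    pose k := maxn i.+1 (Num.truncn ((gap (G i) x)^-1)).+1.
    exists k; rewrite hE.
    have : 1 <= s k x.
      have ik : (i < k)%N by rewrite leq_max leqnn.
      rewrite /s (bigD1 (Ordinal ik))//= (_ : bump (G i) k x = 1).
        by rewrite lerDl; apply: sumr_ge0 => l _; have [_ /(_ x)/andP[]] := bump_test (G l) k.
      apply/min_idPr; rewrite -ler_pdivrMr// mul1r.
      by rewrite (le_trans (ltW (truncnS_gt _)))// ler_nat leq_max leqnn orbT.
    move=> s1; have /andP[_ f1] := f01 x.
    rewrite (_ : Num.min (f x) _ = f x) ?subrr ?ltW//.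
    by apply/min_idPl; rewrite (le_trans f1).
exists k.
have : Lam f <= Lam (fun x => h k x + s k x).
  apply: Lle => //; first exact: bcD.
  move=> x; rewrite hE; have : Num.min (f x) (s k x) <= s k x by rewrite ge_min lexx orbT.
  by lra.
rewrite LD// Lam_sum//.
have : \sum_(i < k) Lam (bump (G i) k) <= \sum_(i < k) lam (G i).
  by apply: ler_sum => i _; exact: le_lam (bump_test _ _).
by lra.
Qed.

Definition outer (A : set 'cV[R]_n) : \bar R := ereal_inf [set (lam G)%:E | G in [set G | open G /\ A `<=` G]].

Let lam_mono G G' : G `<=` G' -> lam G <= lam G'.
Proof.
move=> GG'; apply: lam_le => f [bf f01 fo]; apply: le_lam; split => // x nG'.
by apply: fo => Gx; apply: nG'; exact: GG'.
Qed.

Let outer_open G : open G -> outer G = (lam G)%:E.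
Proof.
move=> oG; apply/eqP; rewrite eq_le; apply/andP; split.
  by apply: ereal_inf_lbound; exists G => //; split.
by apply: le_ereal_inf_tmp => _ [G' [_ GG'] <-]; rewrite lee_fin; exact: lam_mono.
Qed.

Let outer_ge0 A : (0 <= outer A)%E.
Proof. by apply: le_ereal_inf_tmp => _ [G _ <-]; rewrite lee_fin. Qed.

Let outer_le1 A : (outer A <= 1)%E.
Proof.
apply: (@le_trans _ _ (lam setT)%:E).
  apply: ereal_inf_lbound; exists setT => //; split => //; exact: openT.
by rewrite lee_fin; apply: lam_le => f /Lam01/andP[].
Qed.

Let outer0 : outer set0 = 0%E.
Proof.
rewrite outer_open; last exact: open0.
congr EFin; apply/eqP; rewrite eq_le lam_ge0 andbT; apply: lam_le => f [bf f01 f0].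
by rewrite (_ : f = fun=> 0) ?Lcst//; apply/funext => x; exact: f0.
Qed.

Let outer_mono : {homo outer : A B / A `<=` B >-> (A <= B)%E}.
Proof.
move=> A B AB; apply: le_ereal_inf_tmp => _ [G [oG BG] <-]; apply: ereal_inf_lbound.
by exists G => //; split => //; exact: subset_trans BG.
Qed.

Let outer_fin A : outer A \is a fin_num.
Proof. by rewrite ge0_fin_numE// (le_lt_trans (outer_le1 A))// ltry. Qed.

Let outer_approx A (e : R) : 0 < e -> exists G, [/\ open G, A `<=` G & ((lam G)%:E <= outer A + e%:E)%E].
Proof.
move=> e0; have [_ [G [oG AG] <-] h] := lb_ereal_inf_adherent e0 (outer_fin A).
by exists G; split => //; exact: ltW.
Qed.

Let outer_subadd : sigma_subadditive outer.
Proof.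
move=> F; apply/lee_addgt0Pr => e e0.
have e2 : 0 < e / 2 by rewrite divr_gt0.
have ei i : 0 < e / 2 / (2 ^ i.+1)%:R by rewrite divr_gt0// ltr0n expn_gt0.
have [G GP] := choice (fun i => outer_approx (F i) (ei i)).
have oG i : open (G i) by have [] := GP i.
apply: (@le_trans _ _ (outer (\bigcup_i G i))).
  by apply: outer_mono; apply: subset_bigcup => i _; have [] := GP i.
rewrite outer_open; last by apply: bigcup_open.
have [m hm] := lam_bigcup oG e2.
apply: (@le_trans _ _ (\sum_(i < m) lam (G i) + e / 2)%:E); first by rewrite lee_fin.
rewrite [e in leRHS]splitr !EFinD addeA leeD2r// -sumEFin.
apply: le_trans (epsilon_trick _ _ (ltW e2)) => //.
apply: le_trans (nneseries_lim_ge m _); last by move=> i _ _; rewrite adde_ge0// lee_fin ltW.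
by rewrite big_mkord; apply: lee_sum => i _; have [] := GP i.
Qed.

HB.instance Definition _ := isOuterMeasure.Build R 'cV[R]_n outer
  outer0 outer_ge0 outer_mono outer_subadd.

Let outer_meas : {outer_measure set 'cV[R]_n -> \bar R} := outer.

(** Let [V] be a good open cover of [A] and [f] nearly optimal for the part of [V] in [G]. The open
    set [Q] where [f < dl] covers [A] outside [G]; if [g] is nearly optimal for [Q], then
    [f + g <= 1 + dl] everywhere, and [(f + g) / (1 + dl)] is a test function for [V]. So the two
    pieces together weigh little more than [V]. *)
Let open_caratheodory G : open G -> outer_meas.-caratheodory G.
Proof.
move=> oG; apply: le_caratheodory_measurable => A.
rewrite -[leLHS]/(outer (A `&` G) + outer (A `&` ~` G))%E -[leRHS]/(outer A).
apply/lee_addgt0Pr => e e0; have e4 : 0 < e / 4 by rewrite divr_gt0.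
have [V [oV AV lV]] := outer_approx A e4.
have [f [bf f01 fo] fl] := lam_approx (V `&` G) e4.
pose dl : R := Num.min (e / 4) 1.
have dl0 : 0 < dl by rewrite lt_min e4 ltr01.
pose Q := V `&` [set x | f x < dl].
have oQ : open Q by apply: openI => //; exact: (@open_lt_cont _ _ f dl bf.1).
have [g [bg g01 go] gl] := lam_approx Q e4.
have AG : (outer (A `&` G) <= (lam (V `&` G))%:E)%E.
  by rewrite -outer_open; [apply: outer_mono; exact: setSI|exact: openI].
have AnG : (outer (A `&` ~` G) <= (lam Q)%:E)%E.
  rewrite -outer_open//; apply: outer_mono => x [Ax nG]; split; first exact: AV.
  by rewrite /= fo// => -[_ Gx]; apply: nG.
have key : Lam f + Lam g <= (1 + dl) * lam V.
  have d1 : 0 < 1 + dl by rewrite addr_gt0.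
  rewrite -LD// mulrC -ler_pdivrMr// mulrC -LZ; last exact: bcD.
  apply: le_lam; split.
  - by apply: bcZ; exact: bcD.
  - move=> x; have /andP[f0 f1] := f01 x; have /andP[g0 g1] := g01 x.
    rewrite mulr_ge0 ?invr_ge0 ?(ltW d1) ?addr_ge0//= mulrC ler_pdivrMr// mul1r.
    have [Qx|nQ] := pselect (Q x); first by have [_ /= h] := Qx; lra.
    by rewrite (go _ nQ) addr0 (le_trans f1)// lerDl ltW.
  - move=> x nV; rewrite fo; last by case.
    by rewrite go ?addr0 ?mulr0//; case.
have lV1 : lam V <= 1 by apply: lam_le => h /Lam01/andP[].
have dle : dl <= e / 4 by rewrite ge_min lexx.
have dlV : dl * lam V <= e / 4.
  by apply: le_trans dle; rewrite -[leRHS]mulr1 ler_wpM2l// ltW.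
apply: le_trans (leeD AG AnG) _; rewrite -EFinD.
apply: (@le_trans _ _ ((lam V)%:E + (3 * e / 4)%:E)%E).
  by rewrite -EFinD lee_fin; lra.
apply: (@le_trans _ _ (outer A + (e / 4)%:E + (3 * e / 4)%:E)%E); first by rewrite leeD2r.
by rewrite -addeA -EFinD (_ : e / 4 + 3 * e / 4 = e)//; field.
Qed.

Let borel_caratheodory (A : set (borel R n)) : measurable A -> outer_meas.-caratheodory A.
Proof.
move=> mA; have : <<s @open 'cV[R]_n >> A by [].
apply: (smallest_sub (@sigma_algebra_measurable _ (caratheodory_type outer_meas))).
by move=> G; exact: open_caratheodory.
Qed.

Let outerT : outer setT = 1%E.
Proof.
apply/eqP; rewrite eq_le outer_le1 outer_open; last exact: openT.
rewrite lee_fin -{1}L1; apply: le_lam; split; first exact: bc_cst.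
  by move=> x; rewrite ler01 lexx.
by move=> x nT; case: nT.
Qed.

Definition riesz (A : set (borel R n)) : \bar R := outer A.

Let riesz0 : riesz set0 = 0%E. Proof. exact: outer0. Qed.
Let riesz_ge0 A : (0 <= riesz A)%E. Proof. exact: outer_ge0. Qed.
Let riesz_sigma_additive : semi_sigma_additive riesz.
Proof.
move=> F mF tF mUF.
exact: (@caratheodory_measure_sigma_additive _ _ outer_meas F
  (fun i => borel_caratheodory (mF i)) tF (borel_caratheodory mUF)).
Qed.

HB.instance Definition _ := isMeasure.Build _ (borel R n) R riesz riesz0 riesz_ge0 riesz_sigma_additive.
HB.instance Definition _ := Measure_isProbability.Build _ (borel R n) R riesz outerT.

Let mu : probability (borel R n) R := riesz.

(** Up to a layer of height [1 / m], [f] is the mean of the indicators of [U j], on which the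
    clipped layer [F j] equals 1; hence the measure of [U j] is at most [Lam (F j)], and the layers
    add up to [m * f]. *)
Let Ex_le_Lam f : bc f -> (forall x, 0 <= f x <= 1) -> Ex mu f <= Lam f.
Proof.
move=> bf f01; have [cf _] := bf.
have bdd_bc g : bc g -> bdd (g : borel R n -> R).
  by move=> [cg [M gM]]; split; [exact: continuous_borel|exists M].
apply/ler_addgt0Pr => e e0.
pose m := (Num.truncn e^-1).+1.
have m0 : 0 < m%:R :> R by rewrite ltr0n.
have me : m%:R^-1 <= e.
  by rewrite -[leRHS]invrK lef_pV2 ?posrE ?invr_gt0// ltW// truncnS_gt.
pose F (j : 'I_m) x := Num.min (Num.max (m%:R * f x - j%:R) 0) 1.
have F01 j x : 0 <= F j x <= 1.
  by rewrite /F le_min le_max lexx orbT ler01/= ge_min lexx orbT.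
have bF j : bc (F j).
  have -> : F j = (fun x => Num.min (-1 * Num.min (-1 * (m%:R * f x + - j%:R)) 0) 1).
    apply/funext => x; rewrite /F; congr (Num.min _ _).
    by rewrite !mulN1r -[RHS]/(- Num.min _ _) oppr_min opprK oppr0.
  apply: bc_min; last exact: bc_cst.
  apply: bcZ; apply: bc_min; last exact: bc_cst.
  by apply: bcZ; apply: bcD; [exact: bcZ|exact: bc_cst].
have sumF x : m%:R * f x = \sum_(j < m) F j x.
  have /andP[f0 f1] := f01 x.
  have mf1 : m%:R * f x <= m%:R by rewrite -[leRHS]mulr1 ler_wpM2l// ltW.
  have mf0 : 0 <= m%:R * f x by rewrite mulr_ge0// ltW.
  by rewrite /F {1}(clip_sum mf0 mf1).
pose U (j : 'I_m) := [set x | j.+1%:R / m%:R < f x].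
have oU j : open (U j) by exact: open_gt_cont.
have mU j : measurable (U j : set (borel R n)) by apply: sub_sigma_algebra; exact: oU.
have muU j : fine (mu (U j)) <= Lam (F j).
  have -> : mu (U j) = (lam (U j))%:E by exact: outer_open.
  rewrite /=; apply: lam_le => g [bg g01 go]; apply: Lle => // x.
  have [Ux|nU] := pselect (U j x); last by rewrite go//; have /andP[] := F01 j x.
  have /andP[_ g1] := g01 x; rewrite (le_trans g1)// le_min lexx andbT le_max lerBrDr.
  by move: Ux; rewrite /U/= ltr_pdivrMr// [f x * _]mulrC -natr1 addrC => /ltW ->.
have bI j : bdd (\1_(U j) : borel R n -> R).
  by split; [exact: measurable_indic|exists 1 => x; rewrite indicE; case: (_ \in _); rewrite ?normr1// normr0].
have fle x : f x <= m%:R^-1 + m%:R^-1 * \sum_(j < m) \1_(U j) x.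
  have : m%:R * f x <= 1 + \sum_(j < m) \1_(U j) x.
    have /andP[f0 f1] := f01 x.
    have mf1 : m%:R * f x <= m%:R by rewrite -[leRHS]mulr1 ler_wpM2l// ltW.
    apply: le_trans (count_sum mf1) _; rewrite lerD2l; apply: ler_sum => j _.
    rewrite indicE; case: ifPn => // jm; rewrite mem_set//.
    by rewrite /U/= ltr_pdivrMr// mulrC.
  by rewrite -ler_pdivlMl// mulrDr mulr1.
apply: (@le_trans _ _ (Ex mu (fun x => m%:R^-1 + m%:R^-1 * \sum_(j < m) \1_(U j) x))).
  apply: Ex_le => //; first exact: bdd_bc.
  by apply: bddD; [exact: bdd_cst|apply: bddZ; exact: bdd_sum].
rewrite ExD; [|exact: bdd_cst|by apply: bddZ; exact: bdd_sum].
rewrite Ex_cst ExZ; last exact: bdd_sum.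
rewrite Ex_sum// addrC lerD//.
rewrite ler_pdivrMl// -LZ// (_ : (fun x => _ * f x) = (fun x => \sum_(j < m) F j x)); last exact/funext.
rewrite Lam_sum//; apply: ler_sum => j _.
by rewrite /Ex integral_indic// setIT; exact: muU.
Qed.

Lemma riesz_daniell : exists nu : probability (borel R n) R,
  forall f, bc f -> Ex nu f = Lam f.
Proof.
exists mu => f bf.
have bdd_bc g : bc g -> bdd (g : borel R n -> R).
  by move=> [cg [M gM]]; split; [exact: continuous_borel|exists M].
have H g : bc g -> (forall x, 0 <= g x <= 1) -> Ex mu g = Lam g.
  move=> bg g01; apply/eqP; rewrite eq_le Ex_le_Lam//=.
  have bg' : bc (fun x => 1 + -1 * g x) by apply: bcD; [exact: bc_cst|exact: bcZ].
  have := Ex_le_Lam bg'; rewrite LD; [|exact: bc_cst|exact: bcZ].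
  rewrite LZ// L1 ExD; [|exact: bdd_cst|by apply: bddZ; exact: bdd_bc].
  rewrite ExZ ?Ex_cst; last exact: bdd_bc.
  have g01' x : 0 <= 1 + -1 * g x <= 1 by have /andP[] := g01 x; lra.
  by move=> /(_ g01'); lra.
have [cf [M fM]] := bf.
pose M' := M + 1.
have M0 : 0 <= M by exact: le_trans (normr_ge0 _) (fM 0).
have M'0 : 0 < 2 * M' by rewrite /M' mulr_gt0// ltr_wpDl.
pose g x := (2 * M')^-1 * (f x + M').
have bfM : bc (fun x => f x + M') by apply: bcD => //; exact: bc_cst.
have bg : bc g by exact: bcZ.
have g01 x : 0 <= g x <= 1.
  have := fM x; rewrite ler_norml => /andP[h1 h2].
  rewrite /g mulr_ge0 ?invr_ge0 ?(ltW M'0)//=; last by rewrite /M'; lra.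
  by rewrite ler_pdivrMl// mulr1 /M'; lra.
have := H g bg g01; rewrite /g ExZ; last exact: bdd_bc.
rewrite LZ// => /(mulfI _); rewrite invr_eq0 gt_eqF// => /(_ isT).
rewrite ExD; [|exact: bdd_bc|exact: bdd_cst].
by rewrite LD; [|by []|exact: bc_cst]; rewrite Ex_cst Lcst => /addIr.
Qed.

End Riesz.

Section KrylovBogoliubov.
Context {R : realType} {n : nat}.
Variables (B : {bilinear 'cV[R]_n -> 'cV[R]_n -> 'cV[R]_n}) (A S : 'M[R]_n).
Variables (d : measure_display) (Omega : measurableType d) (P : probability Omega R).
Variables (W : R -> Omega -> 'cV[R]_n) (X : 'cV[R]_n -> R -> Omega -> 'cV[R]_n).
Hypothesis W_bm : brownian_motion P W.
Hypothesis X_sol : forall x : 'cV[R]_n, sde_solution P B A S W x (X x).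
Hypothesis B_cons : forall x : 'cV[R]_n, dot x (B x x) = 0.
Hypothesis A_ge0 : forall x : 'cV[R]_n, 0 <= dot x (A *m x).
Implicit Types (f g : 'cV[R]_n -> R).
Let T (t : R) f z := Tr P X t f z.

Let cut (M : R) (x : 'cV[R]_n) : R := Num.min (dot x x) M.

Let cdot : continuous (fun x : 'cV[R]_n => dot x x).
Proof. exact: loc_lip_continuous loc_lip_dot. Qed.

Let bc_cut M : 0 <= M -> bc (cut M).
Proof. by move=> M0; apply: bc_continuous_min => //; move=> x; exact: dot_ge0. Qed.

Lemma Tr_le t f g z : 0 <= t -> bc f -> bc g -> (forall x, f x <= g x) -> T t f z <= T t g z.
Proof. by move=> t0 bf bg fg; apply: Ex_le => //; exact: (bdd_X X_sol). Qed.

Lemma TrD t f g z : 0 <= t -> bc f -> bc g -> T t (fun x => f x + g x) z = T t f z + T t g z.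
Proof. by move=> t0 bf bg; rewrite /T /Tr ExD//; exact: (bdd_X X_sol). Qed.

Lemma TrZ t c f z : 0 <= t -> bc f -> T t (fun x => c * f x) z = c * T t f z.
Proof. by move=> t0 bf; rewrite /T /Tr ExZ//; exact: (bdd_X X_sol). Qed.

Lemma Tr_cst t c z : T t (fun=> c) z = c.
Proof. exact: Ex_cst. Qed.

Lemma markov0 s t f z : 0 <= s -> 0 <= t -> bc f -> (forall x, 0 <= f x) ->
  T (s + t) f z = T s (T t f) z.
Proof.
rewrite le_eqVlt => /predU1P[<-|s0]; last first.
  rewrite le_eqVlt => /predU1P[<-|t0]; last exact: (markov W_bm X_sol).
  move=> bf f0; rewrite addr0 /T; congr Tr.
  by apply/funext => x; rewrite (Tr0 W_bm X_sol).
move=> t0 bf f0; rewrite add0r /T [RHS](Tr0 W_bm X_sol)//.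
exact: (Tr_bc W_bm X_sol).
Qed.

Lemma markov_bc s t f z : 0 <= s -> 0 <= t -> bc f -> T (s + t) f z = T s (T t f) z.
Proof.
move=> s0 t0 bf; have [cf [M fM]] := bf.
have bg : bc (fun x => f x + M) by apply: bcD => //; exact: bc_cst.
have g0 x : 0 <= f x + M by have := fM x; rewrite ler_norml => /andP[]; lra.
have := @markov0 s t _ z s0 t0 bg g0.
rewrite (TrD _ (addr_ge0 s0 t0) bf (bc_cst M)).
have -> : T t (fun x => f x + M) = (fun x => T t f x + M).
  by apply/funext => x; rewrite TrD// ?Tr_cst//; exact: bc_cst.
rewrite TrD//; [|exact: (Tr_bc W_bm X_sol)|exact: bc_cst].
by rewrite !Tr_cst => /addIr.
Qed.

Variable C : R.
Hypothesis C0 : 0 <= C.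
Hypothesis bound : forall (N : nat) (M : R), 0 <= M -> \sum_(k < N) T k%:R (cut M) 0 <= N%:R * C + C.

Let dy (N k : nat) : R := k%:R / (2 ^ N)%:R.
Let M2 N : 0 < (2 ^ N)%:R :> R. Proof. by rewrite ltr0n expn_gt0. Qed.
Let dy0 N k : 0 <= dy N k. Proof. by rewrite divr_ge0// ltW. Qed.
Let K2 : R := projT1 (cid (let: ex_intro2 K K0 HK := energy2 W_bm X_sol B_cons A_ge0 in ex_intro _ K (conj K0 HK))).
Let K20 : 0 <= K2. Proof. by rewrite /K2; case: cid => ? []. Qed.
Let en2 z t : 0 <= t -> (\int[P]_w (dot (X z t w) (X z t w))%:E <= (dot z z + K2 * t)%:E)%E.
Proof. by rewrite /K2; case: cid => ? [? H]; exact: H. Qed.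

(** The hypothesis on averages concerns integer times only; this carries it to the times in between,
    at the cost of the energy created in a unit of time. *)
Let cut_time M s t : 0 <= M -> 0 <= s -> 0 <= t <= 1 -> T (s + t) (cut M) 0 <= T s (cut M) 0 + K2.
Proof.
move=> M0 s0 /andP[t0 t1]; rewrite markov_bc//; last exact: bc_cut.
rewrite -[X in _ + X](Tr_cst s K2 0) -TrD//; [|exact: bc_cut|exact: bc_cst].
apply: Tr_le => //; first by apply: (Tr_bc W_bm X_sol) => //; exact: bc_cut.
  by apply: bcD; [exact: bc_cut|exact: bc_cst].
move=> x; have bX : bdd (fun w => cut M (X x t w)) by apply: (bdd_X X_sol) => //; exact: bc_cut.
have [xM|xM] := leP M (dot x x).
  rewrite /cut (_ : Num.min (dot x x) M = M); last exact/min_idPr.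
  rewrite (@le_trans _ _ M)// ?lerDl// -[leRHS](Tr_cst t M x); apply: Tr_le => //.
  - exact: bc_cut.
  - exact: bc_cst.
  - by move=> y; rewrite /cut ge_min lexx orbT.
rewrite /cut (_ : Num.min (dot x x) M = dot x x); last by apply/min_idPl; exact: ltW.
rewrite -lee_fin EFin_Ex//; apply: (@le_trans _ _ (\int[P]_w (dot (X x t w) (X x t w))%:E)%E).
  apply: ge0_le_integral => //.
  - by move=> w _; rewrite lee_fin le_min dot_ge0.
  - by apply/measurable_EFinP; have [] := bX.
  - by apply/measurable_EFinP; exact: (mX_comp X_sol x t0 cdot).
  - by move=> w _; rewrite lee_fin /cut ge_min lexx.
apply: le_trans (en2 x t0) _; rewrite lee_fin lerD2l -[leRHS]mulr1.
exact: ler_wpM2l.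
Qed.

(** Averages over the grid of mesh [2^-N] on [[0, N]], for the solution started at 0. Any dyadic
    time is eventually a multiple of the mesh, so one sequence of averages gives invariance under
    all dyadic times. *)
Let avg (N : nat) f : R := (N * 2 ^ N)%:R^-1 * \sum_(k < N * 2 ^ N) T (dy N k) f 0.

Let avg_cut N M : (0 < N)%N -> 0 <= M -> avg N (cut M) <= 2 * C + K2.
Proof.
move=> N0 M0.
have NM : 0 < (N * 2 ^ N)%:R :> R by rewrite ltr0n muln_gt0 N0 expn_gt0.
have H L : \sum_(k < L * 2 ^ N) T (dy N k) (cut M) 0 <=
    (2 ^ N)%:R * \sum_(k < L) (T k%:R (cut M) 0 + K2).
  elim: L => [|L ih]; first by rewrite mul0n !big_ord0 mulr0.
  rewrite mulSnr big_split_ord/= big_ord_recr/= mulrDr lerD//.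
  rewrite mulr_natl -[X in _ *+ X]card_ord -sumr_const; apply: ler_sum => j _.
  have -> : dy N (L * 2 ^ N + j) = L%:R + dy N j.
    by rewrite /dy natrD natrM mulrDl mulfK// gt_eqF.
  apply: cut_time => //; rewrite dy0/= ler_pdivrMr// mul1r ler_nat ltnW//.
rewrite /avg ler_pdivrMl//; apply: le_trans (H N) _.
rewrite natrM [N%:R * _]mulrC -mulrA ler_wpM2l//.
rewrite big_split/= sumr_const card_ord.
have := bound N M0; move: (\sum_(i < N) _) => q; rewrite -mulr_natl.
have : C <= N%:R * C by rewrite -[leLHS]mul1r ler_wpM2r// ler1n.
lra.
Qed.

Let avg_lin f g a : bc f -> bc g -> forall N, avg N (fun x => f x + a * g x) = avg N f + a * avg N g.
Proof.
move=> bf bg N; rewrite /avg; set c := _^-1.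
transitivity (c * (\sum_(k < N * 2 ^ N) T (dy N k) f 0 + a * \sum_(k < N * 2 ^ N) T (dy N k) g 0)).
  congr (_ * _); rewrite mulr_sumr -big_split/=; apply: eq_bigr => k _.
  by rewrite TrD ?TrZ//; exact: bcZ.
by rewrite mulrDr; congr (_ + _); rewrite mulrCA.
Qed.

Let avg_le N f g : bc f -> bc g -> (forall x, f x <= g x) -> avg N f <= avg N g.
Proof.
move=> bf bg fg; rewrite /avg ler_wpM2l ?invr_ge0//; apply: ler_sum => k _.
exact: Tr_le.
Qed.

Let avg_cst N c : (0 < N)%N -> avg N (fun=> c) = c.
Proof.
move=> N0; rewrite /avg (eq_bigr (fun=> c)); last by move=> k _; rewrite Tr_cst.
by rewrite sumr_const card_ord -[X in _ * X]mulr_natl mulKf// pnatr_eq0 muln_eq0 negb_or -!lt0n N0 expn_gt0.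
Qed.

Let avg_bound f M : bc f -> (forall x, `|f x| <= M) -> forall N, `|avg N f| <= M.
Proof.
move=> bf fM [|N].
  by rewrite /avg mul0n big_ord0 mulr0 normr0 (le_trans (normr_ge0 _) (fM 0)).
rewrite ler_norml; apply/andP; split.
  rewrite -(@avg_cst N.+1 (- M))//; apply: avg_le => //; first exact: bc_cst.
  by move=> x; have := fM x; rewrite ler_norml => /andP[].
rewrite -[leRHS](@avg_cst N.+1 M)//; apply: avg_le => //; first exact: bc_cst.
by move=> x; have := fM x; rewrite ler_norml => /andP[].
Qed.

Let Lam f : R := ulim (avg ^~ f).

Let Lam_cvg f : bc f -> (avg ^~ f) @ nultra --> Lam f.
Proof. by move=> bf; have [_ [M fM]] := bf; exact: (@ulim_cvg _ _ M (avg_bound bf fM)). Qed.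

Let Lam_lin f g a : bc f -> bc g -> Lam (fun x => f x + a * g x) = Lam f + a * Lam g.
Proof.
move=> bf bg; apply: ulimP; under eq_fun do rewrite avg_lin//.
by apply: cvgD; [exact: Lam_cvg|apply: cvgM; [exact: cvg_cst|exact: Lam_cvg]].
Qed.

Let pos_N : nultra [set N | (0 < N)%N].
Proof. by apply: nultra_oo; exists 1%N. Qed.

Let Lam_le f g : bc f -> bc g -> (forall x, f x <= g x) -> Lam f <= Lam g.
Proof.
move=> bf bg fg; have cf := Lam_cvg bf; have cg := Lam_cvg bg.
rewrite -(cvg_lim _ cf)// -(cvg_lim _ cg)//; apply: ler_lim; [exact: cvgP cf|exact: cvgP cg|].
by apply: filterE => N; exact: avg_le.
Qed.

Let Lam_cst c : Lam (fun=> c) = c.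
Proof.
apply: ulimP; apply: cvg_near_cst.
by apply: filterS pos_N => N /avg_cst ->.
Qed.

Let Lam_cut M : 0 <= M -> Lam (cut M) <= 2 * C + K2.
Proof.
move=> M0; have cf := Lam_cvg (bc_cut M0); rewrite -(cvg_lim _ cf)//.
apply: limr_le; first exact: cvgP cf.
by apply: filterS pos_N => N N0; exact: avg_cut.
Qed.

(** A shift by [r] grid points changes the sum only by [r] terms at either end; relative to the
    length of the grid this is [2 M dy / N]. *)
Let Lam_inv_dyadic f a q : bc f -> Lam (T (dy q a) f) = Lam f.
Proof.
move=> bf; have [cf [M fM]] := bf.
have M0 : 0 <= M by exact: le_trans (normr_ge0 _) (fM 0).
have bTf : bc (T (dy q a) f) by exact: (Tr_bc W_bm X_sol).
apply: ulimP.
have H N : (q <= N)%N -> (0 < N)%N -> `|avg N (T (dy q a) f) - avg N f| <= 2 * M * dy q a * N%:R^-1.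
  move=> qN N0.
  have NM : 0 < (N * 2 ^ N)%:R :> R by rewrite ltr0n muln_gt0 N0 expn_gt0.
  pose r := (a * 2 ^ (N - q))%N.
  have dr : dy q a = dy N r.
    rewrite /dy /r natrM -mulrA; congr (_ * _).
    by rewrite -{2}(subnK qN) expnD natrM invfM mulrA divff ?mul1r// pnatr_eq0 -lt0n expn_gt0.
  have shiftT k : T (dy N k) (T (dy q a) f) 0 = T (dy N (k + r)) f 0.
    by rewrite dr -markov_bc// /dy natrD mulrDl.
  rewrite /avg -mulrBr normrM ger0_norm ?invr_ge0//.
  rewrite (eq_bigr (fun k : 'I_(N * 2 ^ N) => T (dy N (k + r)) f 0)); last by move=> k _; exact: shiftT.
  set L := (N * 2 ^ N)%N.
  have -> : \sum_(k < L) T (dy N (k + r)) f 0 - \sum_(k < L) T (dy N k) f 0 =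
     \sum_(k < r) T (dy N (L + k)) f 0 - \sum_(k < r) T (dy N k) f 0.
    have swap (F : nat -> R) p q0 : \sum_(k < p + q0) F k = \sum_(k < p) F k + \sum_(k < q0) F (p + k)%N.
      by rewrite big_split_ord.
    have e1 := swap (fun k => T (dy N k) f 0) L r.
    have e2 := swap (fun k => T (dy N k) f 0) r L.
    rewrite addnC in e1; rewrite e1 in e2.
    rewrite (eq_bigr (fun k : 'I_L => T (dy N (r + k)) f 0)); last by move=> k _; rewrite addnC.
    by lra.
  have bnd k : `|T (dy N k) f 0| <= M by apply: Ex_norm_le => //; exact: (bdd_X X_sol).
  apply: (@le_trans _ _ (L%:R^-1 * (r%:R * (2 * M)))).
    rewrite ler_wpM2l ?invr_ge0//.
    rewrite (le_trans (ler_normB _ _))// (_ : r%:R * (2 * M) = r%:R * M + r%:R * M); last by ring.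
    by rewrite lerD// (le_trans (ler_norm_sum _ _ _))// mulr_natl -[X in _ *+ X]card_ord -sumr_const ler_sum.
  rewrite dr /dy /L natrM le_eqVlt; apply/orP; left; apply/eqP.
  by field; rewrite !gt_eqF// ltr0n.
have c1 : (fun N => avg N (T (dy q a) f) - avg N f) @ nultra --> (0 : R).
  apply: cvg_nultra; apply/cvgrPdist_le => e e0.
  pose D : R := 2 * M * dy q a.
  have D0 : 0 <= D by rewrite !mulr_ge0.
  pose N1 := (Num.truncn (D / e)).+1.
  exists (maxn q N1) => // N /=; rewrite geq_max => /andP[qN N1N].
  have N0 : (0 < N)%N by exact: leq_trans N1N.
  rewrite sub0r normrN (le_trans (H N qN N0))// -/D ler_pdivrMr ?ltr0n// mulrC -ler_pdivrMr//.
  by rewrite (le_trans (ltW (truncnS_gt _)))// ler_nat.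
have H2 : (fun N => (avg N (T (dy q a) f) - avg N f) + avg N f) @ nultra --> 0 + Lam f.
  by apply: cvgD => //; exact: Lam_cvg.
rewrite add0r in H2; rewrite (_ : (avg ^~ (T (dy q a) f)) =
  (fun N => (avg N (T (dy q a) f) - avg N f) + avg N f))//.
by apply/funext => N; rewrite subrK.
Qed.

(** Invariance holds for dyadic times and bounded continuous functions, then for all times by
    continuity of the paths, then for indicators of open sets as limits of bumps, and finally for
    Borel sets by the pi-lambda theorem. *)
Lemma krylov_bogoliubov : exists mu : probability (borel R n) R,
  [/\ stationary P X mu & forall M : R, 0 <= M -> Ex mu (fun x => Num.min (dot x x) M) <= 2 * C + K2].
Proof.
have LD f g : bc f -> bc g -> Lam (fun x => f x + g x) = Lam f + Lam g.
  move=> bf bg; rewrite -[Lam g]mul1r -Lam_lin//; congr Lam; apply/funext => x.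
  by rewrite mul1r.
have LZ c f : bc f -> Lam (fun x => c * f x) = c * Lam f.
  move=> bf; rewrite -[RHS]add0r -(Lam_cst 0) -Lam_lin//; last exact: bc_cst.
  by congr Lam; apply/funext => x; rewrite add0r.
have Ltight (M : R) : 0 < M -> Lam (fun x => Num.min (dot x x / M) 1) <= (2 * C + K2) / M.
  move=> M0; rewrite (_ : (fun x => _) = (fun x => M^-1 * cut M x)); last first.
    apply/funext => x; rewrite /cut minEle [in RHS]minEle ler_pdivrMr// mul1r.
    by case: ifP => _; rewrite mulrC// divff// gt_eqF.
  rewrite LZ; last exact: bc_cut (ltW M0).
  by rewrite mulrC ler_pM2r ?invr_gt0//; exact: Lam_cut (ltW M0).
have [mu muE] := riesz_daniell LD LZ Lam_le (Lam_cst 1) Ltight.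
exists mu; split; last by move=> M M0; rewrite (muE _ (bc_cut M0)); exact: Lam_cut.
have bdd_bc g : bc g -> bdd (g : borel R n -> R).
  by move=> [cg [M gM]]; split; [exact: continuous_borel|exists M].
have inv t f : 0 <= t -> bc f -> Ex mu (T t f) = Ex mu f.
  move=> t0 bf; have [cf [M fM]] := bf.
  pose a N := Num.truncn (t * (2 ^ N)%:R).
  pose s N := dy N (a N).
  have s0 N : 0 <= s N by exact: dy0.
  have st : s @ \oo --> t.
    apply/cvgrPdist_le => e e0.
    pose N1 := (Num.truncn (e^-1)).+1.
    exists N1 => // N /= N1N.
    have tN0 : 0 <= t * (2 ^ N)%:R by rewrite mulr_ge0.
    have h1 : s N <= t by rewrite /s ler_pdivrMr// truncn_le.
    have h2 : t <= s N + ((2 ^ N)%:R)^-1.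
      by rewrite /s -[X in _ + X]mul1r -mulrDl ler_pdivlMr// natr1 ltW// truncnS_gt.
    have h3 : ((2 ^ N)%:R)^-1 <= e.
      rewrite -[leRHS]invrK lef_pV2 ?posrE ?invr_gt0//.
      rewrite (le_trans (ltW (truncnS_gt _)))// ler_nat (leq_trans N1N)// ltnW//.
      exact: ltn_expl.
    by rewrite ger0_norm ?subr_ge0//; lra.
  have c1 : (fun N => Ex mu (T (s N) f)) @ \oo --> Ex mu (T t f).
    apply: (@Ex_cvg _ _ _ mu (fun N => T (s N) f) _ M).
    - by move=> N; apply: continuous_borel; have [] := Tr_bc W_bm X_sol (s0 N) bf.
    - by move=> N x; apply: Ex_norm_le => //; exact: (bdd_X X_sol).
    - by apply: bdd_bc; exact: (Tr_bc W_bm X_sol).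
    - by apply: aeW => x; have h := Tr_time W_bm X_sol bf s0 t0 st; exact: h.
  have e N : Ex mu (T (s N) f) = Ex mu f.
    rewrite !muE//; [exact: Lam_inv_dyadic|exact: (Tr_bc W_bm X_sol)].
  have c2 : (fun N => Ex mu (T (s N) f)) @ \oo --> Ex mu f.
    by under eq_fun do rewrite e; exact: cvg_cst.
  by rewrite -(cvg_lim _ c1)// (cvg_lim _ c2).
move=> t t0; pose kap (E : set (borel R n)) (x : borel R n) := Ex P (fun w => \1_E (X x t w) : R).
have mXt x : measurable_fun setT (X x t : Omega -> borel R n) by exact: (mX X_sol).
have bI (E : set (borel R n)) : measurable E -> bdd (\1_E : borel R n -> R).
  move=> mE; split; first exact: measurable_indic.
  by exists 1 => x; rewrite indicE; case: (_ \in _); rewrite ?normr1// normr0.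
have bIX (E : set (borel R n)) x : measurable E -> bdd (fun w => \1_E (X x t w) : R).
  move=> mE; have [mi [M iM]] := bI E mE; split; last by exists M => w.
  exact: (measurableT_comp mi (mXt x)).
have I1 (E : set (borel R n)) x : `|\1_E x : R| <= 1.
  by rewrite indicE; case: (_ \in _); rewrite ?normr1// normr0.
(* The class carries measurability of [kap E] along with invariance, since it too has to be obtained
   from the continuous case by limits. *)
pose H := [set E : set (borel R n) | [/\ measurable E, measurable_fun setT (kap E) &
  Ex mu (kap E) = Ex mu (\1_E : borel R n -> R)]].
have kap1 E x : measurable E -> `|kap E x| <= 1.
  by move=> mE; apply: Ex_norm_le; [exact: bIX|move=> w; exact: I1].
have bk E : measurable E -> measurable_fun setT (kap E) -> bdd (kap E).
  by move=> mE mk; split => //; exists 1 => x; exact: kap1.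
have limH (F : nat -> borel R n -> R) (E : set (borel R n)) : measurable E ->
    (forall k, measurable_fun setT (F k)) -> (forall k (x : borel R n), `|F k x| <= 1) ->
    (forall x : borel R n, (fun k => F k x) @ \oo --> (\1_E x : R)) ->
    (forall k, measurable_fun setT (fun x : borel R n => Ex P (fun w => F k (X x t w)))) ->
    (forall k, Ex mu (fun x : borel R n => Ex P (fun w => F k (X x t w))) = Ex mu (F k)) -> H E.
  move=> mE mF F1 Fc mk Fk.
  have bFX k x : bdd (fun w => F k (X x t w)).
    by split; [exact: (measurableT_comp (mF k) (mXt x))|exists 1].
  have cx x : (fun k => Ex P (fun w => F k (X x t w))) @ \oo --> kap E x.
    apply: (@Ex_cvg _ _ _ P (fun k w => F k (X x t w)) _ 1) => //.
    - by move=> k; have [] := bFX k x.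
    - exact: bIX.
    - by apply: aeW => w; exact: Fc.
  have mkE : measurable_fun setT (kap E).
    have mk' k : measurable_fun setT (fun x : borel R n => (Ex P (fun w => F k (X x t w)))%:E).
      exact/measurable_EFinP.
    have cx' (x : borel R n) : setT x -> (fun k => (Ex P (fun w => F k (X x t w)))%:E) @ \oo --> (kap E x)%:E.
      by move=> _; apply: cvg_EFin; [exact: nearW|exact: cx].
    apply/measurable_EFinP => m Y mY.
    exact: (@emeasurable_fun_cvg _ (borel R n) R setT (fun k (x : borel R n) => (Ex P (fun w => F k (X x t w)))%:E)
      (fun x : borel R n => (kap E x)%:E) mk' cx' m Y mY).
  split => //.
  have c1 : (fun k => Ex mu (fun x : borel R n => Ex P (fun w => F k (X x t w)))) @ \oo --> Ex mu (kap E).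
    apply: (@Ex_cvg _ _ _ mu (fun k (x : borel R n) => Ex P (fun w => F k (X x t w))) _ 1) => //.
    - by move=> k x; apply: Ex_norm_le.
    - exact: bk.
    - by apply: aeW => x; exact: cx.
  have c2 : (fun k => Ex mu (F k)) @ \oo --> Ex mu (\1_E : borel R n -> R).
    apply: (@Ex_cvg _ _ _ mu F _ 1) => //; first exact: bI.
    exact: aeW.
  rewrite (_ : (fun k => Ex mu (F k)) = (fun k => Ex mu (fun x : borel R n => Ex P (fun w => F k (X x t w))))) in c2.
    by rewrite -(cvg_lim _ c1)// -(cvg_lim _ c2).
  by apply/funext => k; rewrite Fk.
have openH G : open (G : set 'cV[R]_n) -> H G.
  move=> oG; pose F k (x : 'cV[R]_n) := Num.min (k%:R * gap G x) 1.
  have bF k : bc (F k).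
    apply: bc_continuous_min => //; last by move=> x; rewrite mulr_ge0// gap_ge0.
    move=> x; have Fx : Filter (nbhs x) by exact: nbhs_filter.
    exact: (@cvgM _ _ _ Fx _ _ _ _ (cvg_cst _) (@gap_continuous _ _ G x)).
  apply: (limH F).
  - exact: sub_sigma_algebra.
  - by move=> k; have [] := bdd_bc _ (bF k).
  - by move=> k x; rewrite ger0_norm ?ge_min ?lexx ?orbT// le_min mulr_ge0 ?gap_ge0/=.
  - move=> x; rewrite indicE; apply: cvg_near_cst; have [Gx|nG] := pselect (G x).
      rewrite mem_set//=; exists (Num.truncn ((gap G x)^-1)).+1 => // k /= hk.
      apply/min_idPr; rewrite -ler_pdivrMr ?gap_gt0// mul1r.
      by rewrite (le_trans (ltW (truncnS_gt _)))// ler_nat.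
    rewrite memNset//=; apply: nearW => k; rewrite /F gap_out// mulr0; exact/min_idPl.
  - by move=> k; apply: continuous_borel; have [] := Tr_bc W_bm X_sol t0 (bF k).
  - by move=> k; exact: inv.
have lamH : lambda_system setT H.
  split => //.
  - exact: openH openT.
  - move=> E F FE [mE mkE kE] [mF mkF kF].
    have ind x : \1_(E `\` F) x = \1_E x + -1 * \1_F x :> R.
      rewrite !indicE in_setD; have [Fx|nF] := boolP (x \in F).
        by rewrite andbF (_ : x \in E) ?mulr1 ?addrN// inE; apply: FE; rewrite inE in Fx.
      by rewrite andbT mulr0 addr0.
    have mEF : measurable (E `\` F) by exact: measurableD.
    have kind : kap (E `\` F) = (fun x => kap E x + -1 * kap F x).
      apply/funext => x; rewrite /kap -ExZ; last exact: bIX.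
      rewrite -ExD; [|exact: bIX|by apply: bddZ; exact: bIX].
      by congr Ex; apply/funext => w; rewrite ind.
    split => //; first by rewrite kind; apply: measurable_funD => //; exact: measurable_funM.
    rewrite kind (_ : \1_(E `\` F) = (fun x => \1_E x + -1 * \1_F x)); last by apply/funext => x; exact: ind.
    rewrite ExD; [|exact: bk|by apply: bddZ; exact: bk].
    rewrite ExD; [|exact: bI|by apply: bddZ; exact: bI].
    by rewrite !ExZ; [rewrite kE kF|exact: bI|exact: bk].
  - move=> F ndF HF; apply: (limH (fun k => \1_(F k))).
    + by apply: bigcup_measurable => k _; have [] := HF k.
    + by move=> k; apply: measurable_indic; have [] := HF k.
    + by move=> k x; exact: I1.
    + move=> x; rewrite indicE; apply: cvg_near_cst; have [[k _ Fk]|nF] := pselect ((\bigcup_k F k) x).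
        rewrite mem_set/=; last by exists k.
        exists k => // j /= kj; rewrite indicE mem_set//.
        by have /subsetPset := ndF _ _ kj; exact.
      rewrite memNset//=; apply: nearW => j; rewrite indicE memNset// => Fj.
      by apply: nF; exists j.
    + by move=> k; have [] := HF k.
    + by move=> k; have [] := HF k.
move=> E mE.
have : H E.
  have oI : setI_closed (@open 'cV[R]_n) by move=> G G' oG oG'; exact: openI.
  exact: (@lambda_system_subset _ _ oI setT H lamH openH (fun _ _ => @subsetT _ _)).
move=> [_ mk kE]; rewrite /dual_semigroup /semigroup.
transitivity (\int[mu]_x (kap E x)%:E)%E.
  by apply: eq_integral => x _; rewrite /kap EFin_Ex//; exact: bIX.
rewrite -EFin_Ex; last exact: bk.
by rewrite kE EFin_Ex ?integral_indic ?setIT//; exact: bI.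
Qed.

End KrylovBogoliubov.

(** * Dissipation on a unit window *)

Section Shell.
Context {R : realType} {n : nat}.
Variables (B : {bilinear 'cV[R]_n -> 'cV[R]_n -> 'cV[R]_n}) (A S : 'M[R]_n).
Variables (d : measure_display) (Omega : measurableType d) (P : probability Omega R).
Variables (W : R -> Omega -> 'cV[R]_n) (X : 'cV[R]_n -> R -> Omega -> 'cV[R]_n).
Hypothesis W_bm : brownian_motion P W.
Hypothesis X_sol : forall x : 'cV[R]_n, sde_solution P B A S W x (X x).
Let b := drift B A.

(* The probability in [gsum_spread]. *)
Definition pz : R := (4 * (32 * 64 * 64) * (64 * 64))^-1.

Lemma pz_gt0 : 0 < pz.
Proof. by rewrite invr_gt0 !mulr_gt0. Qed.

Definition dyadic (kj : nat * nat) : R := kj.2%:R / (2 ^ kj.1)%:R.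

Lemma dyadic_ge0 kj : 0 <= dyadic kj.
Proof. by rewrite divr_ge0. Qed.

(** Only dyadic times occur, so that the event is a countable union of measurable ones; continuity
    of the path extends the bound to the unit interval in [quiet_bound]. *)
Definition noisy (M : R) : set Omega := \bigcup_kj
  [set w | dyadic kj <= 1 /\ ~ forall i, `|W (dyadic kj) w i 0| <= M].

Lemma measurable_le_cst (f : Omega -> R) (c : R) : measurable_fun setT f ->
  measurable [set w | f w <= c].
Proof.
move=> mf; rewrite (_ : [set w | _] = f @^-1` [set x | x <= c])//.
rewrite -[X in measurable X]setTI; apply: mf => //.
by rewrite -set_itvNyc; exact: measurable_itv.
Qed.

Lemma measurable_noisy M : measurable (noisy M).
Proof.
have [mW _ _ _] := W_bm.
apply: countable_bigcupT_measurable => // kj.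
have [k1|k1] := boolP (dyadic kj <= 1); last first.
  rewrite (_ : [set w | _] = set0); first exact: measurable0.
  by apply/seteqP; split => [w []|//].
rewrite (_ : [set w | _] = ~` [set w | forall i, `|W (dyadic kj) w i 0| <= M]); last first.
  by apply/seteqP; split => [w []|w nw] //; split.
apply: measurableC; apply: (@measurable_forall _ Omega _ (fun i w => `|W (dyadic kj) w i 0| <= M)) => i.
apply: measurable_le_cst; apply: measurableT_comp; first exact: normr_measurable.
by apply: measurable_cV_coord; exact: mW (dyadic_ge0 _).
Qed.

Lemma noisy_small (e : R) : 0 < e -> exists2 M : R, 0 <= M & Ex P (\1_(noisy M)) <= e.
Proof.
move=> e0.
have mI M : measurable_fun setT (\1_(noisy M) : Omega -> R).
  exact: measurable_indic (measurable_noisy M).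
have c : (fun k : nat => Ex P (\1_(noisy k%:R))) @ \oo --> Ex P (fun=> 0).
  apply: (@Ex_cvg _ _ _ P (fun k => \1_(noisy k%:R)) _ 1) => //.
  - by move=> k w; rewrite indicE; case: (_ \in _); rewrite ?normr1// normr0.
  - exact: bdd_cst.
  apply: filterS (ae_good W_bm X_sol 0) => w [_ wc _ _ _].
  have [M M0 wM] := path_bounded 1 wc.
  apply: cvg_near_cst; exists (Num.truncn M).+1 => // k /= kM.
  rewrite indicE memNset//; case=> kj _ /= [kj1]; apply => i.
  rewrite (le_trans (le_coord_norm _ _ _))// (le_trans (wM _ _)) ?dyadic_ge0//.
  by rewrite (le_trans (ltW (truncnS_gt _)))// ler_nat.
rewrite Ex_cst in c; move/cvgrPdist_le/(_ _ e0) : c => -[k _ /(_ k (leqnn k))] h.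
exists k%:R => //; apply: le_trans h; rewrite sub0r normrN ler_norm//.
Qed.

Lemma quiet_bound M w : path_cont (fun t => W t w) -> 0 <= M -> ~ noisy M w ->
  forall t, 0 <= t <= 1 -> `|W t w| <= M.
Proof.
move=> wc M0 nw t /andP[t0 t1]; apply/ler_addgt0Pr => e e0.
have [h h0 H] := wc t e t0 e0.
pose k := (Num.truncn (h^-1)).+1.
pose j := Num.truncn (t * (2 ^ k)%:R).
have k2 : 0 < (2 ^ k)%:R :> R by rewrite ltr0n expn_gt0.
have tk0 : 0 <= t * (2 ^ k)%:R by rewrite mulr_ge0.
have h1 : dyadic (k, j) <= t by rewrite /dyadic ler_pdivrMr// truncn_le.
have h2 : t <= dyadic (k, j) + ((2 ^ k)%:R)^-1.
  by rewrite /dyadic -[X in _ + X]mul1r -mulrDl ler_pdivlMr// natr1 ltW// truncnS_gt.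
have h3 : ((2 ^ k)%:R)^-1 < h.
  rewrite -[ltRHS]invrK ltf_pV2 ?posrE ?invr_gt0//.
  rewrite (lt_trans (truncnS_gt _))// ltr_nat; exact: ltn_expl.
have /H : `|dyadic (k, j) - t| < h.
  by rewrite distrC ger0_norm ?subr_ge0//; lra.
move=> /(_ (dyadic_ge0 _)) h4.
have h5 : `|W (dyadic (k, j)) w| <= M.
  apply: contrapT => h5; apply: nw; exists (k, j) => //; split; first exact: le_trans h1 t1.
  by move=> h6; apply: h5; apply: mx_norm_le => // i i0; rewrite ord1.
rewrite -[W t w](subrK (W (dyadic (k, j)) w)) (le_trans (ler_normD _ _))//.
by rewrite distrC addrC lerD.
Qed.

Definition defect (z : 'cV[R]_n) (dl : R) (j : nat) (w : Omega) : 'cV[R]_n :=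
  X z (j.+1%:R * dl) w - X z (j%:R * dl) w - dl *: b (X z (j%:R * dl) w)
    - grid_noise S (fun t => W t w) dl j.

Definition rough z dl m : set Omega :=
  ~` [set w | forall p : 'I_m * 'I_n, `|defect z dl p.1 w p.2 0| <= dl].

Lemma measurable_rough z dl m : 0 <= dl -> measurable (rough z dl m).
Proof.
move=> dl0; have [mW _ _ _] := W_bm; have [C C0 bC] := drift_quad_lip B A.
apply: measurableC; apply: (@measurable_forall _ Omega _
  (fun (p : 'I_m * 'I_n) w => `|defect z dl p.1 w p.2 0| <= dl)) => -[j i] /=.
have md : measurable_fun setT (fun w => `|defect z dl j w i 0|).
  apply: measurableT_comp; first exact: normr_measurable.
  rewrite (_ : (fun w => _) = (fun w => X z (j.+1%:R * dl) w i 0 - X z (j%:R * dl) w i 0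
     - dl * b (X z (j%:R * dl) w) i 0 - grid_noise S (fun t => W t w) dl j i 0)); last first.
    by apply/funext => w; rewrite /defect; move: (b _) (grid_noise _ _ _ _) => ? ?; rewrite !mxE.
  have mx t k : 0 <= t -> measurable_fun setT (fun w => X z t w k 0 : R).
    by move=> t0; apply: measurable_cV_coord; exact: (mX X_sol).
  have j0 k : 0 <= k%:R * dl by rewrite mulr_ge0.
  apply: measurable_funB; last first.
    by apply: measurable_mulmx => k; exact: (measurable_increment mW).
  apply: measurable_funB; first by apply: measurable_funB; exact: mx.
  apply: measurable_funM; first exact: measurable_cst.
  exact: (@measurable_comp_continuous _ _ _ _ (fun x => b x i 0 : R)
    (fun w => X z (j%:R * dl) w) (loc_lip_continuous (quad_lip_loc_lip i C0 bC)) (fun k => mx _ k (j0 j))).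
exact: measurable_le_cst md.
Qed.

(** On a good path [path_ode_grid] with tolerance 1 excludes roughness for every fine mesh, so the
    indicator tends to 0 almost surely. The rate is not uniform in [z], whence a threshold that
    depends on [z]. *)
Lemma rough_small z (tau : R) (e : R) : 0 < tau -> 0 < e ->
  exists m0, forall m, (m0 < m)%N -> Ex P (\1_(rough z (tau / m%:R) m)) <= e.
Proof.
move=> tau0 e0.
have mI m : measurable_fun setT (\1_(rough z (tau / m%:R) m) : Omega -> R).
  by apply: measurable_indic; apply: measurable_rough; rewrite divr_ge0// ltW.
have c : (fun m : nat => Ex P (\1_(rough z (tau / m%:R) m))) @ \oo --> Ex P (fun=> 0).
  apply: (@Ex_cvg _ _ _ P (fun m => \1_(rough z (tau / m%:R) m)) _ 1) => //.
  - by move=> k w; rewrite indicE; case: (_ \in _); rewrite ?normr1// normr0.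
  - exact: bdd_cst.
  apply: filterS (ae_good W_bm X_sol z) => w [_ _ xo _ _].
  have [N0 HN] := path_ode_grid (ltW tau0) ltr01 xo.
  apply: cvg_near_cst; exists N0.+1 => // m /= mN0.
  rewrite indicE memNset// => -[] -[j i] /=; apply: le_trans (le_coord_norm _ _ _) _.
  by have := HN m mN0 j (ltn_ord j); rewrite mul1r.
rewrite Ex_cst in c; move/cvgrPdist_le/(_ _ e0) : c => -[k _ Hk].
exists k => m km; have := Hk m (ltnW km); rewrite sub0r normrN.
exact: le_trans (ler_norm _).
Qed.

Lemma noise_spread (dl : R) m (a : nat -> 'cV[R]_n) (c0 : R) : 0 < dl ->
  exists D : set Omega, [/\ measurable D, pz <= Ex P (\1_D) &
  forall w, D w -> dl / 128 * \sum_(j < m) dot (S^T *m a j) (S^T *m a j) <=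
    (c0 + \sum_(j < m) dot (a j) (grid_noise S (fun t => W t w) dl j)) ^+ 2].
Proof.
move=> dl0; have [mW _ _ gW] := W_bm.
pose Z (p : 'I_m * 'I_n) w : R :=
  (W (0 + partial (fun=> dl) p.1.+1) w - W (0 + partial (fun=> dl) p.1) w) p.2 0.
have mZ p : measurable_fun setT (Z p).
  by apply: measurable_increment => //; rewrite add0r partial_cst mulr_ge0// ltW.
have ZE (F : 'I_m * 'I_n -> set R) : (forall p, measurable (F p)) ->
    P [set w | forall p, F p (Z p w)] = (\big[*%E/1%E]_p normal_prob 0 (Num.sqrt dl) (F p))%E.
  by move=> mF; exact: (@gaussian_family _ _ _ _ P W gW m (fun=> dl) 0 F (lexx 0) (fun=> dl0) mF).
pose c (p : 'I_m * 'I_n) : R := (S^T *m a p.1) p.2 0.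
pose s := index_enum ('I_m * 'I_n)%type.
pose D := [set w | dl / 128 * ss c s <= (c0 + gsum Z c s w) ^+ 2].
have us : uniq s by exact: index_enum_uniq.
have ssE : ss c s = \sum_(j < m) dot (S^T *m a j) (S^T *m a j).
  rewrite /ss /s; transitivity (\sum_(j < m) \sum_(i < n) c (j, i) ^+ 2).
    by rewrite pair_bigA/=; apply: eq_bigr => -[].
  by apply: eq_bigr => j _; apply: eq_bigr => i _; rewrite /c/= expr2.
have gE w : gsum Z c s w = \sum_(j < m) dot (a j) (grid_noise S (fun t => W t w) dl j).
  rewrite /gsum /s; transitivity (\sum_(j < m) \sum_(i < n) c (j, i) * Z (j, i) w).
    by rewrite pair_bigA/=; apply: eq_bigr => -[].
  apply: eq_bigr => j _; rewrite /grid_noise dotC dot_mulmx dotC; apply: eq_bigr => i _.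
  by rewrite /c /Z/= !add0r !partial_cst.
have mD : measurable D.
  have mg : measurable_fun setT (fun w => (c0 + gsum Z c s w) ^+ 2).
    apply: measurable_funX; apply: measurable_funD => //; exact: measurable_gsum.
  rewrite (_ : D = (fun w => (c0 + gsum Z c s w) ^+ 2) @^-1` [set x | dl / 128 * ss c s <= x])//.
  rewrite -[X in measurable X]setTI; apply: mg => //.
  by rewrite -set_itvcy; exact: measurable_itv.
exists D; split => //.
  rewrite -lee_fin EFin_Ex; last first.
    split; first exact: measurable_indic.
    by exists 1 => w; rewrite indicE; case: (_ \in _); rewrite ?normr1// normr0.
  by rewrite integral_indic// setIT; exact: (gsum_spread dl0 mZ ZE c c0 us).
by move=> w; rewrite /D/= ssE gE.
Qed.

(** The event on which the tested noise is not too small has probability at least [pz]. Removing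
    noisy and rough paths, at most [pz / 4] each, leaves [pz / 2], and there an average of [phi]
    below [k1] is excluded because it would make the tested noise too small. *)
Lemma average_lower M z (tau k1 : R) (phi : 'cV[R]_n -> R) :
  bc phi -> (forall x, 0 <= phi x) -> 0 < tau -> 0 < k1 -> Ex P (\1_(noisy M)) <= pz / 4 ->
  (exists m1, forall m, (m1 < m)%N -> exists (a : nat -> 'cV[R]_n) (c0 : R), forall w,
     let x j := X z (j%:R * (tau / m%:R)) w in
     good B A S W X z w -> ~ noisy M w -> (forall j, (j < m)%N -> `|defect z (tau / m%:R) j w| <= tau / m%:R) ->
     m%:R^-1 * \sum_(j < m) phi (x j) < k1 ->
     (c0 + \sum_(j < m) dot (a j) (grid_noise S (fun t => W t w) (tau / m%:R) j)) ^+ 2 <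
      tau / m%:R / 128 * \sum_(j < m) dot (S^T *m a j) (S^T *m a j)) ->
  exists m0, forall m, (m0 < m)%N ->
    k1 * (pz / 2) <= m%:R^-1 * \sum_(j < m) Tr P X (j%:R * (tau / m%:R)) phi z.
Proof.
move=> bphi phi0 tau0 k10 HM [m1 H1].
have p4 : 0 < pz / 4 by rewrite divr_gt0// pz_gt0.
have [m2 H2] := rough_small z tau0 p4.
exists (maxn m1 m2) => m; rewrite gtn_max => /andP[m1m m2m].
have m0 : 0 < m%:R :> R by rewrite ltr0n (leq_ltn_trans _ m1m).
have dl0 : 0 < tau / m%:R by rewrite divr_gt0.
have [a [c0 Ha]] := H1 m m1m.
have [D [mD pD HD]] := @noise_spread (tau / m%:R) m a c0 dl0.
have bI (E : set Omega) : measurable E -> bdd (\1_E : Omega -> R).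
  move=> mE; split; first exact: measurable_indic.
  by exists 1 => w; rewrite indicE; case: (_ \in _); rewrite ?normr1// normr0.
have bX j : bdd (fun w => phi (X z (j%:R * (tau / m%:R)) w)).
  by apply: (bdd_X X_sol) => //; rewrite mulr_ge0// ltW.
pose av w := m%:R^-1 * \sum_(j < m) phi (X z (j%:R * (tau / m%:R)) w).
have bav : bdd av by apply: bddZ; apply: bdd_sum.
have bN := bI _ (measurable_noisy M).
have bR := bI _ (@measurable_rough z (tau / m%:R) m (ltW dl0)).
have key : Ex P (\1_D) <= Ex P (fun w => k1^-1 * av w + (\1_(noisy M) w + \1_(rough z (tau / m%:R) m) w)).
  apply: Ex_le_ae; first exact: bI.
    by apply: bddD; [exact: bddZ|exact: bddD].
  apply: filterS (ae_good W_bm X_sol z) => w gw.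
  have av0 : 0 <= k1^-1 * av w.
    apply: mulr_ge0; first by rewrite invr_ge0 ltW.
    by apply: mulr_ge0; [rewrite invr_ge0|apply: sumr_ge0].
  have i0 (E : set Omega) : 0 <= \1_E w :> R by rewrite indicE.
  have [Dw|nD] := pselect (D w); last by rewrite indicE memNset// !addr_ge0.
  rewrite indicE mem_set//=.
  have [Nw|nN] := pselect (noisy M w).
    by rewrite [\1_(noisy M) w]indicE mem_set//= addrCA lerDl addr_ge0.
  have [Rw|nR] := pselect (rough z (tau / m%:R) m w).
    by rewrite [\1_(rough _ _ _) w]indicE mem_set//= addrA lerDr addr_ge0.
  have [avk|avk] := leP k1 (av w).
    apply: (@le_trans _ _ (k1^-1 * av w)); last by rewrite lerDl addr_ge0.
    by rewrite mulrC ler_pdivlMr// mul1r.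
  have := Ha w gw nN _ avk; move/contrapT : nR => nR.
  have dj j : (j < m)%N -> `|defect z (tau / m%:R) j w| <= tau / m%:R.
    move=> jm; apply: mx_norm_le; first exact: ltW.
    by move=> i i0'; rewrite ord1; exact: (nR (Ordinal jm, i)).
  move=> /(_ dj); have := HD w Dw; move=> h1 h2.
  by have := le_lt_trans h1 h2; rewrite ltxx.
have e2 : Ex P (fun w => k1^-1 * av w + (\1_(noisy M) w + \1_(rough z (tau / m%:R) m) w)) =
    k1^-1 * Ex P av + (Ex P (\1_(noisy M)) + Ex P (\1_(rough z (tau / m%:R) m))).
  rewrite ExD; [|exact: bddZ|exact: bddD].
  by rewrite ExZ// ExD.
have avE : Ex P av = m%:R^-1 * \sum_(j < m) Tr P X (j%:R * (tau / m%:R)) phi z.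
  by rewrite /av ExZ ?Ex_sum//; exact: bdd_sum.
rewrite -avE.
have R4 := H2 m m2m.
have : pz / 2 <= k1^-1 * Ex P av by move: key; rewrite e2; lra.
by rewrite [leRHS]mulrC ler_pdivlMr// mulrC.
Qed.

End Shell.

(* Keeps unification from unfolding the projections. *)
Opaque Pi_ker Pi_kerperp.

(** * Discrete paths over one window: kernel component, orthogonal component and duality *)

Section Window.
Context {R : realType} {n : nat}.
Variables (B : 'cV[R]_n -> 'cV[R]_n -> 'cV[R]_n) (A : 'M[R]_n).
Hypothesis BDl : forall u v w, B (u + v) w = B u w + B v w.
Hypothesis BDr : forall u v w, B w (u + v) = B w u + B w v.
Hypothesis BNl : forall u w, B (- u) w = - B u w.
Hypothesis BNr : forall u w, B w (- u) = - B w u.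
Hypothesis BL : forall x v, Lmx B x *m v = B x v + B v x.
Hypothesis A_psd : psd A.
Hypothesis B_ker0 : forall k : 'cV[R]_n, A *m k = 0 -> B k k = 0.
Let b := drift B A.
Let Pk := Pi_ker A.
Let Pp := Pi_kerperp A.

Variable c0 : R.
Hypothesis c01 : 1 <= c0.
Hypothesis c0n : n%:R <= c0.
Hypothesis c0B : forall u v : 'cV[R]_n, `|B u v| <= c0 * `|u| * `|v|.
Hypothesis c0k : forall v : 'cV[R]_n, `|Pk *m v| <= c0 * `|v|.
Hypothesis c0p : forall v : 'cV[R]_n, `|Pp *m v| <= c0 * `|v|.
Hypothesis c0A : forall v : 'cV[R]_n, `|A *m v| <= c0 * `|v|.

Let c00 : 0 <= c0. Proof. exact: le_trans c01. Qed.

Let B_split (z : 'cV[R]_n) : B z z = B (Pk *m z) (Pp *m z) + B (Pp *m z) (Pk *m z) + B (Pp *m z) (Pp *m z).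
Proof.
rewrite -[in LHS](Pi_kerD A z) -/Pk -/Pp.
have := B_ker0 (Pi_ker_in A z); rewrite -/Pk; move: (Pk *m z) (Pp *m z) => k y kk.
by rewrite BDl !BDr kk add0r addrA.
Qed.

(** As [B] vanishes on the diagonal of ker A, every term of the drift contains the orthogonal
    component at least once. *)
Lemma norm_drift z : `|b z| <= 3 * c0 ^+ 2 * (1 + `|z|) * `|Pp *m z|.
Proof.
rewrite /b /drift B_split -(mulmx_Pi_kerperp A z).
have k := c0k z; have p := c0p z; have y0 := normr_ge0 (Pp *m z); have z0 := normr_ge0 z.
have k0 := normr_ge0 (Pk *m z).
rewrite -/Pp; move: (Pk *m z) (Pp *m z) k p y0 k0 => kz yz k p y0 k0.
have h1 : `|B kz yz| <= c0 * (c0 * `|z|) * `|yz|.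
  by rewrite (le_trans (c0B _ _))// ler_wpM2r// ler_wpM2l.
have h2 : `|B yz kz| <= c0 * (c0 * `|z|) * `|yz|.
  by rewrite (le_trans (c0B _ _))// -!mulrA ler_wpM2l// mulrC [leRHS]mulrA ler_wpM2r.
have h3 : `|B yz yz| <= c0 * (c0 * `|z|) * `|yz|.
  by rewrite (le_trans (c0B _ _))// ler_wpM2r// ler_wpM2l.
have h4 : `|A *m yz| <= c0 ^+ 2 * `|yz|.
  rewrite (le_trans (c0A _))// ler_wpM2r// expr2 -[leLHS]mulr1 ler_wpM2l//.
apply: (@le_trans _ _ (c0 * (c0 * `|z|) * `|yz| + c0 * (c0 * `|z|) * `|yz| +
    c0 * (c0 * `|z|) * `|yz| + c0 ^+ 2 * `|yz|)).
  rewrite (le_trans (ler_normB _ _))// lerD//.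
  rewrite (le_trans (ler_normD _ _))// lerD//.
  by rewrite (le_trans (ler_normD _ _))// lerD.
rewrite -subr_ge0 (_ : _ - _ = 2 * (c0 ^+ 2 * `|yz|)); last by ring.
by rewrite !mulr_ge0// sqr_ge0.
Qed.

Lemma norm_perp_B (z : 'cV[R]_n) : `|Pk *m B (Pp *m z) (Pp *m z)| <= c0 ^+ 2 * `|Pp *m z| ^+ 2.
Proof.
rewrite (le_trans (c0k _))// expr2 -mulrA ler_wpM2l// (le_trans (c0B _ _))//.
by rewrite expr2 mulrA.
Qed.

(** Under the cross condition of case (ii) the kernel component is driven only by terms quadratic in
    the orthogonal one. Its motion is then controlled by the time average of [|y|^2], without a
    factor [|z|]. *)
Lemma Pi_ker_drift (z : 'cV[R]_n) :
  Pk *m (B (Pk *m z) (Pp *m z) + B (Pp *m z) (Pk *m z)) = 0 ->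
  Pk *m b z = Pk *m B (Pp *m z) (Pp *m z).
Proof.
move=> H; rewrite /b /drift B_split mulmxBr (Pi_ker_mulmx A_psd) subr0.
by rewrite mulmxDr H add0r.
Qed.

Definition rest (k0 z : 'cV[R]_n) : 'cV[R]_n := Pp *m b z - Lperp B A k0 *m (Pp *m z).

Lemma norm_rest k0 z : `|rest k0 z| <=
  3 * c0 ^+ 2 * (`|Pk *m z - k0| + `|Pp *m z| + 1) * `|Pp *m z|.
Proof.
have -> : rest k0 z = Pp *m (B (Pk *m z - k0) (Pp *m z) + B (Pp *m z) (Pk *m z - k0) +
    B (Pp *m z) (Pp *m z)) - A *m (Pp *m z).
  rewrite /rest /b /drift /Lperp -!mulmxA Pi_kerperp_idem BL mulmxBr.
  rewrite (Pi_kerperp_mulmx A_psd) -(mulmx_Pi_kerperp A z) B_split.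
  rewrite BDl BDr BNl BNr.
  move: (Pk *m z) (Pp *m z) => kz yz.
  move: (B kz yz) (B yz kz) (B yz yz) (B k0 yz) (B yz k0) (A *m yz) => a1 a2 a3 a4 a5 a6.
  rewrite -/Pp !mulmxDr !mulmxN.
  move: (Pp *m a1) (Pp *m a2) (Pp *m a3) (Pp *m a4) (Pp *m a5) => b1 b2 b3 b4 b5.
  by apply/matrixP => i j; rewrite !mxE; ring.
have y0 := normr_ge0 (Pp *m z); have d0 := normr_ge0 (Pk *m z - k0).
move: (Pk *m z - k0) d0 => D d0.
have h1 : `|Pp *m (B D (Pp *m z) + B (Pp *m z) D + B (Pp *m z) (Pp *m z))| <=
    c0 * (c0 * `|D| * `|Pp *m z| + c0 * `|Pp *m z| * `|D| + c0 * `|Pp *m z| * `|Pp *m z|).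
  rewrite (le_trans (c0p _))// ler_wpM2l// (le_trans (ler_normD _ _))// lerD//.
  by rewrite (le_trans (ler_normD _ _))// lerD.
have h4 : `|A *m (Pp *m z)| <= c0 ^+ 2 * `|Pp *m z|.
  rewrite (le_trans (c0A _))// ler_wpM2r// expr2 -[leLHS]mulr1 ler_wpM2l//.
rewrite (le_trans (ler_normB _ _))//; apply: le_trans (lerD h1 h4) _.
rewrite -subr_ge0 (_ : _ - _ = c0 ^+ 2 * `|D| * `|Pp *m z| + 2 * (c0 ^+ 2 * `|Pp *m z| * `|Pp *m z|) +
   2 * (c0 ^+ 2 * `|Pp *m z|)); last by ring.
by rewrite !addr_ge0// !mulr_ge0// sqr_ge0.
Qed.

Section Path.
Variables (x v : nat -> 'cV[R]_n) (m : nat) (dl M1 : R).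
Hypothesis dl0 : 0 <= dl.
Hypothesis x_step : forall j, (j < m)%N -> `|x j.+1 - x j - dl *: b (x j) - v j| <= dl.
Hypothesis v_sum : forall j, (j <= m)%N -> `|\sum_(i < j) v i| <= M1.

Lemma increment_sum j : x j - x 0%N = \sum_(i < j) (x i.+1 - x i - dl *: b (x i) - v i) +
    (dl *: (\sum_(i < j) b (x i)) + \sum_(i < j) v i).
Proof.
elim: j => [|j ih]; first by rewrite !big_ord0 scaler0 !addr0 subrr.
rewrite !big_ord_recr/=.
have -> : x j.+1 - x 0%N = (x j.+1 - x j) + (x j - x 0%N) by rewrite addrA subrK.
rewrite ih.
move: (\sum_(i < j) (x i.+1 - x i - dl *: b (x i) - v i)) (\sum_(i < j) b (x i)) (\sum_(i < j) v i)
  (b (x j)) (v j) (x j.+1) (x j) => a1 a2 a3 a4 a5 a6 a7.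
by apply/matrixP => k l; rewrite !mxE; ring.
Qed.

Lemma increment_le (Q : 'M[R]_n) : (forall u : 'cV[R]_n, `|Q *m u| <= c0 * `|u|) ->
  forall j, (j <= m)%N ->
  `|Q *m x j - Q *m x 0%N| <= dl * \sum_(i < j) `|Q *m b (x i)| + c0 * (M1 + j%:R * dl).
Proof.
move=> c0Q j jm.
rewrite -mulmxBr increment_sum !mulmxDr mulmx_sumr -scalemxAr mulmx_sumr.
have h1 : `|\sum_(i < j) Q *m (x i.+1 - x i - dl *: b (x i) - v i)| <= c0 * (j%:R * dl).
  rewrite (le_trans (ler_norm_sum _ _ _))// mulrCA mulr_natl -[X in _ *+ X]card_ord -sumr_const.
  apply: ler_sum => i _; rewrite (le_trans (c0Q _))// ler_wpM2l// x_step//.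
  exact: leq_trans (ltn_ord i) jm.
have h2 : `|dl *: (\sum_(i < j) Q *m b (x i))| <= dl * \sum_(i < j) `|Q *m b (x i)|.
  by rewrite normrZ ger0_norm// ler_wpM2l// ler_norm_sum.
have h3 : `|Q *m \sum_(i < j) v i| <= c0 * M1.
  by rewrite (le_trans (c0Q _))// ler_wpM2l// v_sum.
rewrite (le_trans (ler_normD _ _))//; have := ler_normD (dl *: (\sum_(i < j) Q *m b (x i))) (Q *m \sum_(i < j) v i).
by lra.
Qed.

Variable Xm : R.
Hypothesis x_le : forall j, (j <= m)%N -> `|x j| <= Xm.
Let y j : 'cV[R]_n := Pp *m x j.

Let Xm0 : 0 <= Xm. Proof. by have := x_le (leq0n m); apply: le_trans. Qed.
Let M10 : 0 <= M1. Proof. by have := v_sum (leq0n m); rewrite big_ord0 normr0. Qed.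

(** The hypothesis says that during [J] steps the orthogonal component moves by at most half of its
    initial size, so it stays above [Y0 / 2] and contributes to the average all that time. *)
Lemma persistence (Y0 : R) J : (J <= m)%N -> 0 <= Y0 -> Y0 <= `|y 0%N| ->
  J%:R * dl * (3 * c0 ^+ 4 * (1 + Xm) * Xm + c0) + c0 * M1 <= Y0 / 2 ->
  J%:R * dl * (Y0 ^+ 2 / 4) <= dl * \sum_(j < m) `|y j| ^+ 2.
Proof.
move=> Jm Y00 Y0y H.
have yj j : (j <= J)%N -> Y0 / 2 <= `|y j|.
  move=> jJ; have := increment_le c0p (leq_trans jJ Jm); rewrite -/(y j) -/(y 0%N) => h.
  have bs : \sum_(i < j) `|Pp *m b (x i)| <= j%:R * (3 * c0 ^+ 4 * (1 + Xm) * Xm).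
    rewrite mulr_natl -[X in _ *+ X]card_ord -sumr_const; apply: ler_sum => i _.
    have im : (i <= m)%N by rewrite (leq_trans (ltnW (ltn_ord i)))// (leq_trans jJ).
    have xi := x_le im; have x0 := normr_ge0 (x i).
    rewrite (le_trans (c0p _))//; apply: (@le_trans _ _ (c0 * (3 * c0 ^+ 2 * (1 + Xm) * (c0 * Xm)))); last first.
      by rewrite le_eqVlt; apply/orP; left; apply/eqP; ring.
    rewrite ler_wpM2l// (le_trans (norm_drift _))//; apply: ler_pM => //.
    - by rewrite !mulr_ge0 ?sqr_ge0// addr_ge0.
    - by rewrite ler_wpM2l ?mulr_ge0 ?sqr_ge0// lerD2l.
    - by rewrite (le_trans (c0p _))// ler_wpM2l.
  have jJR : j%:R <= J%:R :> R by rewrite ler_nat.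
  have G0 : 0 <= 3 * c0 ^+ 4 * (1 + Xm) * Xm.
    by rewrite !mulr_ge0 ?addr_ge0// -[c0 ^+ 4]/(c0 ^+ (2 * 2)) exprM sqr_ge0.
  have h5 : dl * \sum_(i < j) `|Pp *m b (x i)| <= J%:R * dl * (3 * c0 ^+ 4 * (1 + Xm) * Xm).
    rewrite -mulrA mulrCA ler_wpM2l// (le_trans bs)// ler_wpM2r//.
  have h6 : c0 * (j%:R * dl) <= c0 * (J%:R * dl) by rewrite ler_wpM2l// ler_wpM2r.
  have := lerB_dist (y 0%N) (y j); rewrite distrC => h7.
  by lra.
apply: (@le_trans _ _ (dl * \sum_(j < J) `|y j| ^+ 2)).
  rewrite -mulrA mulrCA ler_wpM2l// mulr_natl -[X in _ *+ X]card_ord -sumr_const.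
  apply: ler_sum => j _; have h := yj j (ltnW (ltn_ord j)).
  rewrite (_ : Y0 ^+ 2 / 4 = (Y0 / 2) ^+ 2); last by field.
  by rewrite lerXn2r ?nnegrE ?divr_ge0.
rewrite ler_wpM2l// -(subnKC Jm) big_split_ord/= lerDl.
by apply: sumr_ge0 => i _; rewrite sqr_ge0.
Qed.

Variables (K G1 G2 : R).
Hypothesis K1 : 1 <= K.
Hypothesis G10 : 0 <= G1.
Hypothesis G20 : 0 <= G2.
Hypothesis yK : dl * \sum_(j < m) `|y j| ^+ 2 <= K * (m%:R * dl).
Hypothesis bk : forall j, (j < m)%N -> `|Pk *m b (x j)| <= (G1 + G2 * `|y j|) * `|y j|.

Let tau := m%:R * dl.
Let tau0 : 0 <= tau. Proof. by rewrite mulr_ge0. Qed.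

Let y1 : dl * \sum_(j < m) `|y j| <= 2 * K * tau.
Proof.
apply: (@le_trans _ _ (dl * \sum_(j < m) (1 + `|y j| ^+ 2))).
  by rewrite ler_wpM2l//; apply: ler_sum => j _; have := sqr_ge0 (`|y j| - 1); have := sqr_ge0 (`|y j|); nra.
rewrite big_split/= mulrDr sumr_const card_ord -[X in _ * X]mulr_natl mulr1 [dl * _]mulrC.
rewrite -/tau; have : tau <= K * tau by rewrite -[leLHS]mul1r ler_wpM2r.
by move: yK; rewrite -/tau; lra.
Qed.

Definition drift_gap : R := 2 * G1 * K * tau + G2 * K * tau + c0 * (M1 + tau).

Lemma ker_increment j : (j <= m)%N -> `|Pk *m x j - Pk *m x 0%N| <= drift_gap.
Proof.
move=> jm; apply: le_trans (increment_le c0k jm) _.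
have h1 : c0 * (M1 + j%:R * dl) <= c0 * (M1 + tau).
  by rewrite ler_wpM2l// lerD2l ler_wpM2r// ler_nat.
have h2 : dl * \sum_(i < j) `|Pk *m b (x i)| <= dl * \sum_(i < m) (G1 + G2 * `|y i|) * `|y i|.
  rewrite ler_wpM2l//; apply: (@le_trans _ _ (\sum_(i < j) (G1 + G2 * `|y i|) * `|y i|)).
    by apply: ler_sum => i _; rewrite bk// (leq_trans (ltn_ord i)).
  rewrite -(subnKC jm) big_split_ord/= lerDl.
  by apply: sumr_ge0 => i _; rewrite mulr_ge0// addr_ge0// mulr_ge0.
have h3 : dl * \sum_(i < m) (G1 + G2 * `|y i|) * `|y i| =
   G1 * (dl * \sum_(i < m) `|y i|) + G2 * (dl * \sum_(i < m) `|y i| ^+ 2).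
  rewrite !mulr_sumr -big_split/=; apply: eq_bigr => i _; ring.
have h4 : G1 * (dl * \sum_(i < m) `|y i|) <= G1 * (2 * K * tau) by rewrite ler_wpM2l.
have h5 : G2 * (dl * \sum_(i < m) `|y i| ^+ 2) <= G2 * (K * tau) by rewrite ler_wpM2l.
by rewrite /drift_gap; lra.
Qed.

(** Summation by parts against a discrete adjoint solution. The increments of [a j . y j] telescope,
    and the equation for [y] turns each into tested noise plus three errors: the defect of the step,
    the remainder [rest], and the residual of the covectors. The term with [e2] is the boundary term
    at the end of the window. *)
Lemma window (a : nat -> 'cV[R]_n) (K2 e1 e2 : R) : 0 <= K2 -> 0 <= e1 ->
  (forall j, (j < m)%N -> `|a j.+1| <= K2) -> `|a m| <= e2 ->
  (forall j, (j < m)%N -> `|a j.+1 + dl *: ((Lperp B A (Pk *m x 0%N))^T *m a j.+1) - a j| <= dl * e1) ->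
  `|dot (a 0%N) (y 0%N) + \sum_(j < m) dot (Pp^T *m a j.+1) (v j)| <=
  c0 ^+ 2 * e2 * Xm + 10 * c0 ^+ 3 * K2 * K * tau * (drift_gap + 1) + 2 * c0 * e1 * K * tau.
Proof.
move=> K20 e10 aK am ares.
set L := Lperp B A (Pk *m x 0%N).
pose E j := dot (a j.+1) (Pp *m (x j.+1 - x j - dl *: b (x j) - v j)) +
  dl * dot (a j.+1) (rest (Pk *m x 0%N) (x j)) +
  dot (a j.+1 + dl *: (L^T *m a j.+1) - a j) (y j).
have stepE j : dot (a j.+1) (y j.+1) - dot (a j) (y j) = dot (Pp^T *m a j.+1) (v j) + E j.
  have -> : dot (Pp^T *m a j.+1) (v j) = dot (a j.+1) (Pp *m v j) by rewrite dot_mulmx trmxK.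
  rewrite /E /rest -/L -/(y j) [dot (_ - a j) _]dotBl [dot (_ + dl *: _) _]dotDl dotZl dot_mulmx trmxK.
  have -> : Pp *m (x j.+1 - x j - dl *: b (x j) - v j) = y j.+1 - y j - dl *: (Pp *m b (x j)) - Pp *m v j.
    by rewrite mulmxBr mulmxBr mulmxBr -scalemxAr.
  by rewrite !dotBr dotZr; ring.
have gap0 : 0 <= drift_gap.
  by rewrite /drift_gap !addr_ge0 ?mulr_ge0 ?addr_ge0 ?(le_trans ler01 K1).
have Ebd j : (j < m)%N -> `|E j| <= c0 * K2 * (c0 * dl) +
    dl * (c0 * K2 * (3 * c0 ^+ 2 * (drift_gap + `|y j| + 1) * `|y j|)) + c0 * (dl * e1) * `|y j|.
  move=> jm; have dotle (u w : 'cV[R]_n) : `|dot u w| <= c0 * `|u| * `|w| :> R.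
    by rewrite (le_trans (norm_dot_le _ _))// -!mulrA ler_wpM2r// mulr_ge0.
  have a1 : `|dot (a j.+1) (Pp *m (x j.+1 - x j - dl *: b (x j) - v j))| <= c0 * K2 * (c0 * dl).
    rewrite (le_trans (dotle _ _))//; apply: ler_pM => //; first by rewrite mulr_ge0.
      by rewrite ler_wpM2l// aK.
    by rewrite (le_trans (c0p _))// ler_wpM2l// x_step.
  have a2 : `|dl * dot (a j.+1) (rest (Pk *m x 0%N) (x j))| <=
     dl * (c0 * K2 * (3 * c0 ^+ 2 * (drift_gap + `|y j| + 1) * `|y j|)).
    rewrite normrM ger0_norm// ler_wpM2l// (le_trans (dotle _ _))//; apply: ler_pM => //; first by rewrite mulr_ge0.
      by rewrite ler_wpM2l// aK.
    rewrite (le_trans (norm_rest _ _))// ler_wpM2r// ler_wpM2l ?mulr_ge0 ?sqr_ge0// !lerD2r.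
    exact: ker_increment (ltnW jm).
  have a3 : `|dot (a j.+1 + dl *: (L^T *m a j.+1) - a j) (y j)| <= c0 * (dl * e1) * `|y j|.
    by rewrite (le_trans (dotle _ _))// ler_wpM2r// ler_wpM2l// ares.
  rewrite /E (le_trans (ler_normD _ _))// lerD// (le_trans (ler_normD _ _))// lerD//.
have tele : dot (a m) (y m) = dot (a 0%N) (y 0%N) + \sum_(j < m) dot (Pp^T *m a j.+1) (v j) + \sum_(j < m) E j.
  rewrite -addrA -big_split/= -(eq_bigr _ (fun (j : 'I_m) _ => stepE j)).
  rewrite -(big_mkord xpredT (fun j => dot (a j.+1) (y j.+1) - dot (a j) (y j))).
  by rewrite telescope_sumr// addrC subrK.
have ym : `|dot (a m) (y m)| <= c0 ^+ 2 * e2 * Xm.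
  rewrite (le_trans (norm_dot_le _ _))//.
  apply: (@le_trans _ _ (c0 * e2 * (c0 * Xm))); last by rewrite le_eqVlt; apply/orP; left; apply/eqP; ring.
  apply: ler_pM; rewrite ?mulr_ge0//; first exact: ler_pM.
  by rewrite (le_trans (c0p _))// ler_wpM2l// x_le.
have sE : `|\sum_(j < m) E j| <= 10 * c0 ^+ 3 * K2 * K * tau * (drift_gap + 1) + 2 * c0 * e1 * K * tau.
  rewrite (le_trans (ler_norm_sum _ _ _))//.
  apply: le_trans (ler_sum _ (fun (j : 'I_m) _ => Ebd j (ltn_ord j))) _.
  have -> : \sum_(j < m) (c0 * K2 * (c0 * dl) +
    dl * (c0 * K2 * (3 * c0 ^+ 2 * (drift_gap + `|y j| + 1) * `|y j|)) + c0 * (dl * e1) * `|y j|) =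
    c0 ^+ 2 * K2 * tau + 3 * c0 ^+ 3 * K2 * ((drift_gap + 1) * (dl * \sum_(j < m) `|y j|) +
     dl * \sum_(j < m) `|y j| ^+ 2) + c0 * e1 * (dl * \sum_(j < m) `|y j|).
    rewrite /tau; have -> : m%:R * dl = \sum_(j < m) dl by rewrite sumr_const card_ord mulr_natl.
    rewrite !mulr_sumr -big_split/= !mulr_sumr -!big_split/=; apply: eq_bigr => j _; ring.
  have c3 : 0 <= c0 ^+ 3 * K2 by rewrite mulr_ge0// exprn_ge0.
  have h1 : c0 ^+ 2 * K2 * tau <= c0 ^+ 3 * K2 * (K * tau * (drift_gap + 1)).
    apply: ler_pM; rewrite ?mulr_ge0 ?sqr_ge0//.
      by rewrite ler_wpM2r// exprS -[leLHS]mul1r ler_wpM2r// sqr_ge0.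
    rewrite -mulrA -[leLHS]mul1r; apply: ler_pM => //.
    by rewrite -[leLHS]mulr1 ler_wpM2l// lerDr.
  have h2 : (drift_gap + 1) * (dl * \sum_(j < m) `|y j|) <= (drift_gap + 1) * (2 * K * tau).
    by rewrite ler_wpM2l// addr_ge0.
  have h3 : dl * \sum_(j < m) `|y j| ^+ 2 <= (drift_gap + 1) * (K * tau).
    apply: le_trans yK _; rewrite -/tau -[leLHS]mul1r ler_wpM2r ?mulr_ge0 ?(le_trans ler01 K1)// lerDr//.
  have h4 : c0 ^+ 3 * K2 * ((drift_gap + 1) * (dl * \sum_(j < m) `|y j|) + dl * \sum_(j < m) `|y j| ^+ 2) <=
     c0 ^+ 3 * K2 * ((drift_gap + 1) * (2 * K * tau) + (drift_gap + 1) * (K * tau)).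
    by rewrite ler_wpM2l// lerD.
  have h5 : c0 * e1 * (dl * \sum_(j < m) `|y j|) <= c0 * e1 * (2 * K * tau).
    by rewrite ler_wpM2l// mulr_ge0.
  by lra.
have -> : dot (a 0%N) (y 0%N) + \sum_(j < m) dot (Pp^T *m a j.+1) (v j) = dot (a m) (y m) - \sum_(j < m) E j.
  by rewrite tele addrK.
by rewrite (le_trans (ler_normB _ _))// -addrA lerD.
Qed.

End Path.

End Window.

Section LocLipAlgebra.
Context {R : realType} {n : nat}.
Implicit Types f g : 'cV[R]_n -> R.

Lemma loc_lip_bounded f M : loc_lip f -> exists2 N : R, 0 <= N &
  forall x : 'cV[R]_n, `|x| <= M -> `|f x| <= N.
Proof.
move=> lf; have [L L0 H] := lf `|M|; exists (`|f 0| + L * `|M|); first by rewrite addr_ge0 ?mulr_ge0.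
move=> x xM; have xM' : `|x| <= `|M| by exact: le_trans (ler_norm _).
have z0 : `|0 : 'cV[R]_n| <= `|M| by rewrite normr0.
have h := H x 0 xM' z0; rewrite subr0 in h.
rewrite -[f x](subrK (f 0)) (le_trans (ler_normD _ _))// addrC lerD2l (le_trans h)//.
by rewrite ler_wpM2l.
Qed.

Lemma loc_lipM f g : loc_lip f -> loc_lip g -> loc_lip (fun x => f x * g x).
Proof.
move=> lf lg M; have [L L0 HL] := lf M; have [L' L'0 HL'] := lg M.
have [N N0 HN] := loc_lip_bounded M lf; have [N' N'0 HN'] := loc_lip_bounded M lg.
exists (N * L' + L * N'); first by rewrite addr_ge0 ?mulr_ge0.
move=> x y xM yM.
have -> : f x * g x - f y * g y = f x * (g x - g y) + (f x - f y) * g y by ring.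
rewrite (le_trans (ler_normD _ _))// !normrM mulrDl lerD//.
  by rewrite -mulrA; apply: ler_pM => //; [exact: HN|exact: HL'].
by rewrite mulrAC; apply: ler_pM => //; [exact: HL|exact: HN'].
Qed.

Lemma loc_lip_min f (c : R) : loc_lip f -> loc_lip (fun x => Num.min (f x) c).
Proof.
move=> lf M; have [L L0 HL] := lf M; exists L => // x y xM yM.
apply: le_trans (HL x y xM yM).
have [h1|h1] := leP (f x) c; have [h2|h2] := leP (f y) c;
  by rewrite ler_norml; have := ler_norm (f x - f y); have := ler_norm (- (f x - f y)); rewrite normrN; lra.
Qed.

Lemma loc_lip_quadratic (A : 'M[R]_n) : loc_lip (fun x => dot x (A *m x)).
Proof.
move=> M; exists (n%:R * (n%:R * `|A| * `|M|) + n%:R * `|M| * (n%:R * `|A|)); first by rewrite addr_ge0 ?mulr_ge0.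
move=> x y xM yM.
have xM' : `|x| <= `|M| by exact: le_trans (ler_norm _).
have yM' : `|y| <= `|M| by exact: le_trans (ler_norm _).
have -> : dot x (A *m x) - dot y (A *m y) = dot (x - y) (A *m x) + dot y (A *m (x - y)).
  by rewrite dotBl mulmxBr dotBr; ring.
rewrite (le_trans (ler_normD _ _))// mulrDl lerD//.
  rewrite (le_trans (norm_dot_le _ _))// -!mulrA ler_wpM2l// mulrC !mulrA ler_wpM2r//.
  by rewrite (le_trans (norm_mulmx _ _))// ler_wpM2l ?mulr_ge0.
rewrite (le_trans (norm_dot_le _ _))// -[leRHS]mulrA; apply: ler_pM; rewrite ?mulr_ge0//.
  by rewrite ler_wpM2l.
exact: norm_mulmx.
Qed.

End LocLipAlgebra.

Section CoreArithmetic.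
Context {R : realType}.

(** A number of steps that spans a time between [ep / (2 r)] and [ep / r]. It fits in the window
    because [tau >= 1 / r], which is the reason for requiring [q <= r] later. *)
Lemma choose_steps (ep r dl tau : R) m : 0 < ep -> ep <= 1 -> 0 < r -> 0 < dl -> m%:R * dl = tau ->
  r^-1 <= tau -> dl <= ep / (2 * r) ->
  exists J : nat, [/\ (J <= m)%N, J%:R * dl <= ep / r & ep / (2 * r) <= J%:R * dl].
Proof.
move=> ep0 ep1 r0 dl0 mdl rt dle.
have erE : ep / (r * dl) * dl = ep / r by field; rewrite !gt_eqF.
have er0 : 0 <= ep / (r * dl) by rewrite divr_ge0 ?ltW ?mulr_gt0.
exists (Num.truncn (ep / (r * dl))).
have h1 : (Num.truncn (ep / (r * dl)))%:R * dl <= ep / r.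
  by rewrite -erE ler_wpM2r ?(ltW dl0)// truncn_le.
split => //.
  rewrite -(ler_nat R) -(ler_pM2r dl0) mdl (le_trans h1)// (le_trans _ rt)//.
  by rewrite ler_pdivrMr// mulVf ?gt_eqF.
have h2 : ep / r <= ((Num.truncn (ep / (r * dl)))%:R + 1) * dl.
  by rewrite -erE ler_wpM2r ?(ltW dl0)// natr1 ltW// truncnS_gt.
have : ep / r = ep / (2 * r) + ep / (2 * r) by field; rewrite gt_eqF.
by move: h2; rewrite mulrDl mul1r; lra.
Qed.

Lemma quadratic_growth (c0 Xc r : R) : 0 <= c0 -> 1 <= Xc -> 1 <= r ->
  0 <= 3 * c0 ^+ 4 * (1 + Xc * r) * (Xc * r) + c0 <= (3 * c0 ^+ 4 * (2 * Xc) * Xc + c0) * r ^+ 2.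
Proof.
move=> c00 Xc1 r1.
have q1 : 1 <= Xc * r by rewrite -[leLHS]mulr1 ler_pM.
have c4 : 0 <= 3 * c0 ^+ 4 by rewrite mulr_ge0// exprn_ge0.
have q0 : 0 <= Xc * r by rewrite (le_trans ler01).
apply/andP; split.
  by apply: addr_ge0 => //; apply: mulr_ge0 => //; apply: mulr_ge0 => //; exact: addr_ge0.
have h1 : 3 * c0 ^+ 4 * ((1 + Xc * r) * (Xc * r)) <= 3 * c0 ^+ 4 * ((2 * (Xc * r)) * (Xc * r)).
  by rewrite ler_wpM2l// ler_wpM2r//; lra.
have h2 : c0 <= c0 * r ^+ 2 by rewrite -[leLHS]mulr1 ler_wpM2l// expr_ge1// (le_trans ler01).
by lra.
Qed.

Lemma persistence_budget (r C3 G cM Jd Q : R) : 1 <= C3 -> 1 <= G -> 1 <= r ->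
  8 * C3 * (cM + 1) <= r -> 0 <= Jd -> Jd <= (8 * C3 * G)^-1 / r -> 0 <= Q -> Q <= G * r ^+ 2 ->
  Jd * Q + cM <= r / C3 / 2.
Proof.
move=> C31 G1 r1 cMr J0 Jr Q0 Qr.
have C30 : 0 < C3 by lra.
have G0 : 0 < G by lra.
have r0 : 0 < r by lra.
have a2 : Jd * Q <= (8 * C3 * G)^-1 / r * (G * r ^+ 2) by exact: ler_pM.
have a3 : (8 * C3 * G)^-1 / r * (G * r ^+ 2) = r / (8 * C3) by field; rewrite !gt_eqF.
have a4 : cM <= r / (8 * C3) by rewrite ler_pdivlMr ?mulr_gt0//; lra.
have a5 : r / C3 / 2 = r / (8 * C3) + r / (8 * C3) + r / (4 * C3) by field; rewrite gt_eqF.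
have a6 : 0 <= r / (4 * C3) by rewrite divr_ge0 ?mulr_ge0 ?ltW.
lra.
Qed.

(** An orthogonal component of size [r / C3] over a time of order [1 / r] contributes of order [r]
    to the integral of [|y|^2], which exceeds any fixed [K] for large [r]. *)
Lemma persistence_contra (r C3 K ep Jd : R) : 0 < C3 -> 0 < ep -> 0 < r -> 1 <= K ->
  16 * C3 ^+ 2 * K / ep < r -> ep / (2 * r) <= Jd -> Jd * ((r / C3) ^+ 2 / 4) <= K -> False.
Proof.
move=> C30 ep0 r0 K1; rewrite ltr_pdivrMr// => h4 Jr JK.
have C32 : 0 < 8 * C3 ^+ 2 by rewrite mulr_gt0// exprn_gt0.
have h1 : ep / (2 * r) * ((r / C3) ^+ 2 / 4) <= K.
  by apply: le_trans JK; rewrite ler_wpM2r// divr_ge0// sqr_ge0.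
have h2 : ep / (2 * r) * ((r / C3) ^+ 2 / 4) = ep * r / (8 * C3 ^+ 2) by field; rewrite !gt_eqF.
move: h1; rewrite h2 ler_pdivrMr// => h1.
have : 0 < K * (8 * C3 ^+ 2) by rewrite mulr_gt0//; lra.
lra.
Qed.

Lemma threshold_split (r u v : R) : 0 <= u -> 0 <= v -> u + v + 1 + 1 <= r -> [/\ 1 <= r, u <= r & v < r].
Proof. by move=> u0 v0 h; split; lra. Qed.

Lemma ker_mass (r La k y Xc : R) : 2 * La <= Xc -> 0 <= k -> r ^+ 2 <= La * (k + y) ->
  2 * La * y <= r ^+ 2 -> r ^+ 2 <= Xc * k.
Proof.
move=> LX k0 h1 h2; apply: (@le_trans _ _ (2 * La * k)); last by rewrite ler_wpM2r.
lra.
Qed.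

Lemma sqr_gain (La s : R) : 1 <= La -> 0 <= s -> 2 * La * s <= (2 * La * (s + 1)) ^+ 2.
Proof.
move=> La1 s0; have h : 1 <= 2 * La by lra.
have h2 : 2 * La * s <= (2 * La) ^+ 2 * s by rewrite ler_wpM2r// expr2 -[leLHS]mulr1 ler_pM//; lra.
apply: le_trans h2 _; rewrite [leRHS]exprMn ler_wpM2l ?sqr_ge0//; nra.
Qed.

End CoreArithmetic.

(** * Lower bound for the dissipation over one window *)

Section Core.
Context {R : realType} {n : nat}.
Variables (B : {bilinear 'cV[R]_n -> 'cV[R]_n -> 'cV[R]_n}) (A S : 'M[R]_n).
Variables (d : measure_display) (Omega : measurableType d) (P : probability Omega R).
Variables (W : R -> Omega -> 'cV[R]_n) (X : 'cV[R]_n -> R -> Omega -> 'cV[R]_n).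
Hypothesis W_bm : brownian_motion P W.
Hypothesis X_sol : forall x : 'cV[R]_n, sde_solution P B A S W x (X x).
Hypothesis B_cons : forall x : 'cV[R]_n, dot x (B x x) = 0.
Hypothesis A_psd : psd A.
Hypothesis B_ker0 : forall k : 'cV[R]_n, A *m k = 0 -> B k k = 0.
Let b := drift B A.
Let Pk := Pi_ker A.
Let Pp := Pi_kerperp A.

Lemma dot_decomp (z : 'cV[R]_n) : dot z z = dot (Pk *m z) (Pk *m z) + dot (Pp *m z) (Pp *m z).
Proof.
have := dot_sqrD (Pk *m z) (Pp *m z).
by rewrite (Pi_kerD A z) (Pi_kerperp_orth _ (Pi_ker_in A z)) mulr0 addr0.
Qed.

(** [sup_bound] compares [1 + |X - S W|^2] with [1 + |z|^2] up to a factor [exp L]; for [r] large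
    with respect to the quiet noise the additive constants are absorbed. *)
Lemma annulus (M La : R) : 0 <= M -> 1 <= La -> exists La' R0 : R, [/\ 1 <= La', 1 <= R0 &
  forall (r : R) z w, R0 <= r -> good B A S W X z w -> ~ noisy W M w ->
  r ^+ 2 <= La * dot z z -> dot z z <= La * r ^+ 2 ->
  forall t : R, 0 <= t <= 1 -> r ^+ 2 <= La' * dot (X z t w) (X z t w) /\
     dot (X z t w) (X z t w) <= La' * r ^+ 2].
Proof.
move=> M0 La1.
pose N := n%:R * `|S| * M.
have N0 : 0 <= N by rewrite !mulr_ge0.
have [L [L0 HL]] := @sup_bound _ _ B A S B_cons N N0.
pose e : R := expR L.
have e1 : 1 <= e by rewrite -expR0 ler_expR.
pose D : R := n%:R * N ^+ 2.
have D0 : 0 <= D by rewrite mulr_ge0// sqr_ge0.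
exists (4 * La * e + 2 * e + 2 * D), (1 + 2 * La * e * (1 + 2 * D)).
have Le : 1 <= La * e by rewrite -[leLHS]mul1r ler_pM.
have LD0 : 0 <= La * e * (1 + 2 * D) by rewrite mulr_ge0 ?addr_ge0 ?mulr_ge0// (le_trans ler01).
split; [nra|lra|].
move=> r z w rR gw nw r1 r2 t t01; have [xc wc xo w0 x0] := gw.
have wM := quiet_bound wc M0 nw.
have SM s : 0 <= s <= 1 -> `|S *m W s w| <= N.
  by move=> s01; rewrite (le_trans (norm_mulmx _ _))// ler_wpM2l ?mulr_ge0// wM.
have [h1 h2] := HL (fun s => X z s w) (fun s => W s w) t t01 xc wc xo w0 SM.
have LeD0 : 0 <= La * e * (1 + 2 * D) by rewrite mulr_ge0 ?addr_ge0 ?mulr_ge0// (le_trans ler01).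
have r01 : 1 <= r by lra.
have rr : 1 + 2 * La * e * (1 + 2 * D) <= r ^+ 2.
  by rewrite expr2 (le_trans rR)// -[leLHS]mulr1 ler_pM// (le_trans ler01).
move: h1 h2; rewrite x0 -/e.
have dS : dot (S *m W t w) (S *m W t w) <= D.
  rewrite (le_trans (dot_norm_le _))// ler_wpM2l// lerXn2r ?nnegrE//; exact: SM.
set u := X z t w - S *m W t w.
have xE : X z t w = u + S *m W t w by rewrite subrK.
have ub : dot u u <= 2 * dot (X z t w) (X z t w) + 2 * D.
  have := dot_ge0 (X z t w + S *m W t w); rewrite /u dot_sqrD [dot (_ - _) _]dot_sqrD dotNr dotNr dotNl opprK; lra.
have xb : dot (X z t w) (X z t w) <= 2 * dot u u + 2 * D.
  have := dot_ge0 (u - S *m W t w).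
  have -> : dot (X z t w) (X z t w) = dot (u + S *m W t w) (u + S *m W t w) by rewrite -xE.
  move: dS; clearbody u; move: (S *m W t w) => v dS.
  by rewrite !dot_sqrD dotNr dotNl dotNr opprK; lra.
have u0 := dot_ge0 u; have z0 := dot_ge0 z.
move: (dot u u) u0 (dot z z) z0 r1 r2 ub xb => du du0 dz dz0 r1 r2 ub xb h1 h2.
have dx00 := dot_ge0 (X z t w); move: (dot (X z t w) (X z t w)) ub xb dx00 => dx ub xb dx00.
have La0 : 0 < La by lra.
split.
  have k1 : r ^+ 2 <= La * e * (1 + du).
    apply: (le_trans r1); rewrite -mulrA ler_pM2l//.
    by move: h2; rewrite mulrC; lra.
  have k2 : La * e * (1 + du) <= La * e * (1 + 2 * D) + La * e * (2 * dx).
    rewrite -mulrDr ler_wpM2l ?(le_trans ler01)//; lra.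
  have dx0 : 0 <= e * dx by rewrite mulr_ge0// (le_trans ler01).
  have dx1 : 0 <= D * dx by rewrite mulr_ge0.
  by lra.
have k3 : du <= (1 + La * r ^+ 2) * e.
  apply: le_trans (_ : (1 + dz) * e <= _); first by lra.
  by rewrite ler_wpM2r ?(le_trans ler01)// lerD2l.
have r21 : 1 <= r ^+ 2 by rewrite expr_ge1// (le_trans ler01).
have k4 : e <= e * r ^+ 2 by rewrite -[leLHS]mulr1 ler_wpM2l// (le_trans ler01).
have k5 : D <= D * r ^+ 2 by rewrite -[leLHS]mulr1 ler_wpM2l.
have k6 : 0 <= La * e * r ^+ 2 by rewrite mulr_ge0 ?sqr_ge0// (le_trans ler01).
by lra.
Qed.

Lemma constants : exists c0 : R, [/\ 1 <= c0, n%:R <= c0, (forall u v, `|B u v| <= c0 * `|u| * `|v|),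
  (forall v : 'cV[R]_n, `|Pk *m v| <= c0 * `|v|) & (forall v : 'cV[R]_n, `|Pp *m v| <= c0 * `|v|) /\
  (forall v : 'cV[R]_n, `|A *m v| <= c0 * `|v|)].
Proof.
have [CB CB0 HB] := bilinear_bounded B.
pose c (Q : 'M[R]_n) : R := n%:R * `|Q|.
have c00 Q : 0 <= c Q by rewrite mulr_ge0.
have cQ (Q : 'M[R]_n) (c1 : R) (v : 'cV[R]_n) : c Q <= c1 -> `|Q *m v| <= c1 * `|v|.
  by move=> h; rewrite (le_trans (norm_mulmx _ _))// ler_wpM2r.
exists (1 + n%:R + CB + c Pk + c Pp + c A).
have [h1 h2 h3] := And3 (c00 Pk) (c00 Pp) (c00 A).
have n0 : 0 <= n%:R :> R by [].
move: (c Pk) (c Pp) (c A) (@cQ Pk) (@cQ Pp) (@cQ A) h1 h2 h3 => k1 k2 k3 q1 q2 q3 h1 h2 h3.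
split; [lra|lra| |by move=> v; apply: q1; lra|].
  move=> u v; rewrite (le_trans (HB u v))// ler_wpM2r// ler_wpM2r//; lra.
by split => v; [apply: q2|apply: q3]; lra.
Qed.

Variables (c0 g1 g2 : R).
Hypothesis c01 : 1 <= c0.
Hypothesis c0n : n%:R <= c0.
Hypothesis c0B : forall u v, `|B u v| <= c0 * `|u| * `|v|.
Hypothesis c0k : forall v : 'cV[R]_n, `|Pk *m v| <= c0 * `|v|.
Hypothesis c0p : forall v : 'cV[R]_n, `|Pp *m v| <= c0 * `|v|.
Hypothesis c0A : forall v : 'cV[R]_n, `|A *m v| <= c0 * `|v|.
Hypothesis g10 : 0 <= g1.
Hypothesis g20 : 0 <= g2.
Hypothesis g_bk : forall x : 'cV[R]_n, `|Pk *m b x| <= (g1 * (1 + `|x|) + g2 * `|Pp *m x|) * `|Pp *m x|.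

(** A quarter of the rate at which the drift makes [|x|^4] decrease. *)
Definition psiA (x : 'cV[R]_n) : R := dot x x * dot x (A *m x).
Definition cutA (M : R) (x : 'cV[R]_n) : R := Num.min (psiA x) M.

(* Covectors [a] adapted to the linearization at the frozen kernel component
   [k0]: the last inequality says that the error terms of [window] are beaten by
   the standard deviation of the noise tested against [a]. *)
Definition adapted (K M1 Xc r : R) (q m : nat) (k0 : 'cV[R]_n) := let dl : R := q%:R^-1 / m%:R in
  let tau : R := q%:R^-1 in
  exists (a : nat -> 'cV[R]_n) (K2 e1 e2 : R), [/\ 0 <= K2 /\ 0 <= e1,
    (forall j, (j < m)%N -> `|a j.+1| <= K2), `|a m| <= e2,
    (forall j, (j < m)%N -> `|a j.+1 + dl *: ((Lperp B A k0)^T *m a j.+1) - a j| <= dl * e1) &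
    (c0 ^+ 2 * e2 * (Xc * r) + 10 * c0 ^+ 3 * K2 * K * tau *
       (2 * (g1 * (1 + Xc * r)) * K * tau + g2 * K * tau + c0 * (M1 + tau) + 1) +
      2 * c0 * e1 * K * tau) ^+ 2 <
    dl / 128 * \sum_(j < m) dot (S^T *m (Pp^T *m a j.+1)) (S^T *m (Pp^T *m a j.+1))].

Hypothesis adapted_exists : forall K M1 Xc : R, 1 <= K -> 0 <= M1 -> 1 <= Xc ->
  exists R0 : R, forall r : R, R0 <= r -> exists q : nat, [/\ (0 < q)%N, q%:R <= r &
   forall k0 : 'cV[R]_n, A *m k0 = 0 -> r ^+ 2 <= Xc * dot k0 k0 -> dot k0 k0 <= Xc * r ^+ 2 ->
     exists m1, forall m, (m1 < m)%N -> adapted K M1 Xc r q m k0].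

(** Two situations according to the orthogonal component of [z]. If it is at least [r / C3], it
    persists for a time [1 / r] and small dissipation is impossible. If it is smaller, the kernel
    component has size of order [r] and the adapted covectors apply. The constants [g1] and [g2]
    cover both cases of the theorem: the speed of the kernel component is at most
    [(g1 (1 + |x|) + g2 |y|) |y|]. *)
Lemma core (ka La : R) : 0 < ka -> 1 <= La -> exists R0 : R, forall r : R, R0 <= r ->
  exists (q : nat) (Mf : R), [/\ (0 < q)%N, 0 <= Mf & forall z, r ^+ 2 <= La * dot z z -> dot z z <= La * r ^+ 2 ->
   exists m0, forall m, (m0 < m)%N ->
   ka * r ^+ 2 <= m%:R^-1 * \sum_(j < m) Tr P X (j%:R * (q%:R^-1 / m%:R)) (cutA Mf) z].
Proof.
move=> ka0 La1.
have p4 : 0 < pz / 4 :> R by rewrite divr_gt0// pz_gt0.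
have pz0 : 0 < pz :> R by exact: pz_gt0.
have [M M0 HM] := noisy_small W_bm X_sol p4.
have [La' [R1 [La'1 R11 ann]]] := annulus M0 La1.
have [aA aA0 gapA] := psd_gap A_psd.
(* Compensates the factor [pz / 2] lost in [average_lower]. *)
pose k1 : R := 2 * ka / pz.
have k10 : 0 < k1 by rewrite divr_gt0// mulr_gt0.
pose cc : R := aA / La'.
have cc0 : 0 < cc by rewrite divr_gt0//; lra.
(* In the annulus the dissipation is at least [cc r^2 |y|^2]; an average below [k1 r^2] thus bounds
   the mean of [|y|^2] by [k1 / cc]. *)
pose K : R := 1 + k1 / cc.
have K1 : 1 <= K by rewrite lerDl divr_ge0// ltW.
pose M1 : R := n%:R * `|S| * (2 * M).
have M10 : 0 <= M1 by rewrite !mulr_ge0.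
pose Xc : R := 2 * La * La' + 2 * La.
have Xc1 : 1 <= Xc by rewrite /Xc; nra.
have La'Xc : La' <= Xc by rewrite /Xc; nra.
have LaXc : La <= Xc by rewrite /Xc; nra.
have [R2 HR2] := adapted_exists K1 M10 Xc1.
(* If the orthogonal component is below [r / C3], then [2 La |y|^2 <= r^2], and at least half of the
   lower bound on [|z|^2] is carried by the kernel. *)
pose C3 : R := 2 * La * (n%:R + 1).
have C31 : 1 <= C3 by rewrite /C3; have : 0 <= n%:R :> R by []; nra.
pose G : R := 3 * c0 ^+ 4 * (2 * Xc) * Xc + c0.
have c00 : 0 <= c0 by exact: le_trans c01.
have G1 : 1 <= G.
  by rewrite /G (le_trans c01)// lerDr !mulr_ge0 ?(le_trans ler01 Xc1)// exprn_ge0.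
(* During a time [ep / r] a speed of at most [G r^2] moves the orthogonal component by at most
   [r / (8 C3)]. *)
pose ep : R := (8 * C3 * G)^-1.
have ep0 : 0 < ep by rewrite invr_gt0 !mulr_gt0//; lra.
have ep1 : ep <= 1 by rewrite invf_le1 ?mulr_gt0//; [nra|lra|lra].
pose R3 : R := 8 * C3 * (c0 * M1 + 1) + 16 * C3 ^+ 2 * K / ep + 1.
exists (Num.max (Num.max R1 R2) (R3 + 1)) => r; rewrite !ge_max => /andP[/andP[rR1 rR2] rR3].
have C3K : 0 <= 16 * C3 ^+ 2 * K / ep.
  apply: divr_ge0; last exact: ltW.
  by apply: mulr_ge0; [rewrite mulr_ge0 ?ler0n ?sqr_ge0|exact: le_trans ler01 K1].
have C3M : 0 <= 8 * C3 * (c0 * M1 + 1).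
  apply: mulr_ge0; last by rewrite addr_ge0// mulr_ge0.
  by apply: mulr_ge0; [rewrite ler0n|exact: le_trans ler01 C31].
have [r1 rC3 rK] : [/\ 1 <= r, 8 * C3 * (c0 * M1 + 1) <= r & 16 * C3 ^+ 2 * K / ep < r].
  exact: threshold_split.
have r0 : 0 < r by exact: lt_le_trans r1.
have C30 : 0 < C3 by exact: lt_le_trans C31.
have Xc0 : 0 <= Xc by exact: le_trans Xc1.
have r20 : 0 < r ^+ 2 by rewrite exprn_gt0.
have [q [q0 qr Hq]] := HR2 r rR2.
(* In the annulus [|y|^2 <= La' r^2], so truncation at this level leaves the lower bound
   [cc r^2 |y|^2] intact. *)
pose Mf : R := cc * r ^+ 2 * (La' * r ^+ 2).
have La'0 : 0 <= La' by exact: le_trans La'1.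
have Mf0 : 0 <= Mf by rewrite /Mf; apply: mulr_ge0; apply: mulr_ge0 => //; exact: ltW.
exists q, Mf; split => //.
move=> z z1 z2.
pose tau : R := q%:R^-1.
have q1 : 1 <= q%:R :> R by rewrite ler1n.
have qp : 0 < q%:R :> R by rewrite ltr0n.
have tau0 : 0 < tau by rewrite invr_gt0.
have tau1 : tau <= 1 by rewrite invf_le1.
have taur : r^-1 <= tau by rewrite lef_pV2.
have k1r : 0 < k1 * r ^+ 2 by rewrite mulr_gt0.
have psi0 x : 0 <= psiA x by rewrite mulr_ge0 ?dot_ge0//; have [_ h] := A_psd; exact: h.
have bcut : bc (cutA Mf).
  apply: bc_continuous_min => //; apply: loc_lip_continuous.
  by apply: loc_lipM; [exact: loc_lip_dot|exact: loc_lip_quadratic].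
have cut0 x : 0 <= cutA Mf x.
  by rewrite le_min psi0.
have -> : ka * r ^+ 2 = k1 * r ^+ 2 * (pz / 2) by rewrite /k1; field; rewrite gt_eqF.
apply: (average_lower W_bm X_sol bcut cut0 tau0 k1r HM).
have zdec := dot_decomp z.
have facts m w : (0 < m)%N -> let dl := tau / m%:R in let x j := X z (j%:R * dl) w in
  let v := grid_noise S (fun t => W t w) dl in
  good B A S W X z w -> ~ noisy W M w -> (forall j, (j < m)%N -> `|defect B A S W X z dl j w| <= dl) ->
  [/\ x 0%N = z,
      (forall j, (j < m)%N -> `|x j.+1 - x j - dl *: b (x j) - v j| <= dl),
      (forall j, (j <= m)%N -> `|\sum_(i < j) v i| <= M1),
      (forall j, (j <= m)%N -> `|x j| <= Xc * r) &
      m%:R^-1 * \sum_(j < m) cutA Mf (x j) < k1 * r ^+ 2 ->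
        dl * \sum_(j < m) `|Pp *m x j| ^+ 2 <= K * (m%:R * dl)].
  move=> mp dl x v gw nw df; have [xc wc xo w0 x0] := gw.
  have wM := quiet_bound wc M0 nw.
  have m0 : 0 < m%:R :> R by rewrite ltr0n.
  have dl0 : 0 < dl by rewrite divr_gt0.
  have mdl : m%:R * dl = tau by rewrite /dl mulrCA divff ?mulr1// gt_eqF.
  have t01 j : (j <= m)%N -> 0 <= j%:R * dl <= 1.
    move=> jm; rewrite mulr_ge0 ?(ltW dl0)//= (le_trans _ tau1)// -mdl ler_wpM2r ?(ltW dl0)// ler_nat//.
  have an j (jm : (j <= m)%N) := ann r z w rR1 gw nw z1 z2 _ (t01 j jm).
  split => //.
  - by rewrite /x mul0r.
  - move=> j jm; have -> : \sum_(i < j) v i = S *m (W (j%:R * dl) w - W 0 w).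
      rewrite /v /grid_noise -mulmx_sumr; congr (_ *m _).
      rewrite -(big_mkord xpredT (fun i => W (i.+1%:R * dl) w - W (i%:R * dl) w)).
      by rewrite (telescope_sumr (fun i => W (i%:R * dl) w))// mul0r.
    rewrite (le_trans (norm_mulmx _ _))// ler_wpM2l ?mulr_ge0// w0 subr0 (le_trans (wM _ (t01 j jm)))// (_ : 2 * M = M + M) ?lerDl//; by rewrite mulrDl mul1r.
  - move=> j jm; have [_ h] := an j jm.
    have Xcr : 0 <= Xc * r by rewrite mulr_ge0// ltW.
    rewrite -(@ler_pXn2r _ 2) ?nnegrE// (le_trans (le_norm_dot _))// (le_trans h)// exprMn ler_wpM2r ?(ltW r20)//.
    by rewrite (le_trans La'Xc)// expr2 -[leLHS]mulr1 ler_wpM2l.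
  move=> avk.
  have low j : (j < m)%N -> cc * r ^+ 2 * `|Pp *m x j| ^+ 2 <= cutA Mf (x j).
    move=> jm; have [h1 h2] := an j (ltnW jm).
    have hy := le_norm_dot (Pp *m x j).
    have xd : dot (Pp *m x j) (Pp *m x j) <= dot (x j) (x j).
      by rewrite (dot_decomp (x j)) lerDr dot_ge0.
    have cr : 0 <= cc * r ^+ 2 by rewrite mulr_ge0 ?(ltW cc0) ?(ltW r20).
    rewrite le_min; apply/andP; split; last first.
      by rewrite /Mf ler_wpM2l// (le_trans hy)// (le_trans xd).
    rewrite (_ : cc * r ^+ 2 * _ = r ^+ 2 / La' * (aA * `|Pp *m x j| ^+ 2)); last first.
      by rewrite /cc [aA / La' * _]mulrAC [aA * r ^+ 2]mulrC -!mulrA [aA * (La'^-1 * _)]mulrCA.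
    apply: ler_pM.
    - by rewrite divr_ge0 ?(ltW r20).
    - by rewrite mulr_ge0 ?sqr_ge0// ltW.
    - by rewrite ler_pdivrMr ?(lt_le_trans ltr01)// mulrC.
    - by rewrite (le_trans _ (gapA (x j)))// ler_wpM2l// ltW.
  have s1 : cc * r ^+ 2 * \sum_(j < m) `|Pp *m x j| ^+ 2 <= \sum_(j < m) cutA Mf (x j).
    by rewrite mulr_sumr; apply: ler_sum => j _; exact: low.
  have s2 : m%:R^-1 * \sum_(j < m) `|Pp *m x j| ^+ 2 <= K.
    have h3 : cc * r ^+ 2 * (m%:R^-1 * \sum_(j < m) `|Pp *m x j| ^+ 2) <= k1 * r ^+ 2.
      rewrite mulrCA; apply: le_trans (ltW avk); rewrite ler_wpM2l ?invr_ge0//.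
    have h4 : m%:R^-1 * \sum_(j < m) `|Pp *m x j| ^+ 2 <= k1 / cc.
      by rewrite ler_pdivlMr// mulrC -(ler_pM2r r20) mulrAC.
    by rewrite (le_trans h4)// /K lerDr.
  have -> : dl * \sum_(j < m) `|Pp *m x j| ^+ 2 = tau * (m%:R^-1 * \sum_(j < m) `|Pp *m x j| ^+ 2).
    by rewrite /dl; ring.
  by rewrite mdl mulrC ler_wpM2r// ltW.
have Xcr1 : 1 <= Xc * r by rewrite -[leLHS]mulr1 ler_pM.
have BDl (u v w : 'cV[R]_n) : B (u + v) w = B u w + B v w by exact: linearDl.
have BDr (u v w : 'cV[R]_n) : B w (u + v) = B w u + B w v by exact: linearDr.
have BNl (u w : 'cV[R]_n) : B (- u) w = - B u w by exact: linearNl.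
have BNr (u w : 'cV[R]_n) : B w (- u) = - B w u by exact: linearNr.
have [yA|yB] := leP r (C3 * `|Pp *m z|).
  pose m1 := (Num.truncn (2 * r * tau / ep)).+1.
  (* With zero covectors the inequality to prove is [0 < 0]; the point is that no quiet path
     satisfies the hypotheses. *)
  exists m1 => m m1m; exists (fun=> 0), 0 => w x gw nw df avk; exfalso.
  have mp : (0 < m)%N by exact: leq_ltn_trans m1m.
  have m0 : 0 < m%:R :> R by rewrite ltr0n.
  have [x0 xs vs xl yK] := facts m w mp gw nw df; have {}yK := yK avk.
  set dl := tau / m%:R in xs vs xl yK x avk df x0.
  have dl0 : 0 < dl by rewrite divr_gt0.
  have mdl : m%:R * dl = tau by rewrite /dl mulrCA divff ?mulr1// gt_eqF.
  have dle : dl <= ep / (2 * r).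
    rewrite /dl ler_pdivrMr// [_ * m%:R]mulrC -ler_pdivrMr ?divr_gt0 ?mulr_gt0//.
    rewrite (_ : tau / (ep / (2 * r)) = 2 * r * tau / ep); last by rewrite invf_div mulrA [tau * _]mulrC.
    by rewrite ltW// (lt_trans (truncnS_gt _))// ltr_nat.
  have [J [Jm Jle Jge]] := choose_steps ep0 ep1 r0 dl0 mdl taur dle.
  have Jd0 : 0 <= J%:R * dl by rewrite mulr_ge0// ltW.
  have Y00 : 0 <= r / C3 by rewrite divr_ge0 ?(ltW C30) ?(ltW r0).
  have Yy : r / C3 <= `|Pp *m x 0%N| by rewrite /x x0 ler_pdivrMr// mulrC.
  have /andP[Q0 QG] := quadratic_growth c00 Xc1 r1.
  have cond := persistence_budget C31 G1 r1 rC3 Jd0 Jle Q0 QG.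
  have H := @persistence _ _ B A BDl BDr B_ker0 c0 c01 c0B c0k c0p c0A x _ m dl M1 (ltW dl0) xs vs (Xc * r) xl
    (r / C3) J Jm Y00 Yy cond.
  apply: (persistence_contra C30 ep0 r0 K1 rK Jge).
  apply: (le_trans H); apply: (le_trans yK).
  by rewrite mdl -[leRHS]mulr1 ler_wpM2l// (le_trans ler01).
have kz : A *m (Pk *m z) = 0 by exact: Pi_ker_in.
have yd : 2 * La * dot (Pp *m z) (Pp *m z) <= r ^+ 2.
  have h1 := dot_norm_le (Pp *m z).
  have n0 : 0 <= n%:R :> R by [].
  have h2 : 2 * La * n%:R <= C3 ^+ 2 by exact: sqr_gain.
  apply: (@le_trans _ _ (2 * La * (n%:R * `|Pp *m z| ^+ 2))).
    by rewrite ler_wpM2l// mulr_ge0// (le_trans ler01).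
  rewrite mulrA; apply: (@le_trans _ _ (C3 ^+ 2 * `|Pp *m z| ^+ 2)); first by rewrite ler_wpM2r// sqr_ge0.
  rewrite -exprMn lerXn2r ?nnegrE ?(ltW yB) ?(ltW r0)//.
  by apply: mulr_ge0 => //; exact: ltW.
have k0 := dot_ge0 (Pk *m z); have y0 := dot_ge0 (Pp *m z).
have ka1 : r ^+ 2 <= Xc * dot (Pk *m z) (Pk *m z).
  rewrite zdec in z1; apply: (ker_mass _ k0 z1 yd).
  rewrite /Xc lerDr; apply: mulr_ge0 => //; apply: mulr_ge0 => //; exact: le_trans La1.
have ka2 : dot (Pk *m z) (Pk *m z) <= Xc * r ^+ 2.
  rewrite zdec in z2; apply: (@le_trans _ _ (La * r ^+ 2)).
    by apply: le_trans z2; rewrite lerDl.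
  by rewrite ler_wpM2r ?(ltW r20)//; exact: LaXc.
have [m1 Hm1] := Hq (Pk *m z) kz ka1 ka2.
exists m1 => m m1m; have [a [K2 [e1 [e2 [[K20 e10] aK am ares abd]]]]] := Hm1 m m1m.
exists (fun j => Pp^T *m a j.+1), (dot (a 0%N) (Pp *m z)) => w x gw nw df avk.
have mp : (0 < m)%N by exact: leq_ltn_trans m1m.
have [x0 xs vs xl yK] := facts m w mp gw nw df; have {}yK := yK avk.
apply: le_lt_trans abd; rewrite -/tau.
set dl := tau / m%:R in xs vs xl yK ares *.
have m0 : 0 < m%:R :> R by rewrite ltr0n.
have dl0 : 0 < dl by rewrite divr_gt0.
have mdl : m%:R * dl = tau by rewrite /dl mulrCA divff ?mulr1// gt_eqF.
have G10 : 0 <= g1 * (1 + Xc * r) by rewrite mulr_ge0// addr_ge0// mulr_ge0// ltW.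
have bkx j : (j < m)%N -> `|Pk *m b (x j)| <= (g1 * (1 + Xc * r) + g2 * `|Pp *m x j|) * `|Pp *m x j|.
  move=> jm; rewrite (le_trans (g_bk (x j)))// ler_wpM2r// lerD2r ler_wpM2l// lerD2l.
  by rewrite xl// ltnW.
have ares' j : (j < m)%N -> `|a j.+1 + dl *: ((Lperp B A (Pk *m x 0%N))^T *m a j.+1) - a j| <= dl * e1.
  by move=> jm; rewrite (_ : Pk *m x 0%N = Pk *m z); [exact: ares|congr (_ *m _); exact: x0].
have := @window _ _ B A BDl BDr BNl BNr (LmxE B) A_psd B_ker0 c0 c01 c0n c0B c0k c0p c0A x
  (grid_noise S (fun t => W t w) dl) m dl M1 (ltW dl0) xs vs (Xc * r) xl K (g1 * (1 + Xc * r)) g2 K1 G10 g20 yK bkx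
  a K2 e1 e2 K20 e10 aK am ares'.
have x0P : Pi_kerperp A *m x 0%N = Pp *m z by congr (_ *m _); exact: x0.
rewrite /drift_gap mdl x0P => hw.
rewrite -[leLHS]real_normK ?num_real// lerXn2r ?nnegrE//; exact: le_trans hw.
Qed.

End Core.

(** * Covectors adapted to the linearization *)

Section Powers.
Context {R : realType}.

(* Bernoulli's inequality, applied to [(1 + y) ^ (m / d)] and raised to the power [d]. *)
Lemma bernoulli_power (y : R) (d m : nat) : 0 <= y -> (0 < d)%N -> (d <= m)%N ->
  (1 + m%:R * y / (2 * d%:R)) ^+ d <= (1 + y) ^+ m.
Proof.
move=> y0 d0 dm; have dp : 0 < d%:R :> R by rewrite ltr0n.
have bern k : 1 + k%:R * y <= (1 + y) ^+ k.
  elim: k => [|k IH]; first by rewrite mul0r addr0 expr0.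
  rewrite exprS (le_trans _ (ler_wpM2l _ IH)) ?addr_ge0// (_ : k.+1%:R = k%:R + 1 :> R) ?natr1//.
  have : 0 <= k%:R * y * y by rewrite !mulr_ge0.
  lra.
pose k := (m %/ d)%N.
have k1 : (0 < k)%N by rewrite divn_gt0.
have mk : (m <= 2 * k * d)%N.
  have := ltn_ceil m d0; rewrite -/k => h; rewrite (leq_trans (ltnW h))// leq_mul2r; apply/orP; right.
  by rewrite mul2n -addnn -addn1 leq_add2l.
apply: (@le_trans _ _ ((1 + k%:R * y) ^+ d)).
  apply: lerXn2r; rewrite ?nnegrE ?addr_ge0 ?divr_ge0 ?mulr_ge0// lerD2l ler_pdivrMr ?mulr_gt0//.
  have : m%:R <= 2 * k%:R * d%:R :> R by rewrite -!natrM ler_nat.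
  by move=> h; rewrite (le_trans (ler_wpM2r y0 h))//; lra.
apply: (@le_trans _ _ ((1 + y) ^+ (k * d))).
  by rewrite exprM; apply: lerXn2r; rewrite ?nnegrE ?addr_ge0 ?mulr_ge0 ?exprn_ge0 ?addr_ge0//; exact: bern.
by apply: ler_weXn2l; [rewrite lerDl|exact: leq_trunc_div].
Qed.

Lemma bernoulli_sub (y : R) (j : nat) : 0 <= y -> y <= 1 -> 1 - j%:R * y <= (1 - y) ^+ j.
Proof.
move=> y0 y1; elim: j => [|j IH]; first by rewrite mul0r subr0 expr0.
have y1' : 0 <= 1 - y by rewrite subr_ge0.
rewrite exprS (le_trans _ (ler_wpM2l y1' IH))// (_ : j.+1%:R = j%:R + 1 :> R) ?natr1//.
have : 0 <= j%:R * y * y by rewrite !mulr_ge0.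
lra.
Qed.

Lemma geometric_sum (D : R) m : D != 0 -> (D - 1) * \sum_(j < m) D^-1 ^+ j.+1 = 1 - D^-1 ^+ m.
Proof.
move=> D0; elim: m => [|m IH]; first by rewrite big_ord0 mulr0 expr0 subrr.
rewrite big_ord_recr /= mulrDr IH mulrBl mul1r exprS mulrA mulfV// mul1r; ring.
Qed.

Lemma sum_succ m : \sum_(j < m) (j.+1%:R : R) = m%:R * (m%:R + 1) / 2.
Proof.
elim: m => [|m IH]; first by rewrite big_ord0 mul0r mul0r.
by rewrite big_ord_recr /= IH (_ : m.+1%:R = m%:R + 1 :> R) ?natr1//; field.
Qed.

(* [c + i e] is [(1 + dl (al + i be)) ^ (- j)], in real coordinates. *)
Lemma rotor (dl al be : R) : 0 <= dl -> 0 <= al -> let D := (1 + dl * al) ^+ 2 + (dl * be) ^+ 2 in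
  exists c e : nat -> R, forall j, [/\ c j = (1 + dl * al) * c j.+1 - dl * be * e j.+1,
    e j = (1 + dl * al) * e j.+1 + dl * be * c j.+1 & c j ^+ 2 + e j ^+ 2 = D^-1 ^+ j].
Proof.
move=> dl0 al0 D.
have D0 : D != 0.
  by rewrite gt_eqF// ltr_wpDr ?sqr_ge0// exprn_gt0// ltr_wpDr ?mulr_ge0.
pose g (p : R * R) := (((1 + dl * al) * p.1 + dl * be * p.2) / D, ((1 + dl * al) * p.2 - dl * be * p.1) / D).
pose p j := iter j g (1, 0).
exists (fun j => (p j).1), (fun j => (p j).2) => j.
have pS k : p k.+1 = g (p k) by [].
have pn k : (p k).1 ^+ 2 + (p k).2 ^+ 2 = D^-1 ^+ k.
  elim: k => [|k IH]; first by rewrite /= expr1n expr0n addr0.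
  by rewrite [RHS]exprS -IH pS /=; move: (p k).1 (p k).2 => x y; rewrite /D in D0 *; field.
split; [| |exact: pn]; rewrite pS /=; move: (p j).1 (p j).2 => x y; rewrite /D in D0 *; field; exact: D0.
Qed.

End Powers.

(** * Discrete adjoint solutions attached to an eigenvalue or to a Jordan chain *)

Section Spiral.
Context {R : realType} {n : nat}.
Implicit Types (u v w : 'cV[R]_n) (L T : 'M[R]_n).

Lemma half_le (t x y : R) : t + t <= x + y -> x < t -> t <= y.
Proof. by move=> *; lra. Qed.

Lemma eighth_gap (x : R) : 8 <= x -> 1 / 2 * (1 / 2) * (x / 32) <= 1 / 2 * (1 / 2) * (x / 16 - 1 / 4).
Proof. by move=> *; lra. Qed.

(** The tangent at [x = 1 / 2] of the convex function [(1 - x)^4]. A linear minorant makes the sum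
    over the grid explicit. *)
Lemma quartic_tangent (x : R) : 1 / 16 - (x - 1 / 2) / 2 <= ((1 - x) ^+ 2) ^+ 2.
Proof. by have := sqr_ge0 ((1 - x) ^+ 2 - 1 / 4); have := sqr_ge0 (1 - x - 1 / 2); lra. Qed.

Lemma dot_sub_ge u v : 1 / 2 * dot u u - dot v v <= dot (u - v) (u - v).
Proof. by have := dot_ge0 (u - 2 *: v); rewrite !dot_sqrD !dotNr !dotNl opprK !dotZr !dotZl; lra. Qed.

Lemma dot_pair_le u v (C : R) : `|u| <= C -> `|v| <= C -> dot u u + dot v v <= 2 * (n%:R * C ^+ 2).
Proof.
move=> uC vC; have C0 : 0 <= C by exact: le_trans uC.
rewrite (_ : 2 * _ = n%:R * C ^+ 2 + n%:R * C ^+ 2); last by ring.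
by apply: lerD; apply: (le_trans (dot_norm_le _)); rewrite ler_wpM2l// lerXn2r ?nnegrE.
Qed.

Lemma comb_expand (p q c e : R) (u1 v1 u2 v2 : 'cV[R]_n) :
  p *: (c *: u1 - e *: v1) - q *: (c *: u2 - e *: v2) =
  (p * c) *: u1 + (- (p * e)) *: v1 + (- (q * c)) *: u2 + (q * e) *: v2.
Proof. by apply/matrixP => i k; rewrite !mxE; ring. Qed.

Lemma comb_expand_opp (p q c e : R) (u1 v1 u2 v2 : 'cV[R]_n) :
  p *: (c *: v1 - e *: - u1) - q *: (c *: v2 - e *: - u2) =
  (p * e) *: u1 + (p * c) *: v1 + (- (q * e)) *: u2 + (- (q * c)) *: v2.
Proof. by apply/matrixP => i k; rewrite !mxE; ring. Qed.

Lemma spiral_step L u v w w' (dl al be c e c' e' : R) :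
  L *m u = al *: u - be *: v + w -> L *m v = al *: v + be *: u + w' ->
  c = (1 + dl * al) * c' - dl * be * e' -> e = (1 + dl * al) * e' + dl * be * c' ->
  (c' *: u - e' *: v) + dl *: (L *m (c' *: u - e' *: v)) = c *: u - e *: v + dl *: (c' *: w - e' *: w').
Proof.
move=> Lu Lv -> ->; rewrite mulmxBr -!scalemxAr Lu Lv.
by apply/matrixP => i j; rewrite !mxE; ring.
Qed.

Lemma norm_comb_le u v (c e : R) : `|c *: u - e *: v| <= `|c| * `|u| + `|e| * `|v|.
Proof. by rewrite (le_trans (ler_normB _ _))// !normrZ. Qed.

Lemma dot_comb_sum u v (c e : R) : dot (c *: u - e *: v) (c *: u - e *: v) +
  dot (c *: v - e *: (- u)) (c *: v - e *: (- u)) = (c ^+ 2 + e ^+ 2) * (dot u u + dot v v).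
Proof.
rewrite !(dotDl, dotDr, dotNl, dotNr, dotZl, dotZr) (dotC v u); ring.
Qed.

Lemma sqr_norm_le (x y : R) : 0 <= y -> x ^+ 2 <= y ^+ 2 -> `|x| <= y.
Proof. by move=> y0 h; rewrite -(@ler_pXn2r _ 2) ?nnegrE// real_normK ?num_real. Qed.

Lemma rotor_le (c e q : R) j : 0 <= q -> c ^+ 2 + e ^+ 2 <= (q ^+ 2) ^+ j -> `|c| <= q ^+ j /\ `|e| <= q ^+ j.
Proof.
move=> q0; rewrite exprAC => h; have cc := sqr_ge0 c; have ee := sqr_ge0 e.
by split; apply: sqr_norm_le; rewrite ?exprn_ge0//; lra.
Qed.

(* Both the real and the imaginary part of the complex solution are solutions,
   and one of them carries at least half of the noise. *)
Lemma spiral L T u v (dl al be cS : R) m : 0 <= dl -> 0 <= al ->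
  L *m u = al *: u - be *: v -> L *m v = al *: v + be *: u -> 0 <= cS ->
  (forall x y : R, cS * dot (x *: u + y *: v) (x *: u + y *: v) <= dot (T *m (x *: u + y *: v)) (T *m (x *: u + y *: v))) ->
  let D := (1 + dl * al) ^+ 2 + (dl * be) ^+ 2 in
  exists a : nat -> 'cV[R]_n, [/\ forall j, a j.+1 + dl *: (L *m a j.+1) = a j,
    forall j, `|a j| <= (1 + dl * al)^-1 ^+ j * (`|u| + `|v|) &
    cS / 2 * (\sum_(j < m) D^-1 ^+ j.+1) * (dot u u + dot v v) <= \sum_(j < m) dot (T *m a j.+1) (T *m a j.+1)].
Proof.
move=> dl0 al0 Lu Lv cS0 Tuv D.
have [c [e ce]] := rotor be dl0 al0.
have q0 : 0 < 1 + dl * al by rewrite ltr_wpDr ?mulr_ge0.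
have D0 : 0 < D by rewrite /D ltr_wpDr ?sqr_ge0// exprn_gt0.
have cel j : `|c j| <= (1 + dl * al)^-1 ^+ j /\ `|e j| <= (1 + dl * al)^-1 ^+ j.
  apply: rotor_le; first by rewrite invr_ge0 ltW.
  have [_ _ ->] := ce j; apply: lerXn2r; rewrite ?nnegrE ?invr_ge0 ?exprn_ge0 ?invr_ge0 ?(ltW q0) ?(ltW D0)//.
  by rewrite exprVn lef_pV2 ?posrE ?exprn_gt0//; rewrite lerDl sqr_ge0.
have gen (u' v' : 'cV[R]_n) : L *m u' = al *: u' - be *: v' -> L *m v' = al *: v' + be *: u' ->
   `|u'| + `|v'| <= `|u| + `|v| ->
   (forall j, (c j *: u' - e j *: v') = c j *: u' - e j *: v' /\ (c j.+1 *: u' - e j.+1 *: v') + dl *: (L *m (c j.+1 *: u' - e j.+1 *: v')) = c j *: u' - e j *: v') /\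
   forall j, `|c j *: u' - e j *: v'| <= (1 + dl * al)^-1 ^+ j * (`|u| + `|v|).
  move=> Lu' Lv' uv; split => j.
    split => //; have [h1 h2 _] := ce j.
    rewrite (spiral_step (w := 0) (w' := 0) _ _ h1 h2) ?addr0//.
    by rewrite !scaler0 subr0 scaler0 addr0.
  have [h1 h2] := cel j.
  rewrite (le_trans (norm_comb_le _ _ _ _))// (le_trans _ (ler_wpM2l _ uv)) ?exprn_ge0 ?invr_ge0 ?(ltW q0)//.
  by rewrite mulrDr lerD// ler_wpM2r.
pose N (u' v' : 'cV[R]_n) := \sum_(j < m) dot (T *m (c j.+1 *: u' - e j.+1 *: v')) (T *m (c j.+1 *: u' - e j.+1 *: v')).
have NN : cS * (\sum_(j < m) D^-1 ^+ j.+1) * (dot u u + dot v v) <= N u v + N v (- u).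
  rewrite (_ : cS * _ * _ = \sum_(j < m) cS * (D^-1 ^+ j.+1 * (dot u u + dot v v))); last first.
    by rewrite -mulrA mulr_suml mulr_sumr.
  rewrite /N -[leRHS]big_split /=; apply: ler_sum => j _.
  have [_ _ <-] := ce j.+1; rewrite -dot_comb_sum mulrDr lerD//.
    by have := Tuv (c j.+1) (- e j.+1); rewrite scaleNr.
  by have := Tuv (e j.+1) (c j.+1); rewrite scalerN opprK addrC.
have [h|h] := leP (cS / 2 * (\sum_(j < m) D^-1 ^+ j.+1) * (dot u u + dot v v)) (N u v).
  have [g1 g2] := gen u v Lu Lv (lexx _).
  by exists (fun j => c j *: u - e j *: v); split => // j; have [] := g1 j.
(* The pair [v, - u] represents [- i (u + i v)], so this is the imaginary part of the same complex
   solution. *)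
have [g1 g2] : (forall j, (c j *: v - e j *: - u) = c j *: v - e j *: - u /\ (c j.+1 *: v - e j.+1 *: - u) + dl *: (L *m (c j.+1 *: v - e j.+1 *: - u)) = c j *: v - e j *: - u) /\
   forall j, `|c j *: v - e j *: - u| <= (1 + dl * al)^-1 ^+ j * (`|u| + `|v|).
  apply: gen; [by rewrite Lv scalerN opprK| |by rewrite normrN addrC].
  by rewrite mulmxN Lu scalerN opprB addrC.
exists (fun j => c j *: v - e j *: - u); split => // [j|]; first by have [] := g1 j.
rewrite -/(N v (- u)); move: h NN; move: (N u v) (N v (- u)) => x y.
move: (\sum_(j < m) D^-1 ^+ j.+1) (dot u u + dot v v) => p q h1 h2; lra.
Qed.

(* The bump [phi] and its derivative [psi] make [phi e1 - (psi / s) e2] an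
   approximate solution vanishing at the end of the window. *)
Lemma resonant L T u1 v1 u2 v2 (dl tau be s cS C : R) m : (0 < m)%N -> 0 < tau -> 0 < s -> dl = tau / m%:R ->
  L *m u1 = 0 *: u1 - be *: v1 -> L *m v1 = 0 *: v1 + be *: u1 ->
  L *m u2 = 0 *: u2 - be *: v2 + s *: u1 -> L *m v2 = 0 *: v2 + be *: u2 + s *: v1 -> 0 <= cS -> 1 <= C ->
  (forall x y z t : R, cS * dot (x *: u1 + y *: v1 + z *: u2 + t *: v2) (x *: u1 + y *: v1 + z *: u2 + t *: v2) <=
     dot (T *m (x *: u1 + y *: v1 + z *: u2 + t *: v2)) (T *m (x *: u1 + y *: v1 + z *: u2 + t *: v2))) ->
  `|u1| <= C -> `|v1| <= C -> `|u2| <= C -> `|v2| <= C -> `|be| <= C * s -> C^-1 <= dot u1 u1 + dot v1 v1 ->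
  4 <= tau * s -> 8 * (256 * (n%:R * C ^+ 3)) <= (tau * s) ^+ 2 ->
  (8 <= m)%N -> 4 * C ^+ 2 * s ^+ 2 * tau ^+ 2 <= m%:R ->
  exists a : nat -> 'cV[R]_n, [/\ forall j, (j < m)%N -> `|a j.+1| <= 3 * C,
    `|a m| <= 2 * C / (tau * s * m%:R),
    forall j, (j < m)%N -> `|a j.+1 + dl *: (L *m a j.+1) - a j| <= dl * (5 * C / (tau ^+ 2 * s)) &
    cS * tau / (2 * (256 * C)) <= dl * \sum_(j < m) dot (T *m a j.+1) (T *m a j.+1)].
Proof.
move=> m0 tau0 s0 dlE Lu1 Lv1 Lu2 Lv2 cS0 C1 Tuv u1C v1C u2C v2C beC uv1 ts4 tsn m8 mC.
have mp : 0 < m%:R :> R by rewrite ltr0n.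
have dl0 : 0 < dl by rewrite dlE divr_gt0.
have C0 : 0 < C by lra.
have [c [e ce]] := rotor be (ltW dl0) (lexx 0).
rewrite mulr0 addr0 in ce.
set D := 1 ^+ 2 + (dl * be) ^+ 2 in ce.
have DE : D = 1 + (dl * be) ^+ 2 by rewrite /D expr1n.
have D1 : 1 <= D by rewrite DE lerDl sqr_ge0.
have D0 : 0 < D by lra.
have cel j : `|c j| <= 1 /\ `|e j| <= 1.
  rewrite -(expr1n R j); apply: rotor_le => //; have [_ _ ->] := ce j.
  by rewrite expr1n; apply: lerXn2r; rewrite ?nnegrE ?invr_ge0 ?(ltW D0)//; rewrite invf_le1.
(* The Euler scheme of a rotation loses modulus; for [m] large with respect to [(tau be)^2] the loss
   over the whole window is at most one half. *)
have Dhalf j : (j <= m)%N -> 1 / 2 <= D^-1 ^+ j.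
  move=> jm; have y0 : 0 <= (dl * be) ^+ 2 by exact: sqr_ge0.
  have my : m%:R * (dl * be) ^+ 2 <= 1 / 2.
    rewrite exprMn (_ : m%:R * (dl ^+ 2 * be ^+ 2) = tau ^+ 2 * be ^+ 2 / m%:R); last first.
      by rewrite dlE; field; rewrite gt_eqF.
    rewrite ler_pdivrMr//.
    have b2 : be ^+ 2 <= (C * s) ^+ 2.
      by rewrite -[be ^+ 2]real_normK ?num_real// lerXn2r ?nnegrE// mulr_ge0 ?ltW.
    have h : tau ^+ 2 * be ^+ 2 <= tau ^+ 2 * (C * s) ^+ 2 by rewrite ler_wpM2l// sqr_ge0.
    have h0 : 0 <= tau ^+ 2 * (C * s) ^+ 2 by rewrite mulr_ge0 ?sqr_ge0.
    rewrite exprMn in h h0; lra.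
  have y1 : (dl * be) ^+ 2 <= 1.
    have : (dl * be) ^+ 2 <= m%:R * (dl * be) ^+ 2 by rewrite -[leLHS]mul1r ler_wpM2r// ler1n.
    lra.
  have h1 : 1 - (dl * be) ^+ 2 <= D^-1.
    rewrite -[leRHS]mul1r ler_pdivlMr// DE mulrDr mulr1 mulrBl mul1r.
    have : 0 <= (dl * be) ^+ 2 * (dl * be) ^+ 2 by rewrite mulr_ge0.
    lra.
  apply: (@le_trans _ _ ((1 - (dl * be) ^+ 2) ^+ j)).
    apply: le_trans (bernoulli_sub j y0 y1).
    have : j%:R * (dl * be) ^+ 2 <= m%:R * (dl * be) ^+ 2 by rewrite ler_wpM2r// ler_nat.
    lra.
  by apply: lerXn2r; rewrite ?nnegrE ?subr_ge0 ?invr_ge0 ?(ltW D0).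
(* The bump [(1 - t / tau)^2] on the grid, and its backward difference quotient. [phi] is 0 at the
   end of the window and [psi] is of order [1 / m] there, which makes [a m] small. *)
pose phi (j : nat) : R := (1 - j%:R / m%:R) ^+ 2.
pose psi (j : nat) : R := ((2 * j%:R - 1) / m%:R - 2) / tau.
have phi1 j : (j <= m)%N -> 0 <= phi j <= 1.
  move=> jm; rewrite sqr_ge0 /=.
  have h1 : j%:R / m%:R <= 1 :> R by rewrite ler_pdivrMr// mul1r ler_nat.
  have h0 : 0 <= j%:R / m%:R :> R by rewrite divr_ge0.
  by rewrite -(expr1n R 2) lerXn2r ?nnegrE//; lra.
have psi2 j : (j < m)%N -> `|psi j.+1| <= 2 / tau.
  move=> jm; rewrite normrM [`|tau^-1|]ger0_norm ?invr_ge0 ?(ltW tau0)// ler_wpM2r ?invr_ge0 ?(ltW tau0)//.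
  have j1 : 1 <= j.+1%:R :> R by rewrite ler1n.
  have jm1 : j.+1%:R <= m%:R :> R by rewrite ler_nat.
  have h1 : (2 * j.+1%:R - 1) / m%:R <= 2 :> R.
    by rewrite ler_pdivrMr//; lra.
  have h0 : 0 <= (2 * j.+1%:R - 1) / m%:R :> R.
    by apply: divr_ge0 => //; lra.
  by rewrite ler_norml; lra.
have phiS j : phi j.+1 - phi j = dl * psi j.+1.
  rewrite /phi /psi dlE (_ : j.+1%:R = j%:R + 1 :> R) ?natr1//; field.
  by rewrite !gt_eqF.
have psiS j : psi j - psi j.+1 = - (2 * dl / tau ^+ 2).
  rewrite /psi dlE (_ : j.+1%:R = j%:R + 1 :> R) ?natr1//; field.
  by rewrite !gt_eqF.
have e_le (x y : 'cV[R]_n) j : `|x| <= C -> `|y| <= C -> `|c j *: x - e j *: y| <= 2 * C.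
  move=> xC yC; have [h1 h2] := cel j; rewrite (le_trans (norm_comb_le _ _ _ _))//.
  rewrite (_ : 2 * C = 1 * C + 1 * C); last by ring.
  by rewrite lerD// ler_pM.
have ts0 : 0 < tau * s by rewrite mulr_gt0.
have gen (x1 y1 x2 y2 : 'cV[R]_n) :
    L *m x1 = 0 *: x1 - be *: y1 -> L *m y1 = 0 *: y1 + be *: x1 ->
    L *m x2 = 0 *: x2 - be *: y2 + s *: x1 -> L *m y2 = 0 *: y2 + be *: x2 + s *: y1 ->
    `|x1| <= C -> `|y1| <= C -> `|x2| <= C -> `|y2| <= C ->
    let a j := phi j *: (c j *: x1 - e j *: y1) - (psi j / s) *: (c j *: x2 - e j *: y2) in
    [/\ forall j, (j < m)%N -> `|a j.+1| <= 3 * C, `|a m| <= 2 * C / (tau * s * m%:R) &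
    forall j, (j < m)%N -> `|a j.+1 + dl *: (L *m a j.+1) - a j| <= dl * (5 * C / (tau ^+ 2 * s))].
  move=> Lx1 Ly1 Lx2 Ly2 x1C y1C x2C y2C a; split.
  - move=> j jm; rewrite /a (le_trans (norm_comb_le _ _ _ _))//.
    have h1 := e_le x1 y1 j.+1 x1C y1C; have h2 := e_le x2 y2 j.+1 x2C y2C.
    have /andP[p0 p1] := phi1 j.+1 jm; have p2 := psi2 j jm.
    have q1 : `|phi j.+1| * `|c j.+1 *: x1 - e j.+1 *: y1| <= 1 * (2 * C).
      by rewrite ler_pM// ger0_norm.
    have q2 : `|psi j.+1 / s| * `|c j.+1 *: x2 - e j.+1 *: y2| <= 1 / 2 * (2 * C).
      rewrite ler_pM// normrM [`|s^-1|]ger0_norm ?invr_ge0 ?(ltW s0)//.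
      rewrite (le_trans (ler_wpM2r _ p2)) ?invr_ge0 ?(ltW s0)//.
      rewrite -mulrA -invfM ler_pdivrMr// (_ : 1 / 2 * (tau * s) = tau * s / 2); last by ring.
      by rewrite ler_pdivlMr// (_ : 2 * 2 = 4)// -natrM.
    by rewrite (_ : 3 * C = 1 * (2 * C) + 1 / 2 * (2 * C)); [exact: lerD|field].
  - rewrite /a /phi divff ?gt_eqF// subrr expr0n scale0r sub0r normrN normrZ.
    have -> : psi m = - (tau * m%:R)^-1 by rewrite /psi; field; rewrite !gt_eqF.
    have q0 : 0 < (tau * m%:R)^-1 by rewrite invr_gt0 mulr_gt0.
    rewrite mulNr normrN ger0_norm ?divr_ge0 ?(ltW q0) ?(ltW s0)//.
    rewrite (_ : 2 * C / (tau * s * m%:R) = (tau * m%:R)^-1 / s * (2 * C)); last first.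
      by field; rewrite !gt_eqF.
    by rewrite ler_wpM2l ?divr_ge0 ?(ltW q0) ?(ltW s0)//; exact: e_le.
  move=> j jm; have [h1 h2 _] := ce j.
  have E1 : (c j.+1 *: x1 - e j.+1 *: y1) + dl *: (L *m (c j.+1 *: x1 - e j.+1 *: y1)) = c j *: x1 - e j *: y1.
    rewrite (spiral_step (w := 0) (w' := 0) (al := 0) (be := be) (c := c j) (e := e j)) ?addr0//; last 2 first.
    - by rewrite mulr0 addr0.
    - by rewrite mulr0 addr0.
    by rewrite !scaler0 subr0 scaler0 addr0.
  have E2 : (c j.+1 *: x2 - e j.+1 *: y2) + dl *: (L *m (c j.+1 *: x2 - e j.+1 *: y2)) =
      c j *: x2 - e j *: y2 + (dl * s) *: (c j.+1 *: x1 - e j.+1 *: y1).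
    rewrite (spiral_step (w := s *: x1) (w' := s *: y1) (al := 0) (be := be) (c := c j) (e := e j))//; last 2 first.
    - by rewrite mulr0 addr0.
    - by rewrite mulr0 addr0.
    by congr (_ + _); apply/matrixP => i k; rewrite !mxE; ring.
  have E3 : L *m (c j.+1 *: x1 - e j.+1 *: y1) = - be *: (c j.+1 *: y1 - e j.+1 *: - x1).
    by rewrite mulmxBr -!scalemxAr Lx1 Ly1; apply/matrixP => i k; rewrite !mxE; ring.
  have n3 : `|c j.+1 *: y1 - e j.+1 *: - x1| <= 2 * C by apply: e_le; rewrite ?normrN.
  have n2 := e_le x2 y2 j x2C y2C.
  rewrite /a; move: E1 E2 E3 n3 n2.
  move: (c j.+1 *: x1 - _) (c j *: x1 - _) (c j.+1 *: x2 - _) (c j *: x2 - _) (c j.+1 *: y1 - _) => p1 p0 p4 p3 pp E1 E2 E3 n3 n2.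
  (* The term [s *: e1] that the Jordan block produces from [e2] cancels the increment of [phi] to
     first order; only second differences remain, hence the size [1 / (tau^2 s)]. *)
  have -> : phi j.+1 *: p1 - (psi j.+1 / s) *: p4 + dl *: (L *m (phi j.+1 *: p1 - (psi j.+1 / s) *: p4)) - (phi j *: p0 - (psi j / s) *: p3)
    = (dl * psi j.+1 * dl * - be) *: pp - (2 * dl / tau ^+ 2 / s) *: p3.
    have -> : phi j.+1 *: p1 - (psi j.+1 / s) *: p4 + dl *: (L *m (phi j.+1 *: p1 - (psi j.+1 / s) *: p4)) =
       phi j.+1 *: (p1 + dl *: (L *m p1)) - (psi j.+1 / s) *: (p4 + dl *: (L *m p4)).
      by rewrite mulmxBr -!scalemxAr; move: (L *m p1) (L *m p4) => x y; apply/matrixP => i k; rewrite !mxE; ring.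
    have p0E : p0 = p1 + dl *: (- be *: pp) by rewrite -E1 E3.
    rewrite E1 E2 -[phi j.+1](subrK (phi j)) phiS -[psi j](subrK (psi j.+1)) psiS p0E.
    move: (psi j.+1) (phi j) => ps ph.
    apply/matrixP => i k; rewrite !mxE; field.
    by rewrite !gt_eqF.
  rewrite (le_trans (norm_comb_le _ _ _ _))//.
  have k1 : `|dl * psi j.+1 * dl * - be| <= dl * (2 / tau * dl * (C * s)).
    move: (psi2 j jm); move: (psi j.+1) => ps psb.
    rewrite (_ : `|_| = dl * (`|ps| * dl * `|be|)); last first.
      by rewrite !normrM normrN (ger0_norm (ltW dl0)); ring.
    rewrite ler_wpM2l ?(ltW dl0)//; apply: ler_pM => //; first by rewrite mulr_ge0// ltW.
    by rewrite ler_wpM2r ?(ltW dl0).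
  have k2 : `|2 * dl / tau ^+ 2 / s| = dl * (2 / (tau ^+ 2 * s)).
    rewrite ger0_norm; first by field; rewrite !gt_eqF.
    by rewrite !divr_ge0 ?sqr_ge0 ?mulr_ge0 ?(ltW dl0) ?(ltW s0).
  have k3 : dl * (2 / tau * dl * (C * s)) * (2 * C) <= dl * (C / (tau ^+ 2 * s)).
    rewrite -mulrA ler_wpM2l ?(ltW dl0)//.
    rewrite (_ : 2 / tau * dl * (C * s) * (2 * C) = (4 * C ^+ 2 * s ^+ 2 * tau ^+ 2) * (s * tau ^+ 2 * m%:R)^-1); last first.
      by rewrite dlE; field; rewrite !gt_eqF.
    have iv : 0 <= (s * tau ^+ 2 * m%:R)^-1.
      by rewrite invr_ge0; apply: mulr_ge0 => //; apply: mulr_ge0; rewrite ?sqr_ge0 ?(ltW s0).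
    apply: (le_trans (ler_wpM2r iv mC)).
    rewrite (_ : m%:R / (s * tau ^+ 2 * m%:R) = 1 / (tau ^+ 2 * s)); last by field; rewrite !gt_eqF.
    by rewrite ler_wpM2r// invr_ge0; apply: mulr_ge0; rewrite ?sqr_ge0 ?(ltW s0).
  have k4 : `|dl * psi j.+1 * dl * - be| * `|pp| <= dl * (C / (tau ^+ 2 * s)).
    by apply: le_trans k3; apply: ler_pM.
  have k5 : `|2 * dl / tau ^+ 2 / s| * `|p3| <= dl * (2 / (tau ^+ 2 * s)) * (2 * C).
    by rewrite k2 ler_wpM2l// mulr_ge0 ?(ltW dl0)// divr_ge0// mulr_ge0 ?sqr_ge0 ?(ltW s0).
  apply: (le_trans (lerD k4 k5)).
  by rewrite le_eqVlt; apply/orP; left; apply/eqP; ring.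
pose a (x1 y1 x2 y2 : 'cV[R]_n) j := phi j *: (c j *: x1 - e j *: y1) - (psi j / s) *: (c j *: x2 - e j *: y2).
pose N (x1 y1 x2 y2 : 'cV[R]_n) := dl * \sum_(j < m) dot (T *m a x1 y1 x2 y2 j.+1) (T *m a x1 y1 x2 y2 j.+1).
(* Real and imaginary part together. The chain of the eigenvector contributes at least [1 / (128 C)]
   on average, and the bound on [(tau * s)^2] keeps the other chain below half of it. *)
have NN : cS * tau / (256 * C) <= N u1 v1 u2 v2 + N v1 (- u1) v2 (- u2).
  have low j : (j < m)%N -> cS * ((1 / 2 * (1 / 2)) * (1 / 16 - (j.+1%:R / m%:R - 1 / 2) / 2) / C - 8 * (n%:R * C ^+ 2) / (tau * s) ^+ 2) <=
     dot (T *m a u1 v1 u2 v2 j.+1) (T *m a u1 v1 u2 v2 j.+1) + dot (T *m a v1 (- u1) v2 (- u2) j.+1) (T *m a v1 (- u1) v2 (- u2) j.+1).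
    move=> jm; apply: (@le_trans _ _ (cS * (dot (a u1 v1 u2 v2 j.+1) (a u1 v1 u2 v2 j.+1) + dot (a v1 (- u1) v2 (- u2) j.+1) (a v1 (- u1) v2 (- u2) j.+1)))); last first.
      rewrite mulrDr lerD//.
        by rewrite /a comb_expand; exact: Tuv.
      by rewrite /a comb_expand_opp; exact: Tuv.
    rewrite ler_wpM2l//; apply: le_trans (lerD (dot_sub_ge _ _) (dot_sub_ge _ _)).
    rewrite !dotZl !dotZr.
    have s1 := dot_comb_sum u1 v1 (c j.+1) (e j.+1); have s2 := dot_comb_sum u2 v2 (c j.+1) (e j.+1).
    have [_ _ cD] := ce j.+1; rewrite cD in s1 s2.
    have Dh := Dhalf j.+1 jm.
    have D1j : D^-1 ^+ j.+1 <= 1 by apply: exprn_ile1; rewrite ?invr_ge0 ?(ltW D0) ?invf_le1.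
    have d2 := dot_pair_le u2C v2C.
    have t1 : 1 / 2 / C <= D^-1 ^+ j.+1 * (dot u1 u1 + dot v1 v1).
      by apply: ler_pM => //; rewrite ?invr_ge0 ?(ltW C0).
    have t2 : D^-1 ^+ j.+1 * (dot u2 u2 + dot v2 v2) <= 2 * (n%:R * C ^+ 2).
      apply: le_trans d2; rewrite -[leRHS]mul1r ler_wpM2r// addr_ge0 ?dot_ge0//.
    rewrite -s1 in t1; rewrite -s2 in t2.
    have p2 : (psi j.+1 / s) ^+ 2 <= 4 / (tau * s) ^+ 2.
      rewrite -[leLHS]real_normK ?num_real// (_ : 4 / (tau * s) ^+ 2 = (2 / tau / s) ^+ 2); last by field; rewrite !gt_eqF.
      rewrite lerXn2r ?nnegrE ?divr_ge0 ?(ltW tau0) ?(ltW s0)// normrM [`|s^-1|]ger0_norm ?invr_ge0 ?(ltW s0)//.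
      by rewrite ler_wpM2r ?invr_ge0 ?(ltW s0)//; exact: psi2.
    have f2 : 1 / 16 - (j.+1%:R / m%:R - 1 / 2) / 2 <= phi j.+1 ^+ 2.
      exact: quartic_tangent.
    move: s1 s2 t1 t2 => _ _; move: (dot (c j.+1 *: u1 - _) _) (dot (c j.+1 *: v1 - _) _) (dot (c j.+1 *: u2 - _) _) (dot (c j.+1 *: v2 - _) _) (dot_ge0 (c j.+1 *: u2 - e j.+1 *: v2)) (dot_ge0 (c j.+1 *: v2 - e j.+1 *: - u2)) => A1 A2 A3 A4 A30 A40 t1 t2.
    have g1 : (1 / 16 - (j.+1%:R / m%:R - 1 / 2) / 2) * (1 / 2 / C) <= phi j.+1 ^+ 2 * (A1 + A2).
      apply: (@le_trans _ _ (phi j.+1 ^+ 2 * (1 / 2 / C))); last by rewrite ler_wpM2l// sqr_ge0.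
      by rewrite ler_wpM2r// divr_ge0 ?(ltW C0).
    have g2 : (psi j.+1 / s) ^+ 2 * (A3 + A4) <= 4 / (tau * s) ^+ 2 * (2 * (n%:R * C ^+ 2)).
      by rewrite ler_pM ?sqr_ge0// addr_ge0.
    apply: (@le_trans _ _ (1 / 2 * (phi j.+1 ^+ 2 * (A1 + A2)) - (psi j.+1 / s) ^+ 2 * (A3 + A4))); last first.
      by rewrite le_eqVlt; apply/orP; left; apply/eqP; ring.
    move: g1 g2; move: (phi j.+1 ^+ 2 * _) ((psi j.+1 / s) ^+ 2 * _) => Z1 Z2 g1 g2.
    rewrite (_ : 1 / 2 * (1 / 2) * _ / C = 1 / 2 * ((1 / 16 - (j.+1%:R / m%:R - 1 / 2) / 2) * (1 / 2 / C))); last by ring.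
    rewrite (_ : 8 * (n%:R * C ^+ 2) / (tau * s) ^+ 2 = 4 / (tau * s) ^+ 2 * (2 * (n%:R * C ^+ 2))); last by ring.
    by rewrite lerB// ler_wpM2l.
  have s1 : \sum_(j < m) (cS * ((1 / 2 * (1 / 2)) * (1 / 16 - (j.+1%:R / m%:R - 1 / 2) / 2) / C - 8 * (n%:R * C ^+ 2) / (tau * s) ^+ 2)) =
     cS * ((1 / 2 * (1 / 2)) * (m%:R / 16 - 1 / 4) / C - m%:R * (8 * (n%:R * C ^+ 2) / (tau * s) ^+ 2)).
    rewrite (eq_bigr (fun j : 'I_m => cS * (1 / 4 * (1 / 16 + 1 / 4) / C - 8 * (n%:R * C ^+ 2) / (tau * s) ^+ 2) - cS / (8 * C * m%:R) * j.+1%:R)); last first.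
      by move=> j _; field; rewrite !gt_eqF.
    rewrite sumrB sumr_const card_ord -mulr_sumr sum_succ -[_ *+ m]mulr_natl; field.
    by rewrite !gt_eqF.
  rewrite /N -mulrDr -big_split /=; apply: (@le_trans _ _ (dl * (cS * ((1 / 2 * (1 / 2)) * (m%:R / 16 - 1 / 4) / C - m%:R * (8 * (n%:R * C ^+ 2) / (tau * s) ^+ 2))))); last first.
    by rewrite ler_wpM2l ?(ltW dl0)// -s1; apply: ler_sum => j _; exact: low.
  have m8' : 8 <= m%:R :> R by rewrite (ler_nat R 8 m).
  have q1 : (1 / 2 * (1 / 2)) * (m%:R / 32) / C <= (1 / 2 * (1 / 2)) * (m%:R / 16 - 1 / 4) / C.
    by rewrite ler_wpM2r ?invr_ge0 ?(ltW C0)//; exact: eighth_gap.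
  have q2 : 8 * (n%:R * C ^+ 2) / (tau * s) ^+ 2 <= 1 / (256 * C).
    rewrite ler_pdivrMr ?exprn_gt0//.
    rewrite (_ : 8 * (n%:R * C ^+ 2) = 1 / (256 * C) * (8 * (256 * (n%:R * C ^+ 3)))); last by field; rewrite gt_eqF.
    by apply: ler_wpM2l; [rewrite divr_ge0 ?ler01 ?mulr_ge0 ?ler0n ?(ltW C0)|exact: tsn].
  have q3 : m%:R * (8 * (n%:R * C ^+ 2) / (tau * s) ^+ 2) <= m%:R * (1 / (256 * C)) by rewrite ler_wpM2l.
  have -> : cS * tau / (256 * C) = dl * (cS * (1 / 2 * (1 / 2) * (m%:R / 32) / C - m%:R * (1 / (256 * C)))).
    by rewrite dlE; field; rewrite !gt_eqF.
  by rewrite ler_wpM2l ?(ltW dl0)// ler_wpM2l// lerB.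
have [h|h] := leP (cS * tau / (2 * (256 * C))) (N u1 v1 u2 v2).
  by have [k1 k2 k3] := gen _ _ _ _ Lu1 Lv1 Lu2 Lv2 u1C v1C u2C v2C; exists (a u1 v1 u2 v2).
have [] := gen v1 (- u1) v2 (- u2); rewrite ?normrN//.
- by rewrite Lv1 scalerN opprK.
- by rewrite mulmxN Lu1; apply/matrixP => i k; rewrite !mxE; ring.
- by rewrite Lv2 scalerN opprK.
- by rewrite mulmxN Lu2; apply/matrixP => i k; rewrite !mxE; ring.
move=> k1 k2 k3; exists (a v1 (- u1) v2 (- u2)); split => //; rewrite -/(N v1 (- u1) v2 (- u2)).
have e2 : cS * tau / (256 * C) = cS * tau / (2 * (256 * C)) + cS * tau / (2 * (256 * C)) by field; rewrite gt_eqF.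
by rewrite e2 in NN; exact: half_le NN h.
Qed.

End Spiral.

Section AdaptedExists.
Context {R : realType} {n : nat}.
Variables (B : {bilinear 'cV[R]_n -> 'cV[R]_n -> 'cV[R]_n}) (A S : 'M[R]_n) (c0 cS : R).
Hypothesis c01 : 1 <= c0.
Hypothesis cS0 : 0 < cS.
Hypothesis S_lower : forall u : 'cV[R]_n, cS * dot u u <= dot (S^T *m u) (S^T *m u).
Let Pp := Pi_kerperp A.

Lemma Lmx_scale (s : R) (k : 'cV[R]_n) : Lmx B (s *: k) = s *: Lmx B k.
Proof. by apply/matrixP => i j; rewrite !mxE linearZl_LR linearZr_LR !mxE; ring. Qed.

Lemma Lperp_scale (s : R) (k : 'cV[R]_n) : Lperp B A (s *: k) = s *: Lperp B A k.
Proof. by rewrite /Lperp Lmx_scale -scalemxAr -scalemxAl. Qed.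

Lemma tr_Lperp_scale (s : R) (k v : 'cV[R]_n) : (Lperp B A (s *: k))^T *m v = s *: ((Lperp B A k)^T *m v).
Proof. by rewrite Lperp_scale linearZ -scalemxAl. Qed.

Lemma direction (r Xc : R) (k0 : 'cV[R]_n) : 0 < r -> 1 <= Xc -> A *m k0 = 0 -> r ^+ 2 <= Xc * dot k0 k0 ->
  dot k0 k0 <= Xc * r ^+ 2 -> exists (s : R) k, [/\ 0 < s, k0 = s *: k, A *m k = 0, dot k k = 1 & r <= Xc * s /\ s <= Xc * r].
Proof.
move=> r0 X1 Ak h1 h2; have r20 : 0 < r ^+ 2 by rewrite exprn_gt0.
have X0 : 0 < Xc by lra.
have d0 : 0 < dot k0 k0 by rewrite -(pmulr_rgt0 _ X0) (lt_le_trans r20).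
pose s := Num.sqrt (dot k0 k0).
have s0 : 0 < s by rewrite sqrtr_gt0.
have ss : s ^+ 2 = dot k0 k0 by rewrite sqr_sqrtr ?ltW.
exists s, (s^-1 *: k0); split => //.
- by rewrite scalerA mulfV ?gt_eqF// scale1r.
- by rewrite -scalemxAr Ak scaler0.
- by rewrite dotZl dotZr -ss; field; rewrite gt_eqF.
have XX : Xc <= Xc ^+ 2 by rewrite expr2 -[leLHS]mulr1 ler_wpM2l ?(ltW X0).
split; rewrite -(@ler_pXn2r _ 2) ?nnegrE ?mulr_ge0 ?(ltW s0) ?(ltW r0) ?(ltW X0)// exprMn ss.
  by rewrite (le_trans h1)// ler_wpM2r ?(ltW d0).
by rewrite (le_trans h2)// ler_wpM2r ?(ltW r20).
Qed.

(** An integer [h] with [h^5] comparable to [r], so that [h^4] windows per unit of time have length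
    of order [r^(-4/5)]. *)
Lemma root5 (r : R) : 1 <= r -> exists2 h : nat, (0 < h)%N & h%:R ^+ 5 <= r <= 32 * h%:R ^+ 5.
Proof.
move=> r1; pose p (h : nat) := (h%:R ^+ 5 <= r).
have r0 : 0 <= r by lra.
have p1 : exists h, p h by exists 1%N; rewrite /p expr1n.
have pb h : p h -> (h <= Num.truncn r)%N.
  rewrite /p => ph; rewrite truncn_ge_nat//.
  case: h ph => [|h] ph; first by [].
  by rewrite (le_trans _ ph)// -[leLHS]expr1 ler_weXn2l// ler1n.
case: (ex_maxnP p1 pb) => h ph hmax; exists h.
  by apply: hmax; rewrite /p expr1n.
rewrite (ph : h%:R ^+ 5 <= r) /=; have h1 : (0 < h)%N by apply: hmax; rewrite /p expr1n.
have : ~~ p h.+1 by apply/negP => /hmax; rewrite ltnn.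
rewrite /p -ltNge => /ltW rh; rewrite (le_trans rh)//.
rewrite (_ : 32 * h%:R ^+ 5 = (2 * h%:R) ^+ 5); last by ring.
apply: lerXn2r; rewrite ?nnegrE ?mulr_ge0// -natrM ler_nat.
by rewrite mul2n -addnn -addn1 leq_add2l.
Qed.

Lemma discriminant_bound (x y z : R) : 0 < x -> x <= y -> y <= 1 -> `|z| <= y ->
  0 < (1 + x) ^+ 2 + z ^+ 2 - 1 <= 4 * y.
Proof.
move=> x0 xy y1 zy.
have xx : x ^+ 2 <= y by rewrite expr2 -[leRHS]mulr1; apply: ler_pM => //; lra.
have zz : z ^+ 2 <= y.
  by rewrite -[leLHS]real_normK ?num_real// expr2 -[leRHS]mulr1; apply: ler_pM => //; lra.
have := sqr_ge0 z; have := sqr_ge0 x; move=> *.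
by apply/andP; split; lra.
Qed.

Lemma norm_pair_le (u v : 'cV[R]_n) : dot u u + dot v v = 1 -> `|u| + `|v| <= 2.
Proof.
move=> uv1; have nu := le_norm_dot u; have nv := le_norm_dot v.
have u0 := dot_ge0 u; have v0 := dot_ge0 v.
have nu1 : `|u| <= 1 by rewrite -(@ler_pXn2r _ 2) ?nnegrE// expr1n (le_trans nu)//; lra.
have nv1 : `|v| <= 1 by rewrite -(@ler_pXn2r _ 2) ?nnegrE// expr1n (le_trans nv)//; lra.
lra.
Qed.

(** In powers of [h], with [r ~ h^5] and [tau = h^(-4)]: the growth exponent [tau s al] is of order
    [h], the boundary term is [r h^(-8) = h^(-3)], the nonlinear error [r tau^2] is [h^(-3)], and
    the variance of the tested noise is of order [1 / s ~ h^(-5)]. The squared errors [h^(-6)] lose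
    for large [h]. *)
Lemma adapted_unstable (g1 lam Lam : R) : 0 <= g1 -> 0 < lam -> 1 <= Lam ->
  (forall k : 'cV[R]_n, A *m k = 0 -> dot k k = 1 -> exists al be u v,
     [/\ lam <= al, al <= Lam & `|be| <= Lam] /\
     [/\ (Lperp B A k)^T *m u = al *: u - be *: v, (Lperp B A k)^T *m v = al *: v + be *: u,
         Pp^T *m u = u, Pp^T *m v = v & dot u u + dot v v = 1]) ->
  forall K M1 Xc : R, 1 <= K -> 0 <= M1 -> 1 <= Xc ->
  exists R0 : R, forall r : R, R0 <= r -> exists q : nat, [/\ (0 < q)%N, q%:R <= r &
   forall k0 : 'cV[R]_n, A *m k0 = 0 -> r ^+ 2 <= Xc * dot k0 k0 -> dot k0 k0 <= Xc * r ^+ 2 ->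
     exists m1, forall m, (m1 < m)%N -> adapted B A S c0 g1 0 K M1 Xc r q m k0].
Proof.
move=> g10 lam0 Lam1 spec K M1 Xc K1 M10 X1.
have X0 : 0 < Xc by lra.
have L0 : 0 < Lam by lra.
(* The eighth power of the growth factor is used because the covector at the end is multiplied by
   [r ~ h^5] and [h^(-3)] has to remain. *)
have [C8 C8p hC] : exists2 C8 : R, 0 < C8 & forall x : R, (lam * x / (16 * Xc)) ^+ 8 = x ^+ 8 / C8.
  exists ((16 * Xc / lam) ^+ 8); first by rewrite exprn_gt0// divr_gt0// mulr_gt0.
  by move=> x; field; rewrite !gt_eqF.
have C80 : 0 <= C8 by exact: ltW.
have c00 : 0 <= c0 by exact: le_trans ler01 c01.
have K0 : 0 <= K by lra.
pose E : R := c0 ^+ 2 * (2 * C8) * (Xc * 32) + 20 * c0 ^+ 3 * K * (2 * (g1 * (64 * Xc)) * K + (c0 * (M1 + 1) + 1)).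
have E0 : 0 <= E.
  have a1 : 0 <= c0 ^+ 2 * (2 * C8) * (Xc * 32) by apply: mulr_ge0; [apply: mulr_ge0; [exact: sqr_ge0|exact: mulr_ge0]|rewrite mulr_ge0// ltW].
  have a2 : 0 <= 20 * c0 ^+ 3 * K * (2 * (g1 * (64 * Xc)) * K + (c0 * (M1 + 1) + 1)).
    rewrite !mulr_ge0 ?exprn_ge0// addr_ge0 ?addr_ge0 ?mulr_ge0 ?addr_ge0 ?(ltW X0)//.
  by rewrite /E addr_ge0.
pose H : R := 1 + 2 * C8 + E ^+ 2 * (128 * (16 * (Xc * (32 * Lam))) / cS).
have EcS : 0 <= E ^+ 2 * (128 * (16 * (Xc * (32 * Lam))) / cS).
  apply: mulr_ge0; first exact: sqr_ge0.
  by rewrite divr_ge0 ?(ltW cS0) ?mulr_ge0 ?ler0n ?(ltW X0) ?(ltW L0).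
have H1 : 1 <= H by rewrite /H; lra.
exists (32 * H ^+ 5) => r rH.
have r1 : 1 <= r.
  by have := exprn_ege1 5 H1; lra.
have [h h0 /andP[hr rh]] := root5 r1.
have hH : H <= h%:R.
  rewrite -(@ler_pXn2r _ 5) ?nnegrE//; first lra.
  by lra.
have h1 : 1 <= h%:R :> R by lra.
have hp : 0 < h%:R :> R by lra.
exists (h ^ 4)%N; split; first by rewrite expn_gt0 h0.
  by rewrite natrX (le_trans _ hr)// ler_weXn2l.
move=> k0 Ak0 rk0 kr0.
have r0 : 0 < r by lra.
have [s [k [s0 k0E Ak k1 [rs sr]]]] := direction r0 X1 Ak0 rk0 kr0.
have [al [be [u [v [[lal alL beL] [Lu Lv Pu Pv uv1]]]]]] := spec k Ak k1.
(* At least 8 steps for [bernoulli_power] with exponent 8, and [dl * s * Lam <= 1] so that one step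
   is not too coarse. *)
exists (8 + Num.truncn (s * Lam))%N => m m1; pose tau : R := (h%:R ^+ 4)^-1; pose dl := tau / m%:R.
have m8 : (8 <= m)%N by rewrite (leq_trans _ (ltnW m1))// leq_addr.
have mp : 0 < m%:R :> R by rewrite ltr0n (leq_trans _ m8).
have tau0 : 0 < tau by rewrite invr_gt0 exprn_gt0.
have tau1 : tau <= 1 by rewrite invf_le1 ?exprn_gt0// exprn_ege1.
have dl0 : 0 < dl by rewrite divr_gt0.
have al0 : 0 < al by exact: lt_le_trans lal.
have sal0 : 0 <= s * al by rewrite mulr_ge0 ?ltW.
have mL : s * Lam <= m%:R.
  rewrite ltW// (lt_trans (truncnS_gt _))// ltr_nat (leq_ltn_trans _ m1)//.
  by rewrite -addn1 addnC leq_add2r.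
have dsL : dl * s * Lam <= 1.
  rewrite /dl -mulrA mulrAC ler_pdivrMr// mul1r (le_trans _ mL)// -[leRHS]mul1r ler_wpM2r//.
  by rewrite mulr_ge0 ?ltW.
rewrite k0E /adapted natrX -/tau -/dl.
have Lu' : (Lperp B A (s *: k))^T *m u = (s * al) *: u - (s * be) *: v.
  by rewrite tr_Lperp_scale Lu scalerBr !scalerA.
have Lv' : (Lperp B A (s *: k))^T *m v = (s * al) *: v + (s * be) *: u.
  by rewrite tr_Lperp_scale Lv scalerDr !scalerA.
have T_low (x y : R) : cS * dot (x *: u + y *: v) (x *: u + y *: v) <=
   dot (S^T *m Pp^T *m (x *: u + y *: v)) (S^T *m Pp^T *m (x *: u + y *: v)).
  rewrite -!mulmxA mulmxDr -!scalemxAr Pu Pv; exact: S_lower.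
have [a [a_step a_le a_noise]] := spiral m (ltW dl0) sal0 Lu' Lv' (ltW cS0) T_low.
have uv2 : `|u| + `|v| <= 2.
  exact: norm_pair_le.
pose qq := 1 + dl * (s * al).
have qq1 : 1 <= qq by rewrite lerDl mulr_ge0 ?(ltW dl0).
have qq0 : 0 < qq by exact: lt_le_trans qq1.
have iq : 0 <= qq^-1 <= 1 by rewrite invr_ge0 (ltW qq0) invf_le1.
(* [qq ^ m >= (1 + x / 16) ^ 8] with [x = tau * s * al] of order [h] *)
have pw : (lam * h%:R / (16 * Xc)) ^+ 8 <= qq ^+ m.
  apply: le_trans (bernoulli_power _ _ m8) => //; last by rewrite mulr_ge0 ?(ltW dl0).
  apply: lerXn2r; rewrite ?nnegrE ?divr_ge0 ?mulr_ge0 ?addr_ge0 ?divr_ge0 ?mulr_ge0 ?(ltW lam0) ?(ltW X0) ?(ltW dl0) ?(ltW tau0) ?(ltW s0) ?(ltW al0)//.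
  apply: (@le_trans _ _ (m%:R * (dl * (s * al)) / (2 * 8%:R))); last by rewrite lerDr.
  rewrite (_ : m%:R * (dl * (s * al)) = tau * s * al); last by rewrite /dl; field; rewrite gt_eqF.
  rewrite (_ : 2 * 8%:R = 16 :> R); last by rewrite -natrM.
  rewrite invfM mulrA mulrAC ler_wpM2r//.
  have sh : h%:R / Xc <= tau * s.
    rewrite ler_pdivrMr// /tau -mulrA mulrC ler_pdivlMr ?exprn_gt0// -exprS [s * Xc]mulrC.
    exact: le_trans rs.
  have hX0 : 0 <= h%:R / Xc by rewrite divr_ge0 ?(ltW X0).
  apply: (@le_trans _ _ (lam * (tau * s))); first by rewrite -mulrA ler_wpM2l// ltW.
  by rewrite [leRHS]mulrC ler_wpM2r// mulr_ge0 ?(ltW tau0) ?(ltW s0).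
have hC8 : 0 < h%:R ^+ 8 / C8 by rewrite divr_gt0// exprn_gt0.
have qm : qq^-1 ^+ m <= C8 / h%:R ^+ 8.
  rewrite exprVn (_ : C8 / h%:R ^+ 8 = (h%:R ^+ 8 / C8)^-1); last by rewrite invf_div.
  by rewrite lef_pV2 ?posrE ?exprn_gt0// -hC.
have am : `|a m| <= 2 * C8 / h%:R ^+ 8.
  rewrite (le_trans (a_le m))// -/qq (_ : 2 * C8 / h%:R ^+ 8 = C8 / h%:R ^+ 8 * 2); last by ring.
  by apply: ler_pM => //; rewrite ?exprn_ge0 ?addr_ge0//; have /andP[] := iq.
exists a, 2, 0, (2 * C8 / h%:R ^+ 8); split => //.
- move=> j jm; rewrite (le_trans (a_le j.+1))// -/qq -[leRHS]mul1r; have /andP[i0 i1] := iq.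
  by apply: ler_pM; rewrite ?exprn_ge0 ?addr_ge0// exprn_ile1.
- by move=> j jm; rewrite a_step subrr normr0 mulr0.
have lhs : 0 <= c0 ^+ 2 * (2 * C8 / h%:R ^+ 8) * (Xc * r) +
   10 * c0 ^+ 3 * 2 * K * tau * (2 * (g1 * (1 + Xc * r)) * K * tau + 0 * K * tau + c0 * (M1 + tau) + 1) +
   2 * c0 * 0 * K * tau <= E / h%:R ^+ 3.
  have Xr0 : 0 <= Xc * r by rewrite mulr_ge0 ?ltW.
  have g0 : 0 <= g1 * (1 + Xc * r) by rewrite mulr_ge0// addr_ge0.
  have t0 : 0 <= tau by exact: ltW.
  have b1 : 0 <= 2 * (g1 * (1 + Xc * r)) * K * tau by apply: mulr_ge0 => //; apply: mulr_ge0 => //; exact: mulr_ge0.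
  have b2 : 0 <= c0 * (M1 + tau) by apply: mulr_ge0 => //; exact: addr_ge0.
  have b3 : 0 <= 10 * c0 ^+ 3 * 2 * K * tau by rewrite !mulr_ge0 ?exprn_ge0.
  have b4 : 0 <= c0 ^+ 2 * (2 * C8 / h%:R ^+ 8) * (Xc * r).
    by apply: mulr_ge0 => //; apply: mulr_ge0; rewrite ?sqr_ge0// divr_ge0 ?exprn_ge0 ?mulr_ge0.
  rewrite mulr0 !mul0r !addr0; apply/andP; split.
    apply: addr_ge0 => //; apply: mulr_ge0 => //; apply: addr_ge0 => //; exact: addr_ge0.
  rewrite /E [leRHS]mulrDl; apply: lerD.
    rewrite (_ : c0 ^+ 2 * (2 * C8) * (Xc * 32) / h%:R ^+ 3 = c0 ^+ 2 * (2 * C8 / h%:R ^+ 8) * (Xc * (32 * h%:R ^+ 5))); last first.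
      by field; rewrite gt_eqF.
    rewrite ler_wpM2l//; last by rewrite ler_wpM2l ?(ltW X0).
    by apply: mulr_ge0; rewrite ?sqr_ge0// divr_ge0 ?exprn_ge0 ?mulr_ge0.
  have Xr : 1 + Xc * r <= 64 * Xc * h%:R ^+ 5.
    have q1 : 1 <= Xc * r by rewrite -[leLHS]mulr1 ler_pM.
    have q2 : Xc * r <= Xc * (32 * h%:R ^+ 5) by rewrite ler_wpM2l ?(ltW X0).
    rewrite (_ : 64 * Xc * h%:R ^+ 5 = Xc * (32 * h%:R ^+ 5) + Xc * (32 * h%:R ^+ 5)); last by ring.
    by apply: lerD => //; exact: le_trans q2.
  have t1 : 2 * (g1 * (1 + Xc * r)) * K * tau <= (2 * (g1 * (64 * Xc)) * K) * h%:R.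
    rewrite (_ : 2 * (g1 * (64 * Xc)) * K * h%:R = 2 * (g1 * (64 * Xc * h%:R ^+ 5)) * K * tau); last first.
      by rewrite /tau; field; rewrite gt_eqF.
    by apply: ler_wpM2r => //; apply: ler_wpM2r => //; rewrite ler_wpM2l// ler_wpM2l.
  have t2 : c0 * (M1 + tau) + 1 <= (c0 * (M1 + 1) + 1) * h%:R.
    apply: (@le_trans _ _ (c0 * (M1 + 1) + 1)).
      by rewrite lerD2r ler_wpM2l// lerD2l.
    by rewrite -[leLHS]mulr1 ler_wpM2l// addr_ge0// mulr_ge0// addr_ge0.
  rewrite (_ : 20 * c0 ^+ 3 * K * (2 * (g1 * (64 * Xc)) * K + (c0 * (M1 + 1) + 1)) / h%:R ^+ 3 =
     10 * c0 ^+ 3 * 2 * K * tau * ((2 * (g1 * (64 * Xc)) * K + (c0 * (M1 + 1) + 1)) * h%:R)); last first.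
    by rewrite /tau; field; rewrite gt_eqF.
  rewrite ler_wpM2l// [leRHS]mulrDl -addrA; exact: lerD.
case/andP: lhs => lhs0 lhs1.
apply: (@le_lt_trans _ _ ((E / h%:R ^+ 3) ^+ 2)).
  by apply: lerXn2r; rewrite ?nnegrE// (le_trans lhs0).
move: a_noise; rewrite uv1 mulr1 -/qq; set D := qq ^+ 2 + _; set Gd := \sum_(j < m) D^-1 ^+ j.+1; set G := \sum_(j < m) dot _ _ => a_noise.
have dsp : 0 < dl * s by rewrite mulr_gt0.
have DL : 0 < D - 1 <= 4 * (dl * s * Lam).
  have x1 : 0 <= dl * s * al <= dl * s * Lam by rewrite mulr_ge0 ?(ltW dsp) ?(ltW al0)//= ler_wpM2l ?(ltW dsp).
  have x2 : `|dl * s * be| <= dl * s * Lam by rewrite normrM (ger0_norm (ltW dsp)) ler_wpM2l ?(ltW dsp).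
  have x3 : 0 < dl * s * al by rewrite mulr_gt0.
  case/andP: x1 => _ x1.
  by have := discriminant_bound x3 x1 dsL x2; rewrite -[dl * s * al]mulrA -[dl * s * be]mulrA.
case/andP: DL => D10 DL.
have D0 : 0 < D by rewrite -(subrK 1 D) addr_gt0.
(* The geometric sum is nearly complete, since the solution has decayed below 1/2 at the end;
   dividing by [D - 1], at most of order [dl s Lam], gives a variance of order [1 / (s Lam)]. *)
have Gsum : (D - 1) * Gd >= 1 / 2.
  rewrite /Gd geometric_sum ?gt_eqF//.
  have : D^-1 ^+ m <= 1 / 2.
    apply: (@le_trans _ _ (qq^-1 ^+ m)).
      apply: lerXn2r; rewrite ?nnegrE ?invr_ge0 ?(ltW D0) ?(ltW qq0)// lef_pV2 ?posrE//.
      by rewrite /D (le_trans (ler_eXnr (n := 2) _ qq1))// lerDl sqr_ge0.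
    apply: (le_trans qm); rewrite ler_pdivrMr ?exprn_gt0//.
    rewrite mul1r [leRHS]mulrC ler_pdivlMr// [leLHS]mulrC (le_trans _ (ler_eXnr (n := 8) _ h1))//.
    by rewrite (le_trans _ hH)// /H -addrA addrCA lerDl addr_ge0.
  by move=> Dm; rewrite lerBrDl -lerBrDr (le_trans Dm)// lerBrDr -splitr.
have Gd0 : 0 <= Gd by apply: sumr_ge0 => j _; rewrite exprn_ge0// invr_ge0 ltW.
have G1 : 1 / 2 <= 4 * (dl * s * Lam) * Gd by rewrite (le_trans Gsum)// ler_wpM2r.
have sLp : 0 < s * Lam by rewrite mulr_gt0.
have G2 : (8 * (s * Lam))^-1 <= dl * Gd.
  rewrite -[leLHS]mul1r ler_pdivrMr ?mulr_gt0//.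
  rewrite (_ : dl * Gd * (8 * (s * Lam)) = 2 * (4 * (dl * s * Lam) * Gd)); last by ring.
  by apply: (@le_trans _ _ (2 * (1 / 2))); [rewrite mul1r divff|rewrite ler_wpM2l].
have G3 : cS / 2 * (8 * (s * Lam))^-1 <= dl * G.
  apply: (@le_trans _ _ (cS / 2 * (dl * Gd))); first by rewrite ler_wpM2l// divr_ge0// ltW.
  by rewrite [leLHS]mulrCA ler_wpM2l ?(ltW dl0).
have -> : \sum_(j < m) dot (S^T *m ((Pi_kerperp A)^T *m a j.+1)) (S^T *m ((Pi_kerperp A)^T *m a j.+1)) = G.
  by rewrite /G; apply: eq_bigr => j _; rewrite !mulmxA.
apply: (@lt_le_trans _ _ (1 / 128 * (cS / 2 * (8 * (s * Lam))^-1))); last first.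
  by rewrite (_ : dl / 128 * G = 1 / 128 * (dl * G)); [rewrite ler_wpM2l|ring].
have hE : E ^+ 2 * (128 * (16 * (Xc * (32 * Lam))) / cS) < h%:R.
  by apply: lt_le_trans hH; rewrite /H ltrDr addr_gt0// mulr_gt0.
have s5 : s <= Xc * (32 * h%:R ^+ 5) by rewrite (le_trans sr)// ler_wpM2l ?(ltW X0).
apply: (@lt_le_trans _ _ (1 / 128 * (cS / 2 * (8 * (Xc * (32 * h%:R ^+ 5) * Lam))^-1))); last first.
  rewrite ler_wpM2l// ler_wpM2l ?divr_ge0 ?(ltW cS0)// lef_pV2 ?posrE ?mulr_gt0 ?exprn_gt0//.
  by rewrite ler_wpM2l// ler_wpM2r// ltW.
rewrite (_ : (E / h%:R ^+ 3) ^+ 2 = E ^+ 2 * (128 * (16 * (Xc * (32 * Lam))) / cS) * (cS / (128 * (16 * (Xc * (32 * Lam)))) / h%:R ^+ 6)); last first.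
  by field; rewrite !gt_eqF.
rewrite (_ : 1 / 128 * _ = h%:R * (cS / (128 * (16 * (Xc * (32 * Lam)))) / h%:R ^+ 6)); last first.
  by field; rewrite !gt_eqF.
by rewrite ltr_pM2r// divr_gt0 ?exprn_gt0// divr_gt0// ?mulr_gt0 ?ltr0n.
Qed.

(** With [g1 = 0] the nonlinear error is at most [C2 tau] with [C2] independent of [r], while the
    tested noise has variance at least [c2 tau] up to the constants of [adapted]. The boundary term
    and the residual are made at most [tau] each by taking [m], respectively [r], large. *)
Lemma adapted_resonant (g2 C : R) : 0 <= g2 -> 1 <= C ->
  (forall k : 'cV[R]_n, A *m k = 0 -> dot k k = 1 -> exists be u1 v1 u2 v2,
     [/\ (Lperp B A k)^T *m u1 = - be *: v1, (Lperp B A k)^T *m v1 = be *: u1,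
         (Lperp B A k)^T *m u2 = - be *: v2 + u1 & (Lperp B A k)^T *m v2 = be *: u2 + v1] /\
     [/\ Pp^T *m u1 = u1, Pp^T *m v1 = v1, Pp^T *m u2 = u2 & Pp^T *m v2 = v2] /\
     [/\ `|u1| <= C, `|v1| <= C, `|u2| <= C & `|v2| <= C] /\
     `|be| <= C /\ C^-1 <= dot u1 u1 + dot v1 v1) ->
  forall K M1 Xc : R, 1 <= K -> 0 <= M1 -> 1 <= Xc ->
  exists R0 : R, forall r : R, R0 <= r -> exists q : nat, [/\ (0 < q)%N, q%:R <= r &
   forall k0 : 'cV[R]_n, A *m k0 = 0 -> r ^+ 2 <= Xc * dot k0 k0 -> dot k0 k0 <= Xc * r ^+ 2 ->
     exists m1, forall m, (m1 < m)%N -> adapted B A S c0 0 g2 K M1 Xc r q m k0].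
Proof.
move=> g20 C1 spec K M1 Xc K1 M10 X1.
have X0 : 0 < Xc by lra.
have C0 : 0 < C by lra.
have c00 : 0 <= c0 by exact: le_trans ler01 c01.
have K0 : 0 <= K by lra.
pose C2 : R := 10 * c0 ^+ 3 * (3 * C) * K * (g2 * K + c0 * (M1 + 1) + 1).
have C20 : 0 <= C2.
  apply: mulr_ge0; last by rewrite !addr_ge0// !mulr_ge0// addr_ge0.
  by rewrite !mulr_ge0 ?exprn_ge0// ltW.
pose c2 : R := cS / (128 * (2 * (256 * C))).
have c20 : 0 < c2 by apply: divr_gt0; [exact: cS0|do 3! [apply: mulr_gt0; [by rewrite ltr0n|]]; exact: C0].
(* Exactly the condition [((C2 + 2) tau)^2 < c2 tau]. *)
pose q : nat := (Num.truncn ((C2 + 2) ^+ 2 / c2)).+1.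
have q1 : 1 <= q%:R :> R by rewrite ler1n.
have q0 : 0 < q%:R :> R by rewrite ltr0n.
have qc : (C2 + 2) ^+ 2 < c2 * q%:R by rewrite mulrC -ltr_pdivrMr// truncnS_gt.
pose tau : R := q%:R^-1.
have tau0 : 0 < tau by rewrite invr_gt0.
have tau1 : tau <= 1 by rewrite invf_le1.
(* A lower bound for [tau * s] that meets at once the three demands: [4], the residual, and the
   ratio of the two chains in [resonant]. *)
pose Y : R := 4 + 10 * c0 * C * K * q%:R + 8 * (256 * (n%:R * C ^+ 3)).
have y1 : 0 <= 10 * c0 * C * K * q%:R by rewrite !mulr_ge0 ?(ltW C0).
have y2 : 0 <= 8 * (256 * (n%:R * C ^+ 3)) by do 2! [apply: mulr_ge0; [by rewrite ler0n|]]; apply: mulr_ge0; [exact: ler0n|rewrite exprn_ge0 ?(ltW C0)].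
have Y4 : 4 <= Y by rewrite /Y -addrA lerDl addr_ge0.
have Ya : 10 * c0 * C * K * q%:R <= Y by rewrite /Y addrAC lerDr addr_ge0.
have Yb : 8 * (256 * (n%:R * C ^+ 3)) <= Y by rewrite /Y lerDr addr_ge0.
clearbody Y.
have Y1 : 1 <= Y by lra.
exists (Xc * q%:R * Y) => r rY; exists q.
have qr : q%:R <= r.
  by rewrite (le_trans _ rY)// -[leLHS]mulr1 ler_pM// -[leLHS]mul1r ler_wpM2r.
split => //; move=> k0 Ak0 rk0 kr0.
have r0 : 0 < r by lra.
have r1 : 1 <= r by lra.
have [s [k [s0 k0E Ak k1 [rs sr]]]] := direction r0 X1 Ak0 rk0 kr0.
have [be [u1 [v1 [u2 [v2 [[Lu1 Lv1 Lu2 Lv2] [[Pu1 Pv1 Pu2 Pv2] [[u1C v1C u2C v2C] [beC uv1]]]]]]]]] := spec k Ak k1.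
have Yts : Y <= tau * s.
  rewrite /tau mulrC ler_pdivlMr// -(ler_pM2l X0) (le_trans _ rs)// (le_trans _ rY)//.
  by rewrite -mulrA ler_wpM2l ?(ltW X0)// mulrC.
have ts0 : 0 < tau * s by rewrite mulr_gt0.
exists (8 + Num.truncn (c0 ^+ 2 * (Xc * r) * C * q%:R + 4 * C ^+ 2 * (Xc * r) ^+ 2))%N => m m1.
have b1 : 0 <= c0 ^+ 2 * (Xc * r) * C * q%:R.
  by rewrite !mulr_ge0 ?exprn_ge0 ?(ltW X0) ?(ltW r0) ?(ltW C0).
have b2 : 0 <= 4 * C ^+ 2 * (Xc * r) ^+ 2 by rewrite mulr_ge0 ?sqr_ge0// mulr_ge0 ?sqr_ge0.
have mm : c0 ^+ 2 * (Xc * r) * C * q%:R + 4 * C ^+ 2 * (Xc * r) ^+ 2 <= m%:R.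
  rewrite ltW// (lt_trans (truncnS_gt _))// ltr_nat (leq_ltn_trans _ m1)//.
  by rewrite -addn1 addnC leq_add2r.
have m8 : (8 <= m)%N by rewrite (leq_trans _ (ltnW m1))// leq_addr.
have mp : (0 < m)%N by rewrite (leq_trans _ m8).
have mR : 0 < m%:R :> R by rewrite ltr0n.
have ma : c0 ^+ 2 * (Xc * r) * C * q%:R <= m%:R by rewrite (le_trans _ mm)// lerDl.
have mb : 4 * C ^+ 2 * s ^+ 2 * tau ^+ 2 <= m%:R.
  apply: (@le_trans _ _ (4 * C ^+ 2 * (Xc * r) ^+ 2)); last by rewrite (le_trans _ mm)// lerDr.
  have t1 : tau ^+ 2 <= 1 by rewrite exprn_ile1// ltW.
  have s2 : s ^+ 2 <= (Xc * r) ^+ 2.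
    by apply: lerXn2r; rewrite ?nnegrE ?mulr_ge0 ?(ltW s0) ?(ltW X0) ?(ltW r0).
  have C4 : 0 <= 4 * C ^+ 2 by rewrite mulr_ge0 ?sqr_ge0.
  apply: (@le_trans _ _ (4 * C ^+ 2 * s ^+ 2)); last by rewrite ler_wpM2l.
  by rewrite -[leRHS]mulr1 ler_wpM2l// mulr_ge0// sqr_ge0.
have [] := @resonant _ _ (Lperp B A k0)^T (S^T *m Pp^T) u1 v1 u2 v2 (tau / m%:R) tau (s * be) s cS C m mp tau0 s0 erefl.
- by rewrite k0E tr_Lperp_scale Lu1 scale0r sub0r scalerA mulrN scaleNr.
- by rewrite k0E tr_Lperp_scale Lv1 scale0r add0r scalerA.
- by rewrite k0E tr_Lperp_scale Lu2 scale0r sub0r scalerDr scalerA mulrN scaleNr.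
- by rewrite k0E tr_Lperp_scale Lv2 scale0r add0r scalerDr scalerA.
- exact: ltW.
- by [].
- move=> x y z t; rewrite -mulmxA (_ : Pp^T *m (x *: u1 + y *: v1 + z *: u2 + t *: v2) = x *: u1 + y *: v1 + z *: u2 + t *: v2).
    exact: S_lower.
  by rewrite !mulmxDr -!scalemxAr Pu1 Pv1 Pu2 Pv2.
- by [].
- by [].
- by [].
- by [].
- by rewrite normrM (ger0_norm (ltW s0)) mulrC ler_wpM2r// ltW.
- by [].
- exact: le_trans Yts.
- apply: (le_trans Yb); apply: (le_trans Yts); rewrite expr2 -[leLHS]mulr1 ler_wpM2l ?(ltW ts0)//.
  exact: le_trans Yts.
- by [].
- exact: mb.
move=> a [a_le a_end a_step a_noise].
rewrite /adapted -/tau; exists a, (3 * C), (5 * C / (tau ^+ 2 * s)), (2 * C / (tau * s * m%:R)).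
have C3 : 0 <= 3 * C by rewrite mulr_ge0// ltW.
have C5 : 0 <= 5 * C / (tau ^+ 2 * s).
  by apply: divr_ge0; [rewrite mulr_ge0// ltW|apply: mulr_ge0; [exact: sqr_ge0|exact: ltW]].
split; [by split|exact: a_le|exact: a_end|exact: a_step|].
have h1 : c0 ^+ 2 * (2 * C / (tau * s * m%:R)) * (Xc * r) <= tau.
  rewrite (_ : c0 ^+ 2 * (2 * C / (tau * s * m%:R)) * (Xc * r) = (c0 ^+ 2 * (Xc * r) * C * q%:R) * (tau * (2 / (tau * s)) / m%:R)); last first.
    by rewrite /tau; field; rewrite !gt_eqF.
  have t2 : 2 / (tau * s) <= 1 by rewrite ler_pdivrMr// mul1r (le_trans _ Yts)// (le_trans _ Y4)// ler_nat.
  have p0 : 0 <= tau * (2 / (tau * s)) / m%:R.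
    by apply: divr_ge0 => //; apply: mulr_ge0; [exact: ltW|apply: divr_ge0 => //; exact: ltW].
  apply: (le_trans (ler_wpM2r p0 ma)).
  rewrite mulrCA divff ?gt_eqF// mulr1 -[leRHS]mulr1 ler_wpM2l// ltW//.
have h3 : 2 * c0 * (5 * C / (tau ^+ 2 * s)) * K * tau <= tau.
  rewrite (_ : 2 * c0 * (5 * C / (tau ^+ 2 * s)) * K * tau = (10 * c0 * C * K * q%:R) / (tau * s) * tau); last first.
    by rewrite /tau; field; rewrite !gt_eqF.
  rewrite -[leRHS]mul1r ler_wpM2r ?(ltW tau0)// ler_pdivrMr// mul1r; exact: le_trans Ya Yts.
have h2 : 10 * c0 ^+ 3 * (3 * C) * K * tau * (2 * (0 * (1 + Xc * r)) * K * tau + g2 * K * tau + c0 * (M1 + tau) + 1) <= C2 * tau.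
  rewrite mul0r mulr0 !mul0r add0r /C2 mulrAC ler_wpM2r ?(ltW tau0)//.
  rewrite ler_wpM2l ?mulr_ge0 ?exprn_ge0 ?(ltW C0)// lerD2r lerD//.
    by rewrite -[leRHS]mulr1 ler_wpM2l// mulr_ge0.
  by rewrite ler_wpM2l// lerD2l.
have lhs : c0 ^+ 2 * (2 * C / (tau * s * m%:R)) * (Xc * r) +
  10 * c0 ^+ 3 * (3 * C) * K * tau * (2 * (0 * (1 + Xc * r)) * K * tau + g2 * K * tau + c0 * (M1 + tau) + 1) +
  2 * c0 * (5 * C / (tau ^+ 2 * s)) * K * tau <= (C2 + 2) * tau.
  rewrite (_ : (C2 + 2) * tau = tau + C2 * tau + tau); last by ring.
  by apply: lerD => //; apply: lerD.
apply: (@le_lt_trans _ _ (((C2 + 2) * tau) ^+ 2)).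
  apply: lerXn2r => //; rewrite nnegrE; last by rewrite mulr_ge0 ?addr_ge0 ?(ltW tau0).
  have t0 := ltW tau0; have sC := ltW s0; have CC := ltW C0; have rr := ltW r0; have XX := ltW X0.
  apply: addr_ge0; [apply: addr_ge0|].
  - apply: mulr_ge0; last exact: mulr_ge0.
    by apply: mulr_ge0; [exact: sqr_ge0|apply: divr_ge0; rewrite !mulr_ge0].
  - apply: mulr_ge0; first by rewrite !mulr_ge0 ?exprn_ge0.
    rewrite mul0r mulr0 !mul0r add0r; apply: addr_ge0 => //; apply: addr_ge0; first by rewrite !mulr_ge0.
    by rewrite mulr_ge0// addr_ge0.
  - by apply: mulr_ge0 => //; apply: mulr_ge0 => //; apply: mulr_ge0 => //; exact: mulr_ge0.
apply: (@lt_le_trans _ _ (c2 * tau)).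
  rewrite exprMn expr2 mulrA ltr_pM2r// -[X in X < _]divr1 -[ltRHS]divr1 /tau.
  by rewrite !divr1 ltr_pdivrMr.
rewrite (_ : c2 * tau = 1 / 128 * (cS * tau / (2 * (256 * C)))); last by rewrite /c2; field; rewrite gt_eqF.
rewrite (_ : \sum_(j < m) dot (S^T *m ((Pi_kerperp A)^T *m a j.+1)) (S^T *m ((Pi_kerperp A)^T *m a j.+1)) =
  \sum_(j < m) dot (S^T *m Pp^T *m a j.+1) (S^T *m Pp^T *m a j.+1)); last by apply: eq_bigr => j _; rewrite !mulmxA.
move: a_noise; move: (\sum_(j < m) _) => G a_noise.
by rewrite (_ : tau / m%:R / 128 * G = 1 / 128 * (tau / m%:R * G)); [rewrite ler_wpM2l|ring].
Qed.

End AdaptedExists.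

(** * The matrix exponential *)

Section OperatorNorm.
Context {R : realType} {F : pzRingType} (abs : F -> R).
Hypothesis abs_ge0 : forall x, 0 <= abs x.
Hypothesis abs0 : abs 0 = 0.
Hypothesis abs1 : abs 1 = 1.
Hypothesis absD : forall x y, abs (x + y) <= abs x + abs y.
Hypothesis absM : forall x y, abs (x * y) = abs x * abs y.
Context {n : nat}.
Implicit Types (v : 'cV[F]_n) (M : 'M[F]_n).

Lemma coord_le_l2norm v i : abs (v i 0) <= l2norm abs v.
Proof.
rewrite -[leLHS]ger0_norm// -sqrtr_sqr ler_wsqrtr// (bigD1 i)//= lerDl.
by apply: sumr_ge0 => j _; exact: sqr_ge0.
Qed.

Lemma l2norm_le_sum v : l2norm abs v <= \sum_i abs (v i 0).
Proof.
have s0 : 0 <= \sum_i abs (v i 0) by exact: sumr_ge0.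
rewrite -[leRHS]ger0_norm// -sqrtr_sqr ler_wsqrtr// expr2 mulr_suml; apply: ler_sum => i _.
by rewrite expr2 ler_wpM2l// (bigD1 i)//= lerDl sumr_ge0.
Qed.

Lemma abs_sum (I : Type) (r : seq I) (f : I -> F) : abs (\sum_(i <- r) f i) <= \sum_(i <- r) abs (f i).
Proof.
elim/big_ind2 : _ => //; first by rewrite abs0.
by move=> x1 x2 y1 y2 h1 h2; rewrite (le_trans (absD _ _))// lerD.
Qed.

Lemma l2norm_mulmx_le M v (b : R) : (forall i j, abs (M i j) <= b) -> l2norm abs v <= 1 ->
  l2norm abs (M *m v) <= n%:R * n%:R * b.
Proof.
move=> Mb v1; apply: (le_trans (l2norm_le_sum _)).
apply: (@le_trans _ _ (\sum_(i < n) \sum_(j < n) b)); last first.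
  by rewrite !sumr_const card_ord -[_ *+ _ *+ _]mulr_natl -[b *+ n]mulr_natl mulrA.
apply: ler_sum => i _; rewrite mxE (le_trans (abs_sum _ _))//; apply: ler_sum => j _.
by rewrite absM -[leRHS]mulr1; apply: ler_pM => //; exact: le_trans (coord_le_l2norm _ _) v1.
Qed.

Lemma opnorm_has_ubound M : has_ubound [set l2norm abs (M *m v) | v in [set v : 'cV[F]_n | l2norm abs v <= 1]].
Proof.
exists (n%:R * n%:R * \sum_i \sum_j abs (M i j)) => _ [v v1 <-]; apply: l2norm_mulmx_le => // i j.
rewrite (bigD1 i)//= (bigD1 j)//= -addrA lerDl addr_ge0//.
  by apply: sumr_ge0 => k _.
by apply: sumr_ge0 => k _; exact: sumr_ge0.
Qed.

Lemma opnorm_ge0 M : 0 <= opnorm abs M.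
Proof.
apply: (@le_trans _ _ (l2norm abs (M *m 0))); first exact: sqrtr_ge0.
apply: ub_le_sup; first exact: opnorm_has_ubound.
by exists 0 => //=; rewrite /l2norm big1 ?sqrtr0// => i _; rewrite mxE abs0 expr0n.
Qed.

Lemma entry_le_opnorm M i j : abs (M i j) <= opnorm abs M.
Proof.
have -> : M i j = (M *m (delta_mx j 0 : 'cV[F]_n)) i 0 by rewrite -colE mxE.
apply: (le_trans (coord_le_l2norm _ _)); apply: ub_le_sup; first exact: opnorm_has_ubound.
exists (delta_mx j 0) => //=; rewrite /l2norm (bigD1 j)//= big1 => [|k kj].
  by rewrite mxE !eqxx abs1 expr1n addr0 sqrtr1.
by rewrite mxE (negbTE kj) abs0 expr0n.
Qed.

Lemma opnorm_le M (b : R) : (forall i j, abs (M i j) <= b) -> opnorm abs M <= n%:R * n%:R * b.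
Proof.
move=> Mb; apply: ge_sup.
  exists (l2norm abs (M *m 0)), 0 => //=; rewrite /l2norm big1 ?sqrtr0// => i _.
  by rewrite mxE abs0 expr0n.
by move=> _ [v v1 <-]; exact: l2norm_mulmx_le.
Qed.

End OperatorNorm.

(** * The matrix exponential as a limit of Euler products *)

Section MatrixExponential.
Context {R : realType}.

Lemma cvg_shift2 (T : topologicalType) (u : nat -> T) (l : T) :
  u @ \oo --> l -> (fun N => u N.+2) @ \oo --> l.
Proof. by move=> h U /h[N _ HN]; exists N => // k Nk; apply: HN; rewrite /= ltnW// ltnW. Qed.

Lemma cvg_mx (m n : nat) (u : nat -> 'M[R]_(m, n)) (E : 'M[R]_(m, n)) :
  (forall i j, (fun k => u k i j) @ \oo --> E i j) -> u @ \oo --> E.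
Proof.
move=> h; apply/cvgrPdist_le => e e0.
have : \forall k \near \oo, forall i, forall j, `|E i j - u k i j| <= e.
  apply: filter_forall => i; apply: filter_forall => j.
  by have /cvgrPdist_le/(_ e e0) := h i j.
apply: filterS => k hk; apply: mx_norm_le; first exact: ltW.
by move=> i j; rewrite !mxE.
Qed.

Lemma ffact_le (m k : nat) : (m ^_ k <= m ^ k)%N.
Proof.
elim: k => [|k IH]; first by rewrite ffactn0 expn0.
by rewrite ffactnSr expnSr leq_mul// leq_subr.
Qed.

(** [exp (y / (1 + y)) <= 1 + y], raised to the power [N.+1]; the exponent tends to [x], so this is
    a quantitative form of the classical limit. *)
Lemma expR_ge_power (x : R) (N : nat) : 0 <= x -> expR (x * N.+1%:R / (N.+1%:R + x)) <= (1 + x / N.+1%:R) ^+ N.+1.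
Proof.
move=> x0; pose y : R := x / N.+1%:R.
have y0 : 0 <= y by rewrite divr_ge0.
have Np : 0 < N.+1%:R :> R by [].
have h : expR (y / (1 + y)) <= 1 + y.
  have e : (1 + y)^-1 <= expR (- (y / (1 + y))).
    apply: le_trans (expR_ge1Dx _); rewrite le_eqVlt; apply/orP; left; apply/eqP; field.
    by rewrite gt_eqF// ltr_wpDr.
  by rewrite -[expR _]invrK -expRN -[leRHS]invrK lef_pV2// ?posrE ?invr_gt0 ?expR_gt0// ltr_wpDr.
rewrite (_ : x * _ / _ = (y / (1 + y)) *+ N.+1).
  by rewrite -mulr_natl expRM_natl; apply: lerXn2r; rewrite ?nnegrE ?expR_ge0 ?addr_ge0.
rewrite -mulr_natl /y; field.
rewrite !gt_eqF// ?ltr_wpDr//.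
Qed.

Context {n : nat}.
Implicit Types (M : 'M[R]_n).

Lemma norm_mxX M k : `|M ^+ k| <= (n%:R * `|M|) ^+ k.
Proof.
elim: k => [|k IH].
  rewrite !expr0; apply: mx_norm_le => // i j; rewrite mxE.
  by case: (i == j); rewrite ?normr0 ?normr1.
rewrite !exprS -mulmxE (le_trans (norm_mulmx _ _))//.
by rewrite -!mulrA ler_wpM2l// ler_wpM2l.
Qed.

Lemma scale_mxX (a : R) M k : (a *: M) ^+ k = a ^+ k *: M ^+ k.
Proof.
elim: k => [|k IH]; first by rewrite !expr0 scale1r.
by rewrite !exprS IH -!mulmxE -scalemxAl -scalemxAr scalerA.
Qed.

(* [1 / k! - C(N, k) / N ^ k >= 0], so the difference of the two approximations of
   the exponential of [M] is dominated by the same difference for the number [n |M|]. *)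
Lemma mxexp_euler M : (fun N : nat => (1 + N.+1%:R^-1 *: M) ^+ N.+1) @ \oo --> mxexp M.
Proof.
pose x : R := n%:R * `|M|.
have x0 : 0 <= x by rewrite mulr_ge0.
pose S (N : nat) := \sum_(k < N) (k`!%:R)^-1 *: M ^+ k.
have fp k : 0 < k`!%:R :> R by rewrite ltr0n fact_gt0.
have S_cvg : exists E : 'M[R]_n, S @ \oo --> E.
  exists (\matrix_(i, j) limn (series (fun k => (k`!%:R)^-1 * (M ^+ k) i j))).
  apply: cvg_mx => i j; rewrite mxE.
  have -> : (fun k => S k i j) = series (fun k => (k`!%:R)^-1 * (M ^+ k) i j).
    apply/funext => k; rewrite /S summxE /series /= big_mkord.
    by apply: eq_bigr => l _; rewrite mxE.
  apply: normed_cvg; apply: (@series_le_cvg _ _ (exp_coeff x)).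
  - by move=> k; exact: normr_ge0.
  - by move=> k; rewrite exp_coeff_ge0.
  - move=> k /=; rewrite normrM ger0_norm ?invr_ge0 ?(ltW (fp k))// /exp_coeff mulrC ler_wpM2r ?invr_ge0 ?(ltW (fp k))//.
    exact: le_trans (le_coord_norm _ _ _) (norm_mxX M k).
  exact: is_cvg_series_exp_coeff.
have [E SE] := S_cvg.
have -> : mxexp M = E by apply: cvg_lim => //; exact: norm_hausdorff.
pose D (N : nat) : R := series (exp_coeff x) N.+2 - expR (x * N.+1%:R / (N.+1%:R + x)).
have D0 : D @ \oo --> (0 : R).
  rewrite -(subrr (expR x)); apply: cvgB.
    by apply: cvg_shift2; exact: is_cvg_series_exp_coeff.
  apply: (@cvg_comp _ _ _ (fun N : nat => x * N.+1%:R / (N.+1%:R + x)) expR _ (nbhs x)); last exact: continuous_expR.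
  have -> : (fun N : nat => x * N.+1%:R / (N.+1%:R + x)) = (fun N : nat => x - x ^+ 2 * (N.+1%:R + x)^-1).
    by apply/funext => N; field; rewrite gt_eqF// ltr_wpDr.
  suff : (fun N : nat => x - x ^+ 2 * (N.+1%:R + x)^-1) @ \oo --> (x - x ^+ 2 * 0 : R) by rewrite mulr0 subr0.
  apply: cvgB; first exact: cvg_cst.
  apply: cvgMr.
  apply: (@squeeze_cvgr _ _ _ _ (fun=> 0) (fun N => harmonic N)).
  - near=> N; rewrite invr_ge0 addr_ge0//= /harmonic lef_pV2 ?posrE ?ltr_wpDr// lerDl//.
  - exact: cvg_cst.
  - exact: cvg_harmonic.
rewrite -[X in _ --> X]addr0.
have -> : (fun N : nat => (1 + N.+1%:R^-1 *: M) ^+ N.+1) = (fun N => S N.+2 + ((1 + N.+1%:R^-1 *: M) ^+ N.+1 - S N.+2)).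
  by apply/funext => N; rewrite [RHS]addrC subrK.
apply: cvgD; first exact: cvg_shift2.
apply/cvgr0Pnorm_le => e e0.
have /cvgr0Pnorm_le/(_ e e0) := D0; apply: filterS => N DN.
apply: le_trans DN; apply: le_trans (ler_norm _).
have Np : 0 < N.+1%:R :> R by [].
pose w (k : nat) : R := (k`!%:R)^-1 - N.+1%:R^-1 ^+ k * 'C(N.+1, k)%:R.
have w0 k : 0 <= w k.
  rewrite subr_ge0 -[leRHS]mul1r ler_pdivlMr// -mulrA -natrM bin_ffact exprVn mulrC ler_pdivrMr ?exprn_gt0// mul1r.
  by rewrite -natrX ler_nat ffact_le.
have -> : (1 + N.+1%:R^-1 *: M) ^+ N.+1 - S N.+2 = - \sum_(k < N.+2) w k *: M ^+ k.
  rewrite [1 + _]addrC exprD1n /S -sumrB -sumrN; apply: eq_bigr => k _.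
  by rewrite scale_mxX -scaler_nat scalerA -scalerBl /w -scaleNr opprB [_%:R * _]mulrC.
rewrite normrN (le_trans (ler_norm_sum _ _ _))//.
apply: (@le_trans _ _ (\sum_(k < N.+2) w k * x ^+ k)).
  by apply: ler_sum => k _; rewrite normrZ ger0_norm// ler_wpM2l//; exact: norm_mxX.
rewrite /D; apply: (@le_trans _ _ (series (exp_coeff x) N.+2 - (1 + x / N.+1%:R) ^+ N.+1)); last by rewrite lerB// expR_ge_power.
rewrite [1 + _]addrC exprD1n /series /= big_mkord -sumrN -big_split /=; apply: ler_sum => k _.
rewrite /w mulrBl; apply: lerB; first by rewrite /exp_coeff /= mulrC.
by rewrite exprMn -mulr_natr le_eqVlt; apply/orP; left; apply/eqP; ring.
Unshelve. all: by end_near. Qed.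

Lemma mxexp_euler_tr M (u : 'cV[R]_n) i :
  (fun N : nat => (((1 + N.+1%:R^-1 *: M^T) ^+ N.+1) *m u) i 0) @ \oo --> ((mxexp M)^T *m u) i 0.
Proof.
have trX (P : 'M[R]_n) k : (P^T) ^+ k = (P ^+ k)^T.
  elim: k => [|k IH]; first by rewrite !expr0 trmx1.
  by rewrite exprS exprSr IH -!mulmxE trmx_mul.
have h j : (fun N : nat => ((1 + N.+1%:R^-1 *: M) ^+ N.+1) j i) @ \oo --> mxexp M j i.
  apply/cvgrPdist_le => e e0; have /cvgrPdist_le/(_ e e0) := @mxexp_euler M; apply: filterS => N; apply: le_trans.
  move: (mxexp M) ((1 + N.+1%:R^-1 *: M) ^+ N.+1) => X Y.
  by have := le_coord_norm (X - Y) j i; rewrite !mxE.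
have -> : (fun N : nat => (((1 + N.+1%:R^-1 *: M^T) ^+ N.+1) *m u) i 0) =
   (fun N : nat => \sum_j ((1 + N.+1%:R^-1 *: M) ^+ N.+1) j i * u j 0).
  apply/funext => N; rewrite mxE; apply: eq_bigr => j _; congr (_ * _).
  by rewrite (_ : 1 + _ = (1 + N.+1%:R^-1 *: M)^T) ?trX ?mxE// linearD/= trmx1 linearZ.
rewrite mxE; under [X in _ --> X]eq_bigr do rewrite mxE.
by apply: cvg_sumr => j; apply: cvgM; [exact: h|exact: cvg_cst].
Qed.

End MatrixExponential.

Section Growth.
Context {R : realType} {n : nat}.
Implicit Types (L M : 'M[R]_n) (u v : 'cV[R]_n).

Lemma rotation_power M u v (a b : R) N : M *m u = a *: u - b *: v -> M *m v = a *: v + b *: u ->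
  exists c e : R, [/\ (M ^+ N) *m u = c *: u - e *: v, (M ^+ N) *m v = c *: v + e *: u & c ^+ 2 + e ^+ 2 = (a ^+ 2 + b ^+ 2) ^+ N].
Proof.
move=> Mu Mv; elim: N => [|N [c [e [cu cv ce]]]].
  exists 1, 0; rewrite !expr0 !mul1mx !scale1r !scale0r subr0 addr0; split => //; ring.
exists (a * c - b * e), (a * e + b * c); rewrite exprSr -mulmxE -!mulmxA Mu Mv !mulmxDr mulmxN -!scalemxAr cu cv; split.
- by apply/matrixP => i j; rewrite !mxE; ring.
- by apply/matrixP => i j; rewrite !mxE; ring.
by rewrite [RHS]exprS -ce; ring.
Qed.

Lemma euler_rotation L u v (al be t : R) N : L^T *m u = al *: u - be *: v -> L^T *m v = al *: v + be *: u ->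
  exists c e : R, [/\ ((1 + N.+1%:R^-1 *: (t *: L)^T) ^+ N.+1) *m u = c *: u - e *: v,
    ((1 + N.+1%:R^-1 *: (t *: L)^T) ^+ N.+1) *m v = c *: v + e *: u &
    c ^+ 2 + e ^+ 2 = ((1 + t / N.+1%:R * al) ^+ 2 + (t / N.+1%:R * be) ^+ 2) ^+ N.+1].
Proof.
move=> Lu Lv; apply: rotation_power.
  by rewrite mulmxDl mul1mx linearZ /= -!scalemxAl Lu; apply/matrixP => i j; rewrite !mxE; ring.
by rewrite mulmxDl mul1mx linearZ /= -!scalemxAl Lv; apply/matrixP => i j; rewrite !mxE; ring.
Qed.

(** On the plane of the covectors [u], [v] an Euler product is a rotation with dilation, and
    [bernoulli_power] bounds the dilation below by a polynomial of any degree [d], enough to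
    contradict polynomial growth. *)
Lemma mxexp_grow L u v (al be : R) (d : nat) (t : R) : 0 < al -> 0 <= t -> (0 < d)%N ->
  L^T *m u = al *: u - be *: v -> L^T *m v = al *: v + be *: u -> 0 < dot u u + dot v v ->
  (1 + t * al / (2 * d%:R)) ^+ d <= n%:R ^+ 2 * mxnorm (mxexp (t *: L)).
Proof.
move=> al0 t0 d0 Lu Lv uv0; pose E := mxexp (t *: L); pose g : R := (1 + t * al / (2 * d%:R)) ^+ d.
have g0 : 0 <= g by rewrite exprn_ge0// addr_ge0// divr_ge0 ?mulr_ge0// ltW.
pose W N := (1 + N.+1%:R^-1 *: (t *: L)^T) ^+ N.+1.
have lim : (fun N => dot (W N *m u) (W N *m u) + dot (W N *m v) (W N *m v)) @ \oo --> dot (E^T *m u) (E^T *m u) + dot (E^T *m v) (E^T *m v).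
  by apply: cvgD; apply: cvg_dot => i; exact: mxexp_euler_tr.
have low : g ^+ 2 * (dot u u + dot v v) <= dot (E^T *m u) (E^T *m u) + dot (E^T *m v) (E^T *m v).
  rewrite -(cvg_lim _ lim)//; apply: limr_ge; first by apply/cvg_ex; eexists; exact: lim.
  exists d => // N /= dN; have [c [e [Wu Wv ce]]] := euler_rotation t N Lu Lv.
  rewrite /W Wu Wv.
  have -> : dot (c *: u - e *: v) (c *: u - e *: v) + dot (c *: v + e *: u) (c *: v + e *: u) = (c ^+ 2 + e ^+ 2) * (dot u u + dot v v).
    by rewrite -dot_comb_sum scalerN opprK.
  rewrite ler_wpM2r ?(ltW uv0)// ce.
  have y0 : 0 <= t / N.+1%:R * al by rewrite mulr_ge0 ?divr_ge0// ltW.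
  have h := bernoulli_power y0 d0 (leqW dN).
  apply: (@le_trans _ _ (((1 + t / N.+1%:R * al) ^+ 2) ^+ N.+1)); last first.
    by apply: lerXn2r; rewrite ?nnegrE ?addr_ge0 ?sqr_ge0// lerDl sqr_ge0.
  rewrite exprAC; apply: lerXn2r; rewrite ?nnegrE ?exprn_ge0 ?addr_ge0 ?divr_ge0 ?mulr_ge0 ?(ltW al0)//.
  apply: le_trans h; rewrite /g le_eqVlt; apply/orP; left; apply/eqP; congr ((1 + _) ^+ _); field.
  by rewrite !gt_eqF// ltr0n.
have nE0 : 0 <= mxnorm E.
  by apply: (@opnorm_ge0 _ _ (Num.norm : R -> R)) => //; [exact: normr0|exact: ler_normD|exact: normrM].
have up w : dot (E^T *m w) (E^T *m w) <= n%:R ^+ 3 * mxnorm E ^+ 2 * dot w w.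
  apply: (le_trans (dot_norm_le _)).
  have En : `|E^T| <= mxnorm E.
    apply: mx_norm_le => [|i j]; last first.
      by rewrite mxE; apply: (@entry_le_opnorm _ _ (Num.norm : R -> R)) => //; [exact: normr0|exact: normr1|exact: ler_normD|exact: normrM].
    exact: nE0.
  have Ew : `|E^T *m w| <= n%:R * mxnorm E * `|w|.
    by rewrite (le_trans (norm_mulmx _ _))// ler_wpM2r// ler_wpM2l.
  apply: (@le_trans _ _ (n%:R * (n%:R * mxnorm E * `|w|) ^+ 2)).
    by rewrite ler_wpM2l// lerXn2r// nnegrE// !mulr_ge0.
  rewrite (_ : n%:R * _ ^+ 2 = n%:R ^+ 3 * mxnorm E ^+ 2 * `|w| ^+ 2); last by ring.
  by rewrite ler_wpM2l ?mulr_ge0 ?exprn_ge0// le_norm_dot.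
have key : g ^+ 2 <= n%:R ^+ 3 * mxnorm E ^+ 2.
  rewrite -(ler_pM2r uv0) (le_trans low)// mulrDr lerD//; exact: up.
suff : g <= n%:R ^+ 2 * mxnorm E by [].
have nn0 : 0 <= n%:R ^+ 2 * mxnorm E by rewrite mulr_ge0 ?exprn_ge0.
rewrite -(@ler_pXn2r _ 2) ?nnegrE//; apply: (le_trans key); rewrite [leRHS]exprMn -exprM ler_wpM2r ?sqr_ge0//.
case: (n) => [|k]; first by rewrite !expr0n.
by rewrite ler_weXn2l// ler1n.
Qed.

(** For an imaginary eigenvalue the dilation of the Euler product is [(1 + y)^N] with [N y] tending
    to 0; bounding it by 2 suffices. *)
Lemma mxexp_bounded_covector L u v (be t : R) : 0 <= t ->
  L^T *m u = 0 *: u - be *: v -> L^T *m v = 0 *: v + be *: u ->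
  `|(mxexp (t *: L))^T *m u| <= 2 * (`|u| + `|v|).
Proof.
move=> t0 Lu Lv; apply: mx_norm_le => [|i j]; first by rewrite mulr_ge0// addr_ge0.
rewrite ord1; have lim := @mxexp_euler_tr _ _ (t *: L) u i.
have lim' : (fun N : nat => `|((1 + N.+1%:R^-1 *: (t *: L)^T) ^+ N.+1 *m u) i 0|) @ \oo --> `|((mxexp (t *: L))^T *m u) i 0|.
  by apply: cvg_norm; exact: lim.
rewrite -(cvg_lim _ lim')//; apply: limr_le; first by apply/cvg_ex; eexists; exact: lim'.
pose y0 : R := 2 * (t * be) ^+ 2.
exists (Num.truncn y0).+1 => // N /= yN; have [c [e [Wu _ ce]]] := euler_rotation t N Lu Lv.
rewrite Wu; apply: (le_trans (le_coord_norm _ _ _)); apply: (le_trans (norm_comb_le _ _ _ _)).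
pose y : R := (t / N.+1%:R * be) ^+ 2.
have yge : 0 <= y by exact: sqr_ge0.
have Ny : N.+1%:R * y <= 1 / 2.
  rewrite (_ : N.+1%:R * y = (t * be) ^+ 2 / N.+1%:R); last by rewrite /y; field.
  rewrite ler_pdivrMr// mul1r [leRHS]mulrC ler_pdivlMr// [leLHS]mulrC.
  by rewrite -/y0 ltW// (lt_le_trans (truncnS_gt _))// ler_nat leqW.
have y1 : y <= 1.
  have : y <= N.+1%:R * y by rewrite -[leLHS]mul1r ler_wpM2r// ler1n.
  lra.
have h : c ^+ 2 + e ^+ 2 <= 2.
  rewrite ce mulr0 addr0 expr1n -/y.
  have b := bernoulli_sub N.+1 yge y1.
  have p : (1 + y) ^+ N.+1 * (1 - y) ^+ N.+1 <= 1.
    rewrite -exprMn; apply: exprn_ile1.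
      by rewrite mulr_ge0 ?subr_ge0// addr_ge0.
    by rewrite mulrBr mulr1 mulrDl mul1r; have := sqr_ge0 y; lra.
  have q : (1 + y) ^+ N.+1 * (1 / 2) <= (1 + y) ^+ N.+1 * (1 - y) ^+ N.+1.
    by rewrite ler_wpM2l ?exprn_ge0 ?addr_ge0//; lra.
  lra.
have c2 : `|c| <= 2 by apply: sqr_norm_le => //; have := sqr_ge0 e; lra.
have e2 : `|e| <= 2 by apply: sqr_norm_le => //; have := sqr_ge0 c; lra.
by rewrite mulrDr lerD// ler_wpM2r.
Qed.

End Growth.

(** * Spectral information *)

Section RealImaginary.
Context {R : realType}.
Implicit Types (x y : R[i]).

Lemma ReD x y : complex.Re (x + y) = complex.Re x + complex.Re y.
Proof. by case: x y => [? ?] [? ?]. Qed.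
Lemma ImD x y : complex.Im (x + y) = complex.Im x + complex.Im y.
Proof. by case: x y => [? ?] [? ?]. Qed.
Lemma ReM x y : complex.Re (x * y) = complex.Re x * complex.Re y - complex.Im x * complex.Im y.
Proof. by case: x y => [? ?] [? ?]. Qed.
Lemma ImM x y : complex.Im (x * y) = complex.Re x * complex.Im y + complex.Im x * complex.Re y.
Proof. by case: x y => [? ?] [? ?]. Qed.
Lemma ReN x : complex.Re (- x) = - complex.Re x.
Proof. by case: x. Qed.

Lemma Re_sum (I : Type) (r : seq I) (f : I -> R[i]) :
  complex.Re (\sum_(i <- r) f i) = \sum_(i <- r) complex.Re (f i).
Proof. by apply: (big_morph _ ReD). Qed.
Lemma Im_sum (I : Type) (r : seq I) (f : I -> R[i]) :
  complex.Im (\sum_(i <- r) f i) = \sum_(i <- r) complex.Im (f i).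
Proof. by apply: (big_morph _ ImD). Qed.

Lemma sqr_Normc x : Normc.normc x ^+ 2 = complex.Re x ^+ 2 + complex.Im x ^+ 2.
Proof. by case: x => a b; rewrite /Normc.normc sqr_sqrtr// addr_ge0 ?sqr_ge0. Qed.

Lemma Normc_ge0 x : 0 <= Normc.normc x.
Proof. by case: x => a b; exact: sqrtr_ge0. Qed.

Lemma NormcD x y : Normc.normc (x + y) <= Normc.normc x + Normc.normc y.
Proof. exact: le_normcD. Qed.

Lemma Re_le_Normc x : `|complex.Re x| <= Normc.normc x.
Proof. by apply: sqr_norm_le; rewrite ?Normc_ge0// sqr_Normc lerDl sqr_ge0. Qed.

Lemma Im_le_Normc x : `|complex.Im x| <= Normc.normc x.
Proof. by apply: sqr_norm_le; rewrite ?Normc_ge0// sqr_Normc lerDr sqr_ge0. Qed.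

Lemma Normc_le_sum x : Normc.normc x <= `|complex.Re x| + `|complex.Im x|.
Proof.
rewrite -(@ler_pXn2r _ 2) ?nnegrE ?Normc_ge0 ?addr_ge0// sqr_Normc sqrrD !real_normK ?num_real//.
by rewrite lerD2r lerDl mulrn_wge0// mulr_ge0.
Qed.

Context {n : nat}.
Implicit Types (v w : 'rV[R[i]]_n) (L : 'M[R]_n).

Definition reV v : 'cV[R]_n := \col_i complex.Re (v 0 i).
Definition imV v : 'cV[R]_n := \col_i complex.Im (v 0 i).

Lemma reV_complexify v L : reV (v *m complexify L) = L^T *m reV v.
Proof.
apply/matrixP => i j; rewrite !mxE Re_sum; apply: eq_bigr => k _.
by rewrite !mxE ReM /= mulr0 subr0 mulrC.
Qed.

Lemma imV_complexify v L : imV (v *m complexify L) = L^T *m imV v.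
Proof.
apply/matrixP => i j; rewrite !mxE Im_sum; apply: eq_bigr => k _.
by rewrite !mxE ImM /= mulr0 add0r mulrC.
Qed.

Lemma reVZ (a : R[i]) v : reV (a *: v) = complex.Re a *: reV v - complex.Im a *: imV v.
Proof. by apply/matrixP => i j; rewrite !mxE ReM. Qed.

Lemma imVZ (a : R[i]) v : imV (a *: v) = complex.Re a *: imV v + complex.Im a *: reV v.
Proof. by apply/matrixP => i j; rewrite !mxE ImM. Qed.

Lemma reVD v w : reV (v + w) = reV v + reV w.
Proof. by apply/matrixP => i j; rewrite !mxE ReD. Qed.

Lemma imVD v w : imV (v + w) = imV v + imV w.
Proof. by apply/matrixP => i j; rewrite !mxE ImD. Qed.

Lemma dot_reV_imV_gt0 v : v != 0 -> 0 < dot (reV v) (reV v) + dot (imV v) (imV v).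
Proof.
move=> v0; rewrite lt_def addr_ge0 ?dot_ge0// andbT; apply: contra v0.
rewrite paddr_eq0 ?dot_ge0// => /andP[/eqP/dot_eq0 r0 /eqP/dot_eq0 i0].
apply/eqP/matrixP => i j; rewrite ord1 [RHS]mxE.
have := congr1 (fun u : 'cV[R]_n => u j 0) r0; have := congr1 (fun u : 'cV[R]_n => u j 0) i0.
by rewrite !mxE; case: (v 0 j) => a b /= -> ->.
Qed.

Lemma eigen_bound L (u v : 'cV[R]_n) (al be : R) : L^T *m u = al *: u - be *: v -> L^T *m v = al *: v + be *: u ->
  0 < dot u u + dot v v -> `|al| <= n%:R ^+ 2 * `|L| /\ `|be| <= n%:R ^+ 2 * `|L|.
Proof.
move=> Lu Lv uv0.
have nL : `|L^T| <= `|L| by apply: mx_norm_le => // i j; rewrite mxE le_coord_norm.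
have bd (x y : 'cV[R]_n) : `|dot x (L^T *m y)| <= n%:R ^+ 2 * `|L| * (`|x| * `|y|).
  rewrite (le_trans (norm_dot_le _ _))//.
  have : `|L^T *m y| <= n%:R * `|L| * `|y| by rewrite (le_trans (norm_mulmx _ _))// ler_wpM2r// ler_wpM2l.
  move=> h; have := ler_wpM2l (mulr_ge0 (ler0n R n) (normr_ge0 x)) h; move/le_trans; apply.
  by rewrite le_eqVlt; apply/orP; left; apply/eqP; ring.
have n0 : 0 <= n%:R ^+ 2 * `|L| by rewrite mulr_ge0 ?sqr_ge0.
have uu := le_norm_dot u; have vv := le_norm_dot v.
have uv2 : 2 * (`|u| * `|v|) <= `|u| ^+ 2 + `|v| ^+ 2 by have := sqr_ge0 (`|u| - `|v|); rewrite sqrrB; lra.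
split.
  rewrite -(ler_pM2r uv0) -[X in `|al| * X]ger0_norm ?(ltW uv0)// -normrM.
  have -> : al * (dot u u + dot v v) = dot u (L^T *m u) + dot v (L^T *m v).
    by rewrite Lu Lv dotBr dotDr !dotZr (dotC v u); ring.
  rewrite (le_trans (ler_normD _ _))// (le_trans (lerD (bd _ _) (bd _ _)))// -mulrDr ler_wpM2l// -!expr2 lerD//.
rewrite -(ler_pM2r uv0) -[X in `|be| * X]ger0_norm ?(ltW uv0)// -normrM.
have -> : be * (dot u u + dot v v) = dot u (L^T *m v) - dot v (L^T *m u).
  by rewrite Lu Lv dotBr dotDr !dotZr (dotC v u); ring.
rewrite (le_trans (ler_normB _ _))// (le_trans (lerD (bd _ _) (bd _ _)))// -mulrDr ler_wpM2l//.
by rewrite [`|v| * _]mulrC; lra.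
Qed.

End RealImaginary.

Section JordanRows.
Context {F : fieldType}.

(* In the second case [i] and [j] are the last two rows of a block. *)
Lemma jordan_rows n (J : 'M[F]_n) : is_jordan J ->
  (forall i, exists a, row i J = a *: delta_mx 0 i) \/
  exists i j a, row i J = a *: delta_mx 0 i + delta_mx 0 j /\ row j J = a *: delta_mx 0 j.
Proof.
move=> [m [k [a [e [k0 ->]]]]]; subst n; rewrite castmx_id.
set D := mxdiag _.
have Dd i (p q : 'I_(k i)) : D (tagnat.Rank i p) (tagnat.Rank i q) = jordan_block (k i) (a i) p q.
  have := submxblock_diag (fun i => jordan_block (k i) (a i)) i => /matrixP/(_ p q) <-.
  by rewrite [RHS]mxE.
have Do i j (p : 'I_(k i)) (q : 'I_(k j)) : i != j -> D (tagnat.Rank i p) (tagnat.Rank j q) = 0.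
  move=> ij; rewrite /D /mxdiag.
  have := mxblockK (fun i j => if i == j then conform_mx 0 (jordan_block (k i) (a i)) else 0 : 'M[F]_(k i, k j)) i j.
  by move=> /matrixP/(_ p q); rewrite [LHS]mxE => ->; rewrite (negbTE ij) mxE.
clearbody D.
have RankP z : exists i (p : 'I_(k i)), z = tagnat.Rank i p.
  by exists (tagnat.sig1 z), (tagnat.sig2 z); rewrite tagnat.sig2K.
have eqR i (p q : 'I_(k i)) : (tagnat.Rank i p == tagnat.Rank i q) = (p == q).
  by rewrite -val_eqE /= tagnat.eq_Rank eqxx.
have neqR i j (p : 'I_(k i)) (q : 'I_(k j)) : i != j -> (tagnat.Rank i p == tagnat.Rank j q) = false.
  by move=> ij; rewrite -val_eqE /= tagnat.eq_Rank (negbTE ij).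
have [i ki|small] := pickP (fun i => (1 < k i)%N).
  right; have h1 : ((k i).-1 < k i)%N by rewrite ltn_predL (ltn_trans _ ki).
  have h2 : ((k i).-2 < k i)%N by rewrite (leq_ltn_trans (leq_pred _) h1).
  exists (tagnat.Rank i (Ordinal h2)), (tagnat.Rank i (Ordinal h1)), (a i).
  have k2 : (k i).-2.+1 = (k i).-1 by move: ki; case: (k i) => [|[|]].
  split; apply/rowP => z; have [j [q ->]] := RankP z; rewrite !mxE /=; case: (eqVneq i j) q => [<-|ij] q.
  - by rewrite Dd mxE !eqR -!val_eqE /= k2 [_ == nat_of_ord q]eq_sym mulr_natr.
  - by rewrite Do// ![_ == tagnat.Rank i _]eq_sym !neqR// mulr0 addr0.
  - rewrite Dd mxE !eqR /= [q == _]eq_sym -!val_eqE /= mulr_natr.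
    have -> : (q == (k i).-1.+1 :> nat) = false by rewrite prednK ?(ltn_trans _ ki)// ltn_eqF.
    by rewrite addr0.
  by rewrite Do// [_ == tagnat.Rank i _]eq_sym neqR// mulr0.
left=> z; have [i [p ->]] := RankP z; exists (a i).
apply/rowP => w; have [j [q ->]] := RankP w; rewrite !mxE /=; case: (eqVneq i j) q => [<-|ij] q.
  rewrite Dd mxE eqR /= [q == p]eq_sym mulr_natr.
  have k1 : (k i <= 1)%N by have := small i; rewrite ltnNge => /negbFE.
  have -> : (q == p.+1 :> nat) = false by rewrite ltn_eqF// (leq_trans (ltn_ord q))// (leq_trans k1).
  by rewrite addr0.
by rewrite Do// [_ == tagnat.Rank i _]eq_sym neqR// mulr0.
Qed.

End JordanRows.

Section Spectrum.
Context {R : realType} {n : nat}.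
Variables (B : {bilinear 'cV[R]_n -> 'cV[R]_n -> 'cV[R]_n}) (A : 'M[R]_n).
Let L := Lperp B A.
Let Pp := Pi_kerperp A.

Lemma Lperp_bounded : exists2 C : R, 0 <= C & forall x : 'cV[R]_n, `|L x| <= C * `|x|.
Proof.
have [c c0 cB] := bilinear_bounded B.
exists (n%:R * (n%:R * `|Pp|) * (2 * c) * `|Pp|); first by rewrite !mulr_ge0.
move=> x; have h : `|Lmx B x| <= 2 * c * `|x|.
  apply: mx_norm_le => [|i j]; first by rewrite !mulr_ge0.
  rewrite mxE (le_trans (le_coord_norm _ _ _))// (le_trans (ler_normD _ _))//.
  have d1 := @norm_delta R n 1 j 0.
  have h1 : `|B x (delta_mx j 0)| <= c * `|x|.
    by rewrite (le_trans (cB _ _))// -[leRHS]mulr1 ler_wpM2l// mulr_ge0.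
  have h2 : `|B (delta_mx j 0) x| <= c * `|x|.
    by rewrite (le_trans (cB _ _))// mulrAC -[leRHS]mulr1 ler_wpM2l// mulr_ge0.
  lra.
rewrite /L /Lperp (le_trans (norm_mulmx _ _))// (le_trans (ler_wpM2r _ (ler_wpM2l _ (norm_mulmx _ _))))//.
rewrite (_ : _ * `|x| = n%:R * (n%:R * `|Pp| * (2 * c * `|x|)) * `|Pp|); last by ring.
by rewrite ler_wpM2r// ler_wpM2l// ler_wpM2l// mulr_ge0.
Qed.

(** [L_x v] is symmetric in [x] and [v], so each entry of [Lmx B x] is a coordinate of a fixed
    matrix applied to [x]. *)
Lemma cvg_Lperp (T : Type) (F : set_system T) {FF : Filter F} (x : T -> 'cV[R]_n) (y : 'cV[R]_n) :
  (forall i, (fun k => x k i 0) @ F --> y i 0) -> forall i j, (fun k => L (x k) i j) @ F --> L y i j.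
Proof.
move=> xy i j.
have Lm (z : 'cV[R]_n) a b : Lmx B z a b = (Lmx B (delta_mx b 0) *m z) a 0.
  by rewrite LmxE addrC mxE.
have -> : (fun k => L (x k) i j) = (fun k => \sum_b (\sum_a Pp i a * (Lmx B (delta_mx b 0) *m x k) a 0) * Pp b j).
  apply/funext => k; rewrite /L /Lperp mxE; apply: eq_bigr => b _; congr (_ * _).
  by rewrite mxE; apply: eq_bigr => a _; rewrite -Lm.
have -> : L y i j = \sum_b (\sum_a Pp i a * (Lmx B (delta_mx b 0) *m y) a 0) * Pp b j.
  rewrite /L /Lperp mxE; apply: eq_bigr => b _; congr (_ * _).
  by rewrite mxE; apply: eq_bigr => a _; rewrite -Lm.
apply: cvg_sumr => b; apply: cvgM; last exact: cvg_cst.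
apply: cvg_sumr => a; apply: cvgM; first exact: cvg_cst.
exact: cvg_mulmx.
Qed.

Lemma ker_sphere_dot (k : 'cV[R]_n) : ker_sphere A k -> dot k k = 1.
Proof. by move=> [_ k1]; rewrite -enorm_dot k1 expr1n. Qed.

Lemma ker_sphere_norm (k : 'cV[R]_n) : ker_sphere A k -> `|k| <= 1.
Proof.
by move=> /ker_sphere_dot kk; rewrite -(@ler_pXn2r _ 2) ?nnegrE// expr1n -kk le_norm_dot.
Qed.

Definition clim (f : nat -> R[i]) (l : R[i]) :=
  (fun k => complex.Re (f k)) @ nultra --> complex.Re l /\ (fun k => complex.Im (f k)) @ nultra --> complex.Im l.

Lemma clim_cst l : clim (fun=> l) l.
Proof. by split; exact: cvg_cst. Qed.

Lemma climM f g l m : clim f l -> clim g m -> clim (fun k => f k * g k) (l * m).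
Proof.
move=> [f1 f2] [g1 g2]; split; rewrite ?ReM ?ImM.
  by under eq_fun do rewrite ReM; apply: cvgB; exact: cvgM.
by under eq_fun do rewrite ImM; apply: cvgD; exact: cvgM.
Qed.

Lemma clim_sum (I : Type) (r : seq I) (f : I -> nat -> R[i]) l : (forall i, clim (f i) (l i)) ->
  clim (fun k => \sum_(i <- r) f i k) (\sum_(i <- r) l i).
Proof.
move=> h; split; rewrite ?Re_sum ?Im_sum.
  by under eq_fun do rewrite Re_sum; apply: cvg_sumr => i; have [] := h i.
by under eq_fun do rewrite Im_sum; apply: cvg_sumr => i; have [] := h i.
Qed.

Lemma clim_prod (I : Type) (r : seq I) (f : I -> nat -> R[i]) l : (forall i, clim (f i) (l i)) ->
  clim (fun k => \prod_(i <- r) f i k) (\prod_(i <- r) l i).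
Proof.
move=> h; elim: r => [|i r IH].
  by under eq_fun do rewrite big_nil; rewrite big_nil; exact: clim_cst.
have -> : (fun k => \prod_(j <- i :: r) f j k) = (fun k => f i k * \prod_(j <- r) f j k).
  by apply/funext => k; rewrite big_cons.
by rewrite big_cons; exact: climM.
Qed.

Lemma clim_det (M : nat -> 'M[R[i]]_n) (N : 'M[R[i]]_n) : (forall i j, clim (fun k => M k i j) (N i j)) ->
  clim (fun k => \det (M k)) (\det N).
Proof.
move=> h; apply: clim_sum => s; apply: climM; first exact: clim_cst.
by apply: clim_prod => i.
Qed.

Lemma horner_char_poly (M : 'M[R[i]]_n) a : (char_poly M).[a] = \det (a%:M - M).
Proof.
rewrite horner_sum; apply: eq_bigr => s _.
rewrite hornerM horner_exp !hornerE; congr (_ * _).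
rewrite (big_morph _ (fun p q => hornerM p q a) (hornerC 1 a)).
by apply: eq_bigr => i _; rewrite !mxE !(hornerE, hornerMn).
Qed.

(** The determinant is the product of the differences between [a] and the [n] roots of the
    characteristic polynomial, all of which are eigenvalues. *)
Lemma det_lower (M : 'M[R[i]]_n) a (ep : R) : 0 <= ep ->
  (forall mu, eigenvalue M mu -> ep <= Normc.normc (a - mu)) -> ep ^+ n <= Normc.normc (\det (a%:M - M)).
Proof.
move=> ep0 h; have [r Dp] := closed_field_poly_normal (char_poly M).
move: Dp; rewrite (monicP (char_poly_monic M)) scale1r => Dp.
have sr : size r = n.
  by have := size_char_poly M; rewrite Dp size_prod_XsubC => -[].
have hr z : z \in r -> ep <= Normc.normc (a - z).
  by move=> zr; apply: h; rewrite eigenvalue_root_char Dp root_prod_XsubC.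
rewrite -horner_char_poly Dp horner_prod -sr.
rewrite (big_morph _ (@Normc.normcM R) (@Normc.normc1 R)).
elim: (r) hr => [|z s IH] hs; first by rewrite big_nil expr0.
rewrite big_cons exprS !hornerE; apply: ler_pM; rewrite ?exprn_ge0//.
  by apply: hs; rewrite inE eqxx.
by apply: IH => w ws; apply: hs; rewrite inE ws orbT.
Qed.

(** If the real parts at [x N] were below [1 / N.+1], take the limit [y] and an eigenvalue [lam] at
    [y] with positive real part. It stays at distance [Re lam / 2] from the spectra at [x N], so the
    determinants of [lam - L (x N)] stay away from 0 by [det_lower], although they tend to that of
    [lam - L y], which is 0. *)
Lemma uniform_gap : (forall x : 'cV[R]_n, ker_sphere A x -> exists lam : R[i],
     eigenvalue (complexify (L x)) lam /\ 0 < complex.Re lam) ->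
  exists2 l : R, 0 < l & forall x : 'cV[R]_n, ker_sphere A x -> exists2 mu : R[i],
     eigenvalue (complexify (L x)) mu & l <= complex.Re mu.
Proof.
move=> H; apply: contrapT => no.
have bad (N : nat) : exists x : 'cV[R]_n, ker_sphere A x /\
    forall mu, eigenvalue (complexify (L x)) mu -> complex.Re mu < N.+1%:R^-1.
  apply: contrapT => h; apply: no; exists (N.+1%:R^-1) => // x xS; apply: contrapT => h2.
  apply: h; exists x; split => // mu emu; rewrite ltNge; apply/negP => h3; apply: h2.
  by exists mu.
have [x Hx] := choice bad.
have xS N := (Hx N).1.
have [y xy] := ulim_cV (fun N => ker_sphere_norm (xS N)).
have yS : ker_sphere A y.
  split.
    apply/matrixP => i j; rewrite ord1 [RHS]mxE.
    have h : (fun k => (A *m x k) i 0) @ nultra --> (A *m y) i 0 by exact: cvg_mulmx.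
    rewrite -(cvg_lim _ h)//; have -> : (fun k => (A *m x k) i 0) = (fun=> 0).
      by apply/funext => N; rewrite (xS N).1 mxE.
    by rewrite lim_cst.
  apply: dot1_enorm; have h : (fun k => dot (x k) (x k)) @ nultra --> dot y y by exact: cvg_dot.
  rewrite -(cvg_lim _ h)//; have -> : (fun k => dot (x k) (x k)) = (fun=> 1).
    by apply/funext => N; exact: ker_sphere_dot.
  by rewrite lim_cst.
have [lam [elam lam0]] := H y yS.
pose M (N : nat) : 'M[R[i]]_n := lam%:M - complexify (L (x N)).
have Mlim : clim (fun N => \det (M N)) (\det (lam%:M - complexify (L y))).
  apply: clim_det => i j; have Lij : (fun k => L (x k) i j) @ nultra --> L y i j by exact: cvg_Lperp.
  have E (M0 : 'M[R]_n) : (lam%:M - complexify M0) i j = lam *+ (i == j) - real_complex R (M0 i j) by rewrite !mxE.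
  rewrite /clim E ReD ImD /= oppr0; split.
    have -> : (fun N => complex.Re (M N i j)) = (fun N => complex.Re (lam *+ (i == j)) - L (x N) i j).
      by apply/funext => N; rewrite /M E ReD.
    by apply: cvgB => //; exact: cvg_cst.
  have -> : (fun N => complex.Im (M N i j)) = (fun N => complex.Im (lam *+ (i == j)) + 0).
    by apply/funext => N; rewrite /M E ImD /= oppr0.
  exact: cvg_cst.
have d0 : \det (lam%:M - complexify (L y)) = 0.
  by move: elam; rewrite eigenvalue_root_char => /rootP; rewrite horner_char_poly.
rewrite d0 in Mlim; case: Mlim => M1 M2.
have Mn : (fun N => Normc.normc (\det (M N)) ^+ 2) @ nultra --> (0 : R).
  under eq_fun do rewrite sqr_Normc !expr2.
  suff : (fun N => complex.Re (\det (M N)) * complex.Re (\det (M N)) + complex.Im (\det (M N)) * complex.Im (\det (M N))) @ nultra --> (0 * 0 + 0 * 0 : R).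
    by rewrite mulr0 addr0.
  by apply: cvgD; apply: cvgM.
pose ep : R := complex.Re lam / 2.
have ep0 : 0 < ep by rewrite divr_gt0.
have low : \forall N \near nultra, (ep ^+ n) ^+ 2 <= Normc.normc (\det (M N)) ^+ 2.
  apply: nultra_oo; exists (Num.truncn ep^-1).+1 => // N /= NN.
  apply: lerXn2r; rewrite ?nnegrE ?exprn_ge0 ?Normc_ge0 ?(ltW ep0)//.
  apply: det_lower; first exact: ltW.
  move=> mu emu; rewrite leNgt; apply/negP => dist.
  have h1 := (Hx N).2 mu emu.
  have h2 : complex.Re lam - complex.Re mu < ep.
    by apply: le_lt_trans dist; rewrite -ReN -ReD; apply: le_trans (Re_le_Normc _); exact: ler_norm.
  have h3 : N.+1%:R^-1 <= ep.
    rewrite -[leRHS]invrK lef_pV2 ?posrE ?invr_gt0//.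
    by rewrite ltW// (lt_le_trans (truncnS_gt _))// ler_nat leqW.
  have h4 := lt_le_trans h1 h3; rewrite ltrBlDr in h2.
  have h5 : ep + complex.Re mu < ep + ep by rewrite ltrD2l.
  by have := lt_trans h2 h5; rewrite -splitr ltxx.
have := limr_ge _ low; rewrite (cvg_lim _ Mn)// => /(_ _) h.
have : (ep ^+ n) ^+ 2 <= 0 by apply: h; exact: Mn.
by rewrite leNgt exprn_gt0// exprn_gt0.
Qed.

(** [eigenvalue] refers to row vectors; their real and imaginary parts, as columns, are acted on by
    the transpose, which is the form that the adjoint equation requires. *)
Lemma eigen_real_pair (x : 'cV[R]_n) mu : eigenvalue (complexify (L x)) mu -> exists u v : 'cV[R]_n,
  [/\ (L x)^T *m u = complex.Re mu *: u - complex.Im mu *: v, (L x)^T *m v = complex.Re mu *: v + complex.Im mu *: u &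
      dot u u + dot v v = 1].
Proof.
move=> /eigenvalueP[w Lw w0]; have d0 := dot_reV_imV_gt0 w0.
pose s := (Num.sqrt (dot (reV w) (reV w) + dot (imV w) (imV w)))^-1.
have s2 : s ^+ 2 = (dot (reV w) (reV w) + dot (imV w) (imV w))^-1 by rewrite exprVn sqr_sqrtr// ltW.
exists (s *: reV w), (s *: imV w); split.
- by rewrite -scalemxAr -reV_complexify Lw reVZ; apply/matrixP => i j; rewrite !mxE; ring.
- by rewrite -scalemxAr -imV_complexify Lw imVZ; apply/matrixP => i j; rewrite !mxE; ring.
by rewrite !dotZl !dotZr !mulrA -expr2 -mulrDr s2 mulVf// gt_eqF.
Qed.

Lemma tr_Lperp_proj (x u : 'cV[R]_n) : Pp^T *m ((L x)^T *m u) = (L x)^T *m u /\ (L x)^T *m (Pp^T *m u) = (L x)^T *m u.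
Proof.
have P2 : Pp *m Pp = Pp by exact: Pi_kerperp_idem_mx.
have LP : L x *m Pp = L x by rewrite /L /Lperp -mulmxA P2.
have PL : Pp *m L x = L x by rewrite /L /Lperp !mulmxA P2.
by split; rewrite mulmxA -trmx_mul ?LP ?PL.
Qed.

(** For a nonzero eigenvalue the covectors lie in the range of the transpose of [L x], which [Pp^T]
    fixes. In real coordinates one inverts a rotation with dilation of squared modulus
    [al^2 + be^2]. *)
Lemma eigen_pair_proj (x u v : 'cV[R]_n) (al be : R) : (al != 0) || (be != 0) ->
  (L x)^T *m u = al *: u - be *: v -> (L x)^T *m v = al *: v + be *: u -> Pp^T *m u = u /\ Pp^T *m v = v.
Proof.
move=> nz Lu Lv; pose u' := Pp^T *m u - u; pose v' := Pp^T *m v - v.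
have e1 : al *: u' - be *: v' = 0.
  have := (tr_Lperp_proj x u).1; rewrite Lu mulmxBr -!scalemxAr => /eqP; rewrite -subr_eq0 => /eqP <-.
  by rewrite /u' /v'; apply/matrixP => i j; rewrite !mxE; ring.
have e2 : al *: v' + be *: u' = 0.
  have := (tr_Lperp_proj x v).1; rewrite Lv mulmxDr -!scalemxAr => /eqP; rewrite -subr_eq0 => /eqP <-.
  by rewrite /u' /v'; apply/matrixP => i j; rewrite !mxE; ring.
have D0 : al ^+ 2 + be ^+ 2 != 0 by rewrite paddr_eq0 ?sqr_ge0// !sqrf_eq0 negb_and.
have u0 : u' = 0.
  apply: (scalerI D0); rewrite scaler0 -[RHS](addr0 0) -{1}(scaler0 _ al) -{1}e1 -(scaler0 _ be) -e2.
  by apply/matrixP => i j; rewrite !mxE; ring.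
have v0 : v' = 0.
  apply: (scalerI D0); rewrite scaler0 -[RHS](subr0 0) -{1}(scaler0 _ al) -{1}e2 -(scaler0 _ be) -e1.
  by apply/matrixP => i j; rewrite !mxE; ring.
by move: u0 v0 => /eqP; rewrite subr_eq0 => /eqP u0 /eqP; rewrite subr_eq0 => /eqP v0.
Qed.

Lemma unstable_covectors : (forall x : 'cV[R]_n, ker_sphere A x -> exists lam : R[i],
     eigenvalue (complexify (L x)) lam /\ 0 < complex.Re lam) ->
  exists lam Lam : R, [/\ 0 < lam, 1 <= Lam & forall k : 'cV[R]_n, A *m k = 0 -> dot k k = 1 -> exists al be u v,
     [/\ lam <= al, al <= Lam & `|be| <= Lam] /\
     [/\ (L k)^T *m u = al *: u - be *: v, (L k)^T *m v = al *: v + be *: u,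
         Pp^T *m u = u, Pp^T *m v = v & dot u u + dot v v = 1]].
Proof.
move=> H; have [lam lam0 gap] := uniform_gap H; have [C C0 CL] := Lperp_bounded.
exists lam, (1 + n%:R ^+ 2 * C); split => //; first by rewrite lerDl mulr_ge0 ?sqr_ge0.
move=> k Ak k1; have kS : ker_sphere A k by split => //; exact: dot1_enorm.
have [mu emu lmu] := gap k kS.
have [u [v [Lu Lv uv1]]] := eigen_real_pair emu.
have uv0 : 0 < dot u u + dot v v by rewrite uv1.
have [h1 h2] := eigen_bound Lu Lv uv0.
have Lk : `|L k| <= C.
  by rewrite (le_trans (CL k))// -[leRHS]mulr1 ler_wpM2l// ker_sphere_norm.
have bd : n%:R ^+ 2 * `|L k| <= 1 + n%:R ^+ 2 * C.
  by rewrite (le_trans (ler_wpM2l _ Lk)) ?sqr_ge0// lerDr.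
have al0 : complex.Re mu != 0 by rewrite gt_eqF// (lt_le_trans lam0).
have [Pu Pv] : Pp^T *m u = u /\ Pp^T *m v = v by apply: (@eigen_pair_proj k u v (complex.Re mu) (complex.Im mu)); rewrite ?al0.
exists (complex.Re mu), (complex.Im mu), u, v; split; last by [].
split => //; first exact: le_trans (le_trans (ler_norm _) h1) bd.
exact: le_trans h2 bd.
Qed.

End Spectrum.

Section Resonance.
Context {R : realType} {n : nat}.
Variables (B : {bilinear 'cV[R]_n -> 'cV[R]_n -> 'cV[R]_n}) (A : 'M[R]_n).
Let L := Lperp B A.
Let Pp := Pi_kerperp A.

Lemma polynomial_growth_le0 (M : 'M[R]_n) (u v : 'cV[R]_n) (al be C : R) (J : nat) : 0 <= C ->
  (forall t : R, 0 <= t -> mxnorm (mxexp (t *: M)) <= C * (1 + t ^+ J)) ->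
  M^T *m u = al *: u - be *: v -> M^T *m v = al *: v + be *: u -> 0 < dot u u + dot v v -> al <= 0.
Proof.
move=> C0 H Mu Mv uv0; rewrite leNgt; apply/negP => al0.
pose ka : R := (al / (2 * J.+1%:R)) ^+ J.+1.
have ka0 : 0 < ka by rewrite exprn_gt0// divr_gt0.
pose b : R := n%:R ^+ 2 * (C * 2).
have b0 : 0 <= b by rewrite !mulr_ge0 ?sqr_ge0.
pose t : R := 1 + b / ka.
have bk : 0 <= b / ka by rewrite divr_ge0// ltW.
have t1 : 1 <= t by rewrite lerDl.
have t0 : 0 <= t by rewrite (le_trans ler01).
have tJ : 0 < t ^+ J by rewrite exprn_gt0// (lt_le_trans ltr01).
have h1 := mxexp_grow al0 t0 (ltn0Sn J) Mu Mv uv0.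
have h2 : n%:R ^+ 2 * mxnorm (mxexp (t *: M)) <= b * t ^+ J.
  rewrite /b -mulrA ler_wpM2l ?sqr_ge0// (le_trans (H t t0))// -mulrA ler_wpM2l//.
  by rewrite mulr2n mulrDl mul1r lerD2r exprn_ege1.
have h3 : ka * t * t ^+ J <= (1 + t * al / (2 * J.+1%:R)) ^+ J.+1.
  rewrite -mulrA -exprS /ka -exprMn; apply: lerXn2r.
  - by rewrite nnegrE mulr_ge0// divr_ge0// ltW.
  - by rewrite nnegrE addr_ge0// divr_ge0// mulr_ge0// ltW.
  by rewrite [_ * t]mulrC mulrA lerDr.
have := le_trans h3 (le_trans h1 h2); rewrite ler_pM2r// /t mulrDr mulr1 mulrCA divff ?gt_eqF// mulr1.
by rewrite gerDr leNgt ka0.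
Qed.

(** The rows of [invmx Q] are eigencovectors with imaginary eigenvalues, on which the exponential is
    bounded; multiplication by [Q] recovers all of it. *)
Lemma mxexp_bounded (M : 'M[R]_n) (Q : 'M[R[i]]_n) : Q \in unitmx ->
  (forall i, exists2 a : R[i], complex.Re a = 0 & row i (invmx Q) *m complexify M = a *: row i (invmx Q)) ->
  exists2 b : R, 0 <= b & forall t : R, 0 <= t -> mxnorm (mxexp (t *: M)) <= b.
Proof.
move=> Qu H; pose u i := reV (row i (invmx Q)); pose v i := imV (row i (invmx Q)).
pose b0 : R := \sum_i \sum_l (`|complex.Re (Q i l)| + `|complex.Im (Q i l)|) * (2 * (`|u l| + `|v l|)).
have term i l : 0 <= (`|complex.Re (Q i l)| + `|complex.Im (Q i l)|) * (2 * (`|u l| + `|v l|)).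
  by rewrite !mulr_ge0 ?addr_ge0.
have b00 : 0 <= b0 by apply: sumr_ge0 => i _; apply: sumr_ge0 => l _.
exists (n%:R * n%:R * b0) => [|t t0]; first by rewrite !mulr_ge0.
apply: (@opnorm_le _ _ (Num.norm : R -> R)) => //; [exact: normr0|exact: ler_normD|exact: normrM|].
move=> i j; pose E := mxexp (t *: M).
have uE l : `|E^T *m u l| <= 2 * (`|u l| + `|v l|) /\ `|E^T *m v l| <= 2 * (`|u l| + `|v l|).
  have [a a0 Ha] := H l.
  have Lu : M^T *m u l = 0 *: u l - complex.Im a *: v l by rewrite /u -reV_complexify Ha reVZ a0.
  have Lv : M^T *m v l = 0 *: v l + complex.Im a *: u l by rewrite /v -imV_complexify Ha imVZ a0.
  split; first exact: mxexp_bounded_covector Lu Lv.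
  rewrite addrC -[`|u l|]normrN; apply: (mxexp_bounded_covector (be := complex.Im a)) => //.
    by rewrite Lv scalerN opprK.
  by rewrite mulmxN Lu; apply/matrixP => ? ?; rewrite !mxE; ring.
have -> : E i j = complex.Re ((complexify E) i j) by rewrite mxE.
have -> : complexify E = Q *m (invmx Q *m complexify E) by rewrite mulKVmx.
rewrite mxE Re_sum (le_trans (ler_norm_sum _ _ _))//.
apply: (@le_trans _ _ (\sum_l (`|complex.Re (Q i l)| + `|complex.Im (Q i l)|) * (2 * (`|u l| + `|v l|)))); last first.
  by rewrite /b0 [leRHS](bigD1 i)//= lerDl sumr_ge0// => k _; apply: sumr_ge0 => l _.
apply: ler_sum => l _; rewrite ReM (le_trans (ler_normB _ _))// !normrM mulrDl.
have re : complex.Re ((invmx Q *m complexify E) l j) = (E^T *m u l) j 0.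
  by rewrite -reV_complexify -row_mul !mxE.
have im : complex.Im ((invmx Q *m complexify E) l j) = (E^T *m v l) j 0.
  by rewrite -imV_complexify -row_mul !mxE.
rewrite re im; have [h1 h2] := uE l.
by rewrite lerD// ler_wpM2l//; apply: le_trans (le_coord_norm _ _ _) _.
Qed.

Lemma Lperp_opp (x : 'cV[R]_n) : L (- x) = - L x.
Proof. by rewrite -scaleN1r /L Lperp_scale scaleN1r. Qed.

Lemma sqr_add_le (x y p q : R) : x ^+ 2 <= p -> y ^+ 2 <= q -> (x + y) ^+ 2 <= 2 * (p + q).
Proof. by move=> xp yq; have := sqr_ge0 (x - y); rewrite sqrrB sqrrD; lra. Qed.

Lemma addends_le (p q c : R) : 0 <= p -> 0 <= q -> p + q <= c -> p <= c /\ q <= c.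
Proof. by move=> p0 q0 h; split; apply: le_trans h; rewrite ?lerDl ?lerDr. Qed.

(** A diagonal Jordan form with imaginary spectrum would make the exponential bounded, against the
    lower growth bound with [J >= 1]. So two rows of [invmx Q] form a Jordan chain, and the uniform
    bound on [Q] and its inverse controls their size from above and from below. *)
Lemma resonant_covectors (C : R) (Q : 'cV[R]_n -> 'M[R[i]]_n) : 0 < C ->
  (forall x : 'cV[R]_n, ker_sphere A x -> [/\ Q x \in unitmx,
     is_jordan (invmx (Q x) *m complexify (L x) *m Q x) & cmxnorm (Q x) + cmxnorm (invmx (Q x)) <= C]) ->
  (forall x : 'cV[R]_n, ker_sphere A x -> exists (J : nat) (c C : R),
     [/\ (1 <= J <= n - 2)%N, 0 < c, 0 < C & forall t : R, 0 <= t ->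
        c * t ^+ J <= mxnorm (mxexp (t *: L x)) <= C * (1 + t ^+ J)]) ->
  exists2 C : R, 1 <= C & forall k : 'cV[R]_n, A *m k = 0 -> dot k k = 1 -> exists be u1 v1 u2 v2,
     [/\ (L k)^T *m u1 = - be *: v1, (L k)^T *m v1 = be *: u1,
         (L k)^T *m u2 = - be *: v2 + u1 & (L k)^T *m v2 = be *: u2 + v1] /\
     [/\ Pp^T *m u1 = u1, Pp^T *m v1 = v1, Pp^T *m u2 = u2 & Pp^T *m v2 = v2] /\
     [/\ `|u1| <= C, `|v1| <= C, `|u2| <= C & `|v2| <= C] /\
     `|be| <= C /\ C^-1 <= dot u1 u1 + dot v1 v1.
Proof.
move=> C0 jordan growth; have [CL CL0 LB] := Lperp_bounded B A.
pose D : R := 1 + C + n%:R * `|Pp^T| * C + n%:R ^+ 2 * CL + 2 * (n%:R * C) ^+ 2.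
have d1 : 0 <= n%:R * `|Pp^T| * C by rewrite !mulr_ge0// ltW.
have d2 : 0 <= n%:R ^+ 2 * CL by rewrite mulr_ge0 ?sqr_ge0.
have d3 : 0 <= 2 * (n%:R * C) ^+ 2 by rewrite mulr_ge0 ?sqr_ge0.
have [D1 DC DP DL DD] : [/\ 1 <= D, C <= D, n%:R * `|Pp^T| * C <= D, n%:R ^+ 2 * CL <= D & 2 * (n%:R * C) ^+ 2 <= D].
  by rewrite /D; split; lra.
clearbody D; exists D => // k Ak k1; have kS : ker_sphere A k by split => //; exact: dot1_enorm.
have kS' : ker_sphere A (- k).
  by split; [rewrite mulmxN Ak oppr0|apply: dot1_enorm; rewrite dotNl dotNr opprK].
have [Qu Jk QC] := jordan k kS; set Qi := invmx (Q k) in Jk QC.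
have [J [c [C1 [/andP[J1 _] c0 C10 gr]]]] := growth k kS.
have [J' [c' [C1' [_ _ C10' gr']]]] := growth (- k) kS'.
(* [L (- k) = - L k], so an eigenpair at [k] with real part [al] is one at [- k] with real part
   [- al]; polynomial growth at both points leaves only 0. *)
have imag u v al be : (L k)^T *m u = al *: u - be *: v -> (L k)^T *m v = al *: v + be *: u ->
    0 < dot u u + dot v v -> al = 0.
  move=> Lu Lv uv0; apply/le_anti/andP; split.
    by apply: (@polynomial_growth_le0 (L k) u v al be C1 J (ltW C10)) => // t t0; have /andP[] := gr t t0.
  rewrite -oppr_le0; apply: (@polynomial_growth_le0 (L (- k)) u v (- al) (- be) C1' J' (ltW C10')) => //.
  - by move=> t t0; have /andP[] := gr' t t0.
  - by rewrite Lperp_opp linearN /= mulNmx Lu; apply/matrixP => ? ?; rewrite !mxE; ring.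
  - by rewrite Lperp_opp linearN /= mulNmx Lv; apply/matrixP => ? ?; rewrite !mxE; ring.
have rowL i : row i Qi *m complexify (L k) = row i (Qi *m complexify (L k) *m Q k) *m Qi.
  by rewrite -!row_mul mulmxK.
have row0 i : row i Qi != 0.
  apply/eqP => h; have := row_mul i Qi (Q k); rewrite h mul0mx mulVmx// => /rowP/(_ i).
  by rewrite !mxE eqxx => /eqP; rewrite oner_eq0.
have imag_row i a : row i Qi *m complexify (L k) = a *: row i Qi -> complex.Re a = 0.
  move=> h; apply: (imag (reV (row i Qi)) (imV (row i Qi)) _ (complex.Im a)); last exact: dot_reV_imV_gt0.
    by rewrite -reV_complexify h reVZ.
  by rewrite -imV_complexify h imVZ.
have [diag|[i [j [a [Ji Jj]]]]] := jordan_rows Jk.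
  have [|b b0 bd] := @mxexp_bounded (L k) (Q k) Qu.
    move=> i; have [a Ja] := diag i.
    have h : row i Qi *m complexify (L k) = a *: row i Qi by rewrite rowL Ja -scalemxAl -rowE.
    by exists a => //; exact: imag_row h.
  exfalso; pose t : R := 1 + b / c.
  have bc0 : 0 <= b / c by rewrite divr_ge0// ltW.
  have t1 : 1 <= t by rewrite lerDl.
  have t0 : 0 <= t by rewrite (le_trans ler01).
  have /andP[h _] := gr t t0.
  have h2 : c * t <= b.
    apply: le_trans (bd t t0); apply: le_trans h; rewrite ler_wpM2l ?(ltW c0)//.
    by rewrite -[leLHS]expr1 ler_weXn2l.
  by move: h2; rewrite /t mulrDr mulr1 mulrCA divff ?gt_eqF// mulr1 gerDr leNgt c0.
have Lj : row j Qi *m complexify (L k) = a *: row j Qi by rewrite rowL Jj -scalemxAl -rowE.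
have Li : row i Qi *m complexify (L k) = a *: row i Qi + row j Qi.
  by rewrite rowL Ji mulmxDl -scalemxAl -!rowE.
have a0 := imag_row j a Lj; pose be := complex.Im a.
pose u1 := reV (row j Qi); pose v1 := imV (row j Qi); pose u2 := reV (row i Qi); pose v2 := imV (row i Qi).
have Lu1 : (L k)^T *m u1 = - be *: v1 by rewrite -reV_complexify Lj reVZ a0 scale0r sub0r scaleNr.
have Lv1 : (L k)^T *m v1 = be *: u1 by rewrite -imV_complexify Lj imVZ a0 scale0r add0r.
have Lu2 : (L k)^T *m u2 = - be *: v2 + u1 by rewrite -reV_complexify Li reVD reVZ a0 scale0r sub0r scaleNr.
have Lv2 : (L k)^T *m v2 = be *: u2 + v1 by rewrite -imV_complexify Li imVD imVZ a0 scale0r add0r.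
have PL w := (tr_Lperp_proj B A k w).1; have LP w := (tr_Lperp_proj B A k w).2.
have [Pu1 Pv1] : Pp^T *m u1 = u1 /\ Pp^T *m v1 = v1.
  (* For the eigenvalue 0 the eigencovector is the image of the generalized one, hence in the range
     fixed by [Pp^T]. *)
  have [b0|bN] := eqVneq be 0.
    by split; [have := PL u2; rewrite Lu2|have := PL v2; rewrite Lv2]; rewrite b0 ?oppr0 scale0r add0r.
  apply: (@eigen_pair_proj _ _ B A k u1 v1 0 be); rewrite ?bN ?orbT//.
    by rewrite Lu1 scale0r sub0r scaleNr.
  by rewrite Lv1 scale0r add0r.
have Q0 : 0 <= cmxnorm (Q k) by apply: opnorm_ge0; [exact: Normc_ge0|exact: Normc.normc0|exact: NormcD|exact: Normc.normcM].
have Qi0 : 0 <= cmxnorm Qi by apply: opnorm_ge0; [exact: Normc_ge0|exact: Normc.normc0|exact: NormcD|exact: Normc.normcM].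
have ent (M : 'M[R[i]]_n) x y : cmxnorm M <= C -> Normc.normc (M x y) <= C.
  by move=> h; apply: le_trans h; apply: entry_le_opnorm; [exact: Normc_ge0|exact: Normc.normc0|exact: Normc.normc1|exact: NormcD|exact: Normc.normcM].
have [QkC QiC] := addends_le Q0 Qi0 QC.
have reC l : `|reV (row l Qi)| <= C.
  apply: mx_norm_le; first exact: ltW.
  by move=> x y; rewrite !mxE; apply: le_trans (Re_le_Normc _) _; exact: ent.
have imC l : `|imV (row l Qi)| <= C.
  apply: mx_norm_le; first exact: ltW.
  by move=> x y; rewrite !mxE; apply: le_trans (Im_le_Normc _) _; exact: ent.
have projC (w : 'cV[R]_n) : `|w| <= C -> `|Pp^T *m w| <= D.
  by move=> wC; apply: (le_trans (norm_mulmx _ _)); apply: le_trans DP; rewrite ler_wpM2l ?mulr_ge0.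
have uv1 : 0 < dot u1 u1 + dot v1 v1 by exact: dot_reV_imV_gt0.
(* The generalized covectors may have a component outside the range of [Pp^T]; projecting them keeps
   the chain relations because [L k] is sandwiched between projections. *)
exists be, u1, v1, (Pp^T *m u2), (Pp^T *m v2); split; [|split; [|split; [|split]]].
- split => //.
    by rewrite LP -PL Lu2 mulmxDr -scalemxAr Pu1.
  by rewrite LP -PL Lv2 mulmxDr -scalemxAr Pv1.
- by split => //; rewrite mulmxA -trmx_mul Pi_kerperp_idem_mx.
- by split; [exact: le_trans (reC _) DC|exact: le_trans (imC _) DC|exact: (projC _ (reC _))|exact: (projC _ (imC _))].
- have e1 : (L k)^T *m u1 = 0 *: u1 - be *: v1 by rewrite Lu1 scale0r sub0r scaleNr.
  have e2 : (L k)^T *m v1 = 0 *: v1 + be *: u1 by rewrite Lv1 scale0r add0r.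
  have [_ h] := eigen_bound e1 e2 uv1.
  apply: (le_trans h); apply: le_trans DL; rewrite ler_wpM2l ?sqr_ge0// (le_trans (LB k))//.
  by rewrite -[leRHS]mulr1 ler_wpM2l// (ker_sphere_norm kS).
(* The diagonal entry [j] of [invmx Q *m Q] is 1 and the entries of [Q] are at most [C], so row [j]
   of the inverse cannot be small. *)
have one : 1 <= n%:R * C * (`|u1| + `|v1|).
  have e : (Qi *m Q k) j j = 1 by rewrite mulVmx// mxE eqxx.
  rewrite -[leLHS](Normc.normc1 R) -e mxE.
  have := @abs_sum R _ (@Normc.normc R) (@Normc.normc0 R) NormcD _ (index_enum 'I_n) (fun l => Qi j l * Q k l j).
  move/le_trans; apply.
  apply: (@le_trans _ _ (\sum_(l < n) C * (`|u1| + `|v1|))); last by rewrite sumr_const card_ord -[leLHS]mulr_natl mulrA.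
  apply: ler_sum => l _; rewrite Normc.normcM mulrC; apply: ler_pM; rewrite ?Normc_ge0//; first exact: ent.
  apply: le_trans (Normc_le_sum _) _; apply: lerD.
    by have := le_coord_norm u1 l 0; rewrite !mxE.
  by have := le_coord_norm v1 l 0; rewrite !mxE.
have D0 : 0 < D by exact: lt_le_trans ltr01 D1.
rewrite -[D^-1]mul1r ler_pdivrMr//.
have sq : (`|u1| + `|v1|) ^+ 2 <= 2 * (dot u1 u1 + dot v1 v1).
  have h1 := le_norm_dot u1; have h2 := le_norm_dot v1.
  exact: sqr_add_le.
have one2 : 1 <= (n%:R * C) ^+ 2 * (`|u1| + `|v1|) ^+ 2 by rewrite -exprMn exprn_ege1.
apply: (le_trans one2); apply: (@le_trans _ _ ((n%:R * C) ^+ 2 * (2 * (dot u1 u1 + dot v1 v1)))).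
  by rewrite ler_wpM2l ?sqr_ge0.
by rewrite mulrCA mulrA [leRHS]mulrC ler_wpM2r ?(ltW uv1).
Qed.

End Resonance.

(** * Moments and the stationary measure *)

Section Moments.
Context {R : realType} {n : nat}.
Variables (B : {bilinear 'cV[R]_n -> 'cV[R]_n -> 'cV[R]_n}) (A S : 'M[R]_n).
Variables (d : measure_display) (Omega : measurableType d) (P : probability Omega R).
Variables (W : R -> Omega -> 'cV[R]_n) (X : 'cV[R]_n -> R -> Omega -> 'cV[R]_n).
Hypothesis W_bm : brownian_motion P W.
Hypothesis X_sol : forall x : 'cV[R]_n, sde_solution P B A S W x (X x).
Hypothesis B_cons : forall x : 'cV[R]_n, dot x (B x x) = 0.
Hypothesis A_psd : psd A.
Let T := @Tr R n d Omega P X.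

Lemma sum_blocks (F : nat -> R) (q m : nat) :
  \sum_(k < q * m) F k = \sum_(l < q) \sum_(j < m) F (l * m + j)%N.
Proof.
elim: q => [|q IH]; first by rewrite mul0n !big_ord0.
by rewrite big_ord_recr /= -IH mulSnr big_split_ord /=.
Qed.

(** The grid of the unit interval with [q * m] points is cut into [q] windows, and the Markov
    property at the start of each expresses the sum through the state there. *)
Lemma window_average (q m : nat) (phi : 'cV[R]_n -> R) z : (0 < q)%N -> (0 < m)%N -> bc phi ->
  (q * m)%:R^-1 * \sum_(k < q * m) T (k%:R * (q * m)%:R^-1) phi z =
  Ex P (fun w => q%:R^-1 * \sum_(l < q)
     (m%:R^-1 * \sum_(j < m) T (j%:R * (q%:R^-1 / m%:R)) phi (X z (l%:R / q%:R) w))).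
Proof.
move=> q0 m0 bphi.
have qp : 0 < q%:R :> R by rewrite ltr0n.
have mp : 0 < m%:R :> R by rewrite ltr0n.
have t0 (j : nat) : 0 <= j%:R * (q%:R^-1 / m%:R) :> R by rewrite mulr_ge0 ?divr_ge0 ?invr_ge0.
have l0 (l : nat) : 0 <= l%:R / q%:R :> R by rewrite divr_ge0.
have bT (j : nat) : bc (T (j%:R * (q%:R^-1 / m%:R)) phi) by exact: (Tr_bc W_bm X_sol (t0 j) bphi).
have bg : bc (fun x => m%:R^-1 * \sum_(j < m) T (j%:R * (q%:R^-1 / m%:R)) phi x).
  by apply: bcZ; apply: bc_sum => j; exact: bT.
rewrite ExZ; last by apply: bdd_sum => l; exact: (bdd_X X_sol z (l0 l) bg).
rewrite Ex_sum; last by move=> l; exact: (bdd_X X_sol z (l0 l) bg).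
rewrite (sum_blocks (fun k => T (k%:R * (q * m)%:R^-1) phi z)) natrM invfM -mulrA; congr (_ * _); rewrite mulr_sumr; apply: eq_bigr => l _.
rewrite ExZ; last by apply: bdd_sum => j; exact: (bdd_X X_sol z (l0 l) (bT j)).
rewrite Ex_sum; last by move=> j; exact: (bdd_X X_sol z (l0 l) (bT j)).
congr (_ * _); apply: eq_bigr => j _.
have -> : (l * m + j)%:R * (q%:R^-1 * m%:R^-1) = l%:R / q%:R + j%:R * (q%:R^-1 / m%:R) :> R.
  by rewrite natrD natrM; field; rewrite !gt_eqF.
exact: (markov_bc W_bm X_sol z (l0 l) (t0 j) bphi).
Qed.

Let A_ge0 (x : 'cV[R]_n) : 0 <= dot x (A *m x).
Proof. by have [_ h] := A_psd; exact: h. Qed.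

Hypothesis coreP : forall ka La : R, 0 < ka -> 1 <= La -> exists R0 : R, forall r : R, R0 <= r ->
  exists (q : nat) (Mf : R), [/\ (0 < q)%N, 0 <= Mf & forall z, r ^+ 2 <= La * dot z z -> dot z z <= La * r ^+ 2 ->
   exists m0, forall m, (m0 < m)%N ->
   ka * r ^+ 2 <= m%:R^-1 * \sum_(j < m) Tr P X (j%:R * (q%:R^-1 / m%:R)) (cutA A Mf) z].

Lemma bc_cutA (M : R) : 0 <= M -> bc (cutA A M).
Proof.
move=> M0; apply: bc_continuous_min => //.
  by apply: loc_lip_continuous; apply: loc_lipM; [exact: loc_lip_dot|exact: loc_lip_quadratic].
by move=> x; rewrite mulr_ge0 ?dot_ge0.
Qed.

Lemma cutA_ge0 (M : R) x : 0 <= M -> 0 <= cutA A M x.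
Proof. by move=> M0; rewrite le_min M0 andbT mulr_ge0 ?dot_ge0. Qed.

(* On a quiet path every window of the unit interval starts in the annulus where [coreP] applies. *)
Lemma unit_interval_dissipation (ka : R) : 0 < ka -> exists R0 : R, forall z, R0 <= dot z z ->
  exists2 Mf : R, 0 <= Mf & forall N0 : nat, exists2 N, (N0 <= N)%N &
    ka * dot z z / 2 <= N.+1%:R^-1 * \sum_(k < N.+1) T (k%:R * N.+1%:R^-1) (cutA A Mf) z.
Proof.
move=> ka0.
have q4 : 0 < 1 / 4 :> R by rewrite divr_gt0.
have [M M0 HM] := noisy_small W_bm X_sol q4.
have [La [R1 [La1 R11 ann]]] := annulus A S W X B_cons M0 (lexx 1).
have [R2 HR2] := coreP ka0 La1.
pose R3 : R := 1 + `|R1| + `|R2|.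
have R30 : 0 <= R3 by rewrite !addr_ge0.
exists (R3 ^+ 2) => z zR; pose r := Num.sqrt (dot z z).
have rr : r ^+ 2 = dot z z by rewrite sqr_sqrtr// dot_ge0.
have rR3 : R3 <= r by rewrite -(@ler_pXn2r _ 2) ?nnegrE ?sqrtr_ge0// rr.
have rR1 : R1 <= r.
  by apply: le_trans rR3; rewrite /R3 (le_trans (ler_norm _))// addrAC lerDr addr_ge0.
have rR2 : R2 <= r.
  by apply: le_trans rR3; rewrite /R3 (le_trans (ler_norm _))// lerDr addr_ge0.
have [q [Mf [q0 Mf0 Hq]]] := HR2 r rR2.
exists Mf => // N0.
have r1 : 0 < r by rewrite (lt_le_trans _ rR1)// (lt_le_trans ltr01).
pose c : R := ka * r ^+ 2.
have c0 : 0 < c by rewrite mulr_gt0// exprn_gt0.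
have bphi := bc_cutA Mf0.
have qp : 0 < q%:R :> R by rewrite ltr0n.
pose g (m : nat) (x : 'cV[R]_n) : R := m%:R^-1 * \sum_(j < m) T (j%:R * (q%:R^-1 / m%:R)) (cutA A Mf) x.
have bg m : bc (g m).
  by apply: bcZ; apply: bc_sum => j; apply: (Tr_bc W_bm X_sol) => //; rewrite mulr_ge0 ?divr_ge0 ?invr_ge0.
have g0 m x : 0 <= g m x.
  by rewrite mulr_ge0 ?invr_ge0// sumr_ge0// => j _; apply: Ex_ge0 => w; exact: cutA_ge0.
pose G (m : nat) (w : Omega) : R := q%:R^-1 * \sum_(l < q) g m (X z (l%:R / q%:R) w).
have bG m : bdd (G m).
  by apply: bddZ; apply: bdd_sum => l; apply: (bdd_X X_sol) => //; rewrite divr_ge0.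
have G0 m w : 0 <= G m w by rewrite mulr_ge0 ?invr_ge0// sumr_ge0.
have mI : measurable_fun setT (\1_(noisy W M) : Omega -> R) by apply: measurable_indic; exact: (measurable_noisy W_bm).
have bI : bdd (\1_(noisy W M) : Omega -> R).
  by split => //; exists 1 => w; rewrite indicE; case: (_ \in _); rewrite ?normr1 ?normr0.
(* The number of steps from which [coreP] applies depends on the state, hence on the path;
   truncation at [c] and restriction to quiet paths make dominated convergence in [m] available.
   Quiet paths have probability at least 3/4, which leaves a margin over [c / 2]. *)
pose F m w : R := Num.min (G m w) c * (1 + -1 * \1_(noisy W M) w).
have I1 w : 0 <= (1 + -1 * \1_(noisy W M) w : R) <= 1.
  by rewrite indicE; case: (_ \in _); rewrite /= ?mulr1 ?mulr0 ?addrN ?addr0 lexx ler01.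
have bH : bdd (fun w => 1 + -1 * \1_(noisy W M) w : R) by apply: bddD; [exact: bdd_cst|exact: bddZ].
have minb m w : 0 <= Num.min (G m w) c <= c by rewrite le_min G0 (ltW c0) ge_min lexx orbT.
have mF m : measurable_fun setT (F m).
  apply: measurable_funM; last by have [] := bH.
  by apply: measurable_minr => //; have [] := bG m.
have Fb m w : `|F m w| <= c.
  have /andP[a1 a2] := minb m w; have /andP[b1 b2] := I1 w.
  by rewrite ger0_norm ?mulr_ge0// -[leRHS]mulr1 ler_pM.
have Flim : (fun m => Ex P (F m)) @ \oo --> Ex P (fun w => c * (1 + -1 * \1_(noisy W M) w)).
  apply: (@Ex_cvg _ _ _ P F _ c) => //; first exact: bddZ.
  apply: filterS (ae_good W_bm X_sol z) => w gw.
  have [nw|nw] := pselect (noisy W M w).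
    have e : 1 + -1 * \1_(noisy W M) w = 0 :> R by rewrite indicE mem_set//= mulr1 addrN.
    rewrite e mulr0 (_ : (fun k => F k w) = (fun=> 0)); first exact: cvg_cst.
    by apply/funext => m; rewrite /F e mulr0.
  have near_c : \forall m \near \oo, forall l : 'I_q, c <= g m (X z (l%:R / q%:R) w).
    apply: filter_forall => l.
    have l1 : 0 <= (l%:R / q%:R : R) <= 1 by rewrite divr_ge0//= ler_pdivrMr// mul1r ler_nat ltnW.
    have z1 : r ^+ 2 <= 1 * dot z z by rewrite mul1r rr.
    have z2 : dot z z <= 1 * r ^+ 2 by rewrite mul1r rr.
    have [a1 a2] := ann r z w rR1 gw nw z1 z2 _ l1.
    have [m0 Hm0] := Hq _ a1 a2.
    by exists m0.+1 => // m /= mm; exact: Hm0.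
  apply: cvg_near_cst; apply: filterS near_c => m hm.
  rewrite /F; congr (_ * _); apply/eqP; rewrite eq_le ge_min lexx orbT le_min lexx andbT /=.
  rewrite /G mulrC ler_pdivlMr//; apply: (@le_trans _ _ (\sum_(l < q) c)).
    by rewrite sumr_const card_ord mulr_natr.
  by apply: ler_sum => l _; exact: hm.
have lim_low : c / 2 < Ex P (fun w => c * (1 + -1 * \1_(noisy W M) w)).
  rewrite ExZ// ExD; [|exact: bdd_cst|exact: bddZ].
  rewrite Ex_cst ExZ// ltr_pM2l//; move: HM; move: (Ex P _) => e; lra.
have := cvgr_ge _ Flim _ lim_low => -[m1 _ Hm1].
pose m := (maxn m1 N0).+1.
exists (q * m).-1.
  by rewrite -ltnS prednK ?muln_gt0 ?q0// (leq_trans _ (leq_pmull _ q0))// ltnS leq_maxr.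
rewrite prednK ?muln_gt0 ?q0// window_average//.
apply: (@le_trans _ _ (Ex P (F m))).
  by rewrite -rr; apply: Hm1; rewrite /= /m leqW// leq_maxl.
apply: Ex_le; [by split => //; exists c|exact: (bG m)|].
move=> w; have /andP[a1 a2] := minb m w; have /andP[b1 b2] := I1 w.
apply: (@le_trans _ _ (Num.min (G m w) c * 1)); first by rewrite ler_wpM2l.
by rewrite mulr1 ge_min lexx.
Qed.

Lemma quartic_drift : exists2 C : R, 0 <= C & forall z,
  (\int[P]_w (dot (X z 1 w) (X z 1 w) ^+ 2)%:E <= (dot z z ^+ 2 - dot z z + C)%:E)%E.
Proof.
have [K K0 HK] := energy4 W_bm X_sol B_cons A_ge0.
(* Then [4 * L] is [(K + 1) |z|^2], which turns the term [K |z|^2] of the energy estimate into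
   [- |z|^2]. *)
have ka0 : 0 < (K + 1) / 2 by rewrite divr_gt0// ltr_wpDl.
have [R0 HR0] := unit_interval_dissipation ka0.
have KR0 : 0 <= (K + 1) * `|R0| by rewrite mulr_ge0// addr_ge0.
exists (K + (K + 1) * `|R0|); first by rewrite addr_ge0.
move=> z; have z0 := dot_ge0 z.
have [zR|zR] := leP R0 (dot z z).
  have [Mf Mf0 HN] := HR0 z zR.
  apply: (le_trans (HK (cutA A Mf) z _ (bc_cutA Mf0) _ _ HN)).
  - apply: loc_lip_min; apply: loc_lipM; [exact: loc_lip_dot|exact: loc_lip_quadratic].
  - by move=> x; rewrite cutA_ge0//= ge_min lexx.
  by rewrite lee_fin; lra.
apply: (le_trans (HK (fun=> 0) z 0 (bc_cst 0) _ _ _)).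
- by move=> M; exists 0 => // x y _ _; rewrite subrr normr0 mul0r.
- by move=> x; rewrite lexx mulr_ge0 ?dot_ge0.
- move=> N0; exists N0 => //; rewrite big1 ?mulr0// => k _; exact: Tr_cst.
rewrite lee_fin mulr0 subr0.
have h : dot z z <= `|R0| by rewrite (le_trans (ltW zR))// ler_norm.
have : (K + 1) * dot z z <= (K + 1) * `|R0| by rewrite ler_wpM2l// addr_ge0.
lra.
Qed.

(** The drift inequality is summed over [k] with [|x|^4] truncated, so that the semigroup is applied
    to bounded functions only. One step raises the truncation level by [M], which is why the level
    [K] is general in the induction; at the start from 0 the truncated value is 0. *)
Lemma quadratic_averages : exists2 C : R, 0 <= C & forall (N : nat) (M : R), 0 <= M ->
  \sum_(k < N) T k%:R (fun x => Num.min (dot x x) M) 0 <= N%:R * C + C.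
Proof.
have [C C0 HC] := quartic_drift; exists C => // N M M0.
pose V (x : 'cV[R]_n) : R := dot x x ^+ 2.
have V0 x : 0 <= V x by exact: sqr_ge0.
have cdot : continuous (fun x : 'cV[R]_n => dot x x) by exact: loc_lip_continuous loc_lip_dot.
have cV : continuous V by apply: loc_lip_continuous; apply: loc_lipM; exact: loc_lip_dot.
have bV (K : R) : 0 <= K -> bc (fun x => Num.min (V x) K) by move=> K0; exact: bc_continuous_min.
have bM : bc (fun x : 'cV[R]_n => Num.min (dot x x) M) by apply: bc_continuous_min => // x; exact: dot_ge0.
have mV z : measurable_fun setT (fun w => V (X z 1 w)) by exact: (mX_comp X_sol z ler01 cV).
have step (K : R) z : 0 <= K -> T 1 (fun x => Num.min (V x) K) z + Num.min (dot z z) M <= Num.min (V z) (K + M) + C.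
  move=> K0.
  have bd : bdd (fun w => Num.min (V (X z 1 w)) K) by apply: bdd_min.
  have h1 : T 1 (fun x => Num.min (V x) K) z <= V z - dot z z + C.
    rewrite -lee_fin (EFin_Ex P bd); apply: le_trans (HC z).
    apply: ge0_le_integral => //.
    - by move=> w _; rewrite lee_fin le_min V0.
    - by apply/measurable_EFinP; have [] := bd.
    - by apply/measurable_EFinP; exact: mV.
    - by move=> w _; rewrite lee_fin ge_min lexx.
  have h2 : T 1 (fun x => Num.min (V x) K) z <= K.
    rewrite -[leRHS](Ex_cst P K); apply: Ex_le => //; first exact: bdd_cst.
    by move=> w; rewrite ge_min lexx orbT.
  have m1 : Num.min (dot z z) M <= dot z z by rewrite ge_min lexx.
  have m2 : Num.min (dot z z) M <= M by rewrite ge_min lexx orbT.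
  by case: (leP (V z) (K + M)) => hv; lra.
suff H (K : R) : 0 <= K -> T N%:R (fun x => Num.min (V x) K) 0 + \sum_(k < N) T k%:R (fun x => Num.min (dot x x) M) 0 <= N%:R * C.
  have h0 : 0 <= T N%:R (fun x => Num.min (V x) 0) 0 by apply: Ex_ge0 => w; rewrite le_min V0 lexx.
  have := H 0 (lexx _); lra.
elim: N K => [|N IH] K K0.
  rewrite big_ord0 addr0 mul0r; apply: (@le_trans _ _ (T 0 (fun x => Num.min (V x) K) 0)); first by [].
  by rewrite /T (Tr0 W_bm X_sol _ (bV K K0)) /V dot0l expr0n ge_min lexx.
have KM : 0 <= K + M by exact: addr_ge0.
have bT1 : bc (T 1 (fun x => Num.min (V x) K)) by exact: (Tr_bc W_bm X_sol ler01 (bV K K0)).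
rewrite big_ord_recr /= -[N.+1%:R]natr1.
rewrite /T (markov_bc W_bm X_sol _ (ler0n R N) ler01 (bV K K0)) -/T addrCA.
have hs : T N%:R (T 1 (fun x => Num.min (V x) K)) 0 + T N%:R (fun x => Num.min (dot x x) M) 0 <=
    T N%:R (fun x => Num.min (V x) (K + M)) 0 + C.
  rewrite -(TrD X_sol 0 (ler0n R N) bT1 bM) -[X in _ <= _ + X](@Tr_cst R n d Omega P X N%:R C 0).
  rewrite -(TrD X_sol 0 (ler0n R N) (bV _ KM) (bc_cst C)); apply: (Tr_le X_sol) => //.
  - exact: bcD.
  - by apply: bcD; [exact: bV|exact: bc_cst].
  by move=> x; exact: step.
have := IH (K + M) KM; rewrite mulrDl mul1r; move: hs; lra.
Qed.

(** The measure has a finite second moment, and since the bracket is at least 1 its powers of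
    exponent below [p0 <= 1] are dominated by its square [1 + |x|^2]. *)
Lemma moments_of_core (p0 : R) : p0 <= 1 -> stationary_with_moments P X p0.
Proof.
move=> p01; have [C C0 HC] := quadratic_averages.
have [mu [st Hmu]] := krylov_bogoliubov W_bm X_sol B_cons A_ge0 C0 HC.
move: Hmu; move: (projT1 _) => K2 Hmu.
exists mu; split => // p pp0.
have cdot : continuous (fun x : 'cV[R]_n => dot x x) by exact: loc_lip_continuous loc_lip_dot.
have mdot : measurable_fun setT (fun x : borel R n => dot x x : R) by exact: (continuous_borel cdot).
have int_dot : (\int[mu]_x (dot x x)%:E <= (2 * C + K2)%:E)%E.
  apply: (@trunc_le _ _ _ mu (fun x : borel R n => dot x x : R)) => //.
    by move=> x; exact: dot_ge0.
  by move=> K; exact: Hmu.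
have mjap : measurable_fun setT (fun x : borel R n => japanese x : R).
  have -> : (fun x : borel R n => japanese x : R) = (fun x => Num.sqrt (1 + dot x x)).
    by apply/funext => x; rewrite japaneseE.
  apply: (@measurableT_comp _ _ _ _ _ _ (@Num.sqrt R)) => //; last by apply: measurable_funD.
  by apply: continuous_measurable_fun; exact: sqrt_continuous.
have mf : measurable_fun setT (fun x : borel R n => japanese x `^ p : R).
  by apply: (@measurableT_comp _ _ _ _ _ _ (fun y : R => y `^ p)) => //; exact: measurable_powR.
apply/integrableP; split; first exact/measurable_EFinP.
apply: (@le_lt_trans _ _ (\int[mu]_x (1 + dot x x)%:E)%E).
  apply: ge0_le_integral => //.
  - by apply/measurable_EFinP; exact: measurableT_comp.
  - by apply/measurable_EFinP; apply: measurable_funD.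
  move=> x _; rewrite lee_fin ger0_norm ?powR_ge0//.
  have jj : japanese x ^+ 2 = 1 + dot x x by rewrite japaneseE sqr_sqrtr// addr_ge0 ?dot_ge0.
  have j1 : 1 <= japanese x.
    rewrite -(@ler_pXn2r _ 2) ?nnegrE ?sqrtr_ge0// jj expr1n lerDl dot_ge0//.
  rewrite -jj (le_trans (ler1_powR j1 (le_trans (ltW pp0) p01)))// -[leLHS]expr1 ler_weXn2l//.
rewrite (eq_integral (fun x : borel R n => (1%:E + (dot x x)%:E)%E)); last by move=> x _; rewrite EFinD.
rewrite ge0_integralD//; last 2 first.
- by move=> x _; rewrite lee_fin dot_ge0.
- by apply/measurable_EFinP.
rewrite (_ : \int[mu]_x 1%:E = 1%:E)%E; last by exact: prob_integral_cst.
apply: (@le_lt_trans _ _ (1%:E + (2 * C + K2)%:E)%E); first by rewrite leeD2l.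
by rewrite -EFinD ltry.
Qed.

End Moments.

Section Nondegeneracy.
Context {R : realType} {n : nat}.

Lemma noise_nondegenerate (S : 'M[R]_n) : \rank S = n ->
  exists2 cS : R, 0 < cS & forall u : 'cV[R]_n, cS * dot u u <= dot (S^T *m u) (S^T *m u).
Proof.
move=> rS; have Su : S^T \in unitmx by rewrite unitmx_tr -row_free_unit /row_free rS.
pose c : R := n%:R ^+ 3 * `|invmx S^T| ^+ 2.
have c0 : 0 <= c by rewrite mulr_ge0 ?exprn_ge0.
have c1 : 0 < 1 + c by rewrite ltr_wpDr.
exists (1 + c)^-1 => [|u]; first by rewrite invr_gt0.
rewrite mulrC ler_pdivrMr//; set v := S^T *m u.
have -> : u = invmx S^T *m v by rewrite mulKmx.
apply: (le_trans (dot_norm_le _)); apply: (@le_trans _ _ (c * dot v v)); last first.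
  by rewrite mulrC ler_wpM2l ?dot_ge0// lerDr.
apply: (@le_trans _ _ (n%:R * (n%:R * `|invmx S^T| * `|v|) ^+ 2)).
  by rewrite ler_wpM2l// lerXn2r ?nnegrE ?mulr_ge0// norm_mulmx.
rewrite (_ : n%:R * _ ^+ 2 = c * `|v| ^+ 2); last by rewrite /c; ring.
by rewrite ler_wpM2l// le_norm_dot.
Qed.

Lemma B_ker_homogeneous (B : {bilinear 'cV[R]_n -> 'cV[R]_n -> 'cV[R]_n}) (A : 'M[R]_n) :
  (forall x : 'cV[R]_n, ker_sphere A x -> B x x = 0) -> forall k : 'cV[R]_n, A *m k = 0 -> B k k = 0.
Proof.
move=> H k Ak; have [->|kN] := eqVneq k 0.
  by rewrite -[X in B X _](scale0r 0) linearZl_LR scale0r.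
have d0 : 0 < dot k k.
  by rewrite lt_def dot_ge0 andbT; apply: contra kN => /eqP/dot_eq0 ->.
pose s := Num.sqrt (dot k k).
have s0 : 0 < s by rewrite sqrtr_gt0.
have ss : s ^+ 2 = dot k k by rewrite sqr_sqrtr ?ltW.
have -> : k = s *: (s^-1 *: k) by rewrite scalerA mulfV ?gt_eqF// scale1r.
rewrite linearZl_LR linearZr_LR H ?scaler0//; split; first by rewrite -scalemxAr Ak scaler0.
by apply: dot1_enorm; rewrite dotZl dotZr -ss; field; rewrite gt_eqF.
Qed.

End Nondegeneracy.

Unset Implicit Arguments.

Theorem theorem1p3 (R : realType) (n : nat)
    (B : {bilinear 'cV[R]_n -> 'cV[R]_n -> 'cV[R]_n}) (A sigma : 'M[R]_n)
    (d : measure_display) (Omega : measurableType d) (P : probability Omega R)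
    (W : R -> Omega -> 'cV[R]_n) (X : 'cV[R]_n -> R -> Omega -> 'cV[R]_n)
    (A_psd : psd A)
    (A_ker : exists x : 'cV[R]_n, x != 0 /\ A *m x = 0)
    (B_cons : forall x : 'cV[R]_n, dot x (B x x) = 0)
    (W_bm : brownian_motion P W)
    (X_sol : forall x : 'cV[R]_n, sde_solution P B A sigma W x (X x))
    (sigma_rank : \rank sigma = n)
    (B_ker : forall x : 'cV[R]_n, ker_sphere A x -> B x x = 0)
    (jordan_bound :
      exists (C : R) (Q : 'cV[R]_n -> 'M[R[i]]_n),
        0 < C /\
        forall x : 'cV[R]_n, ker_sphere A x ->
          [/\ Q x \in unitmx,
              is_jordan (invmx (Q x) *m complexify (Lperp B A x) *m Q x) &
              cmxnorm (Q x) + cmxnorm (invmx (Q x)) <= C]) :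
  ((forall x : 'cV[R]_n, ker_sphere A x ->
      exists lam : R[i],
        eigenvalue (complexify (Lperp B A x)) lam /\ 0 < complex.Re lam) ->
    stationary_with_moments P X (2%:R / 3%:R))
  /\
  ((forall x : 'cV[R]_n,
      Pi_ker A *m (B (Pi_ker A *m x) (Pi_kerperp A *m x)
                   + B (Pi_kerperp A *m x) (Pi_ker A *m x)) = 0) ->
    (forall x : 'cV[R]_n, ker_sphere A x ->
      exists (J : nat) (c C : R),
        [/\ (1 <= J <= n - 2)%N, 0 < c, 0 < C &
            forall t : R, 0 <= t ->
              c * t ^+ J <= mxnorm (mxexp (t *: Lperp B A x))
                         <= C * (1 + t ^+ J)]) ->
    stationary_with_moments P X (1%:R / 3%:R)).
Proof.
have B_ker0 := B_ker_homogeneous B_ker.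
have [c0 [c01 c0n c0B c0k [c0p c0A]]] := constants B A.
have c00 : 0 <= c0 by exact: le_trans ler01 c01.
have [cS cS0 S_lower] := noise_nondegenerate sigma_rank.
have BDl (u v w : 'cV[R]_n) : B (u + v) w = B u w + B v w by exact: linearDl.
have BDr (u v w : 'cV[R]_n) : B w (u + v) = B w u + B w v by exact: linearDr.
split=> [unstable|ker_cross growth].
  have [lam [Lam [lam0 Lam1 spec]]] := unstable_covectors unstable.
  (* In case (i) the kernel part of the drift is bounded by the whole drift, linear in the
     orthogonal component with a factor [1 + |x|]. *)
  have g10 : 0 <= 3 * c0 ^+ 3 by rewrite mulr_ge0 ?exprn_ge0.
  have g_bk (x : 'cV[R]_n) : `|Pi_ker A *m drift B A x| <=
      (3 * c0 ^+ 3 * (1 + `|x|) + 0 * `|Pi_kerperp A *m x|) * `|Pi_kerperp A *m x|.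
    rewrite mul0r addr0 (le_trans (c0k _))//.
    apply: (le_trans (ler_wpM2l c00 (norm_drift BDl BDr B_ker0 c01 c0B c0k c0p c0A x))).
    by rewrite le_eqVlt; apply/orP; left; apply/eqP; ring.
  apply: (moments_of_core W_bm X_sol B_cons A_psd); last by rewrite ler_pdivrMr// mul1r ler_nat.
  exact: (core W_bm X_sol B_cons A_psd B_ker0 c01 c0n c0B c0k c0p c0A g10 (lexx 0) g_bk
    (adapted_unstable c01 cS0 S_lower g10 lam0 Lam1 spec)).
have [C [Q [C0 jordan]]] := jordan_bound.
have [D D1 spec] := resonant_covectors C0 jordan growth.
(* In case (ii) the bound is quadratic in the orthogonal component, without the factor [1 + |x|]. *)
have g20 : 0 <= c0 ^+ 2 by exact: sqr_ge0.
have g_bk (x : 'cV[R]_n) : `|Pi_ker A *m drift B A x| <=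
    (0 * (1 + `|x|) + c0 ^+ 2 * `|Pi_kerperp A *m x|) * `|Pi_kerperp A *m x|.
  rewrite mul0r add0r (Pi_ker_drift BDl BDr A_psd B_ker0 (ker_cross x)) -mulrA -expr2.
  exact: norm_perp_B.
apply: (moments_of_core W_bm X_sol B_cons A_psd); last by rewrite ler_pdivrMr// mul1r ler_nat.
exact: (core W_bm X_sol B_cons A_psd B_ker0 c01 c0n c0B c0k c0p c0A (lexx 0) g20 g_bk
  (adapted_resonant c01 cS0 S_lower g20 D1 spec)).
Qed.
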